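(* Let $\tau>0$. If $f,g\in H^1$, with $f\not\equiv0$, satisfy $\varphi=\bar g/f\in\Gamma_\tau$ (the quotient of boundary values, defined a.e. on $\mathbb{S}$) and $0\notin\varphi(\mathbb{S})$, then $f,g\in B^\infty_\tau$.
   Context: $\mathbb{B}$ is the open unit ball of $\mathbb{C}^n$ ($n\ge1$), $\mathbb{S}$ its boundary. $H^1$ is the Hardy space of holomorphic functions on $\mathbb{B}$, identified with their boundary values on $\mathbb{S}$. Membership of an a.e. defined function in a space of continuous functions means that it agrees a.e. with such a function, and $\varphi$ then denotes that continuous function. $B^\infty_\tau$ is the space of holomorphic $f$ on $\mathbb{B}$ with $\sum_{j=0}^m\sup_{z\in\mathbb{B}}|d^jf(z)|(1-|z|^2)^{m-\tau}<\infty$ for some (any) integer $m>\tau$, where $|d^jf|=\sum_{|\alpha|+|\beta|=j}|\partial_\alpha\bar\partial_\beta f|$. $\Lambda_\tau=\Lambda_\tau(\mathbb{S})$ is the classical (Euclidean) Lipschitz-Zygmund space: a continuous $\varphi$ on $\mathbb{S}$ is in $\Lambda_\tau$ iff for some (any) integer $k>\tau$ its harmonic extension $\Phi$ to $\mathbb{B}$ satisfies $\sup_{z\in\mathbb{B}}(1-|z|^2)^{k-\tau}|d^k\Phi(z)|<\infty$. $\Gamma_\tau=\Gamma_\tau(\mathbb{S})$ is the non-isotropic Lipschitz-Zygmund space on $\mathbb{S}$ with respect to the pseudodistance $d(\zeta,\eta)=|1-\bar\zeta\eta|$, $\bar\zeta\eta=\sum_j\bar\zeta_j\eta_j$; it is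 a subspace of $\Lambda_\tau$. For $0<\tau<1/2$ it consists of the continuous $\varphi$ on $\mathbb{S}$ with $\sup_{\zeta\ne\eta}|\varphi(\zeta)-\varphi(\eta)|/d(\zeta,\eta)^\tau<\infty$. For $n=1$, $\Gamma_\tau=\Lambda_\tau$. For $n>1$ and $\tau\ge1/2$ it consists of the $\varphi\in\Lambda_\tau$ for which the norms $\|\varphi\circ\gamma\|_{\Lambda_{2\tau}([0,1])}$ are uniformly bounded over all complex tangential curves $\gamma:[0,1]\to\mathbb{S}$ (i.e. $\sum_j\gamma_j'(t)\overline{\gamma_j(t)}=0$) of class $\mathcal{C}^m$, $m$ an integer $>2\tau$, with $|\gamma^{(i)}|\le1$ for $1\le i\le m$; here $\Lambda_{2\tau}([0,1])$ is the classical Lipschitz-Zygmund space on $[0,1]$. *)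

(* Defs.v *)
From HB Require Import structures.
From mathcomp Require Import all_boot all_order all_algebra.
From mathcomp Require Import complex.
From mathcomp Require Import all_classical all_reals all_analysis.
From mathcomp Require Import measurable_realfun measurable_fun_approximation.

Set Implicit Arguments.
Unset Strict Implicit.
Unset Printing Implicit Defensive.

Import Order.TTheory GRing.Theory Num.Theory.
Import numFieldNormedType.Exports.
Import ComplexField.Normc.

Local Open Scope classical_set_scope.
Local Open Scope ring_scope.
Local Open Scope complex_scope.

(* R[i] as a normed module over itself, as numFieldNormedType does for the
   abstract numeric fields *)
#[export, non_forgetful_inheritance]
HB.instance Definition _ (R : realType) := NormedModule.copy R[i] R[i]^o.

Section lebesgue_measure_tuple.
Context {R : realType}.
Local Notation RT := (measurableTypeR R).

Definition consT n (p : RT * n.-tuple RT) : n.+1.-tuple RT :=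
  [tuple of p.1 :: p.2].

Lemma measurable_consT n : measurable_fun [set: RT * n.-tuple RT] (@consT n).
Proof. exact: measurable_cons. Qed.

Section step.
Variables (n : nat) (mu : {sigma_finite_measure set (n.-tuple RT) -> \bar R}).

Definition lebesgue_step : set (n.+1.-tuple RT) -> \bar R :=
  pushforward (lebesgue_measure \x mu)%E (@consT n).

Let mcons := @measurable_consT n.

Let lebesgue_step0 : lebesgue_step set0 = 0%E.
Proof. exact: measure0. Qed.

Let lebesgue_step_ge0 A : (0 <= lebesgue_step A)%E.
Proof. exact: measure_ge0. Qed.

Let lebesgue_step_sigma_additive : semi_sigma_additive lebesgue_step.
Proof. exact: measure_semi_sigma_additive. Qed.

HB.instance Definition _ := isMeasure.Build _ _ _ lebesgue_step
  lebesgue_step0 lebesgue_step_ge0 lebesgue_step_sigma_additive.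

Let lebesgue_step_sigma_finite : sigma_finite setT lebesgue_step.
Proof.
have /sigma_finiteP[F [TF ndF Foo]] := sigma_finiteT (@lebesgue_measure R).
have /sigma_finiteP[G [TG ndG Goo]] := sigma_finiteT mu.
exists (fun k => (@thead _ _ : n.+1.-tuple RT -> RT) @^-1` F k `&`
    (fun t : n.+1.-tuple RT => [tuple of behead t] : n.-tuple RT) @^-1` G k).
  apply/esym; rewrite -subTset => t _.
  have [i _ Fi] : (\bigcup_k F k) (thead t) by rewrite -TF.
  have [j _ Gj] : (\bigcup_k G k) [tuple of behead t] by rewrite -TG.
  exists (maxn i j) => //; split.
  - by have /subsetPset := ndF _ _ (leq_maxl i j); apply.
  - by have /subsetPset := ndG _ _ (leq_maxr i j); apply.
move=> k; have [mF Fk] := Foo k; have [mG Gk] := Goo k; split.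
  apply: measurableI; rewrite -[X in measurable X]setTI.
    exact: (measurable_tnth ord0).
  exact: measurable_behead.
rewrite /lebesgue_step /pushforward (_ : _ @^-1` _ = F k `*` G k).
  by rewrite product_measure1E// lte_mul_pinfty// ge0_fin_numE.
apply/seteqP; split=> -[x t] /=; rewrite (_ : [tuple of _] = t)//; exact/val_inj.
Qed.

HB.instance Definition _ := @Measure_isSigmaFinite.Build _ _ _ lebesgue_step
  lebesgue_step_sigma_finite.
End step.

(* Lebesgue measure on R^n, as an iterated product measure *)
Fixpoint lebesgue_tuple n : {sigma_finite_measure set (n.-tuple RT) -> \bar R} :=
  match n with
  | 0 => \d_([tuple] : 0.-tuple RT)
  | k.+1 => lebesgue_step (lebesgue_tuple k)
  end.
End lebesgue_measure_tuple.

Section sphere_measure.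
Context {R : realType} (m : nat).
Local Notation RT := (measurableTypeR R).
Implicit Type t : m.-tuple RT.

Definition tnorm t : R := Num.sqrt (\sum_(i < m) (tnth t i : R) ^+ 2).

Definition normalize t : m.-tuple RT := [tuple tnth t i / tnorm t | i < m].

Definition punctured_ball : set (m.-tuple RT) := [set t | 0 < tnorm t <= 1].

Definition tuple_sphere : set (m.-tuple RT) := [set t | tnorm t = 1].

Lemma measurable_tnorm : measurable_fun [set: m.-tuple RT] tnorm.
Proof.
rewrite (_ : tnorm = (@powR R ^~ 2^-1) \o
    (fun t => \sum_(i < m) (tnth t i : R) ^+ 2)); last first.
  apply/funext => t /=; rewrite powR12_sqrt// sumr_ge0// => i _.
  exact: sqr_ge0.
apply: measurableT_comp; first exact: measurable_powR.
apply: measurable_sum => i; apply: measurable_funX; exact: measurable_tnth.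
Qed.

Lemma measurable_normalize : measurable_fun [set: m.-tuple RT] normalize.
Proof.
apply/measurable_fun_tnthP => i.
rewrite (_ : _ \o _ = (fun t => (tnth t i : R) * (tnorm t) `^ (-1))).
  apply: measurable_funM; first exact: measurable_tnth.
  apply: (@measurableT_comp _ _ _ _ _ _ (@powR R ^~ (-1))).
    exact: measurable_powR.
  exact: measurable_tnorm.
by apply/funext => t /=; rewrite tnth_mktuple powR_inv1// sqrtr_ge0.
Qed.

Lemma measurable_punctured_ball : measurable punctured_ball.
Proof.
rewrite (_ : punctured_ball = setT `&` tnorm @^-1` `]0, 1]).
  exact: measurable_tnorm.
by rewrite setTI; apply/seteqP; split => t /=; rewrite in_itv.
Qed.

Let cone : set (m.-tuple RT) -> \bar R :=
  pushforward (mrestr (lebesgue_tuple m) measurable_punctured_ball) normalize.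

Let mnorm := measurable_normalize.

Let cone0 : cone set0 = 0%E. Proof. exact: measure0. Qed.

Let cone_ge0 A : (0 <= cone A)%E. Proof. exact: measure_ge0. Qed.

Let cone_sigma_additive : semi_sigma_additive cone.
Proof. exact: measure_semi_sigma_additive. Qed.

HB.instance Definition _ := isMeasure.Build _ _ _ cone
  cone0 cone_ge0 cone_sigma_additive.

(* Unnormalised surface measure of the unit sphere of R^m, by polar
   coordinates: sigma(A) = m * vol {t | 0 < |t| <= 1, t / |t| \in A}.  It is
   carried by tuple_sphere. *)
Definition sphere_measure : set (m.-tuple RT) -> \bar R :=
  mscale (m%:R%:nng) cone.

HB.instance Definition _ := Measure.on sphere_measure.
End sphere_measure.

Section complex_space.
Context {R : realType} {n : nat}.
Implicit Types (z w v zeta eta : 'rV[R[i]]_n) (F G Phi : 'rV[R[i]]_n -> R[i]).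

Definition vnorm z : R := Num.sqrt (\sum_(j < n) normc (z ord0 j) ^+ 2).

Definition hdot w z : R[i] := \sum_(j < n) conjc (w ord0 j) * z ord0 j.

Definition unit_ball : set 'rV[R[i]]_n := [set z | vnorm z < 1].
Definition closed_unit_ball : set 'rV[R[i]]_n := [set z | vnorm z <= 1].
Definition unit_sphere : set 'rV[R[i]]_n := [set z | vnorm z = 1].

(* R^2n -> C^n, real parts first *)
Definition cvec (t : (n + n).-tuple (measurableTypeR R)) : 'rV[R[i]]_n :=
  \row_(j < n) ((tnth t (lshift n j) : R) +i* (tnth t (rshift n j) : R)).

Definition holomorphic F : Prop := {in unit_ball, forall z, differentiable F z}.

(* Derivative along v over the reals; the line is parametrised by R because
   'D_v would be the derivative over the field R[i]. *)
Definition rderivable v F z : Prop :=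
  derivable (fun s : R => complex.Re (F (z + s%:C *: v))) 0 1 /\
  derivable (fun s : R => complex.Im (F (z + s%:C *: v))) 0 1.
Definition rderive v F z : R[i] :=
  derive1 (fun s : R => complex.Re (F (z + s%:C *: v))) 0 +i*
  derive1 (fun s : R => complex.Im (F (z + s%:C *: v))) 0.

Definition e_ (j : 'I_n) : 'rV[R[i]]_n := delta_mx ord0 j.
Definition ie_ (j : 'I_n) : 'rV[R[i]]_n := 'i%C *: delta_mx ord0 j.

Definition dz (j : 'I_n) F z : R[i] :=
  2^-1 * (rderive (e_ j) F z - 'i%C * rderive (ie_ j) F z).
Definition dzbar (j : 'I_n) F z : R[i] :=
  2^-1 * (rderive (e_ j) F z + 'i%C * rderive (ie_ j) F z).

(* D_alpha F for the multi-index alpha, where D is dz or dzbar *)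
Definition mderive k (D : 'I_n -> ('rV[R[i]]_n -> R[i]) -> 'rV[R[i]]_n -> R[i])
    (alpha : {ffun 'I_n -> 'I_k}) F : 'rV[R[i]]_n -> R[i] :=
  foldr (fun j => iter (alpha j) (D j)) F (enum 'I_n).

(* |d^k F(z)|: the sum over |alpha| + |beta| = k, so all entries are <= k *)
Definition dnorm (k : nat) F z : R :=
  \sum_(ab : {ffun 'I_n -> 'I_k.+1} * {ffun 'I_n -> 'I_k.+1} |
         (\sum_(j < n) ab.1 j + \sum_(j < n) ab.2 j == k)%N)
    normc (mderive dz ab.1 (mderive dzbar ab.2 F) z).

(* sup over the ball of (1 - |z|^2)^rho |d^k F(z)| *)
Definition weighted_sup (rho : R) (k : nat) F : \bar R :=
  ereal_sup [set (dnorm k F z * (1 - vnorm z ^+ 2) `^ rho)%:E | z in unit_ball].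

(* the condition does not depend on the integer m > tau *)
Definition Binfty (tau : R) F : Prop :=
  holomorphic F /\
  exists2 m : nat, tau < m%:R &
    (\sum_(j < m.+1) weighted_sup (m%:R - tau) j F < +oo)%E.

Definition hardy1 F : Prop :=
  holomorphic F /\
  (ereal_sup [set \int[@sphere_measure R (n + n)]_(t in @tuple_sphere R (n + n))
                    (normc (F (r%:C *: cvec t)))%:E | r in `]0%R, (1 : R)%R[]
     < +oo)%E.

(* radial limit; junk where the limit does not exist *)
Definition boundary_value F zeta : R[i] :=
  lim (F (r%:C *: zeta) @[r --> (1 : R)^'-]).

Definition C2_ball F : Prop :=
  forall v w,
    [/\ {in unit_ball, forall z, rderivable v F z},
        {within unit_ball, continuous (rderive v F)},
        {in unit_ball, forall z, rderivable w (rderive v F) z} &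
        {within unit_ball, continuous (rderive w (rderive v F))}].

Definition laplacian F z : R[i] :=
  \sum_(j < n) (rderive (e_ j) (rderive (e_ j) F) z +
                rderive (ie_ j) (rderive (ie_ j) F) z).

Definition harmonic_extension (phi : 'rV[R[i]]_n -> R[i]) Phi : Prop :=
  [/\ {within closed_unit_ball, continuous Phi},
      C2_ball Phi,
      {in unit_ball, forall z, laplacian Phi z = 0} &
      {in unit_sphere, Phi =1 phi}].

Definition Lambda (tau : R) (phi : 'rV[R[i]]_n -> R[i]) : Prop :=
  {within unit_sphere, continuous phi} /\
  exists2 k : nat, tau < k%:R &
    exists2 Phi, harmonic_extension phi Phi &
      (weighted_sup (k%:R - tau) k Phi < +oo)%E.

End complex_space.

Section unit_interval.
Context {R : realType}.
Implicit Types (h u : R -> R[i]) (D : nat -> R -> R[i]).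

(* h is of class C^k on [0,1] and D j is its j-th derivative for j <= k: at the
   endpoints, continuity of D j turns it into the one-sided derivative. *)
Definition Ck_unit (k : nat) h D : Prop :=
  [/\ {in `[0, 1], D 0%N =1 h},
      forall j, (j <= k)%N -> {within `[0, 1], continuous (D j)} &
      forall j, (j < k)%N -> forall t : R, t \in `]0, 1[ ->
        is_derive t 1 (fun s => complex.Re (D j s)) (complex.Re (D j.+1 t)) /\
        is_derive t 1 (fun s => complex.Im (D j s)) (complex.Im (D j.+1 t))].

Definition sup_unit u : \bar R :=
  ereal_sup [set (normc (u t))%:E | t in `[0, 1]].

Definition holder_seminorm (theta : R) u : \bar R :=
  ereal_sup [set (normc (u p.1 - u p.2) / `|p.1 - p.2| `^ theta)%:E |
    p in [set p : R * R |
           [/\ p.1 \in `[0, 1], p.2 \in `[0, 1] & p.1 != p.2]]].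

Definition zygmund_seminorm u : \bar R :=
  ereal_sup [set (normc (u (p.1 + p.2) + u (p.1 - p.2) - 2 * u p.1) / p.2)%:E |
    p in [set p : R * R |
           [/\ 0 < p.2, p.1 + p.2 \in `[0, 1] & p.1 - p.2 \in `[0, 1]]]].

(* h lies in the Lipschitz-Zygmund space of order s > 0 on [0,1], with norm at
   most M.  Here l is the integer with l < s <= l + 1: the l-th derivative is
   Hoelder of exponent s - l if s < l + 1 and Zygmund if s = l + 1. *)
Definition lipzyg_norm_le (s : R) h (M : R) : Prop :=
  exists l D,
    [/\ l%:R < s <= l.+1%:R, Ck_unit l h D &
        (\sum_(j < l.+1) sup_unit (D j) +
         (if (s < l.+1%:R)%R then holder_seminorm (s - l%:R)%R (D l)
          else zygmund_seminorm (D l)) <= M%:E)%E].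

End unit_interval.

Section Gamma.
Context {R : realType} {n : nat}.

(* D i is the i-th derivative of gamma *)
Definition tangential_curve (m : nat) (gamma : R -> 'rV[R[i]]_n)
    (D : nat -> R -> 'rV[R[i]]_n) : Prop :=
  [/\ forall j, Ck_unit m (fun t => gamma t ord0 j) (fun i t => D i t ord0 j),
      {in `[0, 1], forall t, gamma t \in unit_sphere},
      {in `[0, 1], forall t, hdot (gamma t) (D 1%N t) = 0} &
      forall i, (1 <= i <= m)%N -> {in `[0, 1], forall t, vnorm (D i t) <= 1}].

(* Curves of class C^m with derivatives bounded by 1 form a decreasing family in
   m, so that asking for some m > 2 tau is the weakest reading.  For n = 1 and
   tau < 1/2 both descriptions of the space agree. *)
Definition Gamma (tau : R) (phi : 'rV[R[i]]_n -> R[i]) : Prop :=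
  if tau < 2^-1 then
    {within unit_sphere, continuous phi} /\
    exists M : R, forall zeta eta, zeta \in unit_sphere -> eta \in unit_sphere ->
      zeta != eta ->
      normc (phi zeta - phi eta) / normc (1 - hdot zeta eta) `^ tau <= M
  else if n == 1%N then Lambda tau phi
  else
    Lambda tau phi /\
    exists2 m : nat, 2 * tau < m%:R &
      exists M : R, forall gamma D, tangential_curve m gamma D ->
        lipzyg_norm_le (2 * tau) (phi \o gamma) M.

End Gamma.

(* Main.v *)
(** On almost every complex line through the origin the boundary relation becomes
    conj G = phi F, equivalently conj F = G / conj phi, with F, G in the Hardy space
    of the disc; write either as conj F = chi G.  In Cauchy's formula for F at a
    point y = x ee(u) of the disc, any part of chi that extends holomorphically to
    an annulus is integrated over a smaller circle instead.  Removing a Poisson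
    smoothing of chi leaves a part of small Hoelder seminorm, so that the mean of
    the excess of |F| over a fixed level is at most a quarter of that of |G|, and
    conversely: both vanish, and f and g are bounded.  With the kernel
    (1 - y conj(ee t))^-(m+1) and a function Q, holomorphic off the origin, that
    agrees with chi near ee(u) to order (1 - x)^tau, the same formula bounds by
    C (1 - |z|)^(tau - m) the function obtained from f by applying
    G |-> G + (radial derivative of G) / j for j = 1, ..., m; integrating back
    along rays and Cauchy's estimates bound the derivatives of f.

    For tau < 1/2 the function Q is a constant.  Otherwise Gamma is contained in
    Lambda, and Q is a Taylor polynomial of the harmonic extension with conj(ee t)
    replaced by 1 / ee(t).  For 1 / conj phi, such a Q is inverted by a partial
    sum of the geometric series around one value of chi. *)
Require Import Defs.
From mathcomp Require Import all_boot all_order all_algebra.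
From mathcomp Require Import complex.
From mathcomp Require Import all_classical all_reals all_analysis.
From mathcomp Require Import measurable_realfun.
From mathcomp Require Import ring lra.

Set Implicit Arguments.
Unset Strict Implicit.
Unset Printing Implicit Defensive.

Import Order.TTheory GRing.Theory Num.Theory.
Import numFieldNormedType.Exports.
Import ComplexField.Normc.

Local Open Scope classical_set_scope.
Local Open Scope ring_scope.
Local Open Scope complex_scope.

(** The relation holds only almost everywhere, between radial limits of functions that are merely in
    H^1. It is therefore moved inside the disc: subharmonicity of |F|^(1/2) makes |F| uniformly
    integrable over the circles, so that conj F - chi G is small in the mean on circles of radius
    near 1, and all later integrands are continuous. The radial limits exist because phi has no
    zero. Excesses over a level are compared instead of suprema: their means are finite from the
    start, while a bound of sup |F| by a quarter of sup |G| says nothing before the suprema are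
    known to be finite. Slices are known to be good only on a dense set, so constants must not
    depend on the slice. Q is accurate only near ee(u), its error growing like the K-th power of the
    distance; hence the high power of the kernel, with m >= K + tau. Each operator 1 + (radial
    derivative) / j raises the power of the Cauchy kernel by one. The harmonic extension is given as
    a C^2 function; a gradient bound by reflection and a barrier, applied to differences of
    difference quotients, yields the higher derivatives that the Taylor polynomial needs. *)

(** * Modulus, real and imaginary parts *)

Section complex_basics.
Context {R : realType}.
Local Notation C := R[i].
Implicit Types (x y z w : C) (a b e d r : R).

Lemma normc_ge0 z : 0 <= normc z.
Proof. by case: z => a b; rewrite sqrtr_ge0. Qed.

Lemma normr_normc z : `|z| = (normc z)%:C.
Proof. by []. Qed.

Lemma sqr_normc_ReIm z : normc z ^+ 2 = complex.Re z ^+ 2 + complex.Im z ^+ 2.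
Proof. by case: z => a b /=; rewrite sqr_sqrtr// addr_ge0// sqr_ge0. Qed.

Lemma normc_real a : normc a%:C = `|a|.
Proof. by rewrite /= expr0n addr0 sqrtr_sqr. Qed.

Lemma normc_nneg a : 0 <= a -> normc a%:C = a.
Proof. by move=> a0; rewrite normc_real ger0_norm. Qed.

Lemma normc_conj z : normc (conjc z) = normc z.
Proof. by case: z => a b /=; rewrite sqrrN. Qed.

Lemma normc_gt0 z : (0 < normc z) = (z != 0).
Proof.
rewrite lt_neqAle normc_ge0 andbT eq_sym; congr (~~ _).
by apply/eqP/eqP => [/eq0_normc//|->]; rewrite normc0.
Qed.

Lemma normcX z k : normc (z ^+ k) = normc z ^+ k.
Proof. by elim: k => [|k IH]; rewrite ?normc1// !exprS normcM IH. Qed.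

Lemma normcB z w : normc (z - w) = normc (w - z).
Proof. by rewrite -normcN opprB. Qed.

Lemma le_normcB z w : normc (z - w) <= normc z + normc w.
Proof. by rewrite -(normcN w) le_normcD. Qed.

Lemma le_normc_trans x z w : normc (z - w) <= normc (z - x) + normc (x - w).
Proof. by rewrite (_ : z - w = (z - x) + (x - w)) ?le_normcD//; ring. Qed.

Lemma normc_sub_ge z w : normc z - normc w <= normc (z - w).
Proof. by rewrite lerBlDr -{1}(subrK w z) le_normcD. Qed.

Lemma dist_normc z w : `|normc z - normc w| <= normc (z - w).
Proof. by rewrite ler_norml normc_sub_ge lerNl opprB normcB normc_sub_ge. Qed.

Lemma normc_sum (I : Type) (s : seq I) (P : pred I) (F : I -> C) :
  normc (\sum_(i <- s | P i) F i) <= \sum_(i <- s | P i) normc (F i).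
Proof.
elim/big_rec2: _ => [|i u v _ uv]; first by rewrite normc0.
by rewrite (le_trans (le_normcD _ _))// lerD2l.
Qed.

Lemma Re_le_normc z : `|complex.Re z| <= normc z.
Proof. by have := normc_ge_Re z; rewrite normr_normc lecR. Qed.

Lemma Im_le_normc z : `|complex.Im z| <= normc z.
Proof.
rewrite -sqrtr_sqr; case: z => a b /=.
by rewrite ler_wsqrtr// lerDr sqr_ge0.
Qed.

Lemma normc_le_ReIm z : normc z <= `|complex.Re z| + `|complex.Im z|.
Proof.
have -> : z = (complex.Re z)%:C + 'i%C * (complex.Im z)%:C by rewrite -complexE.
rewrite (le_trans (le_normcD _ _))// normcM /= !(expr0n, expr1n, addr0, add0r, mul0r, mul1r, oppr0, mulr0, subr0, sqrtr_sqr, sqrtr1).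
by rewrite normr1 mul1r.
Qed.

Lemma Re_add z w : complex.Re (z + w) = complex.Re z + complex.Re w.
Proof. by lra. Qed.
Lemma Im_add z w : complex.Im (z + w) = complex.Im z + complex.Im w.
Proof. by lra. Qed.
Lemma Re_opp z : complex.Re (- z) = - complex.Re z. Proof. by lra. Qed.
Lemma Im_opp z : complex.Im (- z) = - complex.Im z. Proof. by lra. Qed.
Lemma Re_mul z w :
  complex.Re (z * w) = complex.Re z * complex.Re w - complex.Im z * complex.Im w.
Proof. by case: z; case: w. Qed.
Lemma Im_mul z w :
  complex.Im (z * w) = complex.Re z * complex.Im w + complex.Im z * complex.Re w.
Proof. by case: z => a b; case: w => c d /=; rewrite addrC. Qed.

Lemma ReIm_eq z w :
  complex.Re z = complex.Re w -> complex.Im z = complex.Im w -> z = w.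
Proof. by case: z; case: w => a b c d /= -> ->. Qed.

Lemma conjM z w : conjc (z * w) = conjc z * conjc w.
Proof. exact: rmorphM. Qed.
Lemma conjX z k : conjc (z ^+ k) = conjc z ^+ k.
Proof. exact: rmorphXn. Qed.
Lemma conjB z w : conjc (z - w) = conjc z - conjc w.
Proof. exact: rmorphB. Qed.

Lemma mul_conjc z : z * conjc z = (normc z ^+ 2)%:C.
Proof. by rewrite rmorphXn sqr_normc. Qed.

Lemma conj_unit z : normc z = 1 -> conjc z = z^-1.
Proof.
move=> z1; have z0 : z != 0 by rewrite -normc_gt0 z1.
by apply: (mulfI z0); rewrite mul_conjc z1 expr1n divff.
Qed.

Lemma le_eps a b : (forall e, 0 < e -> a <= b + e) -> a <= b.
Proof. by move=> h; apply/ler_addgt0Pr => e /h. Qed.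

Lemma normc_eq0_eps z : (forall e, 0 < e -> normc z <= e) -> z = 0.
Proof.
move=> h; apply: eq0_normc; apply/le_anti; rewrite normc_ge0 andbT.
by apply: le_eps => e /h; rewrite add0r.
Qed.
End complex_basics.

Ltac pos := lazymatch goal with
  | |- is_true (0 < _ * _) => apply: mulr_gt0; pos
  | |- is_true (0 < _^-1) => rewrite invr_gt0; pos
  | |- is_true (0 < _ ^+ _) => apply: exprn_gt0; pos
  | |- is_true (0 < powR _ _) => apply: powR_gt0; pos
  | |- is_true (0 < _%:R) => rewrite ltr0n; done
  | |- is_true (0 < pi) => exact: pi_gt0
  | |- is_true (0 < Num.min _ _) => rewrite lt_min; apply/andP; split; pos
  | |- is_true (0 < _ + _) =>
      first [apply: addr_gt0; pos | apply: ltr_pwDl; pos | apply: ltr_wpDl; pos | lra]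
  | H : is_true (0 < ?x) |- is_true (0 < ?x) => exact H
  | |- is_true (0 < _) => lra
  | H : is_true (0 <= ?x) |- is_true (0 <= ?x) => exact H
  | H : is_true (0 < ?x) |- is_true (0 <= ?x) => exact (ltW H)
  | |- is_true (0 <= _ + _) => first [apply: addr_ge0; pos | lra]
  | |- is_true (0 <= _ ^+ 2) => exact: sqr_ge0
  | |- is_true (0 <= _ ^+ _) => apply: exprn_ge0; pos
  | |- is_true (0 <= _ * _) => apply: mulr_ge0; pos
  | |- is_true (0 <= _^-1) => rewrite invr_ge0; pos
  | |- is_true (0 <= normc _) => exact: normc_ge0
  | |- is_true (0 <= vnorm _) => exact: sqrtr_ge0
  | |- is_true (0 <= `|_|) => exact: normr_ge0
  | |- is_true (0 <= Num.sqrt _) => exact: sqrtr_ge0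
  | |- is_true (0 <= powR _ _) => exact: powR_ge0
  | |- is_true (0 <= _%:R) => exact: ler0n
  | |- is_true (0 <= _) => lra
  | |- is_true (_ != 0) => apply: lt0r_neq0; pos
  end.

(* Not a definition: unfolding it would make the arguments of [cta] lemmas
   maximally implicit. *)
Record cta {T S : topologicalType} (F : T -> S) (x : T) : Prop :=
  Cta { ctaE : {for x, continuous F} }.

(** * Continuity at a point and its closure rules *)

Section products.
Context {T S U : topologicalType}.

Lemma cta_pair (f : T -> S) (g : T -> U) (t : T) :
  cta f t -> cta g t -> cta (fun x => (f x, g x)) t.
Proof. by move=> [?] [?]; split; exact: cvg_pair. Qed.

Lemma cta_fst (f : T -> S * U) (t : T) : cta f t -> cta (fun x => (f x).1) t.
Proof.
move=> [h]; split=> A hA; apply: (h ((fun p => p.1) @^-1` A)); exists (A, setT); last by case=> a b [].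
by split=> //; exact: filterT.
Qed.

Lemma cta_snd (f : T -> S * U) (t : T) : cta f t -> cta (fun x => (f x).2) t.
Proof.
move=> [h]; split=> A hA; apply: (h ((fun p => p.2) @^-1` A)); exists (setT, A); last by case=> a b [].
by split=> //; exact: filterT.
Qed.
End products.

Section continuity.
Context {R : realType} {T : topologicalType}.
Local Notation C := R[i].
Implicit Types (F G : T -> C) (f g : T -> R) (t : T).

Lemma ctac (S : topologicalType) (c : S) t : cta (fun _ : T => c) t.
Proof. by split; exact: cvg_cst. Qed.
Lemma ctaid t : cta (fun x : T => x) t.
Proof. by split=> A; exact. Qed.
Lemma ctao (S U : topologicalType) (g : S -> U) (f : T -> S) t :
  cta g (f t) -> cta f t -> cta (fun x => g (f x)) t.
Proof. by move=> [hg] [hf]; split; exact: continuous_comp. Qed.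

Lemma ctaD F G t : cta F t -> cta G t -> cta (fun x => F x + G x) t.
Proof. by move=> [hF] [hG]; split; exact: (cvgD hF hG). Qed.
Lemma ctaN F t : cta F t -> cta (fun x => - F x) t.
Proof. by move=> [hF]; split; exact: cvgN. Qed.
Lemma ctaM F G t : cta F t -> cta G t -> cta (fun x => F x * G x) t.
Proof. by move=> [hF] [hG]; split; exact: (cvgM hF hG). Qed.
Lemma ctaX F k t : cta F t -> cta (fun x => F x ^+ k) t.
Proof.
move=> hF; elim: k => [|k IH]; first exact: ctac.
have -> : (fun x => F x ^+ k.+1) = (fun x => F x * F x ^+ k).
  by apply/funext => x; rewrite exprS.
exact: ctaM.
Qed.
Lemma ctaV F t : F t != 0 -> cta F t -> cta (fun x => (F x)^-1) t.
Proof. by move=> F0 [hF]; split; exact: cvgV. Qed.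
Lemma ctaS I (s : seq I) (P : pred I) (F : I -> T -> C) t :
  (forall i, cta (F i) t) -> cta (fun x => \sum_(i <- s | P i) F i x) t.
Proof.
move=> h; elim: s => [|a s IH].
  rewrite (_ : (fun _ => _) = (fun=> 0)); first exact: ctac.
  by apply/funext => x; rewrite big_nil.
case Pa: (P a); last first.
  rewrite (_ : (fun _ => _) = (fun x => \sum_(i <- s | P i) F i x)); first exact: IH.
  by apply/funext => x; rewrite big_cons Pa.
rewrite (_ : (fun _ => _) = (fun x => F a x + \sum_(i <- s | P i) F i x)).
  exact: (ctaD (h a) IH).
by apply/funext => x; rewrite big_cons Pa.
Qed.

Lemma rtaD f g t : cta f t -> cta g t -> cta (fun x => f x + g x) t.
Proof. by move=> [hF] [hG]; split; exact: (cvgD hF hG). Qed.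
Lemma rtaN f t : cta f t -> cta (fun x => - f x) t.
Proof. by move=> [hF]; split; exact: cvgN. Qed.
Lemma rtaM f g t : cta f t -> cta g t -> cta (fun x => f x * g x) t.
Proof. by move=> [hF] [hG]; split; exact: (cvgM hF hG). Qed.
Lemma rtaX f k t : cta f t -> cta (fun x => f x ^+ k) t.
Proof.
move=> hF; elim: k => [|k IH]; first exact: ctac.
have -> : (fun x => f x ^+ k.+1) = (fun x => f x * f x ^+ k).
  by apply/funext => x; rewrite exprS.
exact: rtaM.
Qed.
Lemma rtaV f t : f t != 0 -> cta f t -> cta (fun x => (f x)^-1) t.
Proof. by move=> F0 [hF]; split; exact: cvgV. Qed.
Lemma rta_norm f t : cta f t -> cta (fun x => `|f x|) t.
Proof. by move=> [hF]; split; exact: cvg_norm. Qed.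

Lemma rtaP f t : cta f t <-> (forall e, 0 < e -> \forall s \near t, `|f t - f s| < e).
Proof. by split=> [[/cvgrPdist_lt]//|h]; split; apply/cvgrPdist_lt. Qed.

Lemma ctaP F t :
  cta F t <-> (forall e : R, 0 < e -> \forall s \near t, normc (F t - F s) < e).
Proof.
split=> [[/cvgrPdist_lt h] e e0|h].
  have := h e%:C; rewrite ltcR => /(_ e0); apply: filterS => s.
  by rewrite ltcR.
split; apply/cvgrPdist_lt => e; rewrite ltcE /= => /andP[/eqP ei e0].
have := h _ e0; apply: filterS => s.
by rewrite ltcE ei eqxx.
Qed.

Lemma cta_normc F t : cta F t -> cta (fun x => normc (F x)) t.
Proof.
move=> /ctaP h; apply/rtaP => e /h; apply: filterS => s.
exact/le_lt_trans/dist_normc.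
Qed.
Lemma cta_Re F t : cta F t -> cta (fun x => complex.Re (F x)) t.
Proof.
move=> /ctaP h; apply/rtaP => e /h; apply: filterS => s.
by apply: le_lt_trans; rewrite -Re_opp -Re_add Re_le_normc.
Qed.
Lemma cta_Im F t : cta F t -> cta (fun x => complex.Im (F x)) t.
Proof.
move=> /ctaP h; apply/rtaP => e /h; apply: filterS => s.
by apply: le_lt_trans; rewrite -Im_opp -Im_add Im_le_normc.
Qed.
Lemma cta_ReIm f g t : cta f t -> cta g t -> cta (fun x => f x +i* g x : C) t.
Proof.
move=> /rtaP hf /rtaP hg; apply/ctaP => e e0.
have e2 : 0 < e / 2 by pos.
apply: filterS2 (hf _ e2) (hg _ e2) => s fs gs.
by rewrite (le_lt_trans (normc_le_ReIm _))//= (splitr e) ltrD.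
Qed.
Lemma cta_conj F t : cta F t -> cta (fun x => conjc (F x)) t.
Proof.
move=> /ctaP h; apply/ctaP => e /h; apply: filterS => s.
by rewrite -conjB normc_conj.
Qed.
Lemma cta_real f t : cta f t -> cta (fun x => (f x)%:C : C) t.
Proof. by move=> hf; apply: cta_ReIm => //; exact: ctac. Qed.
Lemma cta_near F G t :
  (\forall s \near t, F s = G s) -> cta F t -> cta G t.
Proof.
move=> h /ctaP hF; apply/ctaP => e /hF; apply: filterS2 (h) => s <-.
by rewrite (nbhs_singleton h).
Qed.
End continuity.

Ltac cta_hyp B y :=
  let b := eval cbv beta in (B y) in
  match goal with
  | H : cta ?A y |- _ =>
      let a := eval cbv beta in (A y) in constr_eq a b; exact H
  | H : forall t, cta ?A t |- _ =>
      let a := eval cbv beta in (A y) in constr_eq a b; exact (H y)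
  end.
Ltac cta1 :=
  match goal with
  | |- cta ?B ?y => cta_hyp B y
  | |- cta (fun _ => ?c) _ => exact (ctac c _)
  | |- cta (fun x => x) _ => exact (ctaid _)
  | |- cta (fun x => @?f x + @?g x) _ => first [apply (@ctaD _ _ f g) | apply (@rtaD _ _ f g)]
  | |- cta (fun x => - @?f x) _ => first [apply (@ctaN _ _ f) | apply (@rtaN _ _ f)]
  | |- cta (fun x => @?f x * @?g x) _ => first [apply (@ctaM _ _ f g) | apply (@rtaM _ _ f g)]
  | |- cta (fun x => @?f x ^+ _) _ => first [apply (@ctaX _ _ f) | apply (@rtaX _ _ f)]
  | |- cta (fun x => (@?f x)^-1) _ => first [apply (@ctaV _ _ f) | apply (@rtaV _ _ f)]
  | |- cta (fun x => `|@?f x|) _ => apply (@rta_norm _ _ f)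
  | |- cta (fun x => normc (@?f x)) _ => apply (@cta_normc _ _ f)
  | |- cta (fun x => complex.Re (@?f x)) _ => apply (@cta_Re _ _ f)
  | |- cta (fun x => complex.Im (@?f x)) _ => apply (@cta_Im _ _ f)
  | |- cta (fun x => conjc (@?f x)) _ => apply (@cta_conj _ _ f)
  | |- cta (fun x => real_complex _ (@?f x)) _ => apply (@cta_real _ _ f)
  | |- cta (fun x => Complex (@?f x) (@?g x)) _ => apply (@cta_ReIm _ _ f g)
  | |- cta (fun x => \sum_(i <- _ | _) (@?f i x)) _ => apply (@ctaS _ _ _ _ _ f) => ?
  | |- cta (fun x => fst (@?f x)) _ => apply (@cta_fst _ _ _ f)
  | |- cta (fun x => snd (@?f x)) _ => apply (@cta_snd _ _ _ f)
  | |- cta normc _ => apply (@cta_normc _ _ (fun z => z))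
  | |- cta (@conjc _) _ => apply (@cta_conj _ _ (fun z => z))
  | |- cta (real_complex _) _ => apply (@cta_real _ _ (fun z => z))
  | |- cta (@complex.Re _) _ => apply (@cta_Re _ _ (fun z => z))
  | |- cta (@complex.Im _) _ => apply (@cta_Im _ _ (fun z => z))
  | |- cta fst _ => apply (@cta_fst _ _ _ (fun p => p))
  | |- cta snd _ => apply (@cta_snd _ _ _ (fun p => p))
  | |- cta (fun x => (@?f x, @?g x)) _ => apply (@cta_pair _ _ _ f g)
  | H : forall t, cta (?F t) _ |- cta (?F _) _ => apply H
  | H : forall t, cta (fun _ => _) t |- _ => apply H
  | H : forall t, cta ?F t |- cta (fun x => ?F (@?g x)) _ => apply (@ctao _ _ _ F g); [exact (H _)|]
  | |- cta _ _ => progress cbv beta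
  end.
Ltac cts := repeat cta1.

Lemma near_all (T : topologicalType) (P : T -> Prop) (t : T) :
  (forall s, P s) -> \forall s \near t, P s.
Proof. by move=> h; exact: (@filterE _ (nbhs t) _ P h). Qed.

Lemma near_and (T : topologicalType) (P Q : T -> Prop) (t : T) :
  (\forall s \near t, P s) -> (\forall s \near t, Q s) ->
  \forall s \near t, P s /\ Q s.
Proof. exact: filterS2. Qed.

(** * Complex derivatives of functions of one variable *)

Section complex_derivative.
Context {R : realType}.
Local Notation C := R[i].
Implicit Types (F G : C -> C) (z w c : C).

Lemma nearCP (P : C -> Prop) z :
  (\forall w \near z, P w) <->
  exists2 d : R, 0 < d & forall w, normc (w - z) < d -> P w.
Proof.
split=> [/nbhs_ballP[e e0 h]|[d d0 h]].
  have : (0 : C) < e by [].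
  rewrite ltcE /= => /andP[/eqP ei e0']; exists (complex.Re e) => // w wd.
  apply: h; rewrite /ball /= normr_normc ltcE /= ei eqxx /=.
  by rewrite normcB.
have d0' : (0 : C) < d%:C by rewrite ltcR.
apply/nbhs_ballP; exists d%:C => //.
by move=> w; rewrite /ball /= normr_normc ltcR normcB; exact: h.
Qed.

Lemma nearRP (P : R -> Prop) (x : R) :
  (\forall y \near x, P y) <->
  exists2 d : R, 0 < d & forall y, `|y - x| < d -> P y.
Proof.
split=> [/nbhs_ballP[e e0 h]|[d d0 h]].
  by exists e => // y yd; apply: h; rewrite /ball /= distrC.
by apply/nbhs_ballP; exists d => // y; rewrite /ball /= distrC; exact: h.
Qed.

(* Caratheodory's form of complex differentiability *)
Definition cder F z c : Prop := exists q : C -> C,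
  [/\ cta q z, q z = c & \forall w \near z, F w = F z + q w * (w - z)].

Lemma cder_cta F z c : cder F z c -> cta F z.
Proof.
move=> [q [hq _ h]]; apply: (@cta_near _ _ (fun w => F z + q w * (w - z))).
  by apply: filterS h => w ->.
by cts.
Qed.

Lemma cder_near F G z c :
  (\forall w \near z, F w = G w) -> cder F z c -> cder G z c.
Proof.
move=> h [q [hq qz hF]]; exists q; split=> //.
by apply: filterS2 (h) hF => w <- ->; rewrite (nbhs_singleton h).
Qed.

Lemma cder_cst (a : C) z : cder (fun=> a) z 0.
Proof.
exists (fun=> 0); split=> //; first exact: ctac.
by apply: near_all => w; rewrite mul0r addr0.
Qed.

Lemma cder_id z : cder (fun w => w) z 1.
Proof.
exists (fun=> 1); split=> //; first exact: ctac.
by apply: near_all => w; ring.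
Qed.

Lemma cderD F G z c c' :
  cder F z c -> cder G z c' -> cder (fun w => F w + G w) z (c + c').
Proof.
move=> [q [hq <- hF]] [q' [hq' <- hG]]; exists (fun w => q w + q' w).
split=> //; first by cts.
by apply: filterS2 hF hG => w -> ->; ring.
Qed.

Lemma cderM F G z c c' : cder F z c -> cder G z c' ->
  cder (fun w => F w * G w) z (c * G z + F z * c').
Proof.
move=> hF' hG'; have cG := cder_cta hG'.
have [q [hq <- hF]] := hF'; have [q' [hq' <- hG]] := hG'.
exists (fun w => q w * G w + F z * q' w); split=> //; first by cts.
by apply: filterS2 hF hG => w -> ->; ring.
Qed.

Lemma cderN F z c : cder F z c -> cder (fun w => - F w) z (- c).
Proof.
move=> [q [hq <- hF]]; exists (fun w => - q w); split; [by cts|by []|].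
by apply: filterS hF => w ->; ring.
Qed.

Lemma cta_neq0_near (T : topologicalType) (F : T -> C) t :
  cta F t -> F t != 0 -> \forall s \near t, F s != 0.
Proof.
move=> /ctaP h F0; have := h (normc (F t)); rewrite normc_gt0 => /(_ F0).
by apply: filterS => s; apply: contraTN => /eqP ->; rewrite subr0 ltxx.
Qed.

Lemma cderV F z c : F z != 0 -> cder F z c ->
  cder (fun w => (F w)^-1) z (- c / F z ^+ 2).
Proof.
move=> F0 hF'; have cF := cder_cta hF'; have [q [hq <- hF]] := hF'.
exists (fun w => - q w / (F z * F w)); split=> //; first by cts; rewrite mulf_neq0.
apply: filterS2 hF (cta_neq0_near cF F0) => w hw w0.
rewrite mulrAC mulNr (_ : q w * (w - z) = F w - F z); last by rewrite hw; ring.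
by field; rewrite F0 w0.
Qed.

Lemma cder_comp F G z c c' : cder F (G z) c -> cder G z c' ->
  cder (fun w => F (G w)) z (c * c').
Proof.
move=> [q [hq <- hF]] hG'; have cG := cder_cta hG'; have [q' [hq' <- hG]] := hG'.
exists (fun w => q (G w) * q' w); split=> //.
  by apply: ctaM => //; exact: (@ctao _ _ _ q G).
have hFG : \forall w \near z, F (G w) = F (G z) + q (G w) * (G w - G z) by case: cG => cG; exact: cG hF.
by apply: filterS2 hFG hG => w -> ->; rewrite -mulrA; congr (_ + _ * _); ring.
Qed.

Lemma cderX F k z c : cder F z c ->
  cder (fun w => F w ^+ k) z (k%:R * F z ^+ k.-1 * c).
Proof.
move=> hF; elim: k => [|k IH].
  by rewrite !mul0r; exact: cder_cst.
have := cderM hF IH.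
rewrite (_ : _ + _ = k.+1%:R * F z ^+ k * c); last first.
  by case: k {IH} => [|k] /=; rewrite ?expr0 -?natr1 ?exprS; ring.
by rewrite (_ : (fun _ => _) = (fun w => F w ^+ k.+1))//; apply/funext => w; rewrite exprS.
Qed.

Lemma cderZ a F z c : cder F z c -> cder (fun w => a * F w) z (a * c).
Proof. by move=> /(cderM (cder_cst a z)); rewrite mul0r add0r. Qed.

Lemma cderP F z c : cder F z c <-> (forall e : R, 0 < e -> \forall w \near z,
  normc (F w - F z - c * (w - z)) <= e * normc (w - z)).
Proof.
split=> [[q [/ctaP hq <- hF]] e /hq h|h].
  apply: filterS2 hF h => w -> qe.
  rewrite (_ : _ - _ = (q w - q z) * (w - z)); last by ring.
  by rewrite normcM ler_wpM2r ?normc_ge0// normcB ltW.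
exists (fun w => if w == z then c else (F w - F z) / (w - z)).
rewrite eqxx; split=> //; last first.
  apply: near_all => w; case: eqP => [->|/eqP wz]; first by rewrite subrr mulr0 addr0.
  by rewrite divfK ?subr_eq0// subrKC.
apply/ctaP => e e0; rewrite eqxx; have := h (e / 2); rewrite divr_gt0// => /(_ isT).
apply: filterS => w; case: eqP => [_ _|/eqP wz]; first by rewrite subrr normc0.
have wz0 : 0 < normc (w - z) by rewrite normc_gt0 subr_eq0.
move=> hw; rewrite normcB (le_lt_trans (y := e / 2)) ?ltr_pdivrMr ?ltr_pMr ?ltr1n//.
rewrite -(ler_pM2r wz0) -normcM mulrBl divfK ?subr_eq0//.
Qed.

Lemma cder_uniq F z c c' : cder F z c -> cder F z c' -> c = c'.
Proof.
move=> /cderP h /cderP h'; apply/eqP; rewrite -subr_eq0; apply/eqP.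
apply: normc_eq0_eps => e e0.
have e2 : 0 < e / 2 by pos.
have /nearCP[d d0 H] := near_and (h _ e2) (h' _ e2).
have [] := H (z + (d / 2)%:C).
  by rewrite addrC addKr normc_nneg ?divr_ge0 ?(ltW d0)// ltr_pdivrMr// ltr_pMr ?ltr1n.
rewrite (addrC z) addrK normc_nneg ?divr_ge0 ?(ltW d0)// => h1 h2.
have d2 : 0 < d / 2 by pos.
rewrite -(ler_pM2r d2) -{1}(normc_nneg (ltW d2)) -normcM.
set u := F _ in h1 h2.
rewrite (_ : (c - c') * _ = (u - F z - c' * (d / 2)%:C) - (u - F z - c * (d / 2)%:C)); last by ring.
rewrite (le_trans (le_normcB _ _))// (splitr e) mulrDl lerD//.
Qed.
End complex_derivative.

Ltac cder1 :=
  match goal with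
  | |- cder (fun _ => ?c) _ _ => eapply cder_cst
  | |- cder (fun x => x) _ _ => eapply cder_id
  | |- cder (fun x => @?f x + @?g x) _ _ => eapply (@cderD _ f g)
  | |- cder (fun x => - @?f x) _ _ => eapply (@cderN _ f)
  | |- cder (fun x => ?a * @?g x) _ _ => eapply (@cderZ _ a g)
  | |- cder (fun x => @?f x * @?g x) _ _ => eapply (@cderM _ f g)
  | |- cder (fun x => @?f x ^+ _) _ _ => eapply (@cderX _ f)
  | |- cder (fun x => (@?f x)^-1) _ _ => eapply (@cderV _ f)
  end.
Ltac cdr := repeat cder1.

(** * Joint continuity and the tube lemma *)

Section topology.
Context {T S U W : topologicalType}.

Lemma cta_uncurry (k : S -> U -> W) (f : T -> S) (g : T -> U) (t : T) :
  cta (fun p : S * U => k p.1 p.2) (f t, g t) -> cta f t -> cta g t ->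
  cta (fun x => k (f x) (g x)) t.
Proof.
move=> hk hf hg.
exact: (@ctao _ _ _ (fun p : S * U => k p.1 p.2) (fun x => (f x, g x))) hk (cta_pair hf hg).
Qed.

(** The tube lemma, in the form that turns joint continuity into uniformity over a compact
    parameter. *)
Lemma near_compact (K : set T) (P : S -> T -> Prop) (s : S) :
  compact K -> (forall t, K t -> \forall p \near (s, t), P p.1 p.2) ->
  \forall r \near s, forall t, K t -> P r t.
Proof.
move=> /compact_near_coveringP cK h.
have H (x : T) : K x -> \forall y \near x & r \near s, P r y.
  move=> /h[[A B] [/= hA hB] H]; exists (B, A) => // -[b a] [/= ? ?].
  exact: (H (a, b)).
exact: cK S (nbhs s) P _ H.
Qed.
End topology.

(** * Integrals of continuous functions over [0,1] *)

Section real_integral.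
Context {R : realType}.
Local Notation mu := (@lebesgue_measure R).
Implicit Types (f g : R -> R) (a b c x y t : R).

Definition rint f : R := \int[mu]_(t in `[0, 1]) f t.

Definition c01 {S : topologicalType} (F : R -> S) : Prop :=
  forall t, 0 <= t <= 1 -> cta F t.

Lemma cta_within (S : topologicalType) (F : R -> S) a b :
  (forall t, a <= t <= b -> cta F t) -> {within `[a, b], continuous F}.
Proof.
move=> h; apply: continuous_in_subspaceT => t; rewrite inE /= in_itv /= => tab.
exact: ctaE (h t tab).
Qed.

Lemma integrable_cta f a b : (forall t, a <= t <= b -> cta f t) ->
  mu.-integrable `[a, b] (EFin \o f).
Proof.
by move=> h; apply: continuous_compact_integrable; [exact: segment_compact|exact: cta_within].
Qed.

Lemma integrable_c01 f : c01 f -> mu.-integrable `[0, 1] (EFin \o f).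
Proof. exact: integrable_cta. Qed.

Let m01 : measurable (`[0, 1]%classic : set R). Proof. exact: measurable_itv. Qed.

Lemma rintD f g : c01 f -> c01 g -> rint (fun t => f t + g t) = rint f + rint g.
Proof. by move=> hf hg; apply: RintegralD => //; exact: integrable_c01. Qed.

Lemma rintZ c f : c01 f -> rint (fun t => c * f t) = c * rint f.
Proof. by move=> hf; apply: RintegralZl => //; exact: integrable_c01. Qed.

Lemma rint_cst c : rint (fun=> c) = c.
Proof.
rewrite /rint Rintegral_cst//; have := @lebesgue_measure_itv R `[0%R, 1%R].
by rewrite /= lte_fin ltr01 oppr0 adde0 => ->; rewrite /= mulr1.
Qed.

Lemma eq_rint f g : (forall t, 0 <= t <= 1 -> f t = g t) -> rint f = rint g.
Proof. by move=> h; apply: eq_Rintegral => t; rewrite inE /= in_itv /=; exact: h. Qed.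

Lemma rintN f : c01 f -> rint (fun t => - f t) = - rint f.
Proof.
by move=> hf; rewrite -mulN1r -rintZ//; apply: eq_rint => t _; rewrite mulN1r.
Qed.

Lemma rintB f g : c01 f -> c01 g -> rint (fun t => f t - g t) = rint f - rint g.
Proof. by move=> hf hg; rewrite rintD ?rintN// => t /hg hgt; cts. Qed.

Lemma ler_rint f g : c01 f -> c01 g -> (forall t, 0 <= t <= 1 -> f t <= g t) ->
  rint f <= rint g.
Proof.
move=> hf hg h; apply: le_Rintegral; [exact: m01|exact: integrable_c01..|].
by move=> t /=; rewrite in_itv /=; exact: h.
Qed.

Lemma rint_ge0 f : (forall t, 0 <= t <= 1 -> 0 <= f t) -> 0 <= rint f.
Proof.
by move=> h; apply: Rintegral_ge0 => t /=; rewrite in_itv /=; exact: h.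
Qed.

Lemma rint_le f c : c01 f -> (forall t, 0 <= t <= 1 -> f t <= c) -> rint f <= c.
Proof. by move=> hf h; rewrite -[leRHS]rint_cst ler_rint// => t _; exact: ctac. Qed.

Lemma ler_norm_rint f g : c01 f -> c01 g ->
  (forall t, 0 <= t <= 1 -> `|f t| <= g t) -> `|rint f| <= rint g.
Proof.
move=> hf hg h; rewrite ler_norml -rintN//.
have hg' : c01 (fun t => - g t) by move=> t /hg hgt; cts.
by rewrite !ler_rint// => t /h; rewrite ler_norml => /andP[].
Qed.

(* Wrapping the class [is_derive] keeps instance resolution out of the proofs. *)
Record rder f x c : Prop := Rder { rderE : is_derive x 1 f c }.

Lemma primitive f a b : (forall t, cta f t) -> exists P : R -> R,
  forall x, a < x < b -> rder P x (f x).
Proof.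
move=> hf; exists (fun x => \int[mu]_(t in `[a, x]) f t) => x /andP[ax xb].
have I : mu.-integrable `[a, b] (EFin \o f) by apply: integrable_cta.
have H := @continuous_FTC1 R f (BLeft a) x b xb I.
have [dP E] := H ltac:(by []) (ctaE (hf x)).
split; apply: DeriveDef; [exact: dP|by rewrite -E derive1E].
Qed.

Lemma rder_eq f x c c' : rder f x c -> c = c' -> rder f x c'.
Proof. by move=> h <-. Qed.

Lemma rder_cta f x c : rder f x c -> cta f x.
Proof.
move=> [h]; split; apply: differentiable_continuous; apply/derivable1_diffP.
exact: ex_derive.
Qed.

Lemma rder_cst c x : rder (fun=> c) x 0.
Proof. by split; exact: is_derive_cst. Qed.

Lemma rder_id x : rder (fun y => y) x 1.
Proof. by split; exact: is_derive_id. Qed.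

Lemma rderD f g x c c' : rder f x c -> rder g x c' ->
  rder (fun y => f y + g y) x (c + c').
Proof. by move=> [hf] [hg]; split; exact: (@is_deriveD _ _ _ f g). Qed.

Lemma rderN f x c : rder f x c -> rder (fun y => - f y) x (- c).
Proof. by move=> [hf]; split; exact: (@is_deriveN _ _ _ f). Qed.

Lemma rderM f g x c c' : rder f x c -> rder g x c' ->
  rder (fun y => f y * g y) x (c * g x + f x * c').
Proof.
move=> [hf] [hg]; split; apply: (is_derive_eq (@is_deriveM _ _ f g x 1 c c' hf hg)).
by rewrite /GRing.scale /=; ring.
Qed.

Lemma rderZ a f x c : rder f x c -> rder (fun y => a * f y) x (a * c).
Proof. by move=> /(rderM (rder_cst a x)); rewrite mul0r add0r. Qed.

Lemma rder_comp f g x c c' : rder f (g x) c -> rder g x c' ->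
  rder (fun y => f (g y)) x (c * c').
Proof. by move=> [hf] [hg]; split; exact: (@is_derive1_comp _ f g). Qed.

Lemma rderX f k x c : rder f x c ->
  rder (fun y => f y ^+ k) x (k%:R * f x ^+ k.-1 * c).
Proof.
move=> hf; elim: k => [|k IH]; first by rewrite !mul0r; exact: rder_cst.
rewrite (_ : (fun _ => _) = (fun y => f y * f y ^+ k)); last first.
  by apply/funext => y; rewrite exprS.
apply: rder_eq (rderM hf IH) _.
by case: k {IH} => [|k] /=; rewrite ?expr0 -?natr1 ?exprS; ring.
Qed.

Lemma rder_near f g x c : (\forall y \near x, f y = g y) -> rder f x c -> rder g x c.
Proof.
move=> h [hf]; by split; apply: (near_eq_is_derive (f := f)).
Qed.

Lemma MVTle f g df dg a b : a <= b -> (forall x, a < x < b -> rder f x (df x)) ->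
  (forall x, a < x < b -> rder g x (dg x)) -> (forall x, a < x < b -> df x <= dg x) ->
  (forall x, a <= x <= b -> cta f x) -> (forall x, a <= x <= b -> cta g x) ->
  f b - f a <= g b - g a.
Proof.
rewrite le_eqVlt => /predU1P[->|ab] hf hg h cf cg; first by lra.
have hd x : x \in `]a, b[ -> is_derive x 1 (fun y => g y + - f y) (dg x + - df x).
  by rewrite in_itv /= => xab; apply: rderE; apply: (rderD (hg _ xab) (rderN (hf _ xab))).
have [x] := MVT ab hd (cta_within (fun x hx => rtaD (cg _ hx) (rtaN (cf _ hx)))).
rewrite in_itv /= => /h hx E; have : 0 <= (dg x + - df x) * (b - a).
  by pos.
by lra.
Qed.

(** The substitutions made in integrals are halvings and translations; composing the primitive with
    the affine map replaces a change of variables. *)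
Lemma FTC_affine P f a b : b != 0 ->
  (forall t, 0 <= t <= 1 -> rder P (a + b * t) (f (a + b * t))) ->
  (forall t, 0 <= t <= 1 -> cta (fun s => f (a + b * s)) t) ->
  rint (fun t => f (a + b * t)) = (P (a + b) - P a) / b.
Proof.
move=> b0 dP hf; pose Q t := b^-1 * P (a + b * t).
have dQ t : 0 <= t <= 1 -> rder Q t (f (a + b * t)).
  move=> /dP dPt; have d1 : rder (fun s => a + b * s) t b.
    by apply: rder_eq (rderD (rder_cst a t) (rderZ b (rder_id t))) _; rewrite add0r mulr1.
  by apply: rder_eq (rderZ _ (rder_comp (g := fun s => a + b * s) dPt d1)) _; rewrite mulrCA mulVf ?mulr1.
have cQ t : 0 <= t <= 1 -> cta Q t by move=> /dQ; exact: rder_cta.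
have t01 (t : R) : t \in `]0%R, 1%R[ -> 0 <= t <= 1.
  by rewrite in_itv => /andP[/ltW -> /ltW ->].
have c0 : cta Q 0 by apply: cQ; rewrite lexx ler01.
have c1 : cta Q 1 by apply: cQ; rewrite lexx ler01.
rewrite /rint /Rintegral (@continuous_FTC2 _ _ Q)//.
- by rewrite /= /Q mulr1 mulr0 addr0 -mulrBr mulrC.
- exact: cta_within.
- split.
  + by move=> t /t01/dQ[?]; exact: ex_derive.
  + by apply: cvg_at_right_filter; exact: ctaE c0.
  + by apply: cvg_at_left_filter; exact: ctaE c1.
- by move=> t /t01/dQ[dt]; rewrite derive1E; exact: derive_val.
Qed.

Lemma FTC P f : (forall t, 0 <= t <= 1 -> rder P t (f t)) -> c01 f ->
  rint f = P 1 - P 0.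
Proof.
move=> dP hf; have := @FTC_affine P f 0 1; rewrite add0r divr1 => <-.
- by apply: eq_rint => t _; rewrite add0r mul1r.
- exact: oner_neq0.
- by move=> t t01; rewrite add0r mul1r; exact: dP.
- move=> t t01; rewrite (_ : (fun _ => _) = f); first exact: hf.
  by apply/funext => s; rewrite add0r mul1r.
Qed.

(** Composition with it makes a function that is continuous at the points of [0,1] continuous on the
    whole line, so that [primitive] applies. *)
Let clamp t : R := Num.max 0 (Num.min 1 t).

Let clampE t : 0 <= t <= 1 -> clamp t = t.
Proof. by case/andP=> t0 t1; rewrite /clamp min_r// max_r. Qed.

Let cta_clamp f : c01 f -> forall t, cta (fun s => f (clamp s)) t.
Proof.
move=> hf t; apply: (@ctao _ _ _ f clamp).
  by apply: hf; rewrite /clamp le_max lexx ge_max ler01 ge_min lexx.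
rewrite /clamp; split; apply: (@continuous_max _ _ (fun=> 0) (fun t => Num.min 1 t)).
  exact: cvg_cst.
apply: (@continuous_min _ _ (fun=> 1) id); [exact: cvg_cst|exact: cvg_id].
Qed.

Lemma rint_halves f : c01 f ->
  rint f = (rint (fun t => f (t / 2)) + rint (fun t => f (2^-1 + t / 2))) / 2.
Proof.
move=> hf; pose g t := f (clamp t); have hg : forall t, cta g t by exact: cta_clamp.
have [P dP] := primitive (-1) 2 hg.
have gf t : 0 <= t <= 1 -> g t = f t by move=> t01; rewrite /g clampE.
have E a b : 0 < b -> 0 <= a -> a + b <= 1 ->
    rint (fun t => f (a + b * t)) = (P (a + b) - P a) / b.
  move=> b0 a0 ab.
  have B t : 0 <= t <= 1 -> 0 <= a + b * t <= 1.
    move=> /andP[t0 t1]; rewrite addr_ge0 ?mulr_ge0 ?(ltW b0)//=.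
    by rewrite (le_trans _ ab)// lerD2l ler_piMr// ltW.
  rewrite -(@FTC_affine P g) ?gt_eqF//.
  - by apply: eq_rint => t t01; rewrite gf// B.
  - by move=> t /B /andP[? ?]; apply: dP; lra.
  - by move=> t _; cts.
have h2 : (0 : R) < 2^-1 by [].
have -> : rint f = P 1 - P 0.
  rewrite (@eq_rint f g) => [|t /gf//]; apply: FTC => t => [/andP[? ?]|_]; last exact: hg.
  by apply: dP; lra.
have -> : rint (fun t => f (t / 2)) = (P (2^-1) - P 0) / 2^-1.
  have := E 0 2^-1 h2 (lexx 0); rewrite add0r => <-; last by lra.
  by apply: eq_rint => t _; rewrite add0r mulrC.
have -> : rint (fun t => f (2^-1 + t / 2)) = (P 1 - P 2^-1) / 2^-1.
  have h1 : 2^-1 + 2^-1 = 1 :> R by lra.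
  have := E 2^-1 2^-1 h2 (ltW h2); rewrite h1 => <- //.
  by apply: eq_rint => t _; rewrite mulrC.
by lra.
Qed.

(** The integral over [x, x + 1] has derivative f(x + 1) - f(x) = 0 in x. *)
Lemma rint_shift f a : (forall t, cta f t) -> (forall t, f (t + 1) = f t) ->
  rint (fun t => f (t + a)) = rint f.
Proof.
move=> hf per; have [P dP] := primitive (- `|a| - 1) (`|a| + 2) hf.
have E b : `|b| <= `|a| -> rint (fun t => f (t + b)) = P (b + 1) - P b.
  rewrite ler_norml => /andP[b1 b2].
  rewrite -[RHS]divr1 -(@FTC_affine P f) ?oner_eq0//.
  - by apply: eq_rint => t _; rewrite mul1r addrC.
  - by move=> t /andP[t0 t1]; apply: dP; lra.
  - by move=> t _; cts.
rewrite E// (_ : rint f = rint (fun t => f (t + 0))); last first.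
  by apply: eq_rint => t _; rewrite addr0.
rewrite E ?normr0//.
pose D x := P (x + 1) - P x.
have dD x : - `|a| - 2^-1 < x < `|a| + 2^-1 -> rder D x 0.
  move=> /andP[x1 x2].
  have d1 : rder (fun s => s + 1) x 1.
    by apply: rder_eq (rderD (rder_id x) (rder_cst 1 x)) _; rewrite addr0.
  have dP1 : rder P (x + 1) (f x) by rewrite -per; apply: dP; lra.
  have dP2 : rder P x (f x) by apply: dP; lra.
  apply: rder_eq (rderD (rder_comp (g := fun s => s + 1) dP1 d1) (rderN dP2)) _.
  by lra.
have [c1 c2] : - `|a| <= a /\ a <= `|a| by apply/andP; rewrite -ler_norml.
have DE x y : - `|a| - 2^-1 < x -> x <= y -> y < `|a| + 2^-1 -> D x = D y.
  move=> hx xy hy; have dD0 t : x <= t <= y -> rder D t 0 by move=> /andP[? ?]; apply: dD; lra.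
  have xyW t : x < t < y -> x <= t <= y by lra.
  have H1 : 0 <= D y - D x.
    rewrite -[leLHS](subrr (0 : R)).
    apply: (@MVTle (fun=> 0) D (fun=> 0) (fun=> 0) x y xy) => [t _|t /xyW/dD0|t _|t _|t /dD0] //.
    - exact: rder_cst.
    - exact: ctac.
    - exact: rder_cta.
  have H2 : D y - D x <= 0.
    rewrite -[leRHS](subrr (0 : R)).
    apply: (@MVTle D (fun=> 0) (fun=> 0) (fun=> 0) x y xy) => [t /xyW/dD0|t _|t _|t /dD0|t _] //.
    - exact: rder_cst.
    - exact: rder_cta.
    - exact: ctac.
  by lra.
rewrite -/(D 0) -/(D a).
by have [a1|/ltW a1] := leP 0 a; [symmetry|]; apply: DE; lra.
Qed.

Lemma compact01 : compact (`[0, 1]%classic : set R).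
Proof. exact: segment_compact. Qed.

Lemma near_c01 (S : topologicalType) (P : S -> R -> Prop) (s : S) :
  (forall t, 0 <= t <= 1 -> \forall p \near (s, t), P p.1 p.2) ->
  \forall r \near s, forall t, 0 <= t <= 1 -> P r t.
Proof.
move=> h; have := @near_compact R S _ P s compact01.
rewrite /= => G; apply: (filterS _ (G _)) => [r hr t t01|t]; last by cts; exact: h.
by apply: hr; rewrite /= in_itv.
Qed.

Lemma cta_rint (S : topologicalType) (k : S -> R -> R) (s : S) :
  (forall t, 0 <= t <= 1 -> cta (fun p : S * R => k p.1 p.2) (s, t)) ->
  (\forall r \near s, c01 (k r)) -> cta (fun r => rint (k r)) s.
Proof.
move=> h hc; apply/rtaP => e e0.
(* Compactness of [0,1] makes the convergence of k r to k s uniform in t. *)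
have h2 : \forall r \near s, forall t, 0 <= t <= 1 -> `|k s t - k r t| <= e / 2.
  apply: near_c01 => t t01.
  have e4 : 0 < e / 4 by pos.
  have /rtaP /(_ _ e4) H := h t t01.
  have H2 : \forall p \near (s, t), `|k s t - k s p.2| < e / 4.
    have c2 : cta (fun p : S * R => k s p.2) (s, t).
      apply: (@ctao _ _ _ (fun q : S * R => k q.1 q.2) (fun p : S * R => (s, p.2))).
        exact: h.
      by cts.
    by have /rtaP /(_ _ e4) := c2.
  apply: filterS2 H H2 => -[r t'] /= H1 H2.
  rewrite (le_trans (ler_distD (k s t) _ _))// distrC.
  by lra.
have hcs : c01 (k s) by exact: nbhs_singleton hc.
apply: filterS2 h2 hc => r hr hcr.
rewrite -rintB// (le_lt_trans (y := rint (fun=> e / 2)))//.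
  apply: ler_norm_rint => // t t01; first by have := hcs t t01; have := hcr t t01 => ? ?; cts.
  exact: ctac.
by rewrite rint_cst ltr_pdivrMr// ltr_pMr ?ltr1n.
Qed.

(** The tube lemma with the distance bound d, near 0, as the parameter. *)
Lemma unif_cont (T : pseudoMetricType R) (f : T -> R) (K : set T) :
  compact K -> (forall t : T, K t -> cta f t) -> forall e : R, 0 < e ->
  exists2 d : R, 0 < d & forall t s : T, K t -> ball t d s -> `|f t - f s| < e.
Proof.
move=> cK hf e e0.
have : \forall d \near (0 : R), forall t : T, K t -> 0 < d ->
    forall s : T, ball t d s -> `|f t - f s| < e.
  apply: near_compact => // t Kt.
  have e2 : 0 < e / 2 by pos.
  have /rtaP /(_ _ e2) := hf t Kt.
  move=> /nbhs_ballP[r /= r0 H].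
  exists (ball (0 : R) (r / 2), ball t (r / 2)).
    by split; apply: nbhsx_ballx; rewrite divr_gt0.
  move=> [d x] [/= + tx]; rewrite /ball /= sub0r normrN => dr d0 s xs.
  have r2 : r / 2 <= r by lra.
  have tx' := H x (le_ball r2 tx).
  have ts : ball t r s.
    rewrite (splitr r); apply: ball_triangle tx (le_ball _ xs).
    by rewrite (le_trans (ler_norm _))// ltW.
  have := H s ts => /= ts'.
  rewrite (le_lt_trans (ler_distD (f t) _ _))// distrC (splitr e) ltrD//.
move=> /nbhs_ballP[r /= r0 H]; exists (r / 2); first by pos.
move=> t s Kt; apply: (H (r / 2)) => //; last by pos.
by rewrite /ball /= sub0r normrN gtr0_norm ?divr_gt0// ltr_pdivrMr// ltr_pMr ?ltr1n.
Qed.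

End real_integral.

(** * Exchange of two integrals of a continuous kernel *)

Section fubini.
Context {R : realType}.
Implicit Types (k : R -> R -> R) (t s a b e : R).

Let quarter (k : R -> R -> R) a b := fun t s => k (a + t / 2) (b + s / 2).

Let II (k : R -> R -> R) := rint (fun t => rint (k t)).

Let C2 (k : R -> R -> R) := forall p, cta (fun q : R * R => k q.1 q.2) p.

Let C2l k t s : C2 k -> cta (k t) s.
Proof. by move=> h; apply: cta_uncurry; [exact: h|exact: ctac|exact: ctaid]. Qed.

Let C2i k t : C2 k -> cta (fun t => rint (k t)) t.
Proof.
by move=> h; apply: cta_rint => [s _|]; [exact: h|apply: near_all => x s _; exact: C2l].
Qed.

Let C2q k a b : C2 k -> C2 (quarter k a b).
Proof. by move=> h [x y]; apply: (@cta_uncurry _ _ _ _ k (fun q : R * R => a + q.1 / 2) (fun q : R * R => b + q.2 / 2)); [exact: h|cts..]. Qed.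

Let II_quarter k : C2 k -> II k = (II (quarter k 0 0) + II (quarter k 0 2^-1) +
  (II (quarter k 2^-1 0) + II (quarter k 2^-1 2^-1))) / 4.
Proof.
move=> h; rewrite /II.
have E a : rint (fun t => rint (k (a + t / 2))) =
    (rint (fun t => rint (quarter k a 0 t)) + rint (fun t => rint (quarter k a 2^-1 t))) / 2.
  rewrite -rintD; [|by move=> t _; exact/C2i/C2q..].
  rewrite mulrC -rintZ; last first.
    by move=> t _; apply: rtaD; exact/C2i/C2q.
  apply: eq_rint => t _; rewrite (rint_halves (f := k _)) => [|s _]; last exact: C2l.
  by rewrite mulrC /quarter; congr (_ * (_ + _)); apply: eq_rint => s _; rewrite add0r.
rewrite rint_halves => [|t _]; last exact: C2i.
rewrite (_ : rint (fun t => rint (k (t / 2))) = rint (fun t => rint (k (0 + t / 2)))); last first.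
  by apply: eq_rint => t _; rewrite add0r.
rewrite (E 0) (E 2^-1).
by move: (rint _) (rint _) (rint _) (rint _) => x y z w; field.
Qed.

(** Both iterated integrals are averages of those over the four quarters of the square. Their
    difference is thus controlled by the oscillation of k on arbitrarily small squares, which
    uniform continuity makes small. *)
Lemma rint_fubini (k : R -> R -> R) : (forall p, cta (fun q : R * R => k q.1 q.2) p) ->
  rint (fun t => rint (k t)) = rint (fun s => rint (k ^~ s)).
Proof.
move=> hk; pose sw (k : R -> R -> R) t s := k s t.
have C2s k' : C2 k' -> C2 (sw k').
  by move=> h [x y]; apply: (@cta_uncurry _ _ _ _ k' (fun q : R * R => q.2) (fun q : R * R => q.1)); [exact: h|cts..].
pose sq (p : R * R) := (0 <= p.1 <= 1) && (0 <= p.2 <= 1).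
(* Induction on the number n of halvings after which the oscillation is at most e. For n = 0 both
   integrals are within e of k'(0, 0). *)
have osc n e k' : C2 k' -> (forall p q, sq p -> sq q -> `|p.1 - q.1| <= 2^-1 ^+ n ->
    `|p.2 - q.2| <= 2^-1 ^+ n -> `|k' p.1 p.2 - k' q.1 q.2| <= e) ->
    `|II k' - II (sw k')| <= 2 * e.
  elim: n k' => [|n IH] k' h ho.
    have z01 : 0 <= (0 : R) <= 1 by lra.
    have d1 x y : 0 <= x <= 1 -> 0 <= y <= 1 -> `|x - y| <= 2^-1 ^+ 0 :> R.
      by move=> /andP[? ?] /andP[? ?]; rewrite expr0 ler_norml; lra.
    have bd k2 : C2 k2 -> (forall t s, 0 <= t <= 1 -> 0 <= s <= 1 ->
        `|k2 t s - k' 0 0| <= e) -> `|II k2 - k' 0 0| <= e.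
      move=> h2 H; rewrite /II -[X in _ - X]rint_cst -rintB => [|t _|t _]; [|exact: C2i|exact: ctac].
      rewrite -[leRHS]rint_cst; apply: ler_norm_rint => [t _|t _|t t01]; [|exact: ctac|].
        by apply: rtaD; [exact: C2i|exact: ctac].
      rewrite -[X in _ - X]rint_cst -rintB => [|s _|s _]; [|exact: C2l|exact: ctac].
      rewrite -[leRHS]rint_cst; apply: ler_norm_rint => [s _|s _|s s01]; [|exact: ctac|exact: H].
      by apply: rtaD; [exact: C2l|exact: ctac].
    have H1 : `|II k' - k' 0 0| <= e.
      apply: bd => // t s t01 s01.
      by apply: (ho (t, s) (0, 0)); rewrite /sq /= ?t01 ?s01 ?z01 ?d1.
    have H2 : `|II (sw k') - k' 0 0| <= e.
      apply: bd => [|t s t01 s01]; first exact: C2s.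
      by apply: (ho (s, t) (0, 0)); rewrite /sq /= ?t01 ?s01 ?z01 ?d1.
    by move: (II k') (II _) (k' 0 0) H1 H2 => x y z; rewrite !ler_norml => /andP[? ?] /andP[? ?]; lra.
  rewrite (II_quarter h) (II_quarter (C2s _ h)).
  have Q a b : 0 <= a <= 2^-1 -> 0 <= b <= 2^-1 ->
      `|II (quarter k' a b) - II (quarter (sw k') b a)| <= 2 * e.
    move=> /andP[a0 a1] /andP[b0 b1]; rewrite (_ : quarter (sw k') b a = sw (quarter k' a b))//.
    apply: IH => [|[x y] [x' y']]; first exact: C2q.
    rewrite /sq /= => /andP[/andP[? ?] /andP[? ?]] /andP[/andP[? ?] /andP[? ?]] hx hy.
    apply: (ho (a + x / 2, b + y / 2) (a + x' / 2, b + y' / 2)); rewrite /sq /=.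
    - by lra.
    - by lra.
    - rewrite (_ : _ - _ = 2^-1 * (x - x')); last by lra.
      by rewrite normrM exprS ler_pM// ger0_norm.
    - rewrite (_ : _ - _ = 2^-1 * (y - y')); last by lra.
      by rewrite normrM exprS ler_pM// ger0_norm.
  have r0 : 0 <= (0 : R) <= 2^-1 by lra.
  have r1 : 0 <= (2^-1 : R) <= 2^-1 by lra.
  move: (Q _ _ r0 r0) (Q _ _ r0 r1) (Q _ _ r1 r0) (Q _ _ r1 r1).
  move: (II (quarter _ 0 0)) (II (quarter _ 0 2^-1)) (II (quarter _ 2^-1 0)) => x1 x2 x3.
  move: (II (quarter _ 2^-1 2^-1)) (II _) (II _) (II _) (II _) => x4 y1 y2 y3 y4.
  by rewrite !ler_norml => /andP[? ?] /andP[? ?] /andP[? ?] /andP[? ?]; lra.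
apply/eqP; rewrite -subr_eq0 -normr_eq0 eq_le normr_ge0 andbT; apply: le_eps => e e0.
rewrite add0r (_ : e = 2 * (e / 2)); last by lra.
have e2 : 0 < e / 2 by pos.
pose K := (`[0, 1]%classic : set R) `*` (`[0, 1]%classic : set R).
have cK : compact K by apply: compact_setX; exact: compact01.
have [d d0 H] := unif_cont cK (fun p _ => hk p) e2.
have [n] : exists n, (2^-1 : R) ^+ n < d.
  have /cvgrPdist_lt /(_ _ d0) [n _ /(_ n (leqnn n))] := @cvg_expr R 2^-1 ltac:(rewrite ger0_norm; lra).
  by rewrite sub0r normrN normrX ger0_norm ?invr_ge0// => ?; exists n.
move=> nd; apply: (osc n) => // p q; rewrite /sq => /andP[p1 p2] _ h1 h2.
apply/ltW/H; first by [].
by split; rewrite /ball /=; [exact: le_lt_trans h1 nd|exact: le_lt_trans h2 nd].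
Qed.
End fubini.

(** * Integrals and mean value inequality for complex-valued functions *)

Section complex_integral.
Context {R : realType}.
Local Notation C := R[i].
Implicit Types (F G : R -> C) (a b z w : C).

Lemma unimodular z : exists2 u : C, normc u = 1 & u * z = (normc z)%:C.
Proof.
have [->|z0] := eqVneq z 0; first by exists 1; rewrite ?normc1// mulr0 normc0.
have n0 : normc z != 0 by rewrite gt_eqF ?normc_gt0.
have n0' : (normc z)%:C != 0 by apply: contra_neq n0 => -[].
exists (conjc z / (normc z)%:C).
  by rewrite normcM normcV normc_conj normc_nneg ?normc_ge0// divff.
by rewrite mulrAC (mulrC (conjc _)) mul_conjc rmorphM mulfK.
Qed.

Definition cint F : C :=
  rint (fun t => complex.Re (F t)) +i* rint (fun t => complex.Im (F t)).

Lemma c01_Re F : c01 F -> c01 (fun t => complex.Re (F t)).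
Proof. by move=> h t /h ?; cts. Qed.
Lemma c01_Im F : c01 F -> c01 (fun t => complex.Im (F t)).
Proof. by move=> h t /h ?; cts. Qed.
Lemma c01_normc F : c01 F -> c01 (fun t => normc (F t)).
Proof. by move=> h t /h ?; cts. Qed.
Lemma c01D F G : c01 F -> c01 G -> c01 (fun t => F t + G t).
Proof. by move=> hF hG t t01; have := hF t t01; have := hG t t01 => ? ?; cts. Qed.
Lemma c01M F G : c01 F -> c01 G -> c01 (fun t => F t * G t).
Proof. by move=> hF hG t t01; have := hF t t01; have := hG t t01 => ? ?; cts. Qed.
Lemma c01N F : c01 F -> c01 (fun t => - F t).
Proof. by move=> h t /h ?; cts. Qed.
Lemma c01c a : c01 (fun _ : R => a).
Proof. by move=> t _; exact: ctac. Qed.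

Lemma eq_cint F G : (forall t, 0 <= t <= 1 -> F t = G t) -> cint F = cint G.
Proof. by move=> h; congr (_ +i* _); apply: eq_rint => t /h ->. Qed.

Lemma cintD F G : c01 F -> c01 G -> cint (fun t => F t + G t) = cint F + cint G.
Proof.
move=> hF hG; apply: ReIm_eq; rewrite ?Re_add ?Im_add /= -rintD.
- by apply: eq_rint => t _; rewrite Re_add.
- exact: c01_Re.
- exact: c01_Re.
- by apply: eq_rint => t _; rewrite Im_add.
- exact: c01_Im.
- exact: c01_Im.
Qed.

Lemma cintZ a F : c01 F -> cint (fun t => a * F t) = a * cint F.
Proof.
move=> hF; have h1 := c01_Re hF; have h2 := c01_Im hF.
have hz (c : R) (f : R -> R) : c01 f -> c01 (fun t => c * f t).
  by move=> h t /h ?; cts.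
apply: ReIm_eq; rewrite ?Re_mul ?Im_mul /= -!rintZ//.
- by rewrite -rintB; [apply: eq_rint => t _; rewrite Re_mul|exact: hz..].
- by rewrite -rintD; [apply: eq_rint => t _; rewrite Im_mul|exact: hz..].
Qed.

Lemma cint_cst a : cint (fun=> a) = a.
Proof. by apply: ReIm_eq; rewrite /= rint_cst. Qed.

Lemma cintN F : c01 F -> cint (fun t => - F t) = - cint F.
Proof.
by move=> hF; rewrite -mulN1r -cintZ//; apply: eq_cint => t _; rewrite mulN1r.
Qed.

Lemma cintB F G : c01 F -> c01 G -> cint (fun t => F t - G t) = cint F - cint G.
Proof. by move=> hF hG; rewrite cintD ?cintN//; exact: c01N. Qed.

Lemma cint_conj F : c01 F -> cint (fun t => conjc (F t)) = conjc (cint F).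
Proof.
move=> hF; have Rc z : complex.Re (conjc z) = complex.Re z by case: z.
have Ic z : complex.Im (conjc z) = - complex.Im z by case: z.
apply: ReIm_eq; rewrite ?Rc ?Ic /=; first by apply: eq_rint => t _; rewrite Rc.
by rewrite -rintN; [apply: eq_rint => t _; rewrite Ic|exact: c01_Im].
Qed.

(** A unimodular factor makes the integral real and nonnegative, and then only real parts have to be
    estimated. *)
Lemma normc_cint_le F : c01 F -> normc (cint F) <= rint (fun t => normc (F t)).
Proof.
move=> hF; have [u u1 uz] := unimodular (cint F).
have huF : c01 (fun t => u * F t) by apply: c01M => //; exact: c01c.
have -> : normc (cint F) = rint (fun t => complex.Re (u * F t)).
  by transitivity (complex.Re (cint (fun t => u * F t))); rewrite // cintZ// uz.
apply: ler_rint => [||t _]; [exact: c01_Re|exact: c01_normc|].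
by rewrite (le_trans (ler_norm _))// (le_trans (Re_le_normc _))// normcM u1 mul1r.
Qed.

Lemma normc_cint F (c : R) : c01 F -> (forall t, 0 <= t <= 1 -> normc (F t) <= c) ->
  normc (cint F) <= c.
Proof.
by move=> hF h; rewrite (le_trans (normc_cint_le hF))// rint_le//; exact: c01_normc.
Qed.

Lemma cint_halves F : c01 F ->
  cint F = (cint (fun t => F (t / 2)) + cint (fun t => F (2^-1 + t / 2))) / 2.
Proof.
move=> hF; have -> : (2^-1 : C) = (2^-1 : R)%:C by rewrite fmorphV rmorph_nat.
apply: ReIm_eq; rewrite ?Re_mul ?Im_mul ?Re_add ?Im_add /= mulr0 ?subr0 ?add0r.
- exact: (rint_halves (c01_Re hF)).
- exact: (rint_halves (c01_Im hF)).
Qed.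

Lemma cint_shift F (a : R) : (forall t, cta F t) -> (forall t, F (t + 1) = F t) ->
  cint (fun t => F (t + a)) = cint F.
Proof.
move=> hF per; congr (_ +i* _).
- by apply: (@rint_shift R (fun t => complex.Re (F t))) => t; [cts|rewrite per].
- by apply: (@rint_shift R (fun t => complex.Im (F t))) => t; [cts|rewrite per].
Qed.

Lemma cta_cint (S : topologicalType) (k : S -> R -> C) (s : S) :
  (forall t, 0 <= t <= 1 -> cta (fun p : S * R => k p.1 p.2) (s, t)) ->
  (\forall r \near s, c01 (k r)) -> cta (fun r => cint (k r)) s.
Proof.
move=> h hc; apply: cta_ReIm; apply: cta_rint.
- by move=> t /h ?; cts.
- by apply: filterS hc => r; exact: c01_Re.
- by move=> t /h ?; cts.
- by apply: filterS hc => r; exact: c01_Im.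
Qed.

Definition dR F (x : R) (c : C) : Prop :=
  rder (fun t => complex.Re (F t)) x (complex.Re c) /\
  rder (fun t => complex.Im (F t)) x (complex.Im c).

(** The real mean value inequality for the component of F in the direction of the increment F b - F
    a. *)
Lemma normc_MVT F dF (B dB : R -> R) (a b : R) : a <= b ->
  (forall x, a < x < b -> dR F x (dF x)) -> (forall x, a < x < b -> rder B x (dB x)) ->
  (forall x, a < x < b -> normc (dF x) <= dB x) ->
  (forall x, a <= x <= b -> cta F x) -> (forall x, a <= x <= b -> cta B x) ->
  normc (F b - F a) <= B b - B a.
Proof.
move=> ab hF hB h cF cB; set z := F b - F a.
have [u u1 uz'] := unimodular z; have uz : complex.Re (u * z) = normc z by rewrite uz'.
pose f t := complex.Re u * complex.Re (F t) + - complex.Im u * complex.Im (F t).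
have fE t : f t = complex.Re (u * F t) by rewrite Re_mul /f mulNr.
have -> : normc z = f b - f a by rewrite -uz !fE mulrBr Re_add Re_opp.
apply: (@MVTle _ f B (fun x => complex.Re (u * dF x)) dB) => //.
- move=> x /hF[h1 h2]; rewrite Re_mul -mulNr.
  by apply: rderD; apply: rderZ.
- move=> x xab; apply: le_trans (h x xab).
  by rewrite (le_trans (ler_norm _))// (le_trans (Re_le_normc _))// normcM u1 mul1r.
- by move=> x /cF ?; rewrite /f; cts.
Qed.
End complex_integral.

(** * The complex exponential and the parametrised circle *)

Section exponential.
Context {R : realType}.
Local Notation C := R[i].
Implicit Types (z w : C) (x t : R).

Definition cexp z : C :=
  (expR (complex.Re z))%:C * (cos (complex.Im z) +i* sin (complex.Im z)).

Lemma cexpD z w : cexp (z + w) = cexp z * cexp w.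
Proof.
rewrite /cexp Re_add Im_add expRD cosD sinD rmorphM /= mulrACA; congr (_ * _).
by apply: ReIm_eq; rewrite ?Re_mul ?Im_mul//= addrC.
Qed.

Lemma normc_cexp z : normc (cexp z) = expR (complex.Re z).
Proof.
rewrite /cexp normcM normc_nneg ?expR_ge0//=.
by rewrite cos2Dsin2 sqrtr1 mulr1.
Qed.

Lemma rderP (f : R -> R) x c e : rder f x c -> 0 < e ->
  \forall y \near x, `|f y - f x - c * (y - x)| <= e * `|y - x|.
Proof.
move=> [/is_derive1_caratheodory[g [hg cg <-]]] e0.
have /rtaP /(_ _ e0) := Cta cg; apply: filterS => y hy.
by rewrite hg -mulrBl normrM ler_wpM2r// distrC ltW.
Qed.

(** By the addition formula only the derivative at 0 matters, and there expR, cos and sin have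
    derivatives 1, 0 and 1. *)
Lemma cder_cexp z : cder cexp z (cexp z).
Proof.
apply/cderP => e e0; set N := normc (cexp z).
have N0 : 0 <= N by exact: normc_ge0.
pose k := Num.min 1 (e / (6 * (N + 1))).
have k0 : 0 < k by rewrite lt_min ltr01 divr_gt0// mulr_gt0// ltr_wpDl.
have d1 : rder expR 0 (1 : R) by have := is_derive_expR (0 : R); rewrite expR0.
have d2 : rder cos 0 (0 : R).
  by have := is_derive_cos (0 : R); rewrite sin0 oppr0.
have d3 : rder sin 0 (1 : R) by have := is_derive_sin (0 : R); rewrite cos0.
have /nearRP[r1 r10 H1] := rderP d1 k0.
have /nearRP[r2 r20 H2] := near_and (rderP d2 k0) (rderP d3 k0).
have c1 : cta (@expR R) 0 by exact: rder_cta d1.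
have /rtaP/(_ _ k0) /nearRP[r3 r30 H3] := c1.
apply/nearCP; exists (Num.min r1 (Num.min r2 r3)).
  by pos.
move=> w; rewrite !lt_min => /and3P[w1 w2 w3]; set h := w - z in w1 w2 w3 *.
have -> : w = z + h by rewrite subrKC.
clearbody h.
rewrite cexpD (_ : _ - _ - _ = cexp z * (cexp h - 1 - h)); last by ring.
rewrite normcM -/N; set x := complex.Re h; set y := complex.Im h.
have hx : `|x| <= normc h by exact: Re_le_normc.
have hy : `|y| <= normc h by exact: Im_le_normc.
have := H1 x; have := H2 y; have := H3 x; rewrite !subr0 expR0 cos0 sin0 !mul1r mul0r !subr0.
move=> /(_ (le_lt_trans hx w3)) A3 /(_ (le_lt_trans hy w2))[A2 A2'] /(_ (le_lt_trans hx w1)) A1.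
have k1 : k <= 1 by rewrite ge_min lexx.
have E2 : expR x <= 2 by move: A3; rewrite distrC ltr_norml => /andP[_ ?]; lra.
have B : normc (cexp h - 1 - h) <= 6 * k * normc h.
  apply: le_trans (normc_le_ReIm _) _.
  have -> : complex.Re (cexp h - 1 - h) = (expR x - 1 - x) + expR x * (cos y - 1).
    by rewrite /cexp !(Re_add, Re_opp) Re_mul /= -/x -/y; ring.
  have -> : complex.Im (cexp h - 1 - h) = expR x * (sin y - y) + (expR x - 1) * y.
    by rewrite /cexp !(Im_add, Im_opp) Im_mul /= -/x -/y; ring.
  have P1 : `|expR x * (cos y - 1)| <= 2 * (k * normc h).
    by rewrite normrM ger0_norm// ler_pM// (le_trans A2)// ler_wpM2l// ltW.
  have P2 : `|expR x * (sin y - y)| <= 2 * (k * normc h).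
    by rewrite normrM ger0_norm// ler_pM// (le_trans A2')// ler_wpM2l// ltW.
  have P3 : `|(expR x - 1) * y| <= k * normc h by rewrite normrM ler_pM// distrC ltW.
  have P4 : `|expR x - 1 - x| <= k * normc h by rewrite (le_trans A1)// ler_wpM2l// ltW.
  rewrite (le_trans (lerD (ler_normD _ _) (ler_normD _ _)))// -mulrA.
  by move: (k * normc h) P1 P2 P3 P4 => u P1 P2 P3 P4; lra.
have N1 : 0 < N + 1 by lra.
rewrite (le_trans (ler_wpM2l N0 B))// mulrA ler_wpM2r ?normc_ge0//.
have ke : k <= e / (6 * (N + 1)) by rewrite ge_min lexx orbT.
rewrite (le_trans (y := (N + 1) * (6 * (e / (6 * (N + 1))))))//.
  by rewrite ler_pM ?mulr_ge0 ?(ltW k0) ?lerDl// ler_pM2l.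
by rewrite le_eqVlt; apply/orP; left; apply/eqP; field; rewrite gt_eqF.
Qed.

(** exp(2 pi i t), of period 1, so that integrals over [0,1] are means over the circle. *)
Definition ee t : C := cos (2 * pi * t) +i* sin (2 * pi * t).

Lemma ee_cexp x t : cexp (x%:C + (2 * pi * t)%:C * 'i%C) = (expR x)%:C * ee t.
Proof.
rewrite /cexp /ee Re_add Im_add Re_mul Im_mul /=.
by rewrite !mulr0 mul0r mulr1 subrr !addr0 add0r.
Qed.

Lemma normc_ee t : normc (ee t) = 1.
Proof. by rewrite /= cos2Dsin2 sqrtr1. Qed.

Lemma ee_neq0 t : ee t != 0.
Proof. by rewrite -normc_gt0 normc_ee. Qed.

Lemma conj_ee t : conjc (ee t) = (ee t)^-1.
Proof. exact/conj_unit/normc_ee. Qed.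

Lemma ee0 : ee 0 = 1. Proof. by rewrite /ee mulr0 cos0 sin0. Qed.

Lemma eeD t s : ee (t + s) = ee t * ee s.
Proof.
rewrite /ee mulrDr cosD sinD; apply: ReIm_eq; rewrite ?Re_mul ?Im_mul//= addrC.
by [].
Qed.

Lemma ee_per t : ee (t + 1) = ee t.
Proof.
have E : 2 * pi = pi *+ 2 :> R by lra.
by rewrite /ee mulrDr mulr1 [in X in _ + X]E cosD2pi sinD2pi.
Qed.

Lemma cta_ee (T : topologicalType) (f : T -> R) (u : T) :
  cta f u -> cta (fun y => ee (f y)) u.
Proof.
move=> hf; apply: cta_ReIm.
- apply: (@ctao _ _ _ (@cos R) (fun y => 2 * pi * f y)); last by cts.
  by split; exact: continuous_cos.
- apply: (@ctao _ _ _ (@sin R) (fun y => 2 * pi * f y)); last by cts.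
  by split; exact: continuous_sin.
Qed.
End exponential.

Ltac cta2 := match goal with
  | |- cta ?B ?y => cta_hyp B y
  | |- cta (fun x => ee (@?f x)) _ => apply (@cta_ee _ _ f)
  | |- cta ee _ => apply (@cta_ee _ _ (fun x => x))
  | |- _ => cta1
  end.
Ltac cts ::= repeat cta2.

(** * Goursat's theorem and the invariance of circle means in an annulus *)

Section goursat.
Context {R : realType}.
Local Notation C := R[i].
Implicit Types (b F : C -> C) (z p q w c : C).

Definition hol (D : set C) F : Prop := forall z, D z -> exists c, cder F z c.

Let A b z p : C := cint (fun s => b (z + s%:C * p)).

(* The boundary integral of the parallelogram with corner z and sides p, q. *)
Let I b z p q : C := p * A b z p + q * A b (z + p) q - p * A b (z + q) p - q * A b z q.

Let edge b z p : Prop := c01 (fun s => b (z + s%:C * p)).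

Let half : (2^-1 : C) = (2^-1 : R)%:C.
Proof. by rewrite fmorphV rmorph_nat. Qed.

Let A_halves b z p : edge b z p ->
  A b z p = (A b z (p / 2) + A b (z + p / 2) (p / 2)) / 2.
Proof.
move=> h; rewrite /A (cint_halves h); congr ((_ + _) / 2).
- by apply: eq_cint => s _; congr (b _); rewrite rmorphM /= -half; field.
- by apply: eq_cint => s _; congr (b _); rewrite rmorphD rmorphM /= -half; field.
Qed.

Let inD b z p q := forall s t : R, 0 <= s <= 1 -> 0 <= t <= 1 ->
  exists c, cder b (z + s%:C * p + t%:C * q) c.

Let edge_p b z p q (t : R) : inD b z p q -> 0 <= t <= 1 -> edge b (z + t%:C * q) p.
Proof.
move=> h t01 s s01; have [c /cder_cta hc] := h s t s01 t01.
apply: (@ctao _ _ _ b); last by cts.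
by rewrite addrAC.
Qed.

Let edge_q b z p q (s : R) : inD b z p q -> 0 <= s <= 1 -> edge b (z + s%:C * p) q.
Proof.
move=> h s01 t t01; have [c /cder_cta hc] := h s t s01 t01.
by apply: (@ctao _ _ _ b); last by cts.
Qed.

Let inD_sub b z p q (i j : bool) : inD b z p q ->
  inD b (z + (if i then p / 2 else 0) + (if j then q / 2 else 0)) (p / 2) (q / 2).
Proof.
move=> h s t /andP[s0 s1] /andP[t0 t1].
have H (k : bool) (x : R) : 0 <= x -> x <= 1 -> 0 <= (if k then 2^-1 else 0) + x / 2 <= 1.
  by move=> x0 x1; case: k; lra.
have [c hc] := h _ _ (H i s s0 s1) (H j t t0 t1); exists c.
rewrite (_ : _ + _ = z + ((if i then 2^-1 else 0) + s / 2)%:C * p +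
  ((if j then 2^-1 else 0) + t / 2)%:C * q)//.
by case: i {hc}; case: j; rewrite !rmorphD !rmorphM ?rmorph0 /= -half; field.
Qed.

Let I_quarter b z p q : inD b z p q ->
  I b z p q = (I b z (p / 2) (q / 2) + I b (z + p / 2) (p / 2) (q / 2)) +
              (I b (z + q / 2) (p / 2) (q / 2) + I b (z + p / 2 + q / 2) (p / 2) (q / 2)).
Proof.
move=> h.
have t0 : 0 <= (0 : R) <= 1 by lra.
have t1 : 0 <= (1 : R) <= 1 by lra.
have := edge_p h t0; have := edge_p h t1; have := edge_q h t0; have := edge_q h t1.
rewrite !mul0r !mul1r !addr0 => e1 e2 e3 e4.
rewrite /I (A_halves e1) (A_halves e2) (A_halves e3) (A_halves e4).
have E1 : z + p = z + p / 2 + p / 2 by field.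
have E2 : z + q = z + q / 2 + q / 2 by field.
have E3 : z + p / 2 + q / 2 + p / 2 = z + p + q / 2 by field.
have E4 : z + q / 2 + p / 2 = z + p / 2 + q / 2 by field.
have E5 : z + q + p / 2 = z + p / 2 + q / 2 + q / 2 by field.
rewrite E5 E3 -E1 -E2 E4.
move: (A b z (p / 2)) (A b (z + p / 2) (p / 2)) (A b (z + p) (q / 2)) => x1 x2 x3.
move: (A b (z + p + q / 2) (q / 2)) (A b (z + q) (p / 2)) => x4 x5.
move: (A b (z + p / 2 + q / 2 + q / 2) (p / 2)) (A b z (q / 2)) => x6 x7.
move: (A b (z + q / 2) (q / 2)) (A b (z + p / 2) (q / 2)) => x8 x9.
move: (A b (z + q / 2) (p / 2)) (A b (z + p / 2 + q / 2) (p / 2)) => y1 y2.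
by move: (A b (z + p / 2 + q / 2) (q / 2)) => y3; field.
Qed.

(** The affine part of b has zero boundary integral, so only the remainder of the expansion at z0
    contributes, over four sides of total length 2 (|p| + |q|). *)
Let I_small b z0 c z p q (e L : R) : inD b z p q ->
  (forall (s t : R) w, 0 <= s <= 1 -> 0 <= t <= 1 -> w = z + s%:C * p + t%:C * q ->
    normc (b w - b z0 - c * (w - z0)) <= e * L) ->
  normc (I b z p q) <= 2 * (normc p + normc q) * (e * L).
Proof.
move=> h hb; pose a w := b z0 + c * (w - z0); pose r w := b w - b z0 - c * (w - z0).
have t0 : 0 <= (0 : R) <= 1 by lra.
have t1 : 0 <= (1 : R) <= 1 by lra.
(* The mean of an affine function over a segment is its value at the midpoint. *)
have Ar w k : edge b w k -> A b w k = b z0 + c * (w + k / 2 - z0) + A r w k.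
  move=> hk.
  have hr : edge r w k by move=> s /hk hs; rewrite /r; cts.
  have <- : A a w k = b z0 + c * (w + k / 2 - z0).
    rewrite /A /a (@eq_cint _ _ (fun s => (b z0 + c * (w - z0)) + (c * k) * s%:C)); last first.
      by move=> s _; ring.
    rewrite cintD ?cintZ ?cint_cst; [|by move=> s _; cts..].
    have -> : cint (fun s : R => s%:C : C) = 2^-1.
      rewrite half; apply: ReIm_eq => /=; last by rewrite rint_cst.
      rewrite (@FTC _ (fun s => 2^-1 * s ^+ 2) id); first by lra.
      - by move=> s _; apply: rder_eq (rderZ _ (rderX 2 (rder_id s))) _; rewrite /= expr1 mulr1; field.
      - by move=> s _; exact: ctaid.
    by ring.
  rewrite /A -cintD//; last by move=> s _; rewrite /a; cts.
  by apply: eq_cint => s _; rewrite /a /r; ring.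
have := edge_p h t0; have := edge_p h t1; have := edge_q h t0; have := edge_q h t1.
rewrite !mul0r !mul1r !addr0 => e1 e2 e3 e4.
have rA w k : edge b w k -> (forall s : R, 0 <= s <= 1 -> normc (r (w + s%:C * k)) <= e * L) ->
    normc (A r w k) <= e * L.
  by move=> hk H; apply: normc_cint => // s /hk hs; rewrite /r; cts.
have B1 : normc (A r z p) <= e * L.
  by apply: rA => // s s01; apply: (hb s 0); rewrite ?mul0r ?addr0.
have B2 : normc (A r z q) <= e * L.
  by apply: rA => // s s01; apply: (hb 0 s); rewrite ?mul0r ?addr0.
have B3 : normc (A r (z + q) p) <= e * L.
  by apply: rA => // s s01; apply: (hb s 1); rewrite ?mul1r 1?addrAC.
have B4 : normc (A r (z + p) q) <= e * L.
  by apply: rA => // s s01; apply: (hb 1 s); rewrite ?mul1r.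
have -> : I b z p q = p * A r z p + q * A r (z + p) q - p * A r (z + q) p - q * A r z q.
  rewrite /I (Ar _ _ e1) (Ar _ _ e2) (Ar _ _ e3) (Ar _ _ e4).
  by move: (A r z p) (A r (z + p) q) (A r (z + q) p) (A r z q) => x1 x2 x3 x4; field.
rewrite (le_trans (le_normcB _ _))// (le_trans (lerD (le_normcB _ _) (lexx _)))//.
rewrite (le_trans (lerD (lerD (le_normcD _ _) (lexx _)) (lexx _)))// !normcM.
have := ler_wpM2l (normc_ge0 p) B1; have := ler_wpM2l (normc_ge0 q) B2.
have := ler_wpM2l (normc_ge0 p) B3; have := ler_wpM2l (normc_ge0 q) B4.
rewrite (_ : 2 * _ * _ = normc p * (e * L) + normc q * (e * L) + normc p * (e * L) + normc q * (e * L)); last by ring.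
move: (normc p * (e * L)) (normc q * (e * L)) => x y; move: (normc p * _) (normc p * _) (normc q * _) (normc q * _) => x1 x2 x3 x4; lra.
Qed.

(** Nested intervals: the left ends u k increase and the right ends u k + 2^-k decrease, so the
    supremum of u lies in all of them. *)
Lemma nested_halves (u : nat -> R) :
  (forall k, u k <= u k.+1 <= u k + 2^-1 ^+ k.+1) ->
  exists v, forall k, u k <= v <= u k + 2^-1 ^+ k.
Proof.
move=> h; have mono k m : u k <= u (k + m)%N.
  by elim: m => [|m IH]; rewrite ?addn0// addnS (le_trans IH)//; case/andP: (h (k + m)%N).
have bd k m : u (k + m)%N + 2^-1 ^+ (k + m)%N <= u k + 2^-1 ^+ k.
  elim: m => [|m IH]; rewrite ?addn0// addnS (le_trans _ IH)//.
  have /andP[_] := h (k + m)%N; rewrite exprS; move: (u _) (u _) (_ ^+ _) => x y d; lra.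
have ub k m : u m <= u k + 2^-1 ^+ k.
  have [km|/ltnW mk] := leqP k m.
    by rewrite -(subnKC km) (le_trans _ (bd k (m - k)%N))// lerDl.
  by rewrite -(subnKC mk) (le_trans (mono m (k - m)%N))// lerDl.
have hs : has_sup (range u).
  by split; [exists (u 0%N), 0%N|exists (u 0%N + 2^-1 ^+ 0) => _ [m _ <-]].
exists (sup (range u)) => k; apply/andP; split; first by apply: ub_le_sup; [exact: hs.2|exists k].
by apply: ge_sup; [exact: hs.1|move=> _ [m _ <-]].
Qed.

Lemma half_pow_lt (e : R) : 0 < e -> exists k, 2^-1 ^+ k < e.
Proof.
move=> e0; have h : `|2^-1 : R| < 1 by rewrite ger0_norm; lra.
have /cvgrPdist_lt /(_ _ e0) [n _ /(_ n (leqnn n))] := cvg_expr h.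
by rewrite sub0r normrN normrX ger0_norm ?invr_ge0// => ?; exists n.
Qed.

Let goursat b z p q : inD b z p q -> I b z p q = 0.
Proof.
move=> h; pose N := normc (I b z p q).
pose corner (u : R * R) := z + u.1%:C * p + u.2%:C * q.
pose hk k : R := 2^-1 ^+ k.
pose sh (i : bool) (k : nat) : R := if i then hk k else 0.
(* The k-th parallelogram, at scale 2^-k, still carries at least 4^-k of the integral. One of its
   four quarters does so for k + 1. Corners are recorded by their coordinates u with respect to p
   and q. *)
pose good k (u : R * R) := inD b (corner u) ((hk k)%:C * p) ((hk k)%:C * q) /\
  N * 4^-1 ^+ k <= normc (I b (corner u) ((hk k)%:C * p) ((hk k)%:C * q)).
have stp k u : good k u -> exists v, good k.+1 v /\
    (u.1 <= v.1 <= u.1 + hk k.+1) /\ (u.2 <= v.2 <= u.2 + hk k.+1).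
  move=> [hD hI].
  have hkS : (hk k.+1)%:C = (hk k)%:C / 2 :> C by rewrite /hk exprSr rmorphM half.
  have h0 : 0 <= hk k.+1 by rewrite exprn_ge0.
  have pq x : (hk k)%:C * x / 2 = (hk k.+1)%:C * x by rewrite hkS; field.
  have shb (i : bool) (a : R) : a <= a + sh i k.+1 <= a + hk k.+1.
    by rewrite /sh; case: i; rewrite ?addr0 ?lexx ?lerDl h0.
  have [i [j hij]] : exists i j : bool, N * 4^-1 ^+ k.+1 <=
      normc (I b (corner u + (sh i k.+1)%:C * p + (sh j k.+1)%:C * q) ((hk k.+1)%:C * p) ((hk k.+1)%:C * q)).
    apply/not_existsP => H.
    have Hn i j : normc (I b (corner u + (sh i k.+1)%:C * p + (sh j k.+1)%:C * q) ((hk k.+1)%:C * p) ((hk k.+1)%:C * q)) < N * 4^-1 ^+ k.+1.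
      by rewrite ltNge; apply/negP => Hij; apply: (H i); exists j.
    move: hI; rewrite (I_quarter hD) !pq.
    have := Hn false false; have := Hn true false; have := Hn false true; have := Hn true true.
    rewrite /sh !mul0r !addr0 exprS => h1 h2 h3 h4; apply/negP; rewrite -ltNge.
    rewrite (le_lt_trans (le_normcD _ _))// (le_lt_trans (lerD (le_normcD _ _) (le_normcD _ _)))//.
    move: (normc _) (normc _) (normc _) (normc _) (4^-1 ^+ k : R) h1 h2 h3 h4 => x1 x2 x3 x4 d.
    by lra.
  exists (u.1 + sh i k.+1, u.2 + sh j k.+1); split; last by split; exact: shb.
  have E : corner (u.1 + sh i k.+1, u.2 + sh j k.+1) = corner u + (sh i k.+1)%:C * p + (sh j k.+1)%:C * q.
    by rewrite /corner /= !rmorphD /=; ring.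
  split; rewrite E//; rewrite -!pq.
  have := @inD_sub _ _ _ _ i j hD.
  rewrite (_ : (if i then _ else _) = (sh i k.+1)%:C * p); last by cts; case: (i); rewrite ?mul0r ?pq.
  by rewrite (_ : (if j then _ else _) = (sh j k.+1)%:C * q)//; rewrite /sh; case: (j); rewrite ?mul0r ?pq.
have g0 : good 0%N (0, 0).
  by rewrite /good /corner !mul0r !addr0 !mul1r mulr1.
have [f [f0 fS]] : exists f : nat -> R * R, f 0%N = (0, 0) /\ forall k, good k (f k) /\
    ((f k).1 <= (f k.+1).1 <= (f k).1 + hk k.+1) /\ ((f k).2 <= (f k.+1).2 <= (f k).2 + hk k.+1).
  have [s Hs] : {s : nat -> R * R -> R * R | forall k u, good k u -> good k.+1 (s k u) /\
      (u.1 <= (s k u).1 <= u.1 + hk k.+1) /\ (u.2 <= (s k u).2 <= u.2 + hk k.+1)}.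
    exists (fun k u => if pselect (good k u) is left g then sval (cid (stp k u g)) else u) => k u g.
    case: pselect => [g'|[]//].
    by case: (cid (stp k u g')) => v /= hv; exact: hv.
  pose f := fix f k := if k is m.+1 then s m (f m) else (0, 0).
  have gf k : good k (f k) by elim: k => [|k IH]; [exact: g0|exact: (Hs k _ IH).1].
  exists f; split=> [|k]; first by [].
  by split; [exact: gf|exact: (Hs k _ (gf k)).2].
have [v1 hv1] := @nested_halves (fun k => (f k).1) (fun k => (fS k).2.1).
have [v2 hv2] := @nested_halves (fun k => (f k).2) (fun k => (fS k).2.2).
have v01 (v x : R) : x = 0 -> x <= v <= x + 2^-1 ^+ 0 -> 0 <= v <= 1.
  by move=> ->; rewrite expr0 add0r.
have w1 : 0 <= v1 <= 1 by apply: (v01 _ _ _ (hv1 0%N)); rewrite f0.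
have w2 : 0 <= v2 <= 1 by apply: (v01 _ _ _ (hv2 0%N)); rewrite f0.
have [c /cderP hc] := h v1 v2 w1 w2; set z0 := z + _ + _ in hc.
pose L := normc p + normc q.
have L0 : 0 <= L by rewrite addr_ge0// normc_ge0.
apply/eqP/negPn; rewrite -normc_gt0 -/N; apply/negP => N0.
(* With this e one has 2 e L^2 < N, whereas [I_small] at scale 2^-k would give N 4^-k <= 2 e L^2
   4^-k. *)
have e0 : 0 < N / (4 * (L ^+ 2 + 1)) by pos.
set e := N / _ in e0; have /nearCP[d d0 Hd] := hc e e0.
have [k Hk] : exists k, 2^-1 ^+ k < d / (L + 1) by apply: half_pow_lt; rewrite divr_gt0// ltr_wpDl.
have hk0 : 0 < hk k by rewrite exprn_gt0.
have [[gD gI] _] := fS k.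
have : normc (I b (corner (f k)) ((hk k)%:C * p) ((hk k)%:C * q)) <=
    2 * (normc ((hk k)%:C * p) + normc ((hk k)%:C * q)) * (e * (hk k * L)).
  apply: (I_small (z0 := z0) (c := c) gD) => s t w s01 t01 wE.
  have wz : normc (w - z0) <= hk k * L.
    rewrite (_ : w - z0 = ((f k).1 + s * hk k - v1)%:C * p + ((f k).2 + t * hk k - v2)%:C * q).
      rewrite (le_trans (le_normcD _ _))// !normcM !normc_real mulrDr lerD// ler_wpM2r ?normc_ge0//.
        have /andP[? ?] : (f k).1 <= v1 <= (f k).1 + hk k := hv1 k; case/andP: s01 => s0 s1.
        have := mulr_ge0 s0 (ltW hk0); have := ler_wpM2r (ltW hk0) s1.
        by rewrite mul1r ler_norml; move: (s * hk k) => x ? ?; apply/andP; split; lra.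
      have /andP[? ?] : (f k).2 <= v2 <= (f k).2 + hk k := hv2 k; case/andP: t01 => s0 s1.
      have := mulr_ge0 s0 (ltW hk0); have := ler_wpM2r (ltW hk0) s1.
      by rewrite mul1r ler_norml; move: (t * hk k) => x ? ?; apply/andP; split; lra.
    by rewrite wE /z0 /corner !(rmorphB, rmorphD, rmorphM) /=; ring.
  have wd : normc (w - z0) < d.
    rewrite (le_lt_trans wz)// (@le_lt_trans _ _ (hk k * (L + 1)))//.
      by lra.
    by rewrite -ltr_pdivlMr// ltr_wpDl.
  by rewrite (le_trans (Hd _ wd))// ler_wpM2l// ltW.
rewrite !normcM normc_nneg ?(ltW hk0)// -mulrDr -/L => /(le_trans gI).
have -> : 2 * (hk k * L) * (e * (hk k * L)) = (2 * e * L ^+ 2) * 4^-1 ^+ k.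
  have -> : (4^-1 : R) ^+ k = hk k * hk k by rewrite -exprMn; congr (_ ^+ _); field.
  by lra.
rewrite ler_pM2r ?exprn_gt0 ?invr_gt0//; apply/negP; rewrite -ltNge /e.
rewrite -subr_gt0 (_ : _ - _ = N * (2 * L ^+ 2 + 4) / (4 * (L ^+ 2 + 1))); last first.
  by field; rewrite gt_eqF// ltr_wpDl// sqr_ge0.
have ? : 0 <= L ^+ 2 by pos.
by rewrite divr_gt0// mulr_gt0//; lra.
Qed.

(** In the coordinate log w the annulus becomes a strip and circles become vertical segments of
    length 2 pi. In Goursat's theorem for the rectangle between two of them the horizontal sides
    cancel by periodicity, so no winding numbers occur. *)
Lemma mean_annulus F (r1 r2 x y : R) :
  hol [set w | r1 < normc w < r2] F -> 0 <= r1 -> r1 < x < r2 -> r1 < y < r2 ->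
  cint (fun t => F (x%:C * ee t)) = cint (fun t => F (y%:C * ee t)).
Proof.
wlog xy : x y / x <= y.
  move=> H hF r0 hx hy; have [xy|/ltW yx] := leP x y; first exact: H.
  by apply/esym; exact: H.
move=> hF r10 /andP[x1 x2] /andP[y1 y2].
have x0 : 0 < x by pos.
have y0 : 0 < y by pos.
pose b w := F (cexp w).
(* One period of the exponential: the side q runs once around the circle. *)
pose q : C := (2 * pi)%:C * 'i%C.
pose p : C := (ln y - ln x)%:C.
have lxy : ln x <= ln y by rewrite ler_ln.
have hD : inD b (ln x)%:C p q.
  move=> s t /andP[s0 s1] _.
  have hin : r1 < normc (cexp ((ln x)%:C + s%:C * p + t%:C * q)) < r2.
    rewrite normc_cexp !Re_add !Re_mul /= !(mul0r, mulr0, mulr1, subr0, subrr, addr0).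
    have d0 : 0 <= ln y - ln x by pos.
    have := mulr_ge0 s0 d0; have := ler_wpM2r d0 s1; rewrite mul1r.
    move: (s * _) => u u1 u0; apply/andP; split.
      by rewrite (lt_le_trans x1)// -[leLHS](lnK x0) ler_expR; lra.
    by rewrite (le_lt_trans _ y2)// -[leRHS](lnK y0) ler_expR; lra.
  have [c hc] := hF _ hin.
  by exists (c * cexp ((ln x)%:C + s%:C * p + t%:C * q)); apply: cder_comp => //; exact: cder_cexp.
have := goursat hD; rewrite /I.
have per w : b (w + q) = b w.
  rewrite /b cexpD; have -> : cexp q = 1; last by rewrite mulr1.
  have := @ee_cexp R 0 1; rewrite rmorph0 add0r mulr1 expR0 rmorph1 mul1r => ->.
  by rewrite -(add0r 1) ee_per ee0.
have -> : A b ((ln x)%:C + q) p = A b (ln x)%:C p.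
  by apply: eq_cint => s _; rewrite addrAC per.
rewrite (_ : _ - _ - _ = q * (A b ((ln x)%:C + p) q - A b (ln x)%:C q)); last by ring.
move=> /eqP; rewrite mulf_eq0 subr_eq0 => /orP[|/eqP].
  rewrite mulf_eq0 => /orP[] /eqP[] /eqP; last by rewrite oner_eq0.
  by rewrite gt_eqF// mulr_gt0// pi_gt0.
have E (z0 : R) : 0 < z0 -> A b (ln z0)%:C q = cint (fun t => F (z0%:C * ee t)).
  move=> z00; apply: eq_cint => t _; rewrite /b mulrA -rmorphM /= (mulrC t) ee_cexp lnK//.
rewrite -(E x x0) -(E y y0).
have -> : (ln x)%:C + p = (ln y)%:C by rewrite -rmorphD subrKC.
by move=> ->.
Qed.
End goursat.

Arguments normc {R} x : simpl never.

(** * Cauchy's formula, first coefficient, differentiation under the integral *)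

Section cauchy.
Context {R : realType}.
Local Notation C := R[i].
Implicit Types (F G : C -> C) (z w c y : C) (r x d : R).

Definition disc r : set C := [set w | normc w < r].

Lemma holP (D : set C) F : hol D F -> forall z, D z -> cta F z.
Proof. by move=> h z /h[c /cder_cta]. Qed.

Lemma hol_sub (D E : set C) F : E `<=` D -> hol D F -> hol E F.
Proof. by move=> ED h z /ED /h. Qed.

Lemma holD (D : set C) F G : hol D F -> hol D G -> hol D (fun z => F z + G z).
Proof. by move=> hF hG z Dz; have [c hc] := hF z Dz; have [d hd] := hG z Dz; exists (c + d); cdr. Qed.

Lemma holM (D : set C) F G : hol D F -> hol D G -> hol D (fun z => F z * G z).
Proof.
move=> hF hG z Dz; have [c hc] := hF z Dz; have [d hd] := hG z Dz.
by exists (c * G z + F z * d); apply: cderM.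
Qed.

Lemma holX (D : set C) F k : hol D F -> hol D (fun z => F z ^+ k).
Proof. by move=> hF z /hF[c hc]; eexists; apply: cderX hc. Qed.

Lemma holV (D : set C) F : (forall z, D z -> F z != 0) -> hol D F -> hol D (fun z => (F z)^-1).
Proof. by move=> F0 hF z Dz; have [c hc] := hF z Dz; eexists; apply: cderV hc; exact: F0. Qed.

Lemma hol_cst (D : set C) c : hol D (fun=> c).
Proof. by move=> z _; exists 0; exact: cder_cst. Qed.

Lemma hol_id (D : set C) : hol D (fun z => z).
Proof. by move=> z _; exists 1; exact: cder_id. Qed.

Lemma hol_comp (D E : set C) F G : hol E G -> hol D F -> (forall z, D z -> E (F z)) ->
  hol D (fun z => G (F z)).
Proof.
move=> hG hF h z Dz; have [c hc] := hF z Dz; have [d hd] := hG _ (h z Dz).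
by exists (d * c); exact: cder_comp.
Qed.

Lemma normc_circle x t : normc (x%:C * ee t) = `|x|.
Proof. by rewrite normcM normc_ee mulr1 normc_real. Qed.

Lemma cta_circle (D : set C) F x : hol D F -> (forall t, D (x%:C * ee t)) ->
  forall t, cta (fun t => F (x%:C * ee t)) t.
Proof.
by move=> hF h t; apply: (@ctao _ _ _ F (fun t => x%:C * ee t)); [exact/(holP hF)|cts].
Qed.

Lemma c01_circle r F x : hol (disc r) F -> 0 <= x < r -> c01 (fun t => F (x%:C * ee t)).
Proof.
move=> hF /andP[x0 xr] t _; apply: cta_circle hF _ t => t.
by rewrite /disc /= normc_circle ger0_norm.
Qed.

(** By [mean_annulus] with inner radius 0 the circle may be shrunk until F is close to F 0 on it. *)
Lemma mean_value r F x : hol (disc r) F -> 0 <= x < r ->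
  cint (fun t => F (x%:C * ee t)) = F 0.
Proof.
move=> hF /andP[]; rewrite le_eqVlt => /predU1P[<- _|x0 xr].
  by rewrite -[RHS]cint_cst; apply: eq_cint => t _; rewrite mul0r.
apply/eqP; rewrite -subr_eq0; apply/eqP/normc_eq0_eps => e e0.
have c0 : cta F 0 by apply: (holP hF); rewrite /disc /= normc0; lra.
have /ctaP/(_ _ e0)/nearCP[d d0 H] := c0.
pose y := Num.min (d / 2) x.
have y0 : 0 < y by rewrite lt_min divr_gt0.
have yd : y < d by rewrite gt_min; apply/orP; left; lra.
have yr : y < r by rewrite gt_min xr orbT.
rewrite (@mean_annulus _ F 0 r x y) ?y0 ?x0//; last by move=> w /= /andP[_]; exact: hF.
have cy : c01 (fun t => F (y%:C * ee t)) by apply: c01_circle hF _; rewrite (ltW y0) yr.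
rewrite -[X in _ - X](@cint_cst R) -cintB//; last exact: c01c.
apply: normc_cint => [|t _]; first by apply: c01D cy _; exact: c01c.
by rewrite normcB; apply/ltW/H; rewrite subr0 normc_circle gtr0_norm.
Qed.

Lemma kernel_neq0 y w : normc y < 1 -> normc w <= 1 -> 1 - y * w != 0.
Proof.
move=> y1 w1; rewrite subr_eq0; apply/eqP => /(congr1 (@normc R)); rewrite normc1 normcM => E.
have : normc y * normc w < 1; last by lra.
by rewrite (le_lt_trans (ler_wpM2l (normc_ge0 y) w1))// mulr1.
Qed.

Lemma kernel_ge y w : normc w <= 1 -> 1 - normc y <= normc (1 - y * w).
Proof.
move=> w1; rewrite (le_trans _ (normc_sub_ge _ _))// normc1 normcM lerD2l lerN2.
by rewrite ler_piMr ?normc_ge0.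
Qed.

Lemma c01_kernel y : normc y < 1 -> c01 (fun t => (1 - y * conjc (ee t))^-1).
Proof. by move=> y1 t _; cts; apply: kernel_neq0; rewrite // normc_conj normc_ee. Qed.

(** The conjugate of the integrand is the value at ee t of (1 - conj y w)^-1, which is holomorphic
    beyond the unit circle and equals 1 at the origin. *)
Lemma mean_kernel y : normc y < 1 -> cint (fun t => (1 - y * conjc (ee t))^-1) = 1.
Proof.
(* A radius r with r > 1 and r |y| < 1 that also makes sense for y = 0. *)
move=> y1; have r0 : 1 < (1 + normc y) / (2 * normc y + (1 - normc y) / 2).
  have y0 := normc_ge0 y.
  by rewrite ltr_pdivlMr; lra.
set r := (_ / _) in r0.
pose F w := (1 - conjc y * w)^-1.
have hF : hol (disc r) F.
  apply: holV => [w|]; last by move=> w _; eexists; cdr.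
  rewrite /disc /= => wr; rewrite subr_eq0; apply/eqP => /(congr1 (@normc R)).
  rewrite normc1 normcM normc_conj => E.
  have y0 := normc_ge0 y.
  have d0 : 0 < 2 * normc y + (1 - normc y) / 2 by lra.
  have := ler_wpM2l y0 (ltW wr); rewrite -E leNgt => /negP; apply.
  by rewrite /r mulrA ltr_pdivrMr// mul1r; have := mulr_ge0 y0 y0; nra.
have := @mean_value r F 1 hF; rewrite ler01 r0 => /(_ isT).
rewrite /F mulr0 subr0 invr1 => /(congr1 (@conjc R)).
rewrite conjc1 -cint_conj; last by apply: (c01_circle hF); rewrite ler01 r0.
move=> H; rewrite -[RHS]H; apply: eq_cint => t _.
by rewrite mul1r conjc_inv conjB conjM conjcK conjc1.
Qed.

(** For g(w) = w (F w - F z) / (w - z) the mean over the circle of radius s is 0 for s < |z|,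
    because g 0 = 0, is constant for s > |z|, and is continuous at s = |z|. Hence it is 0 at s = x,
    although g is only known to be continuous at z. *)
Lemma cauchy_formula r F x y : hol (disc r) F -> 0 < x < r -> normc y < 1 ->
  cint (fun t => F (x%:C * ee t) * (1 - y * conjc (ee t))^-1) = F (x%:C * y).
Proof.
move=> hF /andP[x0 xr] y1; set z := x%:C * y.
have zx : normc z < x by rewrite normcM normc_nneg ?(ltW x0)// gtr_pMr.
have zr : normc z < r by lra.
have [y0|y0] := eqVneq y 0.
  rewrite /z y0 mulr0 -(@mean_value r F x)// ?(ltW x0) ?xr//.
  by apply: eq_cint => t _; rewrite mul0r subr0 invr1 mulr1.
have z0 : z != 0 by rewrite mulf_neq0//; apply/eqP => -[/eqP]; rewrite gt_eqF.
have nz0 : 0 < normc z by rewrite normc_gt0.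
have [c [q [hq qz hqz]]] := hF z zr.
(* The value z c at w = z makes g continuous there. *)
pose g w := if w == z then z * c else w * ((F w - F z) / (w - z)).
have gz w : w != z -> g w = w * ((F w - F z) / (w - z)) by rewrite /g => /negbTE ->.
have ghol w : normc w < r -> w != z -> exists c', cder g w c'.
  move=> wr wz; have [c' hc'] := hF w wr.
  eexists; apply: (@cder_near _ (fun w => w * ((F w - F z) * (w - z)^-1))); last first.
    by cdr; [exact: hc'|rewrite subr_eq0].
  apply/nearCP; exists (normc (w - z)); first by rewrite normc_gt0 subr_eq0.
  by move=> w' hw'; rewrite gz//; apply: contraTneq hw' => ->; rewrite -leNgt normcB.
have gcta w : normc w < r -> cta g w.
  move=> wr; have [->|wz] := eqVneq w z; last by have [c' /cder_cta] := ghol w wr wz.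
  apply: (@cta_near _ _ (fun w => w * q w)); last by cts.
  apply: filterS hqz => w' hw'; have [->|w'z] := eqVneq w' z; first by rewrite /g eqxx qz.
  by rewrite gz// hw' addrC addKr mulfK// subr_eq0.
pose m s := cint (fun t => g (s%:C * ee t)).
have cg s : 0 <= s < r -> c01 (fun t => g (s%:C * ee t)).
  move=> /andP[s0 sr] t _; apply: (@ctao _ _ _ g (fun t => s%:C * ee t)); last by cts.
  by apply: gcta; rewrite normc_circle ger0_norm.
have cm : cta m (normc z).
  apply: cta_cint => [t _|].
    apply: (@ctao _ _ _ g (fun p : R * R => p.1%:C * ee p.2)); last by cts.
    by apply: gcta; rewrite normc_circle ger0_norm ?normc_ge0.
  apply/nearRP; exists (Num.min (normc z) (r - normc z)); first by pos.
  move=> s; rewrite lt_min !ltr_norml => /andP[/andP[s1 _] /andP[_ s2]].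
  by apply: cg; apply/andP; split; lra.
have ml s : 0 <= s < normc z -> m s = 0.
  move=> hs; rewrite /m (@mean_value (normc z))//; first by rewrite gz 1?eq_sym// mul0r.
  move=> w wz; apply: ghol; first by apply: lt_trans zr.
  by apply: contraTneq wz => ->; rewrite /disc /= ltxx.
have mx : m x = 0.
  apply/normc_eq0_eps => e e0; have e2 : 0 < e / 2 by pos.
  have /ctaP/(_ _ e2)/nearRP[d d0 H] := cm.
  pose k := Num.min (d / 2) (Num.min (normc z) ((r - normc z) / 2)).
  have k0 : 0 < k by rewrite !lt_min divr_gt0//= nz0 divr_gt0// subr_gt0.
  have kd : k < d by rewrite gt_min; apply/orP; left; lra.
  have k1 : k <= normc z by rewrite !ge_min lexx orbT.
  have k2 : k <= (r - normc z) / 2 by rewrite !ge_min lexx !orbT.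
  have H1 : normc (m (normc z) - m (normc z - k)) < e / 2.
    by apply: H; rewrite addrC addKr normrN gtr0_norm.
  have H2 : normc (m (normc z) - m (normc z + k)) < e / 2.
    by apply: H; rewrite addrC addKr gtr0_norm.
  have -> : m x = m (normc z + k).
    apply: (@mean_annulus _ g (normc z) r x).
    - move=> w /= /andP[w1 w2]; apply: ghol => //.
      by apply: contraTneq w1 => ->; rewrite ltxx.
    - exact: normc_ge0.
    - by rewrite zx.
    - by clear -k0 k2 zr; apply/andP; split; lra.
  rewrite (ml (normc z - k)) ?subr0 in H1; last by lra; split; lra.
  rewrite -(subr0 (m _)) (le_trans (le_normc_trans (m (normc z)) _ _))// subr0 normcB.
  by lra.
have xC0 : x%:C != 0 :> C by apply/eqP => -[/eqP]; rewrite gt_eqF.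
(* Here x ee t - z = x ee t (1 - y conj (ee t)), so g is the integrand minus its value with F z in
   place of F. *)
have Ek t : F (x%:C * ee t) * (1 - y * conjc (ee t))^-1 =
    g (x%:C * ee t) + F z * (1 - y * conjc (ee t))^-1.
  have et := ee_neq0 t; have xz : x%:C * ee t - z != 0.
    rewrite subr_eq0; apply/eqP => E; move: zx; rewrite -E normc_circle ger0_norm ?ltxx//.
    exact: ltW.
  have k0 : 1 - y * conjc (ee t) != 0 by apply: kernel_neq0; rewrite // normc_conj normc_ee.
  rewrite gz; last by rewrite -subr_eq0.
  rewrite (_ : x%:C * ee t - z = x%:C * ee t * (1 - y * conjc (ee t))); last first.
    by rewrite /z conj_ee; field.
  by field; rewrite k0 xC0 et.
under [LHS]eq_cint => t _ do rewrite Ek.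
rewrite cintD ?cintZ -/(m x) ?mx ?add0r ?mean_kernel ?mulr1//.
- exact: c01_kernel.
- by apply: cg; rewrite (ltW x0) xr.
- by apply: c01M; [exact: c01c|exact: c01_kernel].
Qed.

Lemma c01_bounded (f : R -> C) : c01 f -> exists M, forall t, 0 <= t <= 1 -> normc (f t) <= M.
Proof.
move=> cf; have cn : {within `[0, 1], continuous (fun t => normc (f t))}.
  by apply: cta_within => t /cf ?; cts.
have [t _ h] := EVT_max ler01 cn.
by exists (normc (f t)) => s s01; apply: h; rewrite in_itv.
Qed.

(** Removing the terms of order 0 and 1 from the Cauchy kernel leaves (y conj (ee t))^2 times the
    kernel, which is at most 2 in modulus for |y| <= 1/2. *)
Lemma cauchy_coef r F x c : hol (disc r) F -> 0 < x < r -> cder F 0 c ->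
  forall M, (forall t, 0 <= t <= 1 -> normc (F (x%:C * ee t)) <= M) ->
  x%:C * c = cint (fun t => F (x%:C * ee t) * conjc (ee t)) /\
  forall w, normc w <= x / 2 -> normc (F w - F 0 - c * w) <= 2 * M / x ^+ 2 * normc w ^+ 2.
Proof.
move=> hF xr dF M hM; have /andP[x0 xr'] := xr.
have xC0 : x%:C != 0 :> C by apply/eqP => -[/eqP]; rewrite gt_eqF.
have cF : c01 (fun t => F (x%:C * ee t)) by apply: c01_circle hF _; rewrite (ltW x0) xr'.
have c1 : c01 (fun t => conjc (ee t) : C) by move=> t _; cts.
pose a := cint (fun t => F (x%:C * ee t) * conjc (ee t)).
have c1F : c01 (fun t => F (x%:C * ee t) * conjc (ee t)) by exact: c01M.
have M0 : 0 <= M by apply: le_trans (hM 0 _); rewrite ?normc_ge0// lexx ler01.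
have T y : normc y <= 2^-1 -> normc (F (x%:C * y) - F 0 - y * a) <= 2 * M * normc y ^+ 2.
  move=> y2; have y1 : normc y < 1 by apply: le_lt_trans y2 _; lra.
  have ck := c01_kernel y1.
  have -> : F (x%:C * y) - F 0 - y * a =
      y ^+ 2 * cint (fun t => F (x%:C * ee t) * conjc (ee t) ^+ 2 * (1 - y * conjc (ee t))^-1).
    rewrite -(cauchy_formula hF xr y1) -(@mean_value r F x hF) ?(ltW x0) ?xr'//.
    rewrite /a -cintZ// -cintZ; last by apply: c01M => //; apply: c01M => // t _; cts.
    rewrite -cintB//; last exact: c01M.
    rewrite -cintB//; last by apply: c01M => //; exact: c01c.
      apply: eq_cint => t _; have k0 : 1 - y * conjc (ee t) != 0.
        by apply: kernel_neq0; rewrite // normc_conj normc_ee.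
      by field.
    by apply: c01D; [exact: c01M|exact: c01N].
  rewrite normcM normcX mulrC ler_wpM2r ?sqr_ge0//.
  apply: normc_cint => [|t t01]; first by apply: c01M => //; apply: c01M => // t _; cts.
  have n1 : normc (conjc (ee t) : C) = 1 by rewrite normc_conj normc_ee.
  rewrite normcM [normc (_ * _ ^+ 2)]normcM normcX n1 expr1n mulr1 mulrC.
  rewrite ler_pM ?normc_ge0 ?hM// normcV.
  rewrite invf_ple ?posrE; [|by rewrite normc_gt0 kernel_neq0// n1|by []].
  by have := @kernel_ge y (conjc (ee t)); rewrite n1 lexx => /(_ isT); lra.
have T' w : normc w <= x / 2 ->
    normc (F w - F 0 - a / x%:C * w) <= 2 * M / x ^+ 2 * normc w ^+ 2.
  move=> hw; have E1 : x%:C * (w / x%:C) = w by rewrite mulrC divfK.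
  have E2 : w / x%:C * a = a / x%:C * w by field.
  have E3 : normc (w / x%:C) = normc w / x by rewrite normcM normcV normc_nneg// ltW.
  have := T (w / x%:C); rewrite E1 E2 E3 => H; apply: le_trans (H _) _.
    by rewrite ler_pdivrMr// mulrC.
  by lra.
(* The quadratic remainder shows that a / x is a derivative at 0, and derivatives are unique. *)
have ca : c = a / x%:C.
  apply: cder_uniq dF _; apply/cderP => e e0; apply/nearCP.
  pose K := 2 * M / x ^+ 2 + 1.
  have K0 : 0 < K by rewrite ltr_wpDl// divr_ge0 ?sqr_ge0// mulr_ge0.
  exists (Num.min (x / 2) (e / K)); first by pos.
  move=> w; rewrite subr0 lt_min => /andP[w1 w2].
  rewrite (le_trans (T' w (ltW w1)))// expr2 mulrA ler_wpM2r ?normc_ge0//.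
  rewrite (le_trans (y := K * normc w))//; first by rewrite ler_wpM2r ?normc_ge0// lerDl.
  by rewrite mulrC -ler_pdivlMr// ltW.
by split=> [|w hw]; rewrite ca ?T'// mulrC divfK.
Qed.

Lemma cder_shift F z c : cder F z c -> cder (fun w => F (z + w)) 0 c.
Proof.
move=> h; rewrite -(mulr1 c); apply: cder_comp; first by rewrite addr0.
by have := cderD (cder_cst z 0) (cder_id 0); rewrite add0r.
Qed.

Lemma hol_shift r F z : hol [set w | normc (w - z) < r] F -> hol (disc r) (fun w => F (z + w)).
Proof.
move=> hF; apply: (hol_comp hF) => [w _|w].
  by eexists; exact: (cderD (cder_cst z w) (cder_id w)).
by rewrite /= addrC addKr.
Qed.

(** The quadratic remainder of [cauchy_coef] depends only on the bound M, so it is uniform in t and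
    can be integrated. *)
Lemma cder_cint (k : C -> R -> C) (k' : R -> C) z r M : 0 < r ->
  (forall t, 0 <= t <= 1 -> hol [set w | normc (w - z) < r] (k ^~ t)) ->
  (forall w t, 0 <= t <= 1 -> normc (w - z) < r -> normc (k w t) <= M) ->
  (forall t, 0 <= t <= 1 -> cder (k ^~ t) z (k' t)) ->
  (forall w, normc (w - z) < r -> c01 (k w)) -> c01 k' ->
  cder (fun w => cint (k w)) z (cint k').
Proof.
move=> r0 hk hM dk ck ck'; pose x := r / 2.
have xr : 0 < x < r by rewrite /x; apply/andP; split; lra.
have x0 : 0 < x by pos.
have M0 : 0 <= M.
  apply: le_trans (hM z 0 _ _); [exact: normc_ge0|by lra|by rewrite subrr normc0].
pose K := 2 * M / x ^+ 2 + 1.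
have K0 : 0 < K by rewrite ltr_wpDl// divr_ge0 ?sqr_ge0// mulr_ge0.
apply/cderP => e e0; apply/nearCP.
exists (Num.min (x / 2) (e / K)); first by pos.
move=> w; rewrite lt_min => /andP[w1 w2].
have wr : normc (w - z) < r by rewrite (lt_trans w1); lra.
have zr : normc (z - z) < r by rewrite subrr normc0.
have cw := ck w wr; have cz := ck z zr.
have cc : c01 (fun t => (w - z) * k' t) by apply: c01M => //; exact: c01c.
rewrite (mulrC (cint _)) -cintZ// -cintB// -cintB//; last by apply: c01D => //; exact: c01N.
apply: normc_cint => [|t t01].
  by apply: c01D; [apply: c01D => //; exact: c01N|exact: c01N].
have [] := cauchy_coef (hol_shift (hk t t01)) xr (cder_shift (dk t t01)) (M := M).
  by move=> s _; apply: hM => //; rewrite addrC addKr normc_circle ger0_norm ?(ltW x0)//; case/andP: xr.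
move=> _ /(_ (w - z) (ltW w1)); rewrite subrKC addr0 (mulrC (k' t)) => /le_trans; apply.
rewrite expr2 mulrA ler_wpM2r ?normc_ge0// (le_trans (y := K * normc (w - z)))//.
  by rewrite ler_wpM2r ?normc_ge0// lerDl.
by rewrite mulrC -ler_pdivlMr// ltW.
Qed.
End cauchy.

Ltac nn1 := match goal with
  | H : is_true (0 <= ?x) |- is_true (0 <= ?x) => exact H
  | H : is_true (0 < ?x) |- is_true (0 <= ?x) => exact (ltW H)
  | |- is_true (0 <= _ + _) => apply: addr_ge0
  | |- is_true (0 <= _ ^+ 2) => exact: sqr_ge0
  | |- is_true (0 <= _ ^+ _) => apply: exprn_ge0
  | |- is_true (0 <= _ * _) => apply: mulr_ge0
  | |- is_true (0 <= _^-1) => rewrite invr_ge0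
  | |- is_true (0 <= normc _) => exact: normc_ge0
  | |- is_true (0 <= `|_|) => exact: normr_ge0
  | |- is_true (0 <= Num.sqrt _) => exact: sqrtr_ge0
  | |- is_true (0 <= powR _ _) => exact: powR_ge0
  | |- is_true (0 <= _%:R) => exact: ler0n
  | |- is_true (0 <= 1) => exact: ler01
  | |- is_true (0 <= 0) => exact: lexx
  end.
Ltac nn := repeat nn1.

(** * Polar coordinates and compact discs *)

Section circle_topology.
Context {R : realType}.
Local Notation C := R[i].

Lemma cta_sqrt (T : topologicalType) (f : T -> R) (t : T) :
  cta f t -> cta (fun x => Num.sqrt (f x)) t.
Proof. by move=> hf; apply: (@ctao _ _ _ Num.sqrt f) => //; split; exact: sqrt_continuous. Qed.

Lemma cta_max (T : topologicalType) (f g : T -> R) (t : T) :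
  cta f t -> cta g t -> cta (fun x => Num.max (f x) (g x)) t.
Proof. by move=> [hf] [hg]; split; exact: (@continuous_max _ _ f g). Qed.

Lemma cta_min (T : topologicalType) (f g : T -> R) (t : T) :
  cta f t -> cta g t -> cta (fun x => Num.min (f x) (g x)) t.
Proof. by move=> [hf] [hg]; split; exact: (@continuous_min _ _ f g). Qed.

Lemma Re_conj (z : C) : complex.Re (conjc z) = complex.Re z. Proof. by case: z. Qed.
Lemma Im_conj (z : C) : complex.Im (conjc z) = - complex.Im z. Proof. by case: z. Qed.

Lemma ee_surj (z : C) : normc z = 1 -> exists t : R, z = ee t.
Proof.
move=> z1; have E : complex.Re z ^+ 2 + complex.Im z ^+ 2 = 1.
  by rewrite -sqr_normc_ReIm z1 expr1n.
have a1 : -1 <= complex.Re z <= 1 by rewrite -ler_norml -z1 Re_le_normc.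
pose t : R := acos (complex.Re z) / (2 * pi).
have p0 : 2 * pi != 0 :> R by pos.
have Et : 2 * pi * t = acos (complex.Re z) by rewrite mulrC divfK.
have [_ Ec] := acos_def a1.
have Es : sin (acos (complex.Re z)) = `|complex.Im z|.
  rewrite sin_acos// (_ : 1 - _ = complex.Im z ^+ 2) ?sqrtr_sqr//.
  by lra.
have [b0|b0] := leP 0 (complex.Im z).
  exists t; rewrite /ee Et Ec Es ger0_norm//.
  by apply: ReIm_eq.
exists (- t); rewrite /ee mulrN Et cosN sinN Ec Es ltr0_norm// opprK.
by apply: ReIm_eq.
Qed.

Lemma polar (z : C) : exists t : R, z = (normc z)%:C * ee t.
Proof.
have [->|z0] := eqVneq z 0; first by exists 0; rewrite normc0 mul0r.
have n0 : (normc z)%:C != 0 by apply/eqP => -[/eqP]; rewrite gt_eqF// normc_gt0.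
have [|t zt] := @ee_surj (z / (normc z)%:C).
  by rewrite normcM normcV normc_nneg ?normc_ge0// divff// gt_eqF// normc_gt0.
by exists t; rewrite -zt mulrC divfK.
Qed.

Lemma compact_cdisc (r : R) : compact [set z : C | normc z <= r].
Proof.
pose S : set (R * R) := `[-r, r] `*` `[-r, r].
have cS : compact S by apply: compact_setX; exact: segment_compact.
have cf : {within S, continuous (fun p : R * R => p.1 +i* p.2 : C)}.
  apply: continuous_in_subspaceT => p _.
  have h : cta (fun p : R * R => p.1 +i* p.2 : C) p by cts.
  exact: ctaE h.
apply: subclosed_compact (continuous_compact cf cS) _.
  apply: (@preimage_closed _ _ (@normc R) [set x : R | x <= r]); last exact: closed_le.
  move=> z _; exact: ctaE (cta_normc (ctaid z)).
move=> z /= zr; exists (complex.Re z, complex.Im z); last by apply: ReIm_eq.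
by rewrite /S /= !in_itv -!ler_norml (le_trans (Re_le_normc z) zr) (le_trans (Im_le_normc z) zr).
Qed.
End circle_topology.

Ltac cta3 := match goal with
  | |- cta ?B ?y => cta_hyp B y
  | |- cta (fun x => Num.sqrt (@?f x)) _ => apply (@cta_sqrt _ _ f)
  | |- cta (fun x => Num.max (@?f x) (@?g x)) _ => apply (@cta_max _ _ f g)
  | |- cta (fun x => Num.min (@?f x) (@?g x)) _ => apply (@cta_min _ _ f g)
  | |- _ => cta2
  end.
Ltac cts ::= repeat cta3.

(** * Monotonicity of circle means and uniform integrability in H^1 of the disc *)

Section hardy.
Context {R : realType}.
Local Notation C := R[i].
Implicit Types (z w : C) (r e L t : R).

(** Adding k |z|^2 makes the mean value inequality strict, which excludes an interior maximum. *)
Lemma max_principle (U : C -> R) r m : 0 <= r ->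
  (forall z, normc z <= r -> cta U z) ->
  (forall z, normc z < r -> exists2 d, 0 < d &
     forall x, 0 < x < d -> U z <= rint (fun t => U (z + x%:C * ee t))) ->
  (forall z, normc z = r -> U z <= m) -> forall z, normc z <= r -> U z <= m.
Proof.
move=> r0 cU sU bU z0 z0r; apply: le_eps => e e0.
pose k := e / (r ^+ 2 + 1).
have r21 : 0 < r ^+ 2 + 1 by pos.
have k0 : 0 < k by rewrite divr_gt0.
pose V z := U z + k * normc z ^+ 2.
have cV z : normc z <= r -> cta V z by move=> /cU ?; rewrite /V; cts.
have ke : k * r ^+ 2 <= e by rewrite mulrAC ler_pdivrMr// mulrDr mulr1 lerDl ltW.
have [|||z1] := @compact_EVT_max _ R V [set z | normc z <= r].
- by exists 0; rewrite /= normc0.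
- exact: compact_cdisc.
- apply: continuous_in_subspaceT => z; rewrite inE => /cV h; exact: ctaE h.
rewrite inE /= => z1r Vmax.
have H : U z0 <= V z1.
  by apply: le_trans (Vmax z0 _); rewrite ?inE// /V lerDl mulr_ge0 ?sqr_ge0// ltW.
apply: le_trans H _; move: z1r; rewrite le_eqVlt => /predU1P[z1r|z1r].
  by rewrite /V z1r lerD// bU.
exfalso; have [d d0 hd] := sU z1 z1r.
pose x := Num.min (d / 2) (r - normc z1).
have x0 : 0 < x by rewrite lt_min divr_gt0// subr_gt0.
have xd : x < d by rewrite gt_min; apply/orP; left; lra.
have xr t : normc (z1 + x%:C * ee t) <= r.
  rewrite (le_trans (le_normcD _ _))// normc_circle gtr0_norm// -lerBrDl.
  by rewrite ge_min lexx orbT.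
have cUx : c01 (fun t => U (z1 + x%:C * ee t)).
  by move=> t _; apply: (@ctao _ _ _ U (fun t => z1 + x%:C * ee t)); [exact: cU|cts].
have cN : c01 (fun t => k * normc (z1 + x%:C * ee t) ^+ 2) by move=> t _; cts.
have mN : rint (fun t => k * normc (z1 + x%:C * ee t) ^+ 2) = k * (normc z1 ^+ 2 + x ^+ 2).
  have c1 : c01 (fun t => conjc z1 * (x%:C * ee t)) by move=> t _; cts.
  have E t : normc (z1 + x%:C * ee t) ^+ 2 =
      (normc z1 ^+ 2 + x ^+ 2) + 2 * complex.Re (conjc z1 * (x%:C * ee t)).
    have := cos2Dsin2 (2 * pi * t); rewrite !sqr_normc_ReIm.
    rewrite !(Re_add, Im_add, Re_mul, Im_mul, Re_conj, Im_conj) /=.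
    move: (cos _) (sin _) (complex.Re z1) (complex.Im z1) => u v a b cs.
    apply/eqP; rewrite -subr_eq0; apply/eqP.
    transitivity (x ^+ 2 * (u ^+ 2 + v ^+ 2 - 1)); first by lra.
    by rewrite cs subrr mulr0.
  have c2 : c01 (fun t => complex.Re (conjc z1 * (x%:C * ee t))) by exact: c01_Re.
  have Z : rint (fun t => complex.Re (conjc z1 * (x%:C * ee t))) = 0.
    have hol1 : hol (disc (x + 1)) (fun w => conjc z1 * w) by move=> w _; eexists; cdr.
    have := @mean_value R (x + 1) (fun w => conjc z1 * w) x hol1.
    rewrite (ltW x0) ltrDl ltr01 mulr0 => /(_ isT) /(congr1 (@complex.Re R)) /=.
    by [].
  rewrite rintZ; last by move=> t _; cts.
  rewrite (eq_rint (fun t _ => E t)) rintD ?rint_cst ?rintZ ?Z ?mulr0 ?addr0//.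
  - by move=> t _; exact: ctac.
  - by move=> t /c2 ?; cts.
have : rint (fun t => V (z1 + x%:C * ee t)) <= V z1.
  apply: rint_le => [t t01|t _]; first by cts; apply: rtaD; [exact: cUx|exact: cN].
  by apply: Vmax; rewrite inE /=; exact: xr.
rewrite /V rintD// mN leNgt => /negP; apply.
have := hd x; rewrite x0 xd => /(_ isT) h; apply: le_lt_trans (lerD h (lexx _)) _.
by rewrite ltrD2l mulrDr ltrDl mulr_gt0// exprn_gt0.
Qed.

(** As |1 + x|^(1/2) is the squared modulus of (1 + x)^(1/4) = 1 + x/4 - 3 x^2/32 + ..., it equals
    the left side plus |x|^2/16 plus terms of order 3, which |x|^2/16 absorbs. The left side is the
    real part of a polynomial in x, so its circle means are explicit when x is holomorphic. *)
Lemma sqrt_normc_ge (x : C) : normc x <= 16^-1 ->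
  1 + complex.Re x / 2 - 3 / 16 * complex.Re (x ^+ 2) <= Num.sqrt (normc (1 + x)).
Proof.
move=> hx; have ha := le_trans (Re_le_normc x) hx; have hb := le_trans (Im_le_normc x) hx.
have N := sqr_normc_ReIm (1 + x); move: N; rewrite expr2 Re_add Im_add Re_mul /= add0r.
move: (complex.Re x) (complex.Im x) (normc _) (normc_ge0 (1 + x)) ha hb => a b n n0.
rewrite !ler_norml => /andP[a1 a2] /andP[b1 b2] N.
set q := (1 + a / 2 - _).
have A : a ^+ 2 <= 256^-1 by nra.
have B : b ^+ 2 <= 256^-1 by nra.
have a0 : 0 <= a ^+ 2 by pos.
have b0 : 0 <= b ^+ 2 by pos.
(* Midway between the second-order expansions of q^2 and of |1 + x|, which differ by (a^2 + b^2) /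
   8. *)
pose Y := 1 + a + b ^+ 2 / 2 - (a ^+ 2 + b ^+ 2) / 16.
have h1 : - (a * (a ^+ 2 - b ^+ 2)) <= 16^-1 * (a ^+ 2 + b ^+ 2).
  by move: (a ^+ 2) (b ^+ 2) a0 b0 => u v u0 v0; nra.
have h2 : (a ^+ 2 - b ^+ 2) ^+ 2 <= 128^-1 * (a ^+ 2 + b ^+ 2).
  by move: (a ^+ 2) (b ^+ 2) a0 b0 A B => u v u0 v0 A B; nra.
have qY : q ^+ 2 <= Y.
  rewrite (_ : q ^+ 2 = 1 + a - a ^+ 2 / 8 + 3 / 8 * b ^+ 2 - 3 / 16 * (a * (a ^+ 2 - b ^+ 2)) +
    9 / 256 * (a ^+ 2 - b ^+ 2) ^+ 2); last by rewrite /q; field.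
  rewrite /Y; set u := (_ ^+ 2 - _) ^+ 2 in h2 *; set v := a * _ in h1 *.
  by move: u v (a ^+ 2) (b ^+ 2) a0 b0 h1 h2 => x1 x2 x3 x4; lra.
have Y0 : 0 <= Y by apply: le_trans qY; exact: sqr_ge0.
have Yn : Y <= n.
  rewrite -(ler_sqr _ n0)// expr2 [leRHS]expr2 N.
  rewrite (_ : Y * Y = (1 + a) ^+ 2 + (1 + a) * (b ^+ 2 - (a ^+ 2 + b ^+ 2) / 8) + (b ^+ 2 / 2 - (a ^+ 2 + b ^+ 2) / 16) ^+ 2); last by rewrite /Y; field.
  rewrite -addrA lerD2l.
  by move: (a ^+ 2) (b ^+ 2) a0 b0 A B => u v u0 v0 A B; nra.
have [q0|q0] := leP q 0; first by rewrite (le_trans q0).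
by rewrite -(ger0_norm (ltW q0)) -sqrtr_sqr ler_wsqrtr// (le_trans qY).
Qed.

Variables (F : C -> C) (hF : hol (disc 1) F).

(** |F|^(1/2), regularised at the zeros of F. A power of |F| below the first is still subharmonic,
    and this gain is the source of uniform integrability. *)
Let s e z : R := Num.sqrt (Num.sqrt (normc (F z) ^+ 2 + e ^+ 2)).

Let cF z : normc z < 1 -> cta F z.
Proof. by move=> z1; exact: (holP hF). Qed.

Let cs e z : normc z < 1 -> cta (s e) z.
Proof. by move=> /cF ?; rewrite /s; cts. Qed.

(** Cauchy-Schwarz for the vectors (F z, e) and (F w, e) bounds s at w below by s(z) |1 + X
    w|^(1/2), with X holomorphic and zero at z. By [sqrt_normc_ge] the mean of the second factor is
    at least 1. The radius d is uniform over |z| <= r. *)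
Let s_submean e (r : R) : 0 < e -> r < 1 -> exists2 d, 0 < d & forall z x, normc z <= r -> 0 < x < d ->
  s e z <= rint (fun t => s e (z + x%:C * ee t)).
Proof.
move=> e0 r1.
pose P (x : R) (z : C) := forall t, 0 <= t <= 1 -> normc (F z - F (z + x%:C * ee t)) < e / 16.
have : \forall x \near (0 : R), forall z, normc z <= r -> P x z.
  have NC := @near_compact _ _ [set z : C | normc z <= r] P (0 : R) (@compact_cdisc R r).
  apply: NC => z /= zr.
  have : \forall p \near ((0 : R, z) : R * C), forall t, 0 <= t <= 1 ->
      normc (F p.2 - F (p.2 + p.1%:C * ee t)) < e / 16.
    apply: near_c01 => t _.
    have z1 : normc z < 1 by lra.
    have c1 : cta (fun q : (R * C) * R => F q.1.2 - F (q.1.2 + q.1.1%:C * ee q.2)) ((0, z), t).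
      apply: ctaD; last apply: ctaN.
        by apply: (@ctao _ _ _ F (fun q : (R * C) * R => q.1.2)); [exact: cF|cts].
      apply: (@ctao _ _ _ F (fun q : (R * C) * R => q.1.2 + q.1.1%:C * ee q.2)); last by cts.
      by rewrite /= mul0r addr0; exact: cF.
    have e16 : 0 < e / 16 by pos.
    have /ctaP /(_ _ e16) := c1; rewrite /= mul0r addr0 subrr; apply: filterS => q.
    by rewrite sub0r normcN.
  by [].
move=> /nearRP[d d0 H]; exists (Num.min d (1 - r)); first by pos.
move=> z x zr; rewrite lt_min => /and3P[x0 xd xr].
have Hx t : 0 <= t <= 1 -> normc (F (z + x%:C * ee t) - F z) <= e / 16.
  by move=> t01; rewrite normcB ltW// H// subr0 gtr0_norm.
have zx1 t : normc (z + x%:C * ee t) < 1.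
  rewrite (le_lt_trans (le_normcD _ _))// normc_circle gtr0_norm//.
  by lra.
set F0 := F z; pose N2 := normc F0 ^+ 2 + e ^+ 2.
have N20 : 0 < N2 by rewrite ltr_wpDl ?sqr_ge0 ?exprn_gt0.
pose N0 := Num.sqrt N2.
have N00 : 0 < N0 by rewrite sqrtr_gt0.
have N0E : N0 ^+ 2 = N2 by rewrite sqr_sqrtr// ltW.
pose c : C := conjc F0 / N2%:C.
have N2C : N2%:C != 0 :> C by apply/eqP => -[/eqP]; rewrite gt_eqF.
pose X w := c * (F w - F0).
have nc : normc c * e <= 1.
  rewrite normcM normc_conj normcV normc_nneg ?(ltW N20)// mulrAC ler_pdivrMr// mul1r /N2.
  have := normc_ge0 F0; move: (normc F0) => u u0; have := sqr_ge0 (u - e).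
  by rewrite sqrrB; nra.
have HX t : 0 <= t <= 1 -> normc (X (z + x%:C * ee t)) <= 16^-1.
  move=> /Hx h; rewrite normcM (le_trans (ler_wpM2l (normc_ge0 c) h))// mulrA.
  by lra.
have CS w : N0 * normc (1 + X w) <= Num.sqrt (normc (F w) ^+ 2 + e ^+ 2).
  have E : N2%:C * (1 + X w) = conjc F0 * F w + (e ^+ 2)%:C.
    rewrite /X /c mulrDr mulr1 mulrA (mulrCA N2%:C) divff// mulr1 mulrBr (mulrC (conjc F0) F0) mul_conjc.
    by rewrite /N2 rmorphD /=; ring.
  have H1 : N2 * normc (1 + X w) <= normc F0 * normc (F w) + e ^+ 2.
    rewrite -{1}(normc_nneg (ltW N20)) -normcM E (le_trans (le_normcD _ _))//.
    by rewrite normcM normc_conj normc_nneg ?sqr_ge0.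
  rewrite -(ler_pM2l N00) mulrA -expr2 N0E; apply: le_trans H1 _.
  rewrite -[leLHS]ger0_norm; last by nn.
  rewrite -sqrtr_sqr /N0 -sqrtrM ?(ltW N20)// ler_wsqrtr// /N2.
  move: (normc F0) (normc (F w)) => u v; rewrite -subr_ge0.
  by rewrite (_ : _ - _ = (e * (u - v)) ^+ 2) ?sqr_ge0//; ring.
have LB t : 0 <= t <= 1 -> Num.sqrt N0 * (1 + complex.Re (X (z + x%:C * ee t)) / 2 -
    3 / 16 * complex.Re (X (z + x%:C * ee t) ^+ 2)) <= s e (z + x%:C * ee t).
  move=> /HX /sqrt_normc_ge h; apply: le_trans (ler_wpM2l (sqrtr_ge0 _) h) _.
  by rewrite -sqrtrM ?(ltW N00)// ler_wsqrtr.
have hX : hol (disc (1 - r)) (fun w => X (z + w)).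
  have hFz : hol (disc (1 - r)) (fun w => F (z + w)).
    apply: (hol_shift (F := F) (z := z)) => w /= hw; apply: hF.
    by rewrite /disc /= -(subrK z w) (le_lt_trans (le_normcD _ _))//; lra.
  by apply: holM; [exact: hol_cst|apply: holD => //; exact: hol_cst].
have X0 : X (z + 0) = 0 by rewrite /X addr0 subrr mulr0.
have xr' : 0 <= x < 1 - r by lra.
have m1 := mean_value hX xr'; have m2 := mean_value (holX 2 hX) xr'.
rewrite X0 in m1; rewrite X0 expr0n in m2.
have c1 : c01 (fun t => X (z + x%:C * ee t)) by exact: c01_circle hX xr'.
have c2 : c01 (fun t => X (z + x%:C * ee t) ^+ 2) by exact: c01_circle (holX 2 hX) xr'.
pose u t := complex.Re (X (z + x%:C * ee t)).
pose v t := complex.Re (X (z + x%:C * ee t) ^+ 2).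
have cu : c01 u := c01_Re c1; have cv : c01 v := c01_Re c2.
have -> : s e z = rint (fun t => Num.sqrt N0 * (1 + u t / 2 - 3 / 16 * v t)).
  have d1 : c01 (fun t => u t / 2) by move=> t /cu ?; cts.
  have d2 : c01 (fun t => 3 / 16 * v t) by move=> t /cv ?; cts.
  have d3 : c01 (fun t => 1 + u t / 2) by move=> t /cu ?; cts.
  have d4 : c01 (fun _ : R => 1 : R) by move=> t _; exact: ctac.
  rewrite rintZ; last by move=> t t01; have := cu t t01; have := cv t t01 => ? ?; cts.
  rewrite rintB// rintD// rint_cst rintZ//.
  rewrite (@eq_rint _ _ (fun t => 2^-1 * u t)) => [|t _]; last by lra.
  rewrite rintZ//.
  have -> : rint u = 0 by have := congr1 (@complex.Re R) m1.
  have -> : rint v = 0 by have := congr1 (@complex.Re R) m2.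
  by rewrite !mulr0 addr0 subr0 mulr1.
apply: ler_rint => [t t01|t _|t t01]; last exact: LB.
  by have := cu t t01; have := cv t t01 => ? ?; cts.
by apply: (@ctao _ _ _ (s e) (fun t => z + x%:C * ee t)); [exact: cs|cts].
Qed.

Let q e z : R := Num.sqrt (normc (F z) ^+ 2 + e ^+ 2).

Let sq e z : s e z ^+ 2 = q e z.
Proof. by rewrite sqr_sqrtr. Qed.

Let q_ge e z : normc (F z) <= q e z.
Proof.
rewrite -[leLHS]ger0_norm ?normc_ge0// -sqrtr_sqr ler_wsqrtr// lerDl.
exact: sqr_ge0.
Qed.

Let q_le e z : 0 <= e -> q e z <= normc (F z) + e.
Proof.
move=> e0; have n0 := normc_ge0 (F z).
rewrite -[leRHS]ger0_norm ?addr_ge0// -sqrtr_sqr ler_wsqrtr// sqrrD lerD2r lerDl.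
by rewrite mulrn_wge0// mulr_ge0.
Qed.

Let cq e z : normc z < 1 -> cta (q e) z.
Proof. by move=> /cF ?; rewrite /q; cts. Qed.

Let circ (S : topologicalType) (G : C -> S) r : (forall z, normc z < 1 -> cta G z) ->
  `|r| < 1 -> forall t, cta (fun t => G (r%:C * ee t)) t.
Proof.
move=> cG r1 t; apply: (@ctao _ _ _ G (fun t => r%:C * ee t)); last by cts.
by apply: cG; rewrite normc_circle.
Qed.

(** Young's inequality for min(a, L) and b; where a > L, the remaining (a - L) b is at most (a^2 /
    L) H. *)
Let split_prod (a b L H : R) : 0 <= a -> 0 <= b <= H -> 0 < L ->
  a * b <= Num.min a L ^+ 2 / 2 + b ^+ 2 / 2 + H / L * a ^+ 2.
Proof.
move=> a0 /andP[b0 bH] L0; have [aL|La] := leP a L.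
  have : 0 <= H / L * a ^+ 2 by have := le_trans b0 bH => ?; nn.
  by have := sqr_ge0 (a - b); rewrite sqrrB; move: (H / L * _) => u; lra.
have h1 : a - L <= a ^+ 2 / L.
  by rewrite ler_pdivlMr// expr2 mulrBl lerBlDr; have := sqr_ge0 L; rewrite expr2; nra.
have h2 : (a - L) * b <= H / L * a ^+ 2.
  rewrite mulrAC -mulrA mulrC ler_pM//; first by pos.
by have := sqr_ge0 (L - b); rewrite sqrrB; move: (H / L * _) h2 => u h2; nra.
Qed.

(** U(z) correlates s on the circle through z with the values w of s on the circle of radius r, and
    is subharmonic in z. At z = r it is the mean I to be bounded; on |z| = r' it is bounded by
    [split_prod], whose term I / 2 is absorbed. *)
Let circle_growth e r r' L H : 0 < e -> 0 <= r <= r' -> r' < 1 -> 0 < L ->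
  (forall t, s e (r%:C * ee t) <= H) ->
  rint (fun t => q e (r%:C * ee t)) <=
  rint (fun t => Num.min (q e (r'%:C * ee t)) (L ^+ 2)) +
  2 * H / L * rint (fun t => q e (r'%:C * ee t)).
Proof.
move=> e0 /andP[r0 rr'] r'1 L0 hH.
have r'0 : 0 <= r' by pos.
have n1 : `|r| < 1 by rewrite ger0_norm// (le_lt_trans rr').
have n2 : `|r'| < 1 by rewrite ger0_norm.
pose w t := s e (r%:C * ee t); pose h' t := s e (r'%:C * ee t).
have cw t : cta w t by exact: (circ (cs e)).
have ch' t : cta h' t by exact: (circ (cs e)).
pose U z := rint (fun t => s e (z * ee t) * w t).
have cUk z : normc z < 1 -> forall t, cta (fun t => s e (z * ee t) * w t) t.
  move=> z1 t; apply: rtaM => //; apply: (@ctao _ _ _ (s e) (fun t => z * ee t)); last by cts.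
  by apply: cs; rewrite normcM normc_ee mulr1.
have cU z : normc z < 1 -> cta U z.
  move=> z1; apply: cta_rint => [t _|].
    apply: rtaM; last by apply: (@ctao _ _ _ w (fun p : C * R => p.2)); [exact: cw|cts].
    apply: (@ctao _ _ _ (s e) (fun p : C * R => p.1 * ee p.2)); last by cts.
    by apply: cs; rewrite /= normcM normc_ee mulr1.
  apply/nearCP; exists (1 - normc z); first by rewrite subr_gt0.
  move=> z' hz' t _; apply: cUk; rewrite -(subrK z z').
  by rewrite (le_lt_trans (le_normcD _ _))// -ltrBrDr.
set I' := rint (fun t => q e (r'%:C * ee t)).
set J' := rint (fun t => Num.min _ _).
set I := rint (fun t => q e (r%:C * ee t)).
have shift (g : R -> R) (a : R) : (forall t, cta g t) -> (forall t, g (t + 1) = g t) ->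
    rint (fun t => g (t + a)) = rint g by exact: rint_shift.
have bU z : normc z = r' -> U z <= J' / 2 + I / 2 + H / L * I'.
  move=> zr; have [al] := polar z; rewrite zr => zE.
  have Ez t : s e (z * ee t) = h' (t + al) by rewrite /h' eeD zE -mulrA (mulrC (ee al)).
  have E1 : rint (fun t => Num.min (h' (t + al)) L ^+ 2) = J'.
    rewrite (shift (fun t => Num.min (h' t) L ^+ 2)).
    - apply: eq_rint => t _; rewrite -sq -/(h' t).
      have h0 : 0 <= h' t by exact: sqrtr_ge0.
      have L0' := ltW L0; have [hL|/ltW Lh] := leP (h' t) L.
        by rewrite min_l// ler_sqr.
      by rewrite min_r// ler_sqr.
    - by move=> t; cts.
    - by move=> t; rewrite /h' ee_per.
  have E2 : rint (fun t => h' (t + al) ^+ 2) = I'.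
    rewrite (shift (fun t => h' t ^+ 2)).
    - by apply: eq_rint => t _; rewrite sq.
    - by move=> t; cts.
    - by move=> t; rewrite /h' ee_per.
  have E3 : rint (fun t => w t ^+ 2) = I by apply: eq_rint => t _; rewrite sq.
  have -> : J' / 2 + I / 2 + H / L * I' = rint (fun t =>
      2^-1 * Num.min (h' (t + al)) L ^+ 2 + 2^-1 * w t ^+ 2 + H / L * h' (t + al) ^+ 2).
    rewrite rintD ?rintD ?rintZ ?E1 ?E2 ?E3; [by rewrite mulrC (mulrC I)|by move=> t _; cts..].
  apply: ler_rint => [t _|t _|t _]; [by apply: cUk; rewrite zr|by cts|].
  rewrite Ez mulrC (mulrC 2^-1) [w t * _]mulrC (mulrC 2^-1 (w t ^+ 2)).
  by apply: split_prod => //; [exact: sqrtr_ge0|rewrite sqrtr_ge0 hH].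
have -> : I = U r%:C by apply: eq_rint => t _; rewrite -sq expr2.
suff : U r%:C <= J' / 2 + I / 2 + H / L * I'.
  have -> : U r%:C = I by apply: eq_rint => t _; rewrite -sq expr2.
  by lra.
apply: (max_principle r'0) bU _ _ => [z zr|z zr|].
- by apply: cU; exact: le_lt_trans r'1.
- have [d d0 hd] := s_submean e0 r'1; exists (Num.min d (1 - r')).
    by rewrite lt_min d0 subr_gt0.
  move=> x; rewrite lt_min => /and3P[x0 xd xr].
  have zx t : normc (z + x%:C * ee t) < 1.
    by rewrite (le_lt_trans (le_normcD _ _))// normc_circle gtr0_norm//; lra.
  pose k (t a : R) := s e ((z + x%:C * ee a) * ee t) * w t.
  (* The integrals are exchanged so that [s_submean] applies around z ee t for each fixed t. *)
  rewrite (_ : rint (fun t => U (z + x%:C * ee t)) = rint (fun t => rint (k t))); last first.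
    rewrite (rint_fubini (k := k)) => [|p]//.
    apply: rtaM; last by apply: (@ctao _ _ _ w (fun p : R * R => p.1)); [exact: cw|cts].
    apply: (@ctao _ _ _ (s e) (fun p : R * R => (z + x%:C * ee p.2) * ee p.1)); last by cts.
    by apply: cs; rewrite normcM normc_ee mulr1.
  have ck t a : cta (fun a => s e ((z + x%:C * ee a) * ee t)) a.
    apply: (@ctao _ _ _ (s e) (fun a => (z + x%:C * ee a) * ee t)); last by cts.
    by apply: cs; rewrite normcM normc_ee mulr1.
  apply: ler_rint => [t _|t _|t _].
  + by apply: cUk; exact: lt_trans r'1.
  + apply: cta_rint => [a _|]; last first.
      by apply: near_all => t' a _; apply: rtaM; [exact: ck|exact: ctac].
    apply: rtaM; last by apply: (@ctao _ _ _ w (fun p : R * R => p.1)); [exact: cw|cts].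
    apply: (@ctao _ _ _ (s e) (fun p : R * R => (z + x%:C * ee p.2) * ee p.1)); last by cts.
    by apply: cs; rewrite normcM normc_ee mulr1.
  + rewrite /k (@eq_rint _ _ (fun a => w t * s e ((z + x%:C * ee a) * ee t))) => [|a _]; last by lra.
    rewrite rintZ => [|a _]; last exact: ck.
    rewrite mulrC ler_wpM2l ?sqrtr_ge0//.
    have zt : normc (z * ee t) <= r' by rewrite normcM normc_ee mulr1 ltW.
    apply: le_trans (hd (z * ee t) x zt _) _; first by lra.
    rewrite -(shift (fun a => s e (z * ee t + x%:C * ee a)) t).
    * by rewrite le_eqVlt; apply/orP; left; apply/eqP/eq_rint => a _; rewrite eeD mulrDl mulrA.
    * move=> a; apply: (@ctao _ _ _ (s e) (fun a => z * ee t + x%:C * ee a)); last by cts.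
      apply: cs; rewrite (le_lt_trans (le_normcD _ _))// normc_circle gtr0_norm//.
      by lra.
    * by move=> a; rewrite ee_per.
- by rewrite normc_nneg.
Qed.

Let I r := rint (fun t => normc (F (r%:C * ee t))).

(** The regularisation e tends to 0; it costs at most (1 + 2 H / L) e. The summand 1 next to |F|
    leaves room for e <= 1. *)
Let circle_growth0 r r' L H : 0 <= r <= r' -> r' < 1 -> 0 < L -> 0 <= H ->
  (forall t, normc (F (r%:C * ee t)) + 1 <= H ^+ 2) ->
  I r <= rint (fun t => Num.min (normc (F (r'%:C * ee t))) (L ^+ 2)) + 2 * H / L * I r'.
Proof.
move=> /andP[r0 rr'] r'1 L0 H0 hH; apply: le_eps => eta eta0.
have r'0 : 0 <= r' by pos.
have n1 : `|r| < 1 by rewrite ger0_norm// (le_lt_trans rr').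
have n2 : `|r'| < 1 by rewrite ger0_norm.
pose K := 1 + 2 * H / L.
have K0 : 0 < K by rewrite ltr_pwDl// divr_ge0 ?mulr_ge0// ltW.
pose e := Num.min 1 (eta / K).
have e0 : 0 < e by rewrite lt_min ltr01 divr_gt0.
have e1 : e <= 1 by rewrite ge_min lexx.
have eK : K * e <= eta by rewrite mulrC -ler_pdivlMr// ge_min lexx orbT.
have cN z : normc z < 1 -> cta (fun z => normc (F z)) z by move=> /cF ?; cts.
have cn1 t : cta (fun t => normc (F (r%:C * ee t))) t by exact: (circ cN).
have cn2 t : cta (fun t => normc (F (r'%:C * ee t))) t by exact: (circ cN).
have cq1 t : cta (fun t => q e (r%:C * ee t)) t by exact: (circ (cq e)).
have cq2 t : cta (fun t => q e (r'%:C * ee t)) t by exact: (circ (cq e)).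
have rr : 0 <= r <= r' by lra.
have hs t : s e (r%:C * ee t) <= H.
  have h0 : 0 <= s e (r%:C * ee t) by exact: sqrtr_ge0.
  rewrite -(ler_sqr h0 H0) sq.
  by apply: le_trans (hH t); apply: le_trans (q_le _ (ltW e0)) _; rewrite lerD2l.
have A1 : I r <= rint (fun t => q e (r%:C * ee t)).
  by apply: ler_rint => [t _|t _|t _] //; exact: q_ge.
have A2 : rint (fun t => Num.min (q e (r'%:C * ee t)) (L ^+ 2)) <=
    rint (fun t => Num.min (normc (F (r'%:C * ee t))) (L ^+ 2)) + e.
  rewrite -[X in _ + X]rint_cst -rintD => [|t _|t _]; [|by cts|by cts].
  apply: ler_rint => [t _|t _|t _]; [by cts|by cts|].
  have := q_le (r'%:C * ee t) (ltW e0); move: (q e _) (normc _) (L ^+ 2) => x y z h.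
  by rewrite -lerBlDr le_min !lerBlDr ge_min h ge_min lerDl (ltW e0) orbT.
have A3 : rint (fun t => q e (r'%:C * ee t)) <= I r' + e.
  rewrite -[X in _ + X]rint_cst -rintD => [|t _|t _]; [|exact: cn2|exact: ctac].
  by apply: ler_rint => [t _|t _|t _]; [exact: cq2|cts|exact: q_le (ltW e0)].
apply: le_trans A1 (le_trans (circle_growth e0 rr r'1 L0 hs) _).
apply: le_trans (lerD A2 (ler_wpM2l _ A3)) _; first by pos.
by move: eK; rewrite /K; move: (2 * H / L) (I r') (rint _) => x y z; nra.
Qed.

Let circ_bound r : 0 <= r < 1 -> exists2 H, 0 <= H & forall t, normc (F (r%:C * ee t)) + 1 <= H ^+ 2.
Proof.
move=> /andP[r0 r1].
have [|||c _ hc] := @compact_EVT_max _ R (fun z => normc (F z)) [set z | normc z <= r].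
- by exists 0; rewrite /= normc0.
- exact: compact_cdisc.
- apply: continuous_in_subspaceT => z; rewrite inE /= => zr.
  have /cF ? : normc z < 1 by lra.
  have h : cta (fun z => normc (F z)) z by cts.
  exact: ctaE h.
exists (Num.sqrt (normc (F c) + 1)); first exact: sqrtr_ge0.
move=> t; rewrite sqr_sqrtr ?addr_ge0 ?normc_ge0// lerD2r; apply: hc.
by rewrite inE /= normc_circle ger0_norm.
Qed.

(** Let the truncation level in [circle_growth0] tend to infinity. *)
Lemma circle_mean_mono r r' : 0 <= r <= r' -> r' < 1 -> I r <= I r'.
Proof.
move=> rr' r'1; have /andP[r0 rr] := rr'.
have [|H H0 hH] := @circ_bound r; first by lra.
have r'0 : 0 <= r' by pos.
have I0 : 0 <= I r' by apply: rint_ge0 => t _; exact: normc_ge0.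
apply: le_eps => e e0; pose L := 2 * H * I r' / e + 1.
have L0 : 0 < L by rewrite ltr_wpDl// divr_ge0 ?mulr_ge0// ltW.
apply: le_trans (circle_growth0 rr' r'1 L0 H0 hH) _; apply: lerD.
  have cn2 t : cta (fun t => normc (F (r'%:C * ee t))) t.
    by apply: (circ (G := fun z => normc (F z))); [move=> z /cF ?; cts|rewrite ger0_norm].
  by apply: ler_rint => [t _|t _|t _]; [cts|cts|rewrite ge_min lexx].
rewrite mulrAC ler_pdivrMr// /L mulrDr mulr1 mulrCA divff ?gt_eqF// mulr1 lerDl.
exact: ltW.
Qed.

(** Take r with I r within e/2 of the supremum of the means. By [circle_growth0] the mean truncated
    at L^2 on a larger circle is at least I r - e/2, so at most e is left above that level. *)
Lemma hardy_uniform_integrability B : (forall r, 0 <= r < 1 -> I r <= B) ->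
  forall e, 0 < e -> exists L r, [/\ 0 <= L, 0 <= r < 1 & forall r', r < r' < 1 ->
    rint (fun t => Num.max (normc (F (r'%:C * ee t)) - L) 0) <= e].
Proof.
move=> hB e e0; pose S := [set I r | r in [set r | 0 <= r < 1]].
have hS : has_sup S.
  split; first by exists (I 0), 0 => //=; rewrite lexx ltr01.
  by exists B => _ [r hr <-]; exact: hB.
have e2 : 0 < e / 2 by pos.
have [_ [r hr <-] hI] := sup_adherent e2 hS.
have [H H0 hH] := circ_bound hr; have /andP[r0 r1] := hr.
have B0 : 0 <= B by apply: le_trans (hB r hr); apply: rint_ge0 => t _; exact: normc_ge0.
pose L := 2 * H * B / (e / 2) + 1.
have L0 : 0 < L by rewrite ltr_wpDl// divr_ge0 ?mulr_ge0// ltW.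
exists (L ^+ 2), r; split; [exact: sqr_ge0|exact: hr|] => r' /andP[rr r'1].
have r'0 : 0 <= r' by pos.
have rr' : 0 <= r <= r' by lra.
have cn2 t : cta (fun t => normc (F (r'%:C * ee t))) t.
  by apply: (circ (G := fun z => normc (F z))); [move=> z /cF ?; cts|rewrite ger0_norm].
have IS : I r' <= sup S by apply: ub_le_sup; [exact: hS.2|exists r' => //=; rewrite r'0].
have := circle_growth0 rr' r'1 L0 H0 hH.
have : 2 * H / L * I r' <= e / 2.
  apply: le_trans (ler_wpM2l _ (hB r' _)) _; [by pos|by lra|].
  rewrite mulrAC ler_pdivrMr// /L mulrDr mulr1 mulrCA divff ?gt_eqF// mulr1 lerDl.
  exact: ltW.
have -> : rint (fun t => Num.max (normc (F (r'%:C * ee t)) - L ^+ 2) 0) =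
    I r' - rint (fun t => Num.min (normc (F (r'%:C * ee t))) (L ^+ 2)).
  rewrite -rintB => [|t _|t _]; [|exact: cn2|by cts].
  apply: eq_rint => t _; move: (normc _) (L ^+ 2) => x y.
  have [xy|yx] := leP x y; first by rewrite subrr max_r// subr_le0.
  by rewrite max_l// subr_ge0 ltW.
by move: (rint _) hI IS => x; lra.
Qed.
End hardy.

(** * Invariance of Lebesgue measure under shears and complex rotations *)

Section measure_preserving.
Context {R : realType}.
Local Notation RT := (measurableTypeR R).
Local Notation mu := (@lebesgue_measure R).
Local Notation lam n := (@lebesgue_tuple R n).
Local Open Scope ereal_scope.

Lemma lebesgue_measure_translate (a : R) (A : set RT) : measurable A ->
  mu A = pushforward mu (fun x : RT => (x + a)%R : RT) A.
Proof.
have mt : measurable_fun [set: RT] (fun x : RT => (x + a)%R : RT).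
  exact: measurable_funD.
move=> mA; apply: (@lebesgue_measure_unique R
  (measure_function_pushforward__canonical__measure_function_Measure mu mt)) => //.
move=> X /ocitvP[->|[[b c] _ ->]]; first by [].
rewrite /= /pushforward (_ : _ @^-1` _ = `](b - a)%R, (c - a)%R]%classic); last first.
  by apply/seteqP; split => x /=; rewrite !in_itv/= ltrBlDr lerBrDr.
rewrite !lebesgue_measure_itv/= !lte_fin ltrD2r; case: ifP => // _.
by rewrite -!EFinB opprB addrA subrK.
Qed.

Lemma ge0_integral_translate (a : R) (h : RT -> \bar R) :
  measurable_fun setT h -> (forall x, 0 <= h x) ->
  \int[mu]_x h (x + a)%R = \int[mu]_x h x.
Proof.
move=> mh h0.
have mt : measurable_fun [set: RT] (fun x : RT => (x + a)%R : RT).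
  exact: measurable_funD.
have := @ge0_integral_pushforward _ _ RT RT R _ mt mu setT h measurableT mh.
rewrite preimage_setT => <-//.
pose nu := measure_function_pushforward__canonical__measure_function_Measure mu mt.
apply: (@eq_measure_integral _ _ _ setT mu nu h) => A mA _.
exact/esym/lebesgue_measure_translate.
Qed.

Lemma ge0_integral_cons n (h : n.+1.-tuple RT -> \bar R) :
  measurable_fun setT h -> (forall x, 0 <= h x) ->
  \int[lam n.+1]_t h t = \int[(mu \x lam n)%E]_p h (consT p).
Proof.
move=> mh h0.
by rewrite (ge0_integral_pushforward (@measurable_consT R n)).
Qed.

(* Keeping the shift [s] general makes both cases of the induction on the
   position [i] work by Tonelli. *)
Definition shear n (i : 'I_n) (s : n.-tuple RT -> R) (t : n.-tuple RT) :
    n.-tuple RT :=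
  [tuple if j == i then (tnth t j + s t)%R else tnth t j | j < n].

Lemma measurable_shear n (i : 'I_n) s : measurable_fun setT s ->
  measurable_fun setT (shear i s).
Proof.
move=> ms; apply/measurable_fun_tnthP => j.
rewrite (_ : _ \o _ =
    (fun t => if j == i then (tnth t j + s t)%R else tnth t j)); last first.
  by apply/funext => t /=; rewrite tnth_mktuple.
case: (j == i); last exact: measurable_tnth.
by apply: measurable_funD => //; exact: measurable_tnth.
Qed.

Lemma consT_eq n (x : RT) (y : n.-tuple RT) (t : n.+1.-tuple RT) :
  tnth t ord0 = x -> (forall i, tnth t (lift ord0 i) = tnth y i) ->
  t = consT (x, y).
Proof.
move=> h0 h1; apply: eq_from_tnth => j; case: (unliftP ord0 j) => [k ->|->].
  by rewrite tnthS.
by [].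
Qed.

(** The second hypothesis says that s does not depend on coordinate i. For fixed other coordinates
    the shear is then a translation in that coordinate. *)
Lemma ge0_integral_shear n (i : 'I_n) s (h : n.-tuple RT -> \bar R) :
  measurable_fun setT s -> (forall a t, s (shear i a t) = s t) ->
  measurable_fun setT h -> (forall t, 0 <= h t) ->
  \int[lam n]_t h (shear i s t) = \int[lam n]_t h t.
Proof.
elim: n i s h => [|n IH] i s h ms si mh h0; first by case: (i).
have mc := @measurable_consT R n.
have msh := measurable_shear i ms.
rewrite !ge0_integral_cons//; last exact: measurableT_comp.
have mL : measurable_fun setT (fun p => h (shear i s (consT p))).
  by apply: measurableT_comp => //; exact: measurableT_comp.
have mR : measurable_fun setT (fun p => h (@consT R n p)) by exact: measurableT_comp.
case: (unliftP ord0 i) => [k|] ik; subst i.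
  etransitivity; first exact: fubini_tonelli1.
  etransitivity; last by apply/esym; exact: fubini_tonelli1.
  apply: eq_integral => x _; rewrite /fubini_F.
  have E y : shear (lift ord0 k) s (consT (x, y)) =
      consT (x, shear k (fun y => s (consT (x, y))) y).
    apply: consT_eq => [|j]; rewrite !tnth_mktuple; first by [].
    by rewrite tnthS.
  under eq_integral do rewrite E.
  apply: (IH k (fun y => s (consT (x, y))) (fun y => h (consT (x, y)))) => //.
  - by apply: measurableT_comp => //; apply: measurableT_comp.
  - move=> a y; rewrite -[RHS](si (fun t => a [tuple of behead t])).
    congr s; apply/esym/consT_eq => [|j]; rewrite !tnth_mktuple; first by [].
    rewrite (inj_eq lift_inj) /consT tnthS; case: (j == k) => //.
    by congr (_ + a _)%R; exact/val_inj.
  - by apply: measurableT_comp => //; apply: measurableT_comp.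
etransitivity; first exact: fubini_tonelli2.
etransitivity; last by apply/esym; exact: fubini_tonelli2.
apply: eq_integral => y _; rewrite /fubini_G.
have s0 x : s (consT (x, y)) = s (consT (0%R, y)).
  rewrite -[RHS](si (fun=> x)); congr s; apply/esym.
  apply: consT_eq => [|j]; rewrite !tnth_mktuple /=; last by rewrite tnthS.
  by rewrite add0r.
have E x : shear ord0 s (consT (x, y)) = consT ((x + s (consT (0%R, y)))%R, y).
  apply: consT_eq => [|j]; rewrite !tnth_mktuple /=; last by rewrite tnthS.
  by rewrite s0.
under eq_integral do rewrite E.
rewrite (@ge0_integral_translate _ (fun x => h (consT (x, y))))//.
by apply: measurableT_comp => //; apply: measurableT_comp.
Qed.

Record preserves n (T : n.-tuple RT -> n.-tuple RT) : Prop := Preserves {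
  preserves_measurable : measurable_fun setT T;
  preserves_integral : forall h : n.-tuple RT -> \bar R,
    measurable_fun setT h -> (forall t, 0 <= h t) ->
    \int[lam n]_t h (T t) = \int[lam n]_t h t }.

Lemma preserves_comp n (S T : n.-tuple RT -> n.-tuple RT) :
  preserves S -> preserves T -> preserves (S \o T).
Proof.
move=> [mS hS] [mT hT]; split=> [|h mh h0]; first exact: measurableT_comp.
etransitivity; last exact: hS mh h0.
by apply: (hT (fun t => h (S t))) => //; exact: measurableT_comp.
Qed.

Lemma preserves_shear n (i j : 'I_n) a : i != j ->
  preserves (shear i (fun t => (a * tnth t j)%R)).
Proof.
move=> ij.
have ms : measurable_fun [set: n.-tuple RT] (fun t : n.-tuple RT => (a * tnth t j)%R : RT).
  by apply: measurable_funM => //; exact: measurable_tnth.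
split=> [|h mh h0]; first exact: measurable_shear.
apply: ge0_integral_shear => // b t.
by rewrite tnth_mktuple eq_sym (negbTE ij).
Qed.

(** Exchanges the real and the imaginary coordinate of the same complex variable. *)
Definition partner n (i : 'I_(n + n)) : 'I_(n + n) :=
  match fintype.split i with inl j => rshift n j | inr j => lshift n j end.

Lemma partner_l n (j : 'I_n) : partner (lshift n j) = rshift n j.
Proof. by rewrite /partner (unsplitK (inl j : 'I_n + 'I_n)). Qed.

Lemma partner_r n (j : 'I_n) : partner (rshift n j) = lshift n j.
Proof. by rewrite /partner (unsplitK (inr j : 'I_n + 'I_n)). Qed.

Lemma lt_partner n (i : 'I_(n + n)) : (partner i < n)%N = ~~ (i < n)%N.
Proof.
rewrite -(splitK i); case: (fintype.split i) => j /=.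
  by rewrite partner_l ltn_ord ltnNge leq_addr.
by rewrite partner_r /= ltn_ord ltnNge leq_addr.
Qed.

Lemma partnerK n : involutive (@partner n).
Proof.
move=> i; rewrite -(splitK i); case: (fintype.split i) => j /=.
  by rewrite partner_l partner_r.
by rewrite partner_r partner_l.
Qed.

Definition block_shear n (b : bool) (a : R) (t : (n + n).-tuple RT) :
    (n + n).-tuple RT :=
  [tuple if (i < n)%N == b then (tnth t i + a * tnth t (partner i))%R
         else tnth t i | i < n + n].

Lemma preserves_block_shear n b a : preserves (@block_shear n b a).
Proof.
(* Only the coordinates listed in l are sheared, so that each induction step adds one elementary
   shear. *)
pose T (l : seq 'I_(n + n)) t := [tuple if ((i < n)%N == b) && (i \in l) then
  (tnth t i + a * tnth t (partner i))%R else tnth t i | i < n + n].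
have -> : @block_shear n b a = T (enum 'I_(n + n)).
  apply/funext => t; apply: eq_from_tnth => i; rewrite !tnth_mktuple.
  by rewrite mem_enum andbT.
elim: (enum _) (enum_uniq 'I_(n + n)) => [_|i l IH /= /andP[il ul]].
  rewrite (_ : T [::] = id); first by split => //; exact: measurable_id.
  by apply/funext => t; apply: eq_from_tnth => i; rewrite tnth_mktuple andbF.
have [ib|ib] := boolP ((i < n)%N == b); last first.
  rewrite (_ : T (i :: l) = T l); first exact: IH.
  apply/funext => t; apply: eq_from_tnth => k; rewrite !tnth_mktuple inE.
  by case: (eqVneq k i) => [->|//]; rewrite (negbTE ib).
have ip : (i != partner i).
  by apply/negP => /eqP e; have := lt_partner i; rewrite -e; case: (i < n)%N.
rewrite (_ : T _ = shear i (fun t => (a * tnth t (partner i))%R) \o T l).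
  by apply: preserves_comp; [exact: preserves_shear|exact: IH].
apply/funext => t; apply: eq_from_tnth => k; rewrite !tnth_mktuple inE.
case: (eqVneq k i) => [->|//]; rewrite (negbTE il) ib/=.
by rewrite lt_partner; move: ib; case: (i < n)%N; case: (b).
Qed.

(** Multiplication of all complex coordinates by u, in real coordinates. *)
Definition rot n (u : R[i]) (t : (n + n).-tuple RT) : (n + n).-tuple RT :=
  [tuple if (i < n)%N
   then (complex.Re u * tnth t i - complex.Im u * tnth t (partner i))%R
   else (complex.Re u * tnth t i + complex.Im u * tnth t (partner i))%R
   | i < n + n].

Lemma rot_cat n u v (t : (n + n).-tuple RT) : rot u (rot v t) = rot (u * v)%R t.
Proof.
apply: eq_from_tnth => i; rewrite !tnth_mktuple partnerK lt_partner Re_mul Im_mul.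
case: (i < n)%N => /=; ring.
Qed.

(* A rotation by an angle other than [pi] is a product of three shears. *)
Lemma preserves_rot n u : normc u = 1%R -> preserves (@rot n u).
Proof.
have main v : normc v = 1%R -> (1 + complex.Re v != 0)%R -> preserves (@rot n v).
  (* For v = exp(i theta) this is - tan(theta / 2); the middle shear has coefficient sin theta. *)
  move=> v1 v0; pose a := (- complex.Im v / (1 + complex.Re v))%R.
  have e1 : (1 + a * complex.Im v = complex.Re v)%R.
    have : (complex.Re v ^+ 2 + complex.Im v ^+ 2 = 1)%R by rewrite -sqr_normc_ReIm v1 expr1n.
    move: v0; rewrite /a; move: (complex.Re v) (complex.Im v) => c s c0 cs.
    have ss : (s * s = 1 - c ^+ 2)%R by rewrite -cs; ring.
    apply: (mulIf c0); rewrite mulrDl mul1r mulrAC divfK// mulNr ss; ring.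
  have e2 : (a * (1 + complex.Re v) = - complex.Im v)%R by rewrite divfK.
  rewrite (_ : @rot n v = block_shear true a \o (block_shear false (complex.Im v) \o block_shear true a)).
    by do 2!(apply: preserves_comp; first exact: preserves_block_shear); exact: preserves_block_shear.
  apply/funext => t; apply: eq_from_tnth => i; rewrite !tnth_mktuple /= partnerK lt_partner.
  case: (i < n)%N => /=; rewrite ?lt_partner.
    rewrite -{1}e1 -mulNr -e2 -e1; ring.
  by rewrite -e1; ring.
move=> u1; have [e|/main] := eqVneq (1 + complex.Re u)%R 0%R; last exact.
(* In this case u = -1, a product of two quarter turns. *)
have -> : @rot n u = rot 'i%C \o rot 'i%C.
  have Re1 : complex.Re u = (-1)%R by apply/eqP; rewrite -addr_eq0 addrC e.
  apply/funext => t /=; rewrite rot_cat; congr rot.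
  apply: ReIm_eq; first by rewrite /= Re1; ring.
  rewrite Im_mul /=.
  have : (complex.Re u ^+ 2 + complex.Im u ^+ 2 = 1)%R by rewrite -sqr_normc_ReIm u1 expr1n.
  rewrite Re1 sqrrN expr1n => /(congr1 (fun x => (x - 1)%R)); rewrite subrr addrAC subrr add0r.
  by move/eqP; rewrite sqrf_eq0 => /eqP->; ring.
have i1 : normc ('i%C : R[i]) = 1%R by rewrite /normc expr0n add0r expr1n sqrtr1.
by apply: preserves_comp; apply: main => //=; rewrite addr0 oner_eq0.
Qed.
End measure_preserving.

(** * The Euclidean norm of C^n and its topology *)

Section vector_norm.
Context {R : realType} {n : nat}.
Local Notation C := R[i].
Local Notation V := 'rV[C]_n.
Implicit Types (z w v : V) (a : C).

Lemma vnorm_ge0 z : 0 <= vnorm z. Proof. exact: sqrtr_ge0. Qed.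

Lemma sqr_vnorm z : vnorm z ^+ 2 = \sum_j normc (z ord0 j) ^+ 2.
Proof. by rewrite sqr_sqrtr// sumr_ge0// => j _; exact: sqr_ge0. Qed.

Lemma normc_le_vnorm z j : normc (z ord0 j) <= vnorm z.
Proof.
rewrite -(@ler_pXn2r _ 2)// ?nnegrE ?normc_ge0 ?vnorm_ge0// sqr_vnorm.
by rewrite (bigD1 j)//= lerDl sumr_ge0// => k _; exact: sqr_ge0.
Qed.

Lemma vnorm_le_sum z : vnorm z <= \sum_j normc (z ord0 j).
Proof.
have s0 : 0 <= \sum_j normc (z ord0 j) by apply: sumr_ge0 => j _; exact: normc_ge0.
rewrite -(@ler_pXn2r _ 2)// ?nnegrE ?vnorm_ge0// sqr_vnorm expr2 mulr_suml.
apply: ler_sum => j _; rewrite expr2 ler_wpM2l ?normc_ge0//.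
by rewrite (bigD1 j)//= lerDl sumr_ge0// => k _; exact: normc_ge0.
Qed.

Lemma vnormZ a z : vnorm (a *: z) = normc a * vnorm z.
Proof.
rewrite /vnorm -[normc a]ger0_norm ?normc_ge0// -sqrtr_sqr -sqrtrM ?sqr_ge0//.
by rewrite mulr_sumr; congr Num.sqrt; apply: eq_bigr => j _; rewrite mxE normcM exprMn.
Qed.

Lemma vnormN z : vnorm (- z) = vnorm z.
Proof. by rewrite -scaleN1r vnormZ normcN normc1 mul1r. Qed.

Lemma vnormB z w : vnorm (z - w) = vnorm (w - z).
Proof. by rewrite -vnormN opprB. Qed.

Lemma vnorm0 : vnorm (0 : V) = 0.
Proof. by rewrite -(scale0r (0 : V)) vnormZ normc0 mul0r. Qed.

Lemma vnorm_eq0 z : vnorm z = 0 -> z = 0.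
Proof.
move=> z0; apply/rowP => j; rewrite mxE; apply: eq0_normc.
by apply/le_anti; rewrite normc_ge0 -z0 normc_le_vnorm.
Qed.

Lemma sum_normc_mul_le z w :
  \sum_j normc (z ord0 j) * normc (w ord0 j) <= vnorm z * vnorm w.
Proof.
set a := vnorm z; set b := vnorm w.
have [a0 b0] : 0 <= a /\ 0 <= b by rewrite !vnorm_ge0.
have [ab|ab] := eqVneq (a * b) 0.
  rewrite ab big1// => j _; move/eqP: ab; rewrite mulf_eq0.
  by case/orP => /eqP/vnorm_eq0->; rewrite mxE normc0 ?mul0r ?mulr0.
have ab0 : 0 < a * b by rewrite lt_neqAle eq_sym ab mulr_ge0.
rewrite -(ler_pM2l ab0) mulr_sumr.
have : \sum_j 2 * (a * b * (normc (z ord0 j) * normc (w ord0 j))) <=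
    \sum_j (b ^+ 2 * normc (z ord0 j) ^+ 2 + a ^+ 2 * normc (w ord0 j) ^+ 2).
  apply: ler_sum => j _; rewrite -subr_ge0.
  move: (normc (z ord0 j)) (normc (w ord0 j)) => x y.
  rewrite (_ : _ - _ = (b * x - a * y) ^+ 2) ?sqr_ge0//; ring.
rewrite big_split/= -!mulr_sumr -!sqr_vnorm -/a -/b.
rewrite (_ : _ + _ = 2 * (a * b * (a * b))); last by lra.
by lra.
Qed.

Lemma vnormD z w : vnorm (z + w) <= vnorm z + vnorm w.
Proof.
rewrite -(@ler_pXn2r _ 2)// ?nnegrE ?addr_ge0 ?vnorm_ge0//.
rewrite sqrrD !sqr_vnorm.
apply: (@le_trans _ _ (\sum_j (normc (z ord0 j) ^+ 2 +
   (normc (z ord0 j) * normc (w ord0 j)) *+ 2 + normc (w ord0 j) ^+ 2))).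
  apply: ler_sum => j _; rewrite -sqrrD mxE.
  by rewrite ler_pXn2r ?nnegrE ?addr_ge0 ?normc_ge0// le_normcD.
by rewrite !big_split/= lerD2r lerD2l -mulr2n lerMn2r/= sum_normc_mul_le.
Qed.

Lemma vnorm_trans w z v : vnorm (z - v) <= vnorm (z - w) + vnorm (w - v).
Proof. by rewrite (_ : z - v = (z - w) + (w - v)) ?vnormD// addrA subrK. Qed.

Lemma vnorm_sub_ge z w : vnorm z - vnorm w <= vnorm (z - w).
Proof. by rewrite lerBlDr -{1}(subrK w z) vnormD. Qed.

Lemma nearVP (P : V -> Prop) z : (\forall w \near z, P w) <->
  exists2 d : R, 0 < d & forall w, vnorm (w - z) < d -> P w.
Proof.
split=> [/nbhs_ballP[e e0 h]|[d d0 h]].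
  have : (0 : C) < e by [].
  rewrite ltcE /= => /andP[/eqP ei e0']; exists (complex.Re e) => // w wd.
  apply: h; split => // i j; rewrite ord1 /ball /= normr_normc ltcE /= ei eqxx /=.
  rewrite normcB; apply: le_lt_trans wd.
  by have := normc_le_vnorm (w - z) j; rewrite !mxE.
have d0' : (0 : C) < (d / n.+1%:R)%:C by rewrite ltcR divr_gt0.
apply/nbhs_ballP; exists (d / n.+1%:R)%:C => // w hw; apply: h.
apply: le_lt_trans (vnorm_le_sum _) _.
apply: (@le_lt_trans _ _ (\sum_(j < n) d / n.+1%:R)).
  apply: ler_sum => j _; rewrite !mxE normcB; apply: ltW.
  by have := hw.2 ord0 j; rewrite /ball /= normr_normc ltcR.
by rewrite sumr_const card_ord -[_ *+ n]mulr_natl mulrCA gtr_pMr// ltr_pdivrMr// mul1r ltr_nat.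
Qed.

Lemma cta_vnorm (T : topologicalType) (F : T -> V) t : cta F t ->
  cta (fun s => vnorm (F s)) t.
Proof.
apply: ctao; apply/rtaP => e e0; apply/nearVP; exists e => // w wd.
rewrite real_ltr_norml ?num_real//.
have := vnorm_sub_ge w (F t); have := vnorm_sub_ge (F t) w; rewrite (vnormB (F t)).
by move: wd; move: (vnorm _) (vnorm _) (vnorm _) => x y u; lra.
Qed.

Lemma cta_scale (T : topologicalType) (a : T -> C) (F : T -> V) t :
  cta a t -> cta F t -> cta (fun s => a s *: F s) t.
Proof. by move=> [ha] [hF]; split; apply: cvgZ. Qed.

Lemma ctaVP (T : topologicalType) (F : T -> V) t :
  cta F t <-> (forall e : R, 0 < e -> \forall s \near t, vnorm (F t - F s) < e).
Proof.
split=> [[h] e e0|h].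
  by apply: (h [set w | vnorm (F t - w) < e]); apply/nearVP; exists e => // w; rewrite vnormB.
by split=> A /nearVP[d d0 hd]; apply: filterS (h d d0) => s sd; apply: hd; rewrite vnormB.
Qed.

Lemma cta_vadd (T : topologicalType) (F G : T -> V) t :
  cta F t -> cta G t -> cta (fun s => F s + G s) t.
Proof.
move=> /ctaVP hF /ctaVP hG; apply/ctaVP => e e0.
have e2 : 0 < e / 2 by pos.
apply: filterS2 (hF _ e2) (hG _ e2) => s h1 h2.
rewrite opprD addrACA (le_lt_trans (vnormD _ _))// (splitr e).
exact: ltrD.
Qed.

Lemma cta_vopp (T : topologicalType) (F : T -> V) t :
  cta F t -> cta (fun s => - F s) t.
Proof.
move=> /ctaVP hF; apply/ctaVP => e /hF; apply: filterS => s.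
by rewrite -opprD vnormN.
Qed.

Lemma cta_coord (T : topologicalType) (F : T -> V) j t :
  cta F t -> cta (fun s => F s ord0 j) t.
Proof.
move=> /ctaVP hF; apply/ctaP => e /hF; apply: filterS => s; apply: le_lt_trans.
by have := normc_le_vnorm (F t - F s) j; rewrite !mxE.
Qed.
End vector_norm.

Ltac cta4 := match goal with
 | |- cta (fun _ => vnorm _) _ => apply: cta_vnorm
 | |- cta (fun _ => _ *: _) _ => apply: cta_scale
 | |- @cta _ (matrix _ _ _) (fun _ => _ + _) _ => apply: cta_vadd
 | |- @cta _ (matrix _ _ _) (fun _ => - _) _ => apply: cta_vopp
 | |- cta (fun _ => _ ord0 _) _ => apply: cta_coord
 | _ => cta3
 end.
Ltac cts ::= repeat cta4.

(** * Measurability of continuous functions on R^m *)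

Section measurable_continuous.
Context {R : realType}.
Local Notation RT := (measurableTypeR R).

(** The preimage of an open ray is the union of the countably many boxes with rational centre and
    rational size contained in it. *)
Lemma measurable_eps_continuous m (G : m.-tuple RT -> RT) :
  (forall t e, 0 < e -> exists2 d : R, 0 < d & forall s,
     (forall i, `|tnth s i - tnth t i| < d) -> `|G s - G t| < e) ->
  measurable_fun setT G.
Proof.
move=> hG; apply: (measurability _ (RGenOInfty.measurableE R)) => //.
move=> _ [_ [x ->] <-]; rewrite setTI.
set A := _ @^-1` _.
pose box (q : 'I_m -> R) (k : R) : set (m.-tuple RT) :=
  [set s | forall i, `|tnth s i - q i| < k].
have mbox q k : measurable (box q k).
  rewrite (_ : box q k = \big[setI/setT]_(i < m)
      ((fun s : m.-tuple RT => tnth s i : RT) @^-1` `]q i - k, q i + k[)).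
    apply: bigsetI_measurable => i _; rewrite -[X in measurable X]setTI.
    exact: measurable_tnth.
  rewrite -bigcap_seq; apply/seteqP; split => [s h i _|s h i] /=.
    by rewrite in_itv/= -ltr_distlC distrC.
  have := h i; rewrite /= mem_index_enum => /(_ isT).
  by rewrite in_itv/= -ltr_distlC distrC.
pose B (p : {ffun 'I_m -> rat} * rat) : set (m.-tuple RT) :=
  let b := box (fun i => ratr (p.1 i)) (ratr p.2) in
  if `[< b `<=` A >] then b else set0.
rewrite (_ : A = \bigcup_k (if unpickle k is Some p then B p else set0)).
  apply: bigcup_measurable => k _; case: (unpickle k) => // p.
  by rewrite /B; case: asboolP.
apply/seteqP; split => [t At|t [k _]]; last first.
  by case: (unpickle k) => // p; rewrite /B; case: asboolP => // h /h.
have At' : x < G t by move: At; rewrite /A /= in_itv/= andbT.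
have [|d d0 hd] := hG t (G t - x); first by pos.
have d2 : 0 < d / 2 by pos.
have [k] := rat_in_itvoo d2; rewrite in_itv/= => /andP[k0 kd].
have hq i : exists q : rat, `|tnth t i - ratr q| < ratr k.
  have [|q] := @rat_in_itvoo R (tnth t i - ratr k) (tnth t i + ratr k).
    by lra.
  by move=> hq; exists q; move: hq; rewrite in_itv/= ltr_distlC.
have {hq}[q hq] := choice hq.
exists (pickle ([ffun i => q i], k)) => //; rewrite pickleK /B /=.
have tb : box (fun i => ratr ([ffun i => q i] i)) (ratr k) t.
  by move=> i; rewrite ffunE.
case: asboolP => // h; exfalso; apply: h => s hs.
rewrite /A /= in_itv/= andbT.
have /hd : forall i, `|tnth s i - tnth t i| < d.
  move=> i; have := hs i; have := tb i; rewrite ffunE => h1 h2.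
  rewrite (_ : _ - _ = (tnth s i - ratr (q i)) - (tnth t i - ratr (q i))); last by lra.
  apply: le_lt_trans (ler_normB _ _) _; move: h1 h2 kd.
  by move: `|_| `|_| => a b; lra.
by rewrite ltr_norml => /andP[+ _]; rewrite opprB ltrBrDr subrK.
Qed.

Lemma vnorm_cvec n (t : (n + n).-tuple RT) : vnorm (cvec t) = tnorm t.
Proof.
rewrite /vnorm /tnorm; congr Num.sqrt; rewrite big_split_ord/= -big_split/=.
by apply: eq_bigr => j _; rewrite mxE sqr_normc_ReIm.
Qed.

Lemma vnorm_cvecB_le n (s t : (n + n).-tuple RT) d :
  (forall i, `|tnth s i - tnth t i| <= d) ->
  vnorm (cvec s - cvec t) <= (n + n)%:R * d.
Proof.
move=> h; apply: le_trans (vnorm_le_sum _) _.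
apply: (@le_trans _ _ (\sum_(j < n) (d + d))).
  apply: ler_sum => j _; rewrite !mxE; apply: le_trans (normc_le_ReIm _) _ => /=.
  by apply: lerD; exact: h.
by rewrite sumr_const card_ord mulrnDl -mulrnDr mulr_natl.
Qed.

Lemma measurable_cvec n (G : 'rV[R[i]]_n -> RT) : (forall z, cta G z) ->
  measurable_fun setT (fun t : (n + n).-tuple RT => G (cvec t)).
Proof.
move=> cG; apply: measurable_eps_continuous => t e e0.
have /rtaP/(_ e e0)/nearVP[d d0 hd] := cG (cvec t).
exists (d / ((n + n).+1%:R)) => [|s hs]; first by pos.
rewrite distrC; apply: hd.
apply: le_lt_trans (vnorm_cvecB_le (fun i => ltW (hs i))) _.
by rewrite mulrCA gtr_pMr// ltr_pdivrMr// mul1r ltr_nat.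
Qed.
End measurable_continuous.

(** * Averages over the circle action *)

Section rotations.
Context {R : realType}.
Local Notation RT := (measurableTypeR R).
Local Notation mu := (@lebesgue_measure R).
Local Notation lam n := (@lebesgue_tuple R n).
Local Notation P n := (@punctured_ball R n).

Lemma cvec_rot n u (t : (n + n).-tuple RT) : cvec (rot u t) = u *: cvec t.
Proof.
apply/rowP => j; rewrite !mxE !tnth_mktuple partner_l partner_r /= ltn_ord.
rewrite ltnNge leq_addr /=; case: u => a b /=.
by [].
Qed.

Lemma tnorm_rot n u (t : (n + n).-tuple RT) : normc u = 1 -> tnorm (rot u t) = tnorm t.
Proof. by move=> u1; rewrite -!vnorm_cvec cvec_rot vnormZ u1 mul1r. Qed.

Lemma normalize_rot n u (t : (n + n).-tuple RT) : normc u = 1 ->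
  normalize (rot u t) = rot u (normalize t).
Proof.
move=> u1; apply: eq_from_tnth => i; rewrite !tnth_mktuple (tnorm_rot _ u1).
by case: ifP => _; rewrite ?mulrDl ?mulNr ?mulrA.
Qed.

Lemma punctured_ball_rot n u (t : (n + n).-tuple RT) : normc u = 1 ->
  P (n + n) (rot u t) <-> P (n + n) t.
Proof. by move=> u1; rewrite /punctured_ball /= (tnorm_rot _ u1). Qed.

Lemma cvec_normalize n (t : (n + n).-tuple RT) :
  cvec (normalize t) = (tnorm t)^-1%:C *: cvec t.
Proof.
apply/rowP => j; rewrite !mxE !tnth_mktuple; apply: ReIm_eq => /=.
  by lra.
by lra.
Qed.

Lemma vnorm_normalize n (t : (n + n).-tuple RT) : 0 < tnorm t ->
  vnorm (cvec (normalize t)) = 1.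
Proof.
move=> t0; rewrite cvec_normalize vnormZ vnorm_cvec normc_nneg ?invr_ge0 ?ltW//.
by rewrite mulVf// gt_eqF.
Qed.

Lemma measurable_rot_ee n :
  measurable_fun setT (fun p : (n + n).-tuple RT * RT => rot (ee p.2) p.1).
Proof.
have mre : measurable_fun setT (fun p : (n + n).-tuple RT * RT =>
    complex.Re (ee p.2) : RT).
  apply: (@measurableT_comp _ _ _ _ _ _ (fun x : RT => complex.Re (ee x) : RT)) => //.
  apply: continuous_measurable_fun => x.
  have h : cta (fun x : R => complex.Re (ee x)) x by cts.
  exact: ctaE h.
have mim : measurable_fun setT (fun p : (n + n).-tuple RT * RT =>
    complex.Im (ee p.2) : RT).
  apply: (@measurableT_comp _ _ _ _ _ _ (fun x : RT => complex.Im (ee x) : RT)) => //.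
  apply: continuous_measurable_fun => x.
  have h : cta (fun x : R => complex.Im (ee x)) x by cts.
  exact: ctaE h.
have mt i : measurable_fun setT (fun p : (n + n).-tuple RT * RT => tnth p.1 i).
  exact: (measurableT_comp (measurable_tnth i)).
apply/measurable_fun_tnthP => i.
have [hi|hi] := boolP (i < n)%N.
  rewrite (_ : _ \o _ = (fun p => complex.Re (ee p.2) * tnth p.1 i - complex.Im (ee p.2) * tnth p.1 (partner i))).
    by apply: measurable_funB; apply: measurable_funM => //; exact: mt.
  by apply/funext => p /=; rewrite tnth_mktuple hi.
rewrite (_ : _ \o _ = (fun p => complex.Re (ee p.2) * tnth p.1 i + complex.Im (ee p.2) * tnth p.1 (partner i))).
  by apply: measurable_funD; apply: measurable_funM => //; exact: mt.
by apply/funext => p /=; rewrite tnth_mktuple (negbTE hi).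
Qed.

Local Open Scope ereal_scope.

(** The mean over the orbit of t under the circle. Applied to |F| it gives circle means on slices;
    applied to the indicator of a null set it shows that almost every slice meets this set in a null
    set. *)
Definition rmean n (h : (n + n).-tuple RT -> \bar R) (t : (n + n).-tuple RT) : \bar R :=
  \int[mu]_(s in `[0%R, 1%R]) h (rot (ee s) t).

Section rotation_average.
Variables (n : nat) (h : (n + n).-tuple RT -> \bar R).
Hypotheses (mh : measurable_fun setT h) (h0 : forall t, 0 <= h t).

Let hP t := h t * (\1_(P (n + n)) t)%:E.
Let K (p : (n + n).-tuple RT * RT) : \bar R :=
  hP (rot (ee p.2) p.1) * (\1_(`[0%R, 1%R]%classic : set R) p.2)%:E.

Let mP := @measurable_punctured_ball R (n + n).

Let mhP : measurable_fun setT hP.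
Proof.
apply: emeasurable_funM => //; apply/measurable_EFinP.
exact: measurable_indic.
Qed.

Let hP0 t : 0 <= hP t. Proof. by rewrite mule_ge0. Qed.

Let mK : measurable_fun setT K.
Proof.
apply: emeasurable_funM.
  exact: (measurableT_comp mhP (@measurable_rot_ee n)).
apply/measurable_EFinP.
have m1 : measurable_fun setT (\1_(`[0%R, 1%R]%classic : set RT) : RT -> RT).
  exact: measurable_indic.
exact: (measurableT_comp m1).
Qed.

Let K0 p : 0 <= K p. Proof. by rewrite mule_ge0. Qed.

Lemma rmeanE t : P (n + n) t -> rmean h t = \int[mu]_s K (t, s).
Proof.
move=> Pt; rewrite /rmean integral_mkcond epatch_indic; apply: eq_integral => s _.
rewrite /K /hP /=; congr (_ * _); rewrite indicE mem_set ?mule1//.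
by apply/(punctured_ball_rot t (normc_ee s)).
Qed.

Lemma measurable_rmean : measurable_fun (P (n + n)) (rmean h).
Proof.
apply: (@eq_measurable_fun _ _ _ _ _ (fun t => \int[mu]_s K (t, s))).
  by move=> t; rewrite inE => Pt; rewrite rmeanE.
apply: measurable_funTS.
exact: (@measurable_fun_fubini_tonelli_F _ _ _ _ _ mu K mK K0).
Qed.

(** Tonelli exchanges the circle mean with the integral, and every rotation preserves both the
    measure and the punctured ball. *)
Lemma rotation_average :
  \int[lam (n + n)]_(t in P (n + n)) rmean h t = \int[lam (n + n)]_(t in P (n + n)) h t.
Proof.
have -> : \int[lam (n + n)]_(t in P (n + n)) h t = \int[lam (n + n)]_t hP t.
  by rewrite integral_mkcond epatch_indic.
transitivity (\int[lam (n + n)]_t \int[mu]_s K (t, s)).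
  rewrite integral_mkcond; apply: eq_integral => t _; rewrite patchE.
  case: ifPn => [|]; first by rewrite inE => /rmeanE.
  move=> /negP tP; rewrite integral0_eq// => s _; rewrite /K /hP /= indicE.
  rewrite memNset ?mule0 ?mul0e// => /punctured_ball_rot h1; apply: tP.
  by rewrite inE; apply: h1; exact: normc_ee.
rewrite (@fubini_tonelli _ _ _ _ _ (lam (n + n)) mu K mK K0).
transitivity (\int[mu]_(s in `[0%R, 1%R]) (cst (\int[lam (n + n)]_t hP t)) s).
  rewrite [RHS]integral_mkcond; apply: eq_integral => s _; rewrite patchE.
  case: ifPn => [s1|s1].
    rewrite -(preserves_integral (preserves_rot n (normc_ee s)) mhP hP0).
    by apply: eq_integral => t _; rewrite /K /= indicE s1 mule1.
  by rewrite integral0_eq// => t _; rewrite /K /= indicE (negbTE s1) mule0.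
rewrite integral_cst//= lebesgue_measure_itv/= lte_fin ltr01 -EFinB subr0.
by rewrite mule1.
Qed.
End rotation_average.

Lemma measurable_box m (t : m.-tuple RT) (d : R) :
  measurable [set s : m.-tuple RT | forall i, (`|tnth s i - tnth t i| < d)%R].
Proof.
rewrite (_ : [set s | _] = \big[setI/setT]_(i < m)
    ((fun s : m.-tuple RT => tnth s i : RT) @^-1` `](tnth t i - d)%R, (tnth t i + d)%R[)).
  apply: bigsetI_measurable => i _; rewrite -[X in measurable X]setTI.
  exact: measurable_tnth.
rewrite -bigcap_seq; apply/seteqP; split => [s h i _|s h i] /=.
  by rewrite in_itv/= -ltr_distlC distrC; exact: h.
have := h i; rewrite /= mem_index_enum => /(_ isT).
by rewrite in_itv/= -ltr_distlC distrC.
Qed.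

(** Makes sets of full measure dense. *)
Lemma box_gt0 m (t : m.-tuple RT) (d : R) : (0 < d)%R ->
  0 < lam m [set s | forall i, (`|tnth s i - tnth t i| < d)%R].
Proof.
move=> d0; elim: m t => [|m IH] t.
  rewrite /= diracE mem_set ?lte01//=.
  by case.
pose t' := [tuple tnth t (lift ord0 i) | i < m].
rewrite (_ : [set s | _] = [set s : m.+1.-tuple RT |
   (`|tnth s ord0 - tnth t ord0| < d)%R /\
    forall i, (`|tnth s (lift ord0 i) - tnth t (lift ord0 i)| < d)%R]); last first.
  apply/seteqP; split=> s /= hs; first by split=> [|i]; exact: hs.
  by move=> i; case: (unliftP ord0 i) => [j ->|->]; [exact: hs.2|exact: hs.1].
rewrite /= /lebesgue_step /pushforward (_ : _ @^-1` _ =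
   `](tnth t ord0 - d)%R, (tnth t ord0 + d)%R[%classic `*`
   [set s : m.-tuple RT | forall i, (`|tnth s i - tnth t' i| < d)%R]); last first.
  apply/seteqP; split=> -[x s] /= [h1 h2]; split.
  - by move: h1; rewrite tnth0 in_itv/= distrC ltr_distlC.
  - by move=> i; have := h2 i; rewrite /consT tnthS /t' tnth_mktuple.
  - by move: h1; rewrite tnth0 in_itv/= distrC ltr_distlC.
  - by move=> i; have := h2 i; rewrite /consT tnthS /t' tnth_mktuple.
rewrite product_measure1E//; last exact: measurable_box.
apply: mule_gt0; last exact: IH.
rewrite [X in _ < X]lebesgue_measure_itv/= lte_fin.
rewrite ifT; last by lra.
by rewrite lte_fin subr_gt0 ltrD2l gtrN.
Qed.
End rotations.

(** * Bounded subsequences from bounded integrals *)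

Section frequently_bounded.
Local Open Scope ereal_scope.

(** By Fatou's lemma the lower limit has a finite integral, hence is finite almost everywhere, and
    the sequence returns infinitely often below the lower limit plus 1. *)
Lemma ae_frequently_bounded d (T : measurableType d) (R : realType)
    (mu : {measure set T -> \bar R}) (D : set T) (H : nat -> T -> \bar R) (B : R) :
  measurable D -> (forall k, measurable_fun D (H k)) ->
  (forall k t, D t -> 0 <= H k t) ->
  (forall k, \int[mu]_(t in D) H k t <= B%:E) ->
  {ae mu, forall t, D t -> exists c : R, forall m, exists2 k, (m <= k)%N & H k t <= c%:E}.
Proof.
move=> mD mH H0 HB; pose L t := limn_einf (H^~ t).
have cL t : einfs (H ^~ t) x @[x --> \oo] --> L t.
  by rewrite /L limn_einf_lim; exact: is_cvg_einfs.
have mL : measurable_fun D L.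
  apply: (emeasurable_fun_cvg (fun k t => einfs (H^~ t) k)) => [k|t _]; last exact: cL.
  exact: measurable_fun_einfs.
have Le t k : einfs (H ^~ t) k <= L t.
  rewrite (cvg_unique _ (cL t) (ereal_nondecreasing_cvgn (@nondecreasing_einfs R (H^~ t))))//.
  by apply: ereal_sup_ubound; exists k.
have L0 t : D t -> 0 <= L t.
  move=> Dt; apply: le_trans (Le t 0%N); apply: le_ereal_inf_tmp => _ [k _ <-].
  exact: H0.
have LB : \int[mu]_(t in D) L t <= B%:E.
  apply: le_trans (fatou mu mD mH H0) _; rewrite limn_einf_lim.
  apply: lime_le; first exact: is_cvg_einfs.
  apply: nearW => k; apply: le_trans (HB k); apply: ereal_inf_lbound.
  by exists k => //=.
have iL : mu.-integrable D L.
  apply/integrableP; split => //; apply: le_lt_trans (ltry B).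
  by apply: le_trans LB; rewrite le_eqVlt; apply/orP; left; apply/eqP; apply: eq_integral => t;
    rewrite inE => /L0 /gee0_abs.
apply: filterS (integrable_ae mD iL) => t Lt Dt.
exists (fine (L t) + 1)%R => m.
have : einfs (H ^~ t) m < (fine (L t) + 1)%:E.
  apply: le_lt_trans (Le t m) _; rewrite -{1}(fineK (Lt Dt)) lte_fin ltrDl.
  exact: ltr01.
move=> /ereal_inf_lt[_ [k mk <-]] hk; exists k => //; exact: ltW.
Qed.
End frequently_bounded.

(** * The surface measure compared with Lebesgue measure on the ball *)

Section cone_measure.
Context {R : realType} (m : nat) (m_gt0 : (0 < m)%N).
Local Notation RT := (measurableTypeR R).
Local Notation lam := (@lebesgue_tuple R m).
Local Notation P := (@punctured_ball R m).
Local Open Scope ereal_scope.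

Let mP := @measurable_punctured_ball R m.
Let mN := @measurable_normalize R m.

Lemma measurable_tuple_sphere : measurable (@tuple_sphere R m).
Proof.
rewrite (_ : @tuple_sphere R m = setT `&` (@tnorm R m) @^-1` [set 1%R]).
  exact: measurable_tnorm.
by rewrite setTI.
Qed.

Lemma tnorm_normalize (t : m.-tuple RT) : (0 < tnorm t)%R -> tnorm (normalize t) = 1%R.
Proof.
move=> t0; rewrite /tnorm.
under eq_bigr do rewrite tnth_mktuple exprMn.
rewrite -mulr_suml sqrtrM ?sumr_ge0// => [|i _]; last exact: sqr_ge0.
by rewrite sqrtr_sqr ger0_norm ?invr_ge0 ?ltW// divff// gt_eqF.
Qed.

(** The surface measure is m times the cone measure, and m >= 1. *)
Lemma sphere_integral_ge (h : m.-tuple RT -> \bar R) :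
  measurable_fun setT h -> (forall t, 0 <= h t) ->
  \int[lam]_(t in P) h (normalize t) <=
  \int[@sphere_measure R m]_(t in @tuple_sphere R m) h t.
Proof.
move=> mh h0.
pose lP := measure_function_mrestr__canonical__measure_function_Measure lam mP.
pose cm := measure_function_pushforward__canonical__measure_function_Measure lP mN.
have mS := measurable_tuple_sphere.
have mhN : measurable_fun setT (h \o @normalize R m) by exact: measurableT_comp.
have -> : \int[@sphere_measure R m]_(t in @tuple_sphere R m) h t =
    (m%:R)%:E * \int[cm]_(t in @tuple_sphere R m) h t.
  apply: (@ge0_integral_mscale _ _ _ cm _ mS ((m%:R)%:nng)%R h) => //.
  exact: measurable_funTS.
have -> : \int[cm]_(t in @tuple_sphere R m) h t =
    \int[lP]_(t in @normalize R m @^-1` @tuple_sphere R m) (h \o @normalize R m) t.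
  apply: (@ge0_integral_pushforward _ _ _ _ _ _ mN lP) => //.
  exact: measurable_funTS.
have -> : \int[lam]_(t in P) h (normalize t) = \int[lP]_(t in P) (h \o @normalize R m) t.
  apply: (@eq_measure_integral _ _ _ P lP lam) => A mA AP.
  by rewrite /= /mrestr; congr (lam _); apply/esym/setIidPl.
have le1 : \int[lP]_(t in P) (h \o @normalize R m) t <=
    \int[lP]_(t in @normalize R m @^-1` @tuple_sphere R m) (h \o @normalize R m) t.
  apply: ge0_subset_integral => //.
  - by rewrite -[X in measurable X]setTI; exact: mN.
  - exact: measurable_funTS.
  - by move=> t _; exact: h0.
  - by move=> t /andP[t0 _]; exact: tnorm_normalize.
apply: le_trans le1 _; rewrite -{1}[X in X <= _]mul1e.
apply: lee_wpmul2r; last by rewrite lee_fin ler1n.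
by apply: integral_ge0 => t _; exact: h0.
Qed.

Lemma sphere_null (A : set (m.-tuple RT)) : measurable A ->
  @sphere_measure R m A = 0 -> \int[lam]_(t in P) (\1_A (normalize t))%:E = 0.
Proof.
move=> mA A0.
have mA' : measurable (@normalize R m @^-1` A).
  by rewrite -[X in measurable X]setTI; exact: mN.
have -> : \int[lam]_(t in P) (\1_A (normalize t))%:E = lam ((@normalize R m @^-1` A) `&` P).
  by rewrite -integral_indic//; apply: eq_integral => t _; rewrite !indicE.
move/eqP: A0; rewrite /sphere_measure /mscale mule_eq0 eqe pnatr_eq0.
by rewrite gtn_eqF//= => /eqP.
Qed.
End cone_measure.

(** * Slices on which the boundary relation and the mean bounds hold *)

Section good_slices.
Context {R : realType} (n : nat) (n_gt0 : (0 < n)%N).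
Local Notation C := R[i].
Local Notation V := 'rV[C]_n.
Local Notation RT := (measurableTypeR R).
Local Notation mu := (@lebesgue_measure R).
Local Notation lam := (@lebesgue_tuple R (n + n)).
Local Notation P := (@punctured_ball R (n + n)).
Implicit Types (F f g phi : V -> C) (z w zeta : V).

Lemma holomorphic_cta F z : holomorphic F -> vnorm z < 1 -> cta F z.
Proof.
move=> hF z1; split; apply: differentiable_continuous; apply: hF.
by rewrite inE.
Qed.

(** Outside the unit ball F is arbitrary. Scaling by r / max(1, |z|) in place of r keeps the
    argument inside the ball everywhere and changes nothing for |z| <= 1. *)
Lemma measurable_radial F r : holomorphic F -> 0 <= r < 1 ->
  exists2 h : (n + n).-tuple RT -> R, measurable_fun setT (h : _ -> RT) &
    (forall t, 0 <= h t) /\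
    forall t, tnorm t <= 1 -> h t = normc (F (r%:C *: cvec t)).
Proof.
move=> hF /andP[r0 r1].
have mx0 z : 0 < Num.max 1 (vnorm z) by rewrite (lt_le_trans ltr01)// le_max lexx.
have [c [cc c0 c1]] : exists c : V -> R, [/\ forall z, cta c z,
    forall z, normc (c z)%:C * vnorm z < 1 & forall z, vnorm z <= 1 -> c z = r].
  exists (fun z => r / Num.max 1 (vnorm z)); split=> z.
  - by have := mx0 z => m0; cts; rewrite gt_eqF.
  - rewrite normc_nneg ?divr_ge0 ?(ltW (mx0 _))//.
    rewrite mulrAC ltr_pdivrMr// mul1r.
    apply: (@le_lt_trans _ _ (r * Num.max 1 (vnorm z))); last by rewrite gtr_pMl.
    by rewrite ler_wpM2l// le_max lexx orbT.
  - by move=> z1; rewrite max_l// divr1.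
exists (fun t => normc (F ((c (cvec t))%:C *: cvec t))).
  apply: (@measurable_cvec _ _ (fun z : V => normc (F ((c z)%:C *: z)))) => z.
  apply: cta_normc.
  have hc : cta (fun z : V => (c z)%:C *: z) z.
    by cts.
  by apply: ctao hc; apply: holomorphic_cta hF _; rewrite vnormZ.
split=> [t|t t1]; first exact: normc_ge0.
by rewrite c1// vnorm_cvec.
Qed.

Lemma hardy1_bound F : hardy1 F -> exists B : R, forall r, 0 < r < 1 ->
  (\int[lam]_(t in P) (normc (F (r%:C *: cvec (normalize t))))%:E <= B%:E)%E.
Proof.
move=> [hF hB]; set S := ereal_sup _ in hB.
have key r : 0 < r < 1 ->
    (\int[lam]_(t in P) (normc (F (r%:C *: cvec (normalize t))))%:E <= S)%E.
  move=> r01; have /andP[r0 r1] := r01.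
  have r01' : 0 <= r < 1 by lra.
  have [h mh [h0 hE]] := measurable_radial hF r01'.
  apply: (@le_trans _ _ (\int[@sphere_measure R (n + n)]_(t in @tuple_sphere R (n + n)) (h t)%:E)%E).
    rewrite (_ : (\int[lam]_(t in P) _)%E = (\int[lam]_(t in P) (h (normalize t))%:E)%E).
      apply: (sphere_integral_ge _ (h := fun t => (h t)%:E)); first by rewrite addn_gt0 n_gt0.
        exact/measurable_EFinP.
      by move=> t; rewrite lee_fin.
    apply: eq_integral => t; rewrite inE => /andP[t0 _].
    by rewrite hE// tnorm_normalize.
  apply: ereal_sup_ubound; exists r; first by [].
  by apply: eq_integral => t; rewrite inE => t1; rewrite hE// t1.
have h2 : (0 < 2^-1 :> R) && (2^-1 < 1 :> R) by lra.
have S0 : (0 <= S)%E.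
  by apply: le_trans (key _ h2); apply: integral_ge0 => t _; rewrite lee_fin normc_ge0.
by exists (fine S) => r /key; rewrite fineK// ge0_fin_numE.
Qed.

Lemma cvec_surj z : exists t : (n + n).-tuple RT, cvec t = z.
Proof.
exists [tuple match fintype.split i with inl j => complex.Re (z ord0 j)
  | inr j => complex.Im (z ord0 j) end | i < n + n].
apply/rowP => j; rewrite mxE !tnth_mktuple.
rewrite (unsplitK (inl j : 'I_n + 'I_n)) (unsplitK (inr j : 'I_n + 'I_n)).
by case: (z ord0 j).
Qed.

(** A box around zeta0 / 2 has positive measure, so it contains a point outside the null set; this
    point lies in the punctured ball and is close to zeta0 after normalisation. *)
Lemma ae_dense (Q : V -> Prop) :
  {ae lam, forall t, P t -> Q (cvec (normalize t))} ->
  forall zeta0 e, vnorm zeta0 = 1 -> 0 < e ->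
  exists zeta, [/\ vnorm zeta = 1, vnorm (zeta - zeta0) < e & Q zeta].
Proof.
move=> [Z [mZ Z0 hZ]] zeta0 e z1 e0.
have [t0 ht0] := cvec_surj ((2^-1)%:C *: zeta0).
pose N : R := (n + n).+1%:R.
(* 1/4 keeps the norm of the point positive and at most 1; doubling and normalising cost at most 4
   eta <= e / 2. *)
pose eta := Num.min (4^-1) (e / 8).
have eta0 : 0 < eta by rewrite lt_min invr_gt0 ltr0n divr_gt0.
pose box := [set s : (n + n).-tuple RT | forall i, `|tnth s i - tnth t0 i| < eta / N].
have bpos : (0 < lam box)%E by apply: box_gt0; rewrite divr_gt0.
have [t [bt tZ]] : exists t, box t /\ ~ Z t.
  apply: contrapT => hn; have bZ : box `<=` Z.
    by move=> t bt; apply: contrapT => tZ; apply: hn; exists t.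
  move: bpos; rewrite ltNge => /negP; apply; rewrite -Z0.
  by apply: le_measure => //; rewrite inE//; exact: measurable_box.
have dt : vnorm (cvec t - cvec t0) < eta.
  apply: le_lt_trans (vnorm_cvecB_le (fun i => ltW (bt i))) _.
  by rewrite mulrCA gtr_pMr// ltr_pdivrMr// mul1r ltr_nat.
have n0 : vnorm (cvec t0) = 2^-1.
  by rewrite ht0 vnormZ z1 mulr1 normc_nneg.
have [e4 e8] : eta <= 4^-1 /\ eta <= e / 8 by split; rewrite ge_min lexx ?orbT.
have h1 := vnorm_sub_ge (cvec t) (cvec t0).
have h2 := vnorm_sub_ge (cvec t0) (cvec t); rewrite vnormB in h2.
set a := vnorm (cvec t) in h1 h2.
have [a0 a1] : 0 < a /\ a <= 1.
  by move: dt h1 h2 e4; rewrite n0; move: (vnorm (_ - _)) => x; split; lra.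
have Pt : P t by rewrite /punctured_ball /= -vnorm_cvec a0.
exists (cvec (normalize t)); split.
- by apply: vnorm_normalize; rewrite -vnorm_cvec.
- rewrite cvec_normalize -vnorm_cvec -/a.
  have -> : zeta0 = 2%:C *: cvec t0.
    by rewrite ht0 scalerA -rmorphM/= divff// scale1r.
  rewrite (_ : _ - _ = (a^-1 - 2)%:C *: cvec t + 2%:C *: (cvec t - cvec t0)); last first.
    by rewrite scalerBr addrA -scalerDl -rmorphD/= subrK.
  apply: le_lt_trans (vnormD _ _) _; rewrite !vnormZ !normc_real -/a.
  rewrite -{2}(ger0_norm (ltW a0)) -normrM mulrBl mulVf ?gt_eqF//.
  have h3 : `|1 - 2 * a| <= 2 * vnorm (cvec t - cvec t0).
    by rewrite ler_norml; move: h1 h2; rewrite n0; move: (vnorm (_ - _)) => x hx hy; apply/andP; split; lra.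
  rewrite (@ger0_norm _ 2)//.
  by move: h3 dt e8 e0; move: (vnorm (_ - _)) `|_| => x y; lra.
- by apply: contrapT => hn; apply: tZ; apply: hZ => /(_ Pt).
Qed.

Lemma rint_integral (h : R -> R) : c01 h ->
  (\int[mu]_(s in `[0%R, 1%R]) (h s)%:E)%E = (rint h)%:E.
Proof.
move=> ch; rewrite /rint /Rintegral fineK//.
exact: integrable_fin_num (integrable_c01 ch).
Qed.

Definition slice_relation f g phi zeta :=
  {ae mu, forall s : RT, 0 <= s <= 1 -> phi (ee s *: zeta) =
     conjc (boundary_value g (ee s *: zeta)) / boundary_value f (ee s *: zeta)}.

Definition mean_modulus F zeta (r : R) := rint (fun s => normc (F (r%:C *: (ee s *: zeta)))).

(** The rotation means of |f| + |g| have bounded integrals, so Fatou bounds them along a subsequence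
    of radii for almost every t; [ae_dense] then finds a good slice near any given one. *)
Lemma good_slices f g phi : hardy1 f -> hardy1 g ->
  {ae @sphere_measure R (n + n), forall t, phi (cvec t) =
       conjc (boundary_value g (cvec t)) / boundary_value f (cvec t)} ->
  forall zeta0 e, vnorm zeta0 = 1 -> 0 < e ->
  exists zeta, [/\ vnorm zeta = 1, vnorm (zeta - zeta0) < e,
    slice_relation f g phi zeta &
    exists c, forall m, exists2 k, (m <= k)%N &
      mean_modulus f zeta (k.+1%:R / k.+2%:R) + mean_modulus g zeta (k.+1%:R / k.+2%:R) <= c].
Proof.
move=> hf hg hphi.
(* Fatou needs a sequence of radii; monotonicity of circle means recovers the other radii in
   [good_pairs]. *)
pose r k : R := k.+1%:R / k.+2%:R.
have r01 k : 0 < r k < 1.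
  by rewrite divr_gt0//= ltr_pdivrMr// mul1r ltr_nat.
have r01' k : 0 <= r k < 1 by have /andP[/ltW -> ->] := r01 k.
have [Bf hBf] := hardy1_bound hf; have [Bg hBg] := hardy1_bound hg.
have mP := @measurable_punctured_ball R (n + n).
have mN := @measurable_normalize R (n + n).
have mF F k : hardy1 F ->
    measurable_fun setT (fun t => normc (F ((r k)%:C *: cvec (normalize t))) : RT).
  move=> [hF _]; have [h mh [h0 hE]] := measurable_radial hF (r01' k).
  rewrite (_ : (fun t => _) = h \o @normalize R (n + n)); first exact: measurableT_comp.
  apply/funext => t /=; rewrite hE// -vnorm_cvec cvec_normalize vnormZ vnorm_cvec.
  rewrite normc_nneg ?invr_ge0 ?sqrtr_ge0//; have [->|t0] := eqVneq (tnorm t) 0.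
    by [].
  by rewrite mulVf.
pose H k t := (normc (f ((r k)%:C *: cvec (normalize t))) +
               normc (g ((r k)%:C *: cvec (normalize t))))%:E : \bar R.
have mH k : measurable_fun setT (H k).
  by apply/measurable_EFinP; apply: measurable_funD; exact: mF.
have H0 k t : (0 <= H k t)%E by rewrite lee_fin addr_ge0// normc_ge0.
have b1 : {ae lam, forall t, P t ->
    exists c : R, forall m, exists2 k, (m <= k)%N & (rmean (H k) t <= c%:E)%E}.
  apply: (ae_frequently_bounded (B := Bf + Bg)) => //.
  - by move=> k; apply: measurable_rmean.
  - by move=> k t _; apply: integral_ge0 => s _.
  - move=> k; rewrite rotation_average//.
    rewrite (_ : (\int[lam]_(t in P) H k t)%E =
      (\int[lam]_(t in P) (normc (f ((r k)%:C *: cvec (normalize t))))%:E +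
       \int[lam]_(t in P) (normc (g ((r k)%:C *: cvec (normalize t))))%:E)%E).
      by rewrite EFinD; apply: leeD; [exact: hBf|exact: hBg].
    rewrite -ge0_integralD//.
    + by move=> t _; rewrite lee_fin normc_ge0.
    + by apply/measurable_funTS/measurable_EFinP; exact: mF.
    + by move=> t _; rewrite lee_fin normc_ge0.
    + by apply/measurable_funTS/measurable_EFinP; exact: mF.
have [A [mA A0 hA]] := hphi.
pose hAn (t : (n + n).-tuple RT) : \bar R := (\1_A (normalize t))%:E.
have mhA : measurable_fun setT hAn.
  apply/measurable_EFinP.
  have m1 : measurable_fun setT (\1_A : (n + n).-tuple RT -> RT) by [].
  exact: (measurableT_comp m1 mN).
have hA0 t : (0 <= hAn t)%E by rewrite lee_fin.
(* A nonnegative function with integral 0: for almost every t the circle through [normalize t] meets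
   the exceptional set A in a null set. *)
have b2 : {ae lam, forall t, P t -> rmean hAn t = 0%E}.
  have mr := measurable_rmean mhA hA0.
  have /(ae_eq_integral_abs lam mP mr) : (\int[lam]_(t in P) `|rmean hAn t| = 0)%E.
    transitivity (\int[lam]_(t in P) rmean hAn t)%E.
      by apply: eq_integral => t _; rewrite gee0_abs//; apply: integral_ge0.
    by rewrite rotation_average//; apply: sphere_null => //; rewrite addn_gt0 n_gt0.
  by [].
have both : {ae lam, forall t, P t ->
    (slice_relation f g phi (cvec (normalize t)) /\
    exists c, forall m, exists2 k, (m <= k)%N &
      mean_modulus f (cvec (normalize t)) (r k) + mean_modulus g (cvec (normalize t)) (r k) <= c)}.
  apply: filterS2 b1 b2 => t h1 h2 Pt.
  have t0 : 0 < tnorm t by have /andP[] := Pt.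
  have rotE s : cvec (normalize (rot (ee s) t)) = ee s *: cvec (normalize t).
    by rewrite normalize_rot ?normc_ee// cvec_rot.
  split.
    have ms : measurable_fun setT (fun s : RT => hAn (rot (ee s) t)).
      apply: (measurableT_comp mhA).
      exact: (measurableT_comp (@measurable_rot_ee R n) (@pair1_measurable _ _ _ _ t)).
    have m01 : measurable (`[0%R, 1%R]%classic : set RT) by [].
    have /(ae_eq_integral_abs mu m01 (measurable_funTS ms)) :
        (\int[mu]_(s in `[0%R, 1%R]) `|hAn (rot (ee s) t)| = 0)%E.
      rewrite -[RHS](h2 Pt); apply: eq_integral => s _.
      by rewrite gee0_abs.
    apply: filterS => s hs s01; have {hs} : hAn (rot (ee s) t) = 0%E by apply: hs; rewrite /= in_itv.
    rewrite -rotE /hAn => -[] hs; apply: contrapT => hn.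
    by move: hs; rewrite indicE mem_set; [move/eqP; rewrite oner_eq0|exact: hA].
  have [c hc] := h1 Pt; exists c => m; have [k mk hk] := hc m; exists k => //.
  have cF F : hardy1 F -> c01 (fun s => normc (F ((r k)%:C *: (ee s *: cvec (normalize t))))).
    move=> [hF _] s _; apply: cta_normc.
    have hcc : cta (fun s : R => (r k)%:C *: (ee s *: cvec (normalize t))) s by cts.
    apply: ctao hcc; apply: holomorphic_cta hF _; rewrite !vnormZ normc_ee vnorm_normalize// !mulr1.
    by have /andP[? ?] := r01' k; rewrite normc_nneg.
  rewrite /mean_modulus -rintD; [|exact: cF|exact: cF].
  rewrite -lee_fin -rint_integral; last by move=> s s01; have h1' := cF f hf s s01; have h2' := cF g hg s s01; cts.
  apply: le_trans hk; rewrite le_eqVlt; apply/orP; left; apply/eqP.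
  by apply: eq_integral => s _; rewrite /H rotE.
move=> zeta0 e z1 e0; have [zeta [h1 h2 [h3 h4]]] := ae_dense (Q := fun zeta =>
  slice_relation f g phi zeta /\ exists c, forall m, exists2 k, (m <= k)%N &
    mean_modulus f zeta (r k) + mean_modulus g zeta (r k) <= c) both z1 e0.
by exists zeta; split.
Qed.
End good_slices.

(** * From almost everywhere radial limits to small defects in the mean *)

Section boundary_pairs.
Context {R : realType}.
Local Notation C := R[i].
Local Notation mu := (@lebesgue_measure R).
Implicit Types (F G chi : C -> C) (r e B L M : R).

Lemma radii_lim (x : R) : x < 1 ->
  exists K, forall k, (K <= k)%N -> x < k.+1%:R / k.+2%:R.
Proof.
move=> x1; have x10 : 0 < 1 - x by pos.
exists (Num.bound (1 - x)^-1) => k Kk.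
have h : (1 - x)^-1 < k.+2%:R.
  apply: lt_le_trans (archi_boundP _) _; first by pos.
  by rewrite ler_nat; apply: leq_trans Kk _; rewrite -addn2 leq_addr.
have : (1 - x)^-1 * (1 - x) < k.+2%:R * (1 - x) by rewrite ltr_pM2r.
rewrite mulVf ?gt_eqF// ltr_pdivlMr ?ltr0n// -[k.+2]addn1 natrD.
by move: (k.+1%:R : R) => y; lra.
Qed.

Lemma bounded_convergence (D : nat -> R -> R) L : (forall k, c01 (D k)) ->
  (forall k t, 0 <= t <= 1 -> 0 <= D k t <= L) ->
  {ae mu, forall s, 0 <= s <= 1 -> forall e, 0 < e ->
     exists K, forall k, (K <= k)%N -> D k s <= e} ->
  forall e, 0 < e -> exists K, forall k, (K <= k)%N -> rint (D k) <= e.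
Proof.
move=> cD hD hae e e0.
have m01 : measurable (`[0, 1]%classic : set R) by [].
have in01 (s : R) : `[0, 1]%classic s -> 0 <= s <= 1 by [].
have [|||||_ _ ] := @dominated_convergence _ _ R mu `[0, 1]%classic m01
  (fun k t => (D k t)%:E) (cst 0%E) (cst L%:E).
- by move=> k; have /integrableP[] := integrable_c01 (cD k).
- exact: measurable_cst.
- have FF := ae_filter_ringOfSetsType mu.
  apply: filterS hae => s hs /in01 s01.
    apply/fine_cvgP; split; first by apply: nearW.
    apply/cvgrPdist_le => d d0; have [K hK] := hs s01 d d0.
    exists K => // k /= Kk; rewrite sub0r normrN ger0_norm; last by have /andP[] := hD k s s01.
    exact: hK.
- have : c01 (fun _ : R => L) by move=> t _; cts.
  exact: integrable_c01.
- apply: aeW => s k /in01 s01; have /andP[h1 h2] := hD k s s01.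
  by rewrite /= ger0_norm.
rewrite integral0 => /fine_cvgP[_ /cvgrPdist_le/(_ e e0)[K _ hK]].
exists K => k Kk; have := hK k Kk; rewrite /= sub0r normrN.
by apply: le_trans; rewrite /rint /Rintegral ler_norm.
Qed.

Definition radial_lim F (s : R) (a : C) := forall e, 0 < e ->
  exists2 r0, r0 < 1 & forall r, r0 < r < 1 -> normc (F (r%:C * ee s) - a) <= e.

Definition mean_bounded F B := forall r, 0 <= r < 1 -> rint (fun t => normc (F (r%:C * ee t))) <= B.

Definition defect F G chi r :=
  rint (fun t => normc (conjc (F (r%:C * ee t)) - chi (ee t) * G (r%:C * ee t))).

(** The relation conj F = chi G in the mean: on some circles of radius arbitrarily close to 1 it
    fails by little. In this form it no longer refers to boundary values of F and G. *)
Definition paired F G chi := forall e r0, 0 < e -> r0 < 1 ->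
  exists2 r, r0 < r < 1 & 0 < r /\ defect F G chi r <= e.

(** Splits the defect into a bounded part, for dominated convergence, and two excesses, for uniform
    integrability. *)
Lemma min_split (a b c M L : R) : 0 <= M -> 0 <= L -> a <= b + M * c ->
  a <= Num.min a ((1 + M) * L) + (Num.max (b - L) 0 + M * Num.max (c - L) 0).
Proof.
move=> M0 L0 h; have [h1|h1] := leP a ((1 + M) * L).
  by rewrite lerDl addr_ge0 ?mulr_ge0// le_max lexx orbT.
have h2 : b - L <= Num.max (b - L) 0 by rewrite le_max lexx.
have h3 : M * (c - L) <= M * Num.max (c - L) 0 by rewrite ler_wpM2l// le_max lexx.
by move: h2 h3 h; rewrite mulrBr; move: (Num.max _ _) (M * Num.max _ _) => x y; lra.
Qed.

(** The defect tends to 0 at almost every angle. Truncated, it does so in the mean by dominated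
    convergence; the part above the truncation is small on all circles near the boundary by
    [hardy_uniform_integrability]. *)
Lemma paired_ae F G chi B M : hol (disc 1) F -> hol (disc 1) G ->
  mean_bounded F B -> mean_bounded G B ->
  (forall t : R, cta (fun t => chi (ee t)) t) -> (forall t, normc (chi (ee t)) <= M) ->
  {ae mu, forall s, 0 <= s <= 1 -> exists a b,
     [/\ radial_lim F s a, radial_lim G s b & conjc a = chi (ee s) * b]} ->
  paired F G chi.
Proof.
move=> hF hG bF bG cchi bchi hae e r0 e0 r01.
have M0 : 0 <= M by apply: le_trans (bchi 0); exact: normc_ge0.
have e3 : 0 < e / (3 * (1 + M)) by pos.
have [L1 [r1 [L10 /andP[r10 r11] hL1]]] := hardy_uniform_integrability hF bF e3.
have [L2 [r2 [L20 /andP[r20 r21] hL2]]] := hardy_uniform_integrability hG bG e3.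
pose L := Num.max L1 L2.
have L0 : 0 <= L by rewrite le_max L10.
pose r k : R := k.+1%:R / k.+2%:R.
have r01k k : 0 < r k < 1 by rewrite divr_gt0//= ltr_pdivrMr// mul1r ltr_nat.
have rlim := radii_lim.
pose D k t := normc (conjc (F ((r k)%:C * ee t)) - chi (ee t) * G ((r k)%:C * ee t)).
have cF k t : cta (fun t => F ((r k)%:C * ee t)) t.
  apply: cta_circle hF _ t => s; rewrite /disc /= normc_circle.
  by have /andP[h1 h2] := r01k k; rewrite gtr0_norm.
have cG k t : cta (fun t => G ((r k)%:C * ee t)) t.
  apply: cta_circle hG _ t => s; rewrite /disc /= normc_circle.
  by have /andP[h1 h2] := r01k k; rewrite gtr0_norm.
have cD k t : cta (D k) t by rewrite /D; have := cF k; have := cG k; move=> ? ?; cts.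
have L'0 : 0 <= (1 + M) * L by pos.
have e30 : 0 < e / 3 by pos.
have [|||K1 hK1] := @bounded_convergence (fun k t => Num.min (D k t) ((1 + M) * L)) ((1 + M) * L) _ _ _ (e / 3) e30.
- by move=> k t _; have := cD k => ?; cts.
- by move=> k t _; rewrite le_min normc_ge0 L'0/= ge_min lexx orbT.
- have FF := ae_filter_ringOfSetsType mu.
  apply: filterS hae => s hs s01 d d0; have [a [b [ha hb hab]]] := hs s01.
  have M1 : 0 < 1 + M by pos.
  have d2 : 0 < d / (1 + M) by pos.
  have [x1 x11 hx1] := ha _ d2; have [x2 x21 hx2] := hb _ d2.
  have [|K hK] := rlim (Num.max x1 x2); first by rewrite gt_max x11.
  exists K => k /hK; rewrite gt_max => /andP[h1 h2]; have /andP[_ h3] := r01k k.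
  rewrite ge_min; apply/orP; left; rewrite /D.
  rewrite (_ : _ - _ = conjc (F ((r k)%:C * ee s) - a) - chi (ee s) * (G ((r k)%:C * ee s) - b)); last first.
    by rewrite conjB hab; ring.
  apply: le_trans (le_normcB _ _) _; rewrite normc_conj normcM.
  have g1 : normc (F ((r k)%:C * ee s) - a) <= d / (1 + M) by apply: hx1; rewrite h1 h3.
  have g2 : normc (G ((r k)%:C * ee s) - b) <= d / (1 + M) by apply: hx2; rewrite h2 h3.
  have g3 : normc (chi (ee s)) * normc (G ((r k)%:C * ee s) - b) <= M * (d / (1 + M)).
    by apply: ler_pM => //; exact: normc_ge0.
  apply: le_trans (lerD g1 g3) _.
  by rewrite -{1}[d / _]mul1r -mulrDl mulrCA divff ?mulr1// gt_eqF.
have [|K2 hK2] := rlim (Num.max r0 (Num.max r1 r2)); first by rewrite !gt_max r01 r11.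
pose k := maxn K1 K2.
have /hK2 : (K2 <= k)%N by exact: leq_maxr.
rewrite !gt_max => /andP[h0 /andP[h1 h2]]; have /andP[h3 h4] := r01k k.
exists (r k); first by rewrite h0.
split=> //; have := hK1 k (leq_maxl _ _); rewrite -/(D k) => hK.
pose E1 t := Num.max (normc (F ((r k)%:C * ee t)) - L) 0.
pose E2 t := Num.max (normc (G ((r k)%:C * ee t)) - L) 0.
have cE1 t : cta E1 t by rewrite /E1; have := cF k => ?; cts.
have cE2 t : cta E2 t by rewrite /E2; have := cG k => ?; cts.
have sE1 : rint E1 <= e / (3 * (1 + M)).
  apply: le_trans (hL1 (r k) _); last by rewrite h1.
  have := cF k => ?; apply: ler_rint => [t _|t _|t _]; [cts|cts|].
  by rewrite ge_max !le_max lexx orbT andbT; apply/orP; left; rewrite lerD2l lerN2 le_max lexx.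
have sE2 : rint E2 <= e / (3 * (1 + M)).
  apply: le_trans (hL2 (r k) _); last by rewrite h2.
  have := cG k => ?; apply: ler_rint => [t _|t _|t _]; [cts|cts|].
  by rewrite ge_max !le_max lexx orbT andbT; apply/orP; left; rewrite lerD2l lerN2 le_max lexx orbT.
have cm t : cta (fun t => Num.min (D k t) ((1 + M) * L)) t by have := cD k => ?; cts.
have : defect F G chi (r k) <= rint (fun t => Num.min (D k t) ((1 + M) * L) + (E1 t + M * E2 t)).
  rewrite /defect -/(D k); apply: ler_rint => [t _|t _|t _]; [exact: cD|cts|].
  apply: min_split => //; rewrite /D; apply: le_trans (le_normcB _ _) _.
  by rewrite normc_conj normcM lerD2l ler_wpM2r ?normc_ge0.
rewrite rintD; [|by move=> t _; cts|by move=> t _; cts].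
rewrite rintD; [|by move=> t _; cts|by move=> t _; cts].
rewrite rintZ; last by move=> t _; cts.
move=> h; apply: le_trans h _.
have hM : M * rint E2 <= M * (e / (3 * (1 + M))) by rewrite ler_wpM2l.
apply: le_trans (lerD hK (lerD sE1 hM)) _.
rewrite -{1}[e / (3 * _)]mul1r -mulrDl invfM mulrCA [_ * (3^-1 * _)]mulrCA divff ?gt_eqF ?ltr_pwDl//.
lra.
Qed.
End boundary_pairs.

(** * Slices of holomorphic functions of n variables *)

Section holomorphic_slices.
Context {R : realType} (n : nat).
Local Notation C := R[i].
Local Notation V := 'rV[C]_n.
Local Notation mu := (@lebesgue_measure R).
Implicit Types (f g phi : V -> C) (z v zeta : V).

Lemma holomorphic_line f z v : holomorphic f -> vnorm z < 1 ->
  exists c, cder (fun l => f (z + l *: v)) 0 c.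
Proof.
move=> hf z1; have df : differentiable f z by apply: hf; rewrite inE.
have dv : derivable f z v by exact: diff_derivable.
pose q (h : C) := h^-1 *: ((f \o shift z) (h *: v) - f z).
have hq : q h @[h --> 0^'] --> 'D_v f z by [].
exists ('D_v f z), (fun l => if l == 0 then 'D_v f z else q l); split.
- apply/ctaP => e e0; rewrite eqxx.
  have e0' : 0 < e%:C by rewrite ltcR.
  have /cvgrPdist_lt/(_ _ e0') := hq.
  move=> h; have /nearCP[d d0 hd] : \forall l \near (0 : C), l != 0 -> `|'D_v f z - q l| < e%:C.
    exact: h.
  apply/nearCP; exists d => // l /hd; case: eqP => [_ _|/eqP l0 /(_ isT)].
    by rewrite subrr normc0.
  by rewrite ltcR.
- by rewrite eqxx.
- apply: near_all => l; rewrite scale0r addr0 subr0.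
  case: eqP => [->|/eqP l0]; first by rewrite scale0r addr0 mulr0 addr0.
  have -> : q l = l^-1 * (f (l *: v + z) - f z) by [].
  by rewrite mulrAC mulVf// mul1r [f z + _]addrC subrK addrC.
Qed.

Lemma holomorphic_slice f zeta : holomorphic f -> vnorm zeta = 1 ->
  hol (disc 1) (fun l => f (l *: zeta)).
Proof.
move=> hf z1 l l1; have lz : vnorm (l *: zeta) < 1 by rewrite vnormZ z1 mulr1.
have [c hc] := holomorphic_line zeta hf lz; exists c.
have : cder (fun w => f (l *: zeta + (w - l) *: zeta)) l (c * 1).
  apply: (@cder_comp _ (fun w => f (l *: zeta + w *: zeta)) (fun w => w - l)).
    by rewrite subrr.
  by have := cderD (cder_id l) (cder_cst (- l) l); rewrite addr0.
rewrite mulr1; apply: cder_near; apply: near_all => w.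
by rewrite -scalerDl addrC subrK.
Qed.

(** Where the limit does not exist, [lim] is the default value 0; a nonzero boundary value is
    therefore a true limit. *)
Lemma boundary_value_lim f zeta : boundary_value f zeta != 0 ->
  forall e : R, 0 < e -> exists2 r0, r0 < 1 &
    forall r, r0 < r < 1 -> normc (f (r%:C *: zeta) - boundary_value f zeta) <= e.
Proof.
rewrite /boundary_value /lim /lim_in => h e e0.
have [hl|hn] := pselect (exists l : C, f (r%:C *: zeta) @[r --> (1 : R)^'-] --> l); last first.
  by move: h; rewrite getPN ?eqxx// => l hl; apply: hn; exists l.
have {}hl := getPex hl.
have e0' : 0 < e%:C by rewrite ltcR.
have /cvgrPdist_le/(_ _ e0') := hl.
move=> [d /= d0 hd]; exists (1 - d); first by lra.
move=> r /andP[r1 r2]; have := hd r; rewrite /= normr_normc lecR normcB; apply=> //.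
by rewrite /ball_ /= ltr_norml; apply/andP; split; lra.
Qed.

Lemma slice_boundary f zeta s : boundary_value f (ee s *: zeta) != 0 ->
  radial_lim (fun l => f (l *: zeta)) s (boundary_value f (ee s *: zeta)).
Proof.
move=> /boundary_value_lim h e /h[r0 r01 hr]; exists r0 => // r /hr.
by rewrite scalerA.
Qed.

Lemma good_pairs f g phi : (0 < n)%N -> hardy1 f -> hardy1 g ->
  {ae @sphere_measure R (n + n), forall t, phi (cvec t) =
       conjc (boundary_value g (cvec t)) / boundary_value f (cvec t)} ->
  (forall zeta, vnorm zeta = 1 -> forall s : R, cta (fun s => phi (ee s *: zeta)) s) ->
  (exists M m : R, 0 < m /\ forall zeta, vnorm zeta = 1 -> m <= normc (phi zeta) <= M) ->
  forall zeta0 e, vnorm zeta0 = 1 -> 0 < e ->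
  exists zeta, [/\ vnorm zeta = 1, vnorm (zeta - zeta0) < e,
    exists B, mean_bounded (fun l => f (l *: zeta)) B /\ mean_bounded (fun l => g (l *: zeta)) B,
    paired (fun l => f (l *: zeta)) (fun l => g (l *: zeta))
       (fun l => (conjc (phi (l *: zeta)))^-1) &
    paired (fun l => g (l *: zeta)) (fun l => f (l *: zeta)) (fun l => phi (l *: zeta))].
Proof.
move=> n0 hf hg hphi cphi [M [m [m0 hM]]] zeta0 e z0 e0.
have [zeta [z1 hz hrel [c hc]]] := good_slices n0 hf hg hphi z0 e0.
have hF : hol (disc 1) (fun l => f (l *: zeta)) by apply: holomorphic_slice hf.1 z1.
have hG : hol (disc 1) (fun l => g (l *: zeta)) by apply: holomorphic_slice hg.1 z1.
have pn s : m <= normc (phi (ee s *: zeta)) <= M.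
  by apply: hM; rewrite vnormZ normc_ee mul1r.
have pn0 s : phi (ee s *: zeta) != 0.
  by rewrite -normc_gt0; have /andP[h _] := pn s; exact: lt_le_trans h.
(* A bound at infinitely many radii extends to all radii because circle means increase. *)
have bnd F' : hol (disc 1) F' ->
   (forall j, exists2 k, (j <= k)%N & rint (fun t => normc (F' ((k.+1%:R / k.+2%:R)%:C * ee t))) <= c) ->
   mean_bounded F' c.
  move=> hF' h r /andP[r0 r1]; have [K hK] := radii_lim r1; have [k Kk hk] := h K.
  apply: le_trans hk; apply: circle_mean_mono => //; first by rewrite r0 ltW// hK.
  by rewrite ltr_pdivrMr// mul1r ltr_nat.
have mE F' k : mean_modulus F' zeta (k.+1%:R / k.+2%:R) =
    rint (fun t => normc (F' (((k.+1%:R / k.+2%:R)%:C * ee t) *: zeta))).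
  by rewrite /mean_modulus; apply: eq_rint => t _; rewrite scalerA.
have mge F' k : 0 <= mean_modulus F' zeta (k.+1%:R / k.+2%:R).
  by apply: rint_ge0 => t _; exact: normc_ge0.
have bF : mean_bounded (fun l => f (l *: zeta)) c.
  apply: bnd hF _ => j; have [k jk hk] := hc j; exists k => //; rewrite -mE.
  by apply: le_trans hk; rewrite lerDl mge.
have bG : mean_bounded (fun l => g (l *: zeta)) c.
  apply: bnd hG _ => j; have [k jk hk] := hc j; exists k => //; rewrite -mE.
  by apply: le_trans hk; rewrite lerDr mge.
(* Division by 0 gives 0 and phi has no zero, so neither boundary value is 0 where the relation
   holds, and both are true radial limits. *)
have nz s : phi (ee s *: zeta) = conjc (boundary_value g (ee s *: zeta)) / boundary_value f (ee s *: zeta) ->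
   boundary_value f (ee s *: zeta) != 0 /\ boundary_value g (ee s *: zeta) != 0.
  move=> h; have := pn0 s; rewrite h mulf_eq0 invr_eq0 negb_or => /andP[h1 h2]; split=> //.
  by move: h1; apply: contraNN => /eqP->; rewrite conjc0.
exists zeta; split=> //; first by exists c.
- apply: (paired_ae (B := c) (M := m^-1)) => //.
  + by move=> t; have := cphi zeta z1 => cc; cts; rewrite fmorph_eq0.
  + move=> t; rewrite normcV ?normc_conj; have /andP[h _] := pn t.
    by rewrite lef_pV2 ?posrE ?normc_gt0.
  + apply: filterS hrel => s hs s01; have E := hs s01; have [h1 h2] := nz s E.
    exists (boundary_value f (ee s *: zeta)), (boundary_value g (ee s *: zeta)); split.
    * exact: slice_boundary.
    * exact: slice_boundary.
    * rewrite E conjM conjcK fmorphV invfM invrK /= mulrAC mulVf// mul1r.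
      by [].
- apply: (paired_ae (B := c) (M := M)) => //.
  + by move=> t; exact: cphi.
  + by move=> t; have /andP[] := pn t.
  + apply: filterS hrel => s hs s01; have E := hs s01; have [h1 h2] := nz s E.
    exists (boundary_value g (ee s *: zeta)), (boundary_value f (ee s *: zeta)); split.
    * exact: slice_boundary.
    * exact: slice_boundary.
    * by rewrite E divfK.
Qed.
End holomorphic_slices.

(** * Real powers and uniform means of the Cauchy kernel *)

Section real_powers.
Context {R : realType}.
Implicit Types (a b p s x t : R).

Lemma rder_powR p x : 0 < x -> rder (fun y => y `^ p) x (p * x `^ (p - 1)).
Proof. by move=> x0; split; exact: is_derive1_powR. Qed.

Lemma cta_powR (T : topologicalType) (f : T -> R) p (t : T) : 0 < f t -> cta f t ->
  cta (fun y => f y `^ p) t.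
Proof. by move=> /(rder_powR p) /rder_cta h hf; exact: (@ctao _ _ _ (fun y : R => y `^ p) f). Qed.

Lemma powR_le p a b : 0 <= p -> 0 <= a -> a <= b -> a `^ p <= b `^ p.
Proof. by move=> p0 a0 ab; apply: ge0_ler_powR; rewrite ?nnegrE// (le_trans a0). Qed.

Lemma powR_anti p a b : p <= 0 -> 0 < a -> a <= b -> b `^ p <= a `^ p.
Proof.
move=> p0 a0 ab; have b0 := lt_le_trans a0 ab.
rewrite -[p]opprK !(powRN _ (- p)) lef_pV2 ?posrE ?powR_gt0//.
by apply: powR_le; rewrite ?oppr_ge0// ltW.
Qed.

Lemma powR_add p q x : 0 < x -> x `^ (p + q) = x `^ p * x `^ q.
Proof. by move=> x0; rewrite powRD// (gt_eqF x0) implybT. Qed.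

Lemma normc_1subee t : 0 <= t <= 1 -> normc (1 - ee t) = 2 * sin (pi * t).
Proof.
move=> /andP[t0 t1].
have s0 : 0 <= sin (pi * t :> R).
  by apply: sin_ge0_pi; rewrite mulr_ge0 ?pi_ge0//= ler_piMr ?pi_ge0.
apply/eqP; rewrite -(@eqrXn2 _ 2) ?normc_ge0 ?mulr_ge0//; apply/eqP.
rewrite sqr_normc_ReIm /ee Re_add Im_add Re_opp Im_opp /=.
rewrite (_ : 2 * pi * t = (pi * t) *+ 2); last by lra.
rewrite cos_mulr2n sin_mulr2n; have := cos2Dsin2 (pi * t).
move: (cos _) (sin _) => c s cs.
have -> : c ^+ 2 = 1 - s ^+ 2 by rewrite -cs; ring.
rewrite (_ : (0 - _) ^+ 2 = 4 * c ^+ 2 * s ^+ 2); last by lra.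
have -> : c ^+ 2 = 1 - s ^+ 2 by rewrite -cs; ring.
ring.
Qed.

Lemma circle_lower_bound : exists2 c : R, 0 < c &
  forall t, 0 <= t <= 1 -> c * Num.min t (1 - t) <= normc (1 - ee t).
Proof.
pose q : R := pi / 4.
have p0 := pi_gt0 R.
have q0 : 0 < q by rewrite divr_gt0.
have q2 : q < pi / 2 by rewrite /q; lra.
have cq : 0 < cos q by apply: cos_gt0_pihalf; rewrite q2 andbT; lra.
have sq : 0 < sin q by apply: sin_gt0_pihalf; rewrite q0.
pose c := Num.min (cos q) (sin q).
have c0 : 0 < c by rewrite lt_min cq.
(* Up to pi/4 the slope of sin is at least cos (pi/4); beyond, sin is at least sin (pi/4), while u
   <= pi/2 < 2. *)
have key u : 0 <= u <= pi / 2 -> c * u <= sin u * 2.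
  move=> /andP[u0 u2]; have [uq|qu] := leP u q.
    have h : cos q * u - cos q * 0 <= sin u - sin 0.
      apply: (@MVTle _ (fun x => cos q * x) sin (fun=> cos q) cos) => //.
      - by move=> x _; have := rderZ (cos q) (rder_id x); rewrite mulr1.
      - by move=> x _; split; exact: is_derive_sin.
      - by move=> x /andP[x0 xu]; apply/ltW; rewrite ltr_cos ?in_itv/=; lra.
      - by move=> x _; cts.
      - by move=> x _; apply: (@rder_cta _ _ _ (cos x)); split; exact: is_derive_sin.
    move: h; rewrite sin0 mulr0 !subr0 => h.
    have h2 : c * u <= cos q * u by rewrite ler_wpM2r// ge_min lexx.
    have h3 : 0 <= sin u by apply: sin_ge0_pi; apply/andP; split; lra.
    lra.
  have h1 : sin q <= sin u.
    by apply/ltW; rewrite ltr_sin ?in_itv/=; lra.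
  have h2 : c <= sin q by rewrite ge_min lexx orbT.
  have h3 : c * u <= sin q * 2.
    apply: ler_pM; [lra|lra|exact: h2|]; have := @pihalf_lt2 R; lra.
  by lra.
exists (c * pi); first by pos.
move=> t /andP[t0 t1]; rewrite normc_1subee ?t0// [2 * _]mulrC.
have [h|h] := leP t (1 - t).
  by rewrite -mulrA; apply: key; rewrite mulr_ge0 ?(ltW p0)//=; nra.
rewrite -mulrA -[sin (pi * t)]opprK -sinN.
have -> : - sin (- (pi * t)) = sin (pi * (1 - t)).
  by rewrite mulrBr mulr1 addrC sinDpi.
by apply: key; apply/andP; split; nra.
Qed.

(** The modulus dominates both 1 - x and half of the chord |1 - ee t|, hence a multiple of their
    sum. *)
Lemma kernel_lower_bound : exists2 c : R, 0 < c & forall x t, 0 <= x <= 1 ->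
  0 <= t <= 1 -> c * ((1 - x) + Num.min t (1 - t)) <= normc (1 - x%:C * ee t).
Proof.
have [c c0 hc] := circle_lower_bound.
exists (Num.min (2^-1) (c / 4)); first by pos.
move=> x t /andP[x0 x1] /andP[t0 t1].
have h1 : 1 - x <= normc (1 - x%:C * ee t).
  by have := @kernel_ge R x%:C (ee t); rewrite normc_ee normc_nneg//; apply.
have h2 : normc (1 - ee t) <= 2 * normc (1 - x%:C * ee t).
  rewrite (_ : 1 - ee t = (1 - x%:C * ee t) - (1 - x)%:C * ee t); last first.
    by rewrite rmorphB /=; ring.
  apply: le_trans (le_normcB _ _) _; rewrite normcM normc_ee mulr1 normc_nneg ?subr_ge0//.
  by move: h1; move: (normc _) => u; lra.
have h3 := hc t; rewrite t0 t1 in h3; have {}h3 := h3 isT.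
have m0 : 0 <= Num.min t (1 - t) by rewrite le_min t0 subr_ge0.
have k1 : Num.min 2^-1 (c / 4) * (1 - x) <= 2^-1 * (1 - x).
  by rewrite ler_wpM2r ?subr_ge0// ge_min lexx.
have k2 : Num.min 2^-1 (c / 4) * Num.min t (1 - t) <= c / 4 * Num.min t (1 - t).
  by rewrite ler_wpM2r// ge_min lexx orbT.
rewrite mulrDr; move: k1 k2 h1 h2 h3; move: (Num.min t _) (Num.min _ _ * _) (Num.min _ _ * _) (normc _) (normc _).
by move=> a k1 k2 u v; nra.
Qed.

(** The exponent s - 1 exceeds -1, so the singularity that appears at the ends of [0,1] as x tends
    to 1 is integrable, and the bound does not depend on x. *)
Lemma kernel_mean s : 0 < s -> s <= 1 -> exists2 K, 0 < K & forall x, 0 <= x < 1 ->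
  rint (fun t => normc (1 - x%:C * ee t) `^ (s - 1)) <= K.
Proof.
move=> s0 s1; have [c c0 hc] := kernel_lower_bound.
(* Each of the two ends is integrated with the primitive y^s / s at arguments y <= 2. *)
exists (c `^ (s - 1) * (2 * (2 `^ s / s))); first by pos; rewrite ?invr_gt0 ?powR_gt0.
move=> x /andP[x0 x1]; pose d := 1 - x; have d0 : 0 < d by rewrite subr_gt0.
have p0 : s - 1 <= 0 by lra.
have ck t : cta (fun t => normc (1 - x%:C * ee t) `^ (s - 1)) t.
  apply: cta_powR; last by cts.
  by rewrite normc_gt0 kernel_neq0 ?normc_ee ?normc_nneg.
have c1 : c01 (fun t => (d + t) `^ (s - 1)).
  move=> t /andP[t0 _]; apply: (@cta_powR _ (fun t => d + t)); last by cts.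
  by pos.
have c2 : c01 (fun t => (d + (1 - t)) `^ (s - 1)).
  move=> t /andP[t0 t1]; apply: (@cta_powR _ (fun t => d + (1 - t))); last by cts.
  by pos.
have c3 : c01 (fun t => (d + t) `^ (s - 1) + (d + (1 - t)) `^ (s - 1)).
  by move=> t t01; have h1 := c1 t t01; have h2 := c2 t t01; cts.
have b1 : rint (fun t => normc (1 - x%:C * ee t) `^ (s - 1)) <=
    rint (fun t => c `^ (s - 1) * ((d + t) `^ (s - 1) + (d + (1 - t)) `^ (s - 1))).
  apply: ler_rint => [t _|t t01|t t01]; [exact: ck|by have h := c3 t t01; cts|].
  have /andP[t0 t1] := t01.
  have m0 : 0 <= Num.min t (1 - t) by rewrite le_min subr_ge0.
  have h := hc x t; rewrite x0 (ltW x1) t01 -/d in h.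
  apply: (@le_trans _ _ ((c * (d + Num.min t (1 - t))) `^ (s - 1))).
    by apply: powR_anti => //; [rewrite mulr_gt0// ltr_pwDl|exact: h].
  rewrite powRM ?(ltW c0)//; last by pos.
  rewrite ler_wpM2l ?powR_ge0//; case: (leP t (1 - t)) => _.
    by rewrite lerDl powR_ge0.
  by rewrite lerDr powR_ge0.
apply: le_trans b1 _; rewrite rintZ// ler_wpM2l ?powR_ge0// rintD//.
have sn0 : s != 0 by pos.
have E1 : rint (fun t => (d + t) `^ (s - 1)) = (d + 1) `^ s / s - (d + 0) `^ s / s.
  apply: (@FTC _ (fun t => (d + t) `^ s / s)) => // t /andP[t0 _].
  have dt : 0 < d + t by pos.
  have h := rder_comp (rder_powR s dt) (rderD (rder_cst d t) (rder_id t)).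
  have := rderZ s^-1 h; rewrite add0r mulr1 mulrA mulVf// mul1r => h'.
  by apply: rder_near h'; apply: near_all => y; rewrite mulrC.
have E2 : rint (fun t => (d + (1 - t)) `^ (s - 1)) = - ((d + (1 - 1)) `^ s / s) - - ((d + (1 - 0)) `^ s / s).
  apply: (@FTC _ (fun t => - ((d + (1 - t)) `^ s / s))) => // t /andP[t0 t1].
  have dt : 0 < d + (1 - t) by lra.
  have hg : rder (fun y => d + (1 - y)) t (-1).
    by have := rderD (rder_cst d t) (rderD (rder_cst 1 t) (rderN (rder_id t))); rewrite !add0r.
  have h := @rder_comp _ (fun y : R => y `^ s) (fun y => d + (1 - y)) t _ _ (rder_powR s dt) hg.
  have := rderZ (- s^-1) h; rewrite mulrN1 mulrNN mulrA mulVf// mul1r => h'.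
  by apply: rder_near h'; apply: near_all => y; rewrite mulNr mulrC.
have d2 : (d + 1) `^ s <= 2 `^ s by apply: powR_le; rewrite /d; lra.
have q0 := powR_ge0 d s.
rewrite E1 E2 subrr subr0 !addr0 opprK.
have := ler_wpM2r (ltW (_ : 0 < s^-1)) d2; rewrite invr_gt0 => /(_ s0).
have : 0 <= d `^ s / s by pos.
by move: (_ / s) (_ / s) (_ / s) => u v w; lra.
Qed.
End real_powers.

Ltac cta5 := match goal with
 | |- cta ?B ?y => cta_hyp B y
 | |- cta (fun x => powR (@?f x) ?p) _ => apply (@cta_powR _ _ f p)
 | _ => cta4
 end.
Ltac cts ::= repeat cta5.

(** * Poisson smoothing of a Hoelder function on the circle *)

Section poisson.
Context {R : realType}.
Local Notation C := R[i].
Implicit Types (chi Q : C -> C) (r e s t u H M : R).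

Lemma normc_1subM (e w : C) : normc e = 1 -> normc (e - w) = normc (1 - conjc e * w).
Proof.
move=> e1; rewrite -[LHS]mul1r -{1}e1 -normc_conj -normcM mulrBr.
by rewrite [conjc e * e]mulrC mul_conjc e1 expr1n.
Qed.

Lemma ee_opp t : ee (- t) = conjc (ee t) :> C.
Proof.
apply: (mulfI (ee_neq0 t)); rewrite -eeD addrN ee0 conj_ee divff//.
exact: ee_neq0.
Qed.

Lemma cta_on_circle chi H s : 0 < s ->
  (forall t u, normc (chi (ee t) - chi (ee u)) <= H * normc (ee t - ee u) `^ s) ->
  forall t, cta (fun t => chi (ee t)) t.
Proof.
move=> s0 hH t; apply/ctaP => e e0.
have d0 : 0 < (e / (`|H| + 1)) `^ s^-1 by pos.
have : cta (fun t => ee t) t :> Prop by cts.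
move=> /ctaP/(_ _ d0); apply: filterS => u hu.
apply: le_lt_trans (hH _ _) _.
have h1 : normc (ee t - ee u) `^ s <= e / (`|H| + 1).
  have -> : e / (`|H| + 1) = ((e / (`|H| + 1)) `^ s^-1) `^ s.
    by rewrite -powRrM mulVf ?gt_eqF// powRr1// divr_ge0// ltW.
  by apply: powR_le; rewrite ?normc_ge0// ltW.
have h2 : H * normc (ee t - ee u) `^ s <= `|H| * (e / (`|H| + 1)).
  apply: le_trans (ler_wpM2r (powR_ge0 _ _) (ler_norm H)) _.
  by rewrite ler_wpM2l.
apply: le_lt_trans h2 _; rewrite mulrCA gtr_pMr// ltr_pdivrMr// mul1r; lra.
Qed.

Section smoothing.
Variables (r : R) (r01 : 0 < r < 1).
Let r0 : 0 < r. Proof. by have /andP[] := r01. Qed.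
Let r1 : r < 1. Proof. by have /andP[] := r01. Qed.

(** The Poisson kernel continued from |w| = 1, where conj w = 1 / w, to a holomorphic function of w
    in r < |w| < 1 / r. *)
Definition pk (w : C) u : C :=
  (1 - r ^+ 2)%:C * ((1 - r%:C * w * conjc (ee u))^-1 * (1 - r%:C * w^-1 * ee u)^-1).

Definition pker u : R := (1 - r ^+ 2) * normc (1 - r%:C * ee u) ^- 2.

Definition poisson chi (w : C) : C := cint (fun u => chi (ee u) * pk w u).

Let k0 u : 1 - r%:C * ee u != 0.
Proof. by apply: kernel_neq0; rewrite ?normc_ee ?normc_nneg// ltW. Qed.

Lemma one_sub_neq0 (w : C) : normc w < 1 -> 1 - w != 0.
Proof. by move=> w1; have := @kernel_neq0 R w 1 w1; rewrite normc1 mulr1; apply. Qed.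

Lemma inv_sqr_normc (z : C) : (normc z ^- 2)%:C = (z * conjc z)^-1.
Proof. by rewrite mul_conjc; exact: fmorphV. Qed.

Lemma pk_circle t u : pk (ee t) u = (pker (u - t))%:C.
Proof.
rewrite /pk /pker rmorphM; congr (_ * _).
etransitivity; last exact: (esym (inv_sqr_normc _)).
rewrite -invfM; congr (_^-1); rewrite conjB conjM conjc1 conjc_real.
rewrite -(ee_opp (u - t)) opprB !eeD !ee_opp -(conj_ee t).
move: (ee u) (ee t) (conjc _) (conjc _) => a b c d; ring.
Qed.

Lemma pker_ge0 u : 0 <= pker u.
Proof. by apply: mulr_ge0; [rewrite subr_ge0 expr_le1// ltW|nn]. Qed.

Lemma cta_pker t : cta pker t.
Proof.
have h : cta (fun u => (1 - r ^+ 2) * (normc (1 - r%:C * ee u) ^+ 2)^-1) t.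
  by cts; rewrite expf_neq0// gt_eqF// normc_gt0.
exact: h.
Qed.

(** Up to the factor 1 - r^2 this is Cauchy's formula for (1 - r w)^-1 at the point r. *)
Lemma rint_pker : rint pker = 1.
Proof.
have : cint (fun u => (pker u)%:C) = 1.
  have hF : hol (disc r^-1) (fun w : C => (1 - r%:C * w)^-1).
    apply: holV => [w hw|]; last first.
      apply: (@hol_sub _ setT) => //; move=> w _; eexists.
      exact: (cderD (cder_cst 1 w) (cderN (cderZ r%:C (cder_id w)))).
    apply: one_sub_neq0; rewrite normcM normc_nneg ?(ltW r0)// -(divff (lt0r_neq0 r0)).
    by rewrite ltr_pM2l.
  have yr : normc (r%:C : C) < 1 by rewrite normc_nneg// ltW.
  have := @cauchy_formula R r^-1 _ 1 r%:C hF.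
  rewrite ltr01 invf_gt1// r1 => /(_ isT yr).
  rewrite mul1r => h.
  have -> : (1 : C) = (1 - r ^+ 2)%:C * (1 - r%:C * r%:C)^-1.
    have -> : (1 - r ^+ 2)%:C = 1 - r%:C * r%:C :> C by rewrite rmorphB rmorphXn.
    by rewrite divff// one_sub_neq0// normcM normc_nneg ?(ltW r0)// mulr_ilt1// ltW.
  rewrite -h -cintZ; last first.
    move=> t _; cts.
      by rewrite mul1r.
    by apply: kernel_neq0; rewrite ?normc_conj ?normc_ee.
  apply: eq_cint => u _; rewrite -[u in LHS]subr0 -pk_circle ee0 /pk mul1r invr1 !mulr1.
  by rewrite mulrC [X in _ = _ * X]mulrC [LHS]mulrC.
by move=> /(congr1 (@complex.Re R)).
Qed.

Lemma pk_bound w u rho sigma : r < rho -> sigma < r^-1 ->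
  rho <= normc w <= sigma ->
  normc (pk w u) <= (1 - r * sigma)^-1 * (1 - r / rho)^-1.
Proof.
move=> h1 h2 /andP[w1 w2].
have rho0 : 0 < rho by exact: lt_trans r0 h1.
have w0 : 0 < normc w by pos.
have s1 : 0 < 1 - r * sigma by rewrite subr_gt0 -(divff (lt0r_neq0 r0)) ltr_pM2l.
have s2 : 0 < 1 - r / rho by rewrite subr_gt0 ltr_pdivrMr// mul1r.
have b1 : 1 - r * sigma <= normc (1 - r%:C * w * conjc (ee u)).
  apply: le_trans (kernel_ge _ _); last by rewrite normc_conj normc_ee.
  by rewrite lerD2l lerN2 normcM normc_nneg ?(ltW r0)// ler_pM2l.
have b2 : 1 - r / rho <= normc (1 - r%:C * w^-1 * ee u).
  apply: le_trans (kernel_ge _ _); last by rewrite normc_ee.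
  rewrite lerD2l lerN2 normcM normc_nneg ?(ltW r0)// normcV.
  by rewrite ler_pM2l// lef_pV2.
rewrite /pk !normcM !normcV -[leRHS]mul1r; apply: ler_pM; nn.
  by rewrite normc_nneg ?subr_ge0 ?expr_le1 ?gerBl ?sqr_ge0// ltW.
by apply: ler_pM; nn; rewrite lef_pV2 ?posrE// (lt_le_trans _ b1, lt_le_trans _ b2).
Qed.

Lemma hol_poisson chi M : (forall t, cta (fun t => chi (ee t)) t) ->
  (forall t, normc (chi (ee t)) <= M) ->
  hol [set w | r < normc w < r^-1] (poisson chi).
Proof.
move=> cchi hM z /= /andP[z0 z1].
pose d := Num.min ((normc z - r) / 2) ((r^-1 - normc z) / 2).
have d0 : 0 < d by rewrite lt_min !divr_gt0// subr_gt0.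
have [d1 d2] : d <= (normc z - r) / 2 /\ d <= (r^-1 - normc z) / 2.
  by split; rewrite ge_min lexx ?orbT.
have hw w : normc (w - z) < d -> (r + normc z) / 2 <= normc w <= (r^-1 + normc z) / 2.
  move=> wd; have := normc_sub_ge w z; have := normc_sub_ge z w; rewrite (normcB z).
  by move: wd d1 d2; move: (normc (w - z)) => x; lra.
have nA w u : r < normc w < r^-1 -> 1 - r%:C * w * conjc (ee u) != 0.
  move=> /andP[_ h]; apply: kernel_neq0; last by rewrite normc_conj normc_ee.
  by rewrite normcM normc_nneg ?(ltW r0)// -(divff (lt0r_neq0 r0)) ltr_pM2l.
have nB w u : r < normc w < r^-1 -> 1 - r%:C * w^-1 * ee u != 0.
  move=> /andP[h _]; apply: kernel_neq0; last by rewrite normc_ee.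
  rewrite normcM normc_nneg ?(ltW r0)// normcV ltr_pdivrMr ?mul1r//.
  exact: lt_trans r0 h.
have n0 w : r < normc w -> w != 0 by move=> h; rewrite -normc_gt0; exact: lt_trans h.
have din w : normc (w - z) < d -> r < normc w < r^-1.
  by move=> /hw; move: z0 z1; move: (normc z) (normc w) => x y; lra.
have dk w u : r < normc w < r^-1 -> cder (fun w => chi (ee u) * pk w u) w
   (chi (ee u) * ((1 - r ^+ 2)%:C * (
     - (- (r%:C * conjc (ee u))) / (1 - r%:C * w * conjc (ee u)) ^+ 2 * (1 - r%:C * w^-1 * ee u)^-1 +
     (1 - r%:C * w * conjc (ee u))^-1 * (- (r%:C * ee u / w ^+ 2) / (1 - r%:C * w^-1 * ee u) ^+ 2)))).
  move=> hwr; have /andP[wr _] := hwr; apply: cderZ; apply: cderZ; apply: cderM.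
    apply: cderV; first exact: nA.
    have h := cderD (cder_cst 1 w) (cderZ (- (r%:C * conjc (ee u))) (cder_id w)).
    rewrite add0r mulr1 in h; apply: cder_near h; apply: near_all => v; ring.
  apply: cderV; first exact: nB.
  have h := cderD (cder_cst 1 w) (cderZ (- (r%:C * ee u)) (cderV (n0 w wr) (cder_id w))).
  rewrite add0r mulN1r mulrNN in h; apply: cder_near h; apply: near_all => v; ring.
eexists; apply: (@cder_cint _ (fun w u => chi (ee u) * pk w u)
   (fun u => chi (ee u) * ((1 - r ^+ 2)%:C * (
     - (- (r%:C * conjc (ee u))) / (1 - r%:C * z * conjc (ee u)) ^+ 2 * (1 - r%:C * z^-1 * ee u)^-1 +
     (1 - r%:C * z * conjc (ee u))^-1 * (- (r%:C * ee u / z ^+ 2) / (1 - r%:C * z^-1 * ee u) ^+ 2))))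
   z d (M * ((1 - r * ((r^-1 + normc z) / 2))^-1 * (1 - r / ((r + normc z) / 2))^-1))).
- exact: d0.
- by move=> t _ w /= wd; eexists; apply: dk; exact: din.
- move=> w t _ wd; rewrite normcM; apply: ler_pM; rewrite ?normc_ge0//.
  by apply: pk_bound (hw w wd); move: z0 z1; move: (normc z) (r^-1) => x y; lra.
- by move=> t _; apply: dk; rewrite z0.
- move=> w wd t _; have h1 := nA w t (din w wd); have h2 := nB w t (din w wd).
  by rewrite /pk; cts.
- move=> t _; have hz : r < normc z < r^-1 by lra.
  have h1 := nA z t hz; have h2 := nB z t hz.
  by cts; rewrite ?expf_neq0.
Qed.

Lemma poisson_bound chi M w rho : (forall t, cta (fun t => chi (ee t)) t) ->
  (forall t, normc (chi (ee t)) <= M) -> r < rho -> rho <= normc w <= 1 ->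
  normc (poisson chi w) <= M * ((1 - r)^-1 * (1 - r / rho)^-1).
Proof.
move=> cchi hM rr hw; have M0 : 0 <= M by apply: le_trans (hM 0); exact: normc_ge0.
have r1' : 1 < r^-1 by rewrite invf_gt1.
apply: normc_cint => [t _|t _].
  have /andP[w1 w2] := hw.
  have w0 : 0 < normc w by apply: lt_le_trans w1; exact: lt_trans rr.
  have h1 : 1 - r%:C * w * conjc (ee t) != 0.
    apply: kernel_neq0; last by rewrite normc_conj normc_ee.
    rewrite normcM normc_nneg ?(ltW r0)//; apply: le_lt_trans r1.
    by rewrite ler_piMr// ltW.
  have h2 : 1 - r%:C * w^-1 * ee t != 0.
    apply: kernel_neq0; last by rewrite normc_ee.
    rewrite normcM normc_nneg ?(ltW r0)// normcV ltr_pdivrMr// mul1r.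
    exact: lt_le_trans w1.
  by rewrite /pk; cts.
rewrite normcM; apply: ler_pM; rewrite ?normc_ge0//.
by have := pk_bound t rr r1' hw; rewrite mulr1.
Qed.

Lemma poissonE chi t : (forall t, cta (fun t => chi (ee t)) t) ->
  poisson chi (ee t) = cint (fun u => chi (ee t * ee u) * (pker u)%:C).
Proof.
move=> cchi; rewrite /poisson -(@cint_shift R (fun u => chi (ee u) * pk (ee t) u) t).
- by apply: eq_cint => u _; rewrite pk_circle addrK eeD mulrC [ee u * _]mulrC mulrC.
- move=> u; have h : cta (fun u => chi (ee u) * (pker (u - t))%:C) u.
    have h1 : cta (fun u => pker (u - t)) u.
      by apply: (@ctao _ _ _ pker (fun u => u - t)); [exact: cta_pker|cts].
    by cts.
  by apply: cta_near h; apply: near_all => v; rewrite pk_circle.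
- by move=> u; rewrite /pk ee_per.
Qed.

Lemma cta_rotate chi t v : (forall t, cta (fun t => chi (ee t)) t) ->
  cta (fun v => chi (ee t * ee v)) v.
Proof.
move=> cchi; have h : cta (fun v => chi (ee (t + v))) v.
  by apply: (@ctao _ _ _ (fun t => chi (ee t)) (fun v => t + v)); [exact: cchi|cts].
by apply: cta_near h; apply: near_all => x; rewrite eeD.
Qed.

Lemma pker_mean_le (f : R -> C) c : 0 <= c -> (forall v, cta f v) ->
  (forall v, normc (f v) <= c) -> normc (cint (fun v => f v * (pker v)%:C)) <= c.
Proof.
move=> c0 cf hf; have cp := cta_pker.
apply: le_trans (normc_cint_le _) _; first by move=> v _; cts.
rewrite -[leRHS]mulr1 -rint_pker -rintZ; last by move=> v _; exact: cp.
apply: ler_rint => [v _|v _|v _]; [cts|cts|].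
by rewrite normcM normc_nneg ?pker_ge0// ler_wpM2r ?pker_ge0.
Qed.

(** The smoothing averages rotated copies of chi with total weight 1, and rotations keep the Hoelder
    constant. *)
Lemma poisson_holder chi H s : 0 < s -> 0 <= H ->
  (forall t u, normc (chi (ee t) - chi (ee u)) <= H * normc (ee t - ee u) `^ s) ->
  forall t u, normc (poisson chi (ee t) - poisson chi (ee u)) <= H * normc (ee t - ee u) `^ s.
Proof.
move=> s0 H0 hH t u; have cchi := cta_on_circle s0 hH.
have cr w v := @cta_rotate chi w v cchi; have cp := cta_pker.
rewrite !poissonE// -cintB; [|by move=> v _; have := cr t v => ?; cts|by move=> v _; have := cr u v => ?; cts].
rewrite (_ : (fun _ => _) = (fun v => (chi (ee t * ee v) - chi (ee u * ee v)) * (pker v)%:C)); last first.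
  by apply/funext => v; rewrite mulrBl.
apply: pker_mean_le => [|v|v]; first by pos.
  by cts.
by rewrite -!eeD (le_trans (hH _ _))// !eeD -mulrBl normcM normc_ee mulr1.
Qed.

(** With q = |1 - r ee v| the integrand is at most 4 H (1 - r) q^(s - 2). Since q >= 1 - r, one
    factor q^(s/2 - 1) is traded for (1 - r)^(s/2 - 1), and the mean of the other one is at most
    K. *)
Lemma poisson_close chi H s K : 0 < s -> s <= 1 -> 0 <= H ->
  rint (fun t => normc (1 - r%:C * ee t) `^ (s / 2 - 1)) <= K ->
  (forall t u, normc (chi (ee t) - chi (ee u)) <= H * normc (ee t - ee u) `^ s) ->
  forall t, normc (chi (ee t) - poisson chi (ee t)) <= 4 * H * K * (1 - r) `^ (s / 2).
Proof.
move=> s0 s1 H0 hK hH t; have cchi := cta_on_circle s0 hH.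
have cr v := @cta_rotate chi t v cchi; have cp := cta_pker.
have d0 : 0 < 1 - r by rewrite subr_gt0.
have q0 u : 0 < normc (1 - r%:C * ee u) by rewrite normc_gt0.
have ck u : cta (fun t => normc (1 - r%:C * ee t) `^ (s / 2 - 1)) u.
  by cts.
have -> : chi (ee t) - poisson chi (ee t) =
    cint (fun v => (chi (ee t) - chi (ee t * ee v)) * (pker v)%:C).
  rewrite poissonE// -[X in X - _](mulr1 (chi (ee t))).
  have -> : (1 : C) = cint (fun v => (pker v)%:C).
    apply: ReIm_eq; rewrite /cint /=; first by rewrite ?rint_pker.
    by rewrite rint_cst.
  rewrite -cintZ; last by move=> v _; cts.
  rewrite -cintB; [|by move=> v _; cts|by move=> v _; have := cr v => ?; cts].
  by apply: eq_cint => v _; rewrite mulrBl.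
apply: le_trans (normc_cint_le _) _; first by move=> v _; have := cr v => ?; cts.
have hb : 4 * H * (1 - r) `^ (s / 2) * rint (fun t => normc (1 - r%:C * ee t) `^ (s / 2 - 1)) <=
    4 * H * K * (1 - r) `^ (s / 2).
  rewrite [leRHS]mulrAC; apply: ler_wpM2l => //.
  by pos.
apply: le_trans hb; rewrite -rintZ; last by move=> v _; exact: ck.
apply: ler_rint => [v _|v _|v _]; [by have := cr v => ?; cts|by have := ck v => ?; cts|].
rewrite normcM normc_nneg ?pker_ge0// -eeD.
have e1 : normc (ee t - ee (t + v)) = normc (1 - ee v).
  by rewrite eeD -{1}[ee t]mulr1 -mulrBr normcM normc_ee mul1r.
set q := normc (1 - r%:C * ee v).
have e2 : normc (1 - ee v) <= 2 * q.
  rewrite (_ : 1 - ee v = (1 - r%:C * ee v) - (1 - r)%:C * ee v); last first.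
    by rewrite rmorphB /=; ring.
  apply: le_trans (le_normcB _ _) _; rewrite normcM normc_ee mulr1 normc_nneg ?(ltW d0)//.
  have : 1 - r <= q.
    by have := @kernel_ge R r%:C (ee v); rewrite normc_ee (normc_nneg (ltW r0)); apply.
  by rewrite -/q; move: q => q; lra.
have e3 : 1 - r <= q.
  by have := @kernel_ge R r%:C (ee v); rewrite normc_ee (normc_nneg (ltW r0)); apply.
have qv : 0 < q by pos.
have f1 : normc (chi (ee t) - chi (ee (t + v))) <= H * (2 * q `^ s).
  apply: le_trans (hH _ _) _; rewrite e1 ler_wpM2l//.
  apply: le_trans (powR_le (ltW s0) (normc_ge0 _) e2) _.
  rewrite powRM ?(ltW qv)// ler_wpM2r ?powR_ge0//.
  by rewrite -[leRHS]powRr1// ler_powR// ler1n.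
have f2 : pker v <= 2 * (1 - r) * q ^- 2.
  rewrite /pker -/q ler_wpM2r//; first by pos.
  by rewrite -subr_ge0 (_ : _ - _ = (1 - r) ^+ 2) ?sqr_ge0//; ring.
apply: le_trans (ler_pM (normc_ge0 _) (pker_ge0 _) f1 f2) _.
have f3 : q `^ s * q ^- 2 <= (1 - r) `^ (s / 2 - 1) * q `^ (s / 2 - 1).
  have -> : q ^- 2 = q `^ (- 2%:R) by rewrite powRN powR_mulrn// ltW.
  rewrite -powR_add// (_ : s + - 2%:R = (s / 2 - 1) + (s / 2 - 1)); last by lra.
  rewrite powR_add// ler_wpM2r ?powR_ge0//; apply: powR_anti => //; lra.
have f4 : (1 - r) * (1 - r) `^ (s / 2 - 1) = (1 - r) `^ (s / 2).
  by rewrite -{1}(powRr1 (ltW d0)) -powR_add//; congr powR; ring.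
rewrite -f4; move: f3; move: (q `^ s) (q ^- 2) ((1 - r) `^ (s / 2 - 1)) (q `^ (s / 2 - 1)) => a b c d f3.
rewrite [leLHS](_ : _ = 4 * H * (1 - r) * (a * b)); last by lra.
rewrite [leRHS](_ : _ = 4 * H * (1 - r) * (c * d)); last by lra.
by rewrite ler_wpM2l// !mulr_ge0// ltW.
Qed.
End smoothing.

(** Interpolation: the remainder has Hoelder constant 2 H at exponent s and is uniformly of size (1
    - r)^(s/2), so the geometric mean of the two bounds is a small constant at exponent s/2. *)
Lemma holder_smoothing H s eta : 0 < s -> s <= 1 -> 0 <= H -> 0 < eta ->
  exists2 r, 0 < r < 1 & forall chi,
    (forall t u, normc (chi (ee t) - chi (ee u)) <= H * normc (ee t - ee u) `^ s) ->
    forall t u, normc ((chi (ee t) - poisson r chi (ee t)) - (chi (ee u) - poisson r chi (ee u))) <=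
      eta * normc (ee t - ee u) `^ (s / 2).
Proof.
move=> s0 s1 H0 eta0.
have s20 : 0 < s / 2 by pos.
have [|K K0 hK] := kernel_mean s20; first by lra.
(* 16 H^2 K is the product of the constants 2 H and 8 H K of the two bounds; 1 is added to divide by
   c even when H = 0. *)
pose c := 16 * H ^+ 2 * K + 1.
have c0 : 0 < c by rewrite ltr_wpDl// !mulr_ge0// ltW.
pose d := Num.min (2^-1) ((eta ^+ 2 / c) `^ (s / 2)^-1).
have d0 : 0 < d by rewrite lt_min invr_gt0 ltr0n powR_gt0// divr_gt0// exprn_gt0.
have d2 : d <= 2^-1 by rewrite ge_min lexx.
have dp : d `^ (s / 2) <= eta ^+ 2 / c.
  have -> : eta ^+ 2 / c = ((eta ^+ 2 / c) `^ (s / 2)^-1) `^ (s / 2).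
    rewrite -powRrM mulVf ?gt_eqF// powRr1// divr_ge0 ?sqr_ge0// ltW//.
  by apply: powR_le; rewrite ?(ltW s20)// ?(ltW d0)// ge_min lexx orbT.
have r01 : 0 < 1 - d < 1 by apply/andP; split; lra.
exists (1 - d) => // chi hH t u.
have r01' : 0 <= 1 - d < 1 by lra.
have h1 := poisson_close r01 s0 s1 H0 (hK _ r01') hH.
have h2 := poisson_holder r01 s0 H0 hH t u.
rewrite subKr in h1; set D := normc _.
have D0 : 0 <= D by exact: normc_ge0.
have a0 := powR_ge0 (normc (ee t - ee u)) (s / 2).
have b1 : D <= 2 * H * (normc (ee t - ee u) `^ (s / 2)) ^+ 2.
  have -> : (normc (ee t - ee u) `^ (s / 2)) ^+ 2 = normc (ee t - ee u) `^ s.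
    by rewrite -powR_mulrn// -powRrM; congr powR; lra.
  rewrite /D (_ : _ - _ = (chi (ee t) - chi (ee u)) - (poisson (1 - d) chi (ee t) - poisson (1 - d) chi (ee u))); last by ring.
  apply: le_trans (le_normcB _ _) _; apply: le_trans (lerD (hH t u) h2) _.
  by lra.
have b2 : D <= 8 * H * K * d `^ (s / 2).
  apply: le_trans (le_normcB _ _) _.
  apply: le_trans (lerD (h1 t) (h1 u)) _; rewrite le_eqVlt; apply/orP; left; apply/eqP; ring.
rewrite -(@ler_pXn2r _ 2)// ?nnegrE ?mulr_ge0// ?(ltW eta0)//.
apply: (@le_trans _ _ ((8 * H * K * d `^ (s / 2)) * (2 * H * (normc (ee t - ee u) `^ (s / 2)) ^+ 2))).
  by rewrite expr2; apply: ler_pM.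
rewrite exprMn.
have e1 : 16 * H ^+ 2 * K * d `^ (s / 2) <= eta ^+ 2.
  apply: (@le_trans _ _ (c * (eta ^+ 2 / c))); last by rewrite mulrCA divff ?mulr1// gt_eqF.
  apply: ler_pM; rewrite ?powR_ge0// ?mulr_ge0 ?sqr_ge0// ?(ltW K0)//.
  by rewrite lerDl.
have := ler_wpM2r (sqr_ge0 (normc (ee t - ee u) `^ (s / 2))) e1.
by lra.
Qed.
End poisson.

(** * Cauchy's formula for a conjugate pair and the contraction of excesses *)

Section conjugate_pairs.
Context {R : realType}.
Local Notation C := R[i].
Implicit Types (F G Q chi : C -> C) (r x s t u v e A eta rho : R).

Lemma invr_ge0_normc (z : C) : 0 <= (normc z)^-1.
Proof. by pos. Qed.

Lemma chord_le x t : 0 <= x <= 1 -> normc (1 - ee t) <= 2 * normc (1 - x%:C * ee t).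
Proof.
move=> /andP[x0 x1].
rewrite (_ : 1 - ee t = (1 - x%:C * ee t) - (1 - x)%:C * ee t); last first.
  by rewrite rmorphB /=; ring.
apply: le_trans (le_normcB _ _) _; rewrite normcM normc_ee mulr1 normc_nneg ?subr_ge0//.
have : 1 - x <= normc (1 - x%:C * ee t).
  by have := @kernel_ge R x%:C (ee t); rewrite normc_ee normc_nneg//; apply.
by move: (normc _) => q; lra.
Qed.

Lemma kernel_circle_ge x t : 0 <= x -> 1 - x <= normc (1 - x%:C * ee t).
Proof. by move=> x0; have := @kernel_ge R x%:C (ee t); rewrite normc_ee normc_nneg//; apply. Qed.

Lemma kernel_circle_gt0 x t : 0 <= x < 1 -> 0 < normc (1 - x%:C * ee t).
Proof. by move=> /andP[x0 x1]; apply: lt_le_trans (kernel_circle_ge t x0); rewrite subr_gt0. Qed.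

Lemma conj_kernel x t u : 1 - x%:C * ee u * conjc (ee t) = conjc (1 - x%:C * ee (t - u)).
Proof. by rewrite conjB conjM conjc1 conjc_real -(ee_opp (t - u)) opprB eeD ee_opp mulrA. Qed.

(** Conjugation turns the kernel, which is antiholomorphic in ee t, into a holomorphic function of
    ee t, next to the holomorphic G. Replacing conj F by chi G costs the defect times the largest
    value of the kernel. *)
Lemma pair_representation F G chi rho x u p : hol (disc 1) F -> hol (disc 1) G ->
  (forall t, cta (fun t => chi (ee t)) t) -> 0 <= rho < 1 -> 0 <= x < 1 ->
  normc (conjc (cint (fun t => F (rho%:C * ee t) * ((1 - x%:C * ee u * conjc (ee t)) ^+ p)^-1)) -
    cint (fun t => chi (ee t) * G (rho%:C * ee t) * ((1 - x%:C * ee (t - u)) ^+ p)^-1)) <=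
  defect F G chi rho / (1 - x) ^+ p.
Proof.
move=> hF hG cchi rho01 x01; have q0 t := kernel_circle_gt0 t x01.
have /andP[rho0 rho1] := rho01; have /andP[x0 x1] := x01.
have cF t : cta (fun t => F (rho%:C * ee t)) t.
  by apply: cta_circle hF _ t => s; rewrite /disc /= normc_circle ger0_norm.
have cG t : cta (fun t => G (rho%:C * ee t)) t.
  by apply: cta_circle hG _ t => s; rewrite /disc /= normc_circle ger0_norm.
have kp t : (1 - x%:C * ee (t - u)) ^+ p != 0 by rewrite expf_neq0// -normc_gt0.
have ck t : cta (fun t => ((1 - x%:C * ee (t - u)) ^+ p)^-1) t by have := kp t => ?; cts.
have ck' t : cta (fun t => ((1 - x%:C * ee u * conjc (ee t)) ^+ p)^-1) t.
  by cts; rewrite conj_kernel -conjX fmorph_eq0.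
rewrite -cint_conj; last by move=> t _; cts.
rewrite (eq_cint (G := fun t => conjc (F (rho%:C * ee t)) * ((1 - x%:C * ee (t - u)) ^+ p)^-1)); last first.
  move=> t _; rewrite conjM conj_kernel fmorphV -[conjc _ ^+ p]conjX.
  by congr (_ * _^-1); exact: conjcK.
rewrite -cintB; [|by move=> t _; cts|by move=> t _; cts].
apply: le_trans (normc_cint_le _) _; first by move=> t _; cts.
rewrite /defect mulrC -rintZ; last by move=> t _; cts.
apply: ler_rint => [t _|t _|t _]; [cts|cts|].
rewrite -mulrBl normcM mulrC ler_wpM2r ?normc_ge0// normcV normcX.
rewrite lef_pV2 ?posrE ?exprn_gt0 ?subr_gt0//.
by apply: lerXn2r; rewrite ?nnegrE ?subr_ge0 ?normc_ge0 ?(ltW x1)// kernel_circle_ge.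
Qed.

(** All factors are holomorphic in an annulus, so the mean may be taken over the circle of radius
    rho' < 1, where the kernel is bounded independently of x. *)
Lemma pair_holomorphic_part G Q a b rho rho' x u p AQ AG : hol (disc 1) G ->
  hol [set w | a < normc w < b] Q -> 0 <= a -> a < rho' -> rho' < 1 -> 1 < b ->
  (forall t, normc (Q (rho'%:C * ee t)) <= AQ) ->
  (forall w, normc w <= rho' -> normc (G w) <= AG) ->
  0 < rho < 1 -> 0 <= x < 1 ->
  normc (cint (fun t => Q (ee t) * G (rho%:C * ee t) * ((1 - x%:C * ee (t - u)) ^+ p)^-1)) <=
  AQ * AG * (1 - rho') ^- p.
Proof.
move=> hG hQ a0 ar r1 b1 hAQ hAG /andP[rho0 rho1] /andP[x0 x1].
(* Up to this radius Q, G(rho w) and the kernel are all holomorphic; for x = 0 the kernel sets no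
   limit. *)
pose b' := Num.min b (Num.min rho^-1 (if x == 0 then b else x^-1)).
have b'1 : 1 < b'.
  rewrite !lt_min b1 invf_gt1// rho1; case: eqVneq => // xn.
  by rewrite invf_gt1// lt_neqAle eq_sym xn.
have [bb brho] : b' <= b /\ b' <= rho^-1.
  by split; rewrite /b' !ge_min lexx ?orbT.
have bx w : normc w < b' -> x * normc w < 1.
  rewrite /b' !lt_min => /andP[_ /andP[_]]; case: eqVneq => [->|xn h]; first by lra.
  have xp : 0 < x by pos.
  by rewrite -(divff xn) ltr_pM2l.
clearbody b'; pose F w := Q w * G (rho%:C * w) * ((1 - x%:C * w * ee (- u)) ^+ p)^-1.
have hF : hol [set w | a < normc w < b'] F.
  apply: holM; first apply: holM.
  - by apply: hol_sub hQ => w /= /andP[-> h]; exact: lt_le_trans bb.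
  - apply: (hol_comp hG); last first.
      move=> w /= /andP[_ h]; rewrite /disc /= normcM normc_nneg ?(ltW rho0)//.
      rewrite -(divff (lt0r_neq0 rho0)) ltr_pM2l//.
      exact: lt_le_trans brho.
    by move=> w _; eexists; exact: (cderZ rho%:C (cder_id w)).
  - apply: holV => [w /= /andP[_ /bx h]|].
      apply: expf_neq0; apply: one_sub_neq0.
      by rewrite !normcM normc_ee mulr1 normc_nneg.
    apply: holX => w _; eexists.
    have h := cderD (cder_cst 1 w) (cderZ (- (x%:C * ee (- u))) (cder_id w)).
    by apply: cder_near h; apply: near_all => v; ring.
have E : cint (fun t => F (1%:C * ee t)) = cint (fun t => F (rho'%:C * ee t)).
  have r'0 : 0 < rho' by pos.
  by apply: (mean_annulus hF a0); rewrite ?ar ?(lt_trans ar r1)//= (lt_trans r1).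
rewrite (eq_cint (G := fun t => F (1%:C * ee t))); last first.
  by move=> t _; rewrite /F !mul1r eeD mulrA.
rewrite E; have r'0 : 0 <= rho' by pos.
apply: normc_cint => [t _|t _].
  apply: (cta_circle hF) => s.
  by rewrite /= normc_circle (ger0_norm r'0) ar (lt_trans r1 b'1).
rewrite /F; clear E hF bx F.
have h1 : normc (G (rho%:C * (rho'%:C * ee t))) <= AG.
  apply: hAG; rewrite !normcM normc_ee mulr1 (normc_nneg (ltW rho0)) (normc_nneg r'0).
  by rewrite ler_piMl// ltW.
have h2 : (normc ((1 - x%:C * (rho'%:C * ee t) * ee (- u)) ^+ p))^-1 <= (1 - rho') ^- p.
  have h3 : 1 - rho' <= normc (1 - x%:C * (rho'%:C * ee t) * ee (- u)).
    rewrite (_ : 1 - _ = 1 - (x%:C * rho'%:C) * (ee t * ee (- u))); last by ring.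
    apply: le_trans (kernel_ge _ _); last by rewrite normcM !normc_ee.
    rewrite lerD2l lerN2 normcM (normc_nneg x0) (normc_nneg r'0).
    by rewrite ler_piMl// ltW.
  have r1' : 0 < 1 - rho' by pos.
  rewrite normcX lef_pV2 ?posrE; last 2 first.
  - by pos.
  - exact: exprn_gt0.
  by apply: lerXn2r h3; rewrite nnegrE ?normc_ge0// ltW.
rewrite !normcM normcV.
exact: ler_pM (mulr_ge0 (normc_ge0 _) (normc_ge0 _)) (invr_ge0_normc _) (ler_pM (normc_ge0 _) (normc_ge0 _) (hAQ t) h1) h2.
Qed.

(** chi is the sum of Q, the constant (chi - Q)(ee u) and an increment of chi - Q. The first part is
    moved to the inner circle, the second meets only G 0, and the increment, of size eta |ee t - ee
    u|^s, weakens the kernel from power -1 to power s - 1. *)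
Lemma pair_pointwise F G chi Q a b rho rho' x u AQ AG M1 eta s :
  hol (disc 1) F -> hol (disc 1) G -> (forall t, cta (fun t => chi (ee t)) t) ->
  hol [set w | a < normc w < b] Q -> 0 <= a -> a < rho' -> rho' < 1 -> 1 < b ->
  (forall t, normc (Q (rho'%:C * ee t)) <= AQ) ->
  (forall w, normc w <= rho' -> normc (G w) <= AG) -> 0 < s -> s <= 1 -> 0 <= eta ->
  (forall t, normc (chi (ee t) - Q (ee t)) <= M1) ->
  (forall t u, normc ((chi (ee t) - Q (ee t)) - (chi (ee u) - Q (ee u))) <=
     eta * normc (ee t - ee u) `^ s) ->
  0 < rho < 1 -> 0 <= x < 1 ->
  normc (F (rho%:C * (x%:C * ee u))) <= AQ * AG / (1 - rho') + M1 * AG +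
    defect F G chi rho / (1 - x) +
    2 * eta * rint (fun t => normc (G (rho%:C * ee t)) * normc (1 - x%:C * ee (t - u)) `^ (s - 1)).
Proof.
move=> hF hG cchi hQ a0 ar r1 b1 hAQ hAG s0 s1 eta0 hM1 heta rho01 x01.
have /andP[rho0 rho1] := rho01; have /andP[x0 x1] := x01.
have rho01' : 0 <= rho < 1 by lra.
have q0 t := kernel_circle_gt0 t x01.
have cG t : cta (fun t => G (rho%:C * ee t)) t.
  by apply: cta_circle hG _ t => v; rewrite /disc /= normc_circle gtr0_norm.
have cQ t : cta (fun t => Q (ee t)) t.
  have h : cta (fun t => Q (1%:C * ee t)) t.
    apply: cta_circle hQ _ t => v; rewrite /= normc_circle ger0_norm// b1 andbT.
    exact: lt_trans r1.
  by apply: cta_near h; apply: near_all => v; rewrite mul1r.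
have k0 t : 1 - x%:C * ee (t - u) != 0 by rewrite -normc_gt0.
have ck t : cta (fun t => (1 - x%:C * ee (t - u))^-1) t by have := k0 t => ?; cts.
have cp t : cta (fun t => normc (1 - x%:C * ee (t - u)) `^ (s - 1)) t.
  by cts.
have hrep := pair_representation u 1 hF hG cchi rho01' x01.
have hhol := pair_holomorphic_part u 1 hG hQ a0 ar r1 b1 hAQ hAG rho01 x01.
have yx : normc (x%:C * ee u : C) < 1 by rewrite normcM normc_ee mulr1 normc_nneg.
have hcf : cint (fun t => F (rho%:C * ee t) * ((1 - x%:C * ee u * conjc (ee t)) ^+ 1)^-1) =
    F (rho%:C * (x%:C * ee u)).
  by rewrite -(cauchy_formula hF rho01 yx); apply: eq_cint => t _; rewrite expr1.
rewrite hcf !expr1 in hrep hhol.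
have hmean : cint (fun t => G (rho%:C * ee t) * (1 - x%:C * ee (t - u))^-1) = G 0.
  pose H w := G (rho%:C * w) * (1 - x%:C * ee (- u) * w)^-1.
  pose b' := Num.min rho^-1 (if x == 0 then 2 else x^-1).
  have b'1 : 1 < b'.
    rewrite lt_min invf_gt1// rho1; case: eqVneq => [_|xn]; first by lra.
    by rewrite invf_gt1// lt_neqAle eq_sym xn.
  have hH : hol (disc b') H.
    apply: holM.
      apply: (hol_comp hG); last first.
        move=> w; rewrite /disc /= lt_min => /andP[h _].
        by rewrite normcM normc_nneg ?(ltW rho0)// -(divff (lt0r_neq0 rho0)) ltr_pM2l.
      by move=> w _; eexists; exact: (cderZ rho%:C (cder_id w)).
    apply: holV => [w|w _]; last first.
      eexists; have h := cderD (cder_cst 1 w) (cderZ (- (x%:C * ee (- u))) (cder_id w)).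
      by apply: cder_near h; apply: near_all => v; ring.
    rewrite /disc /= lt_min => /andP[_]; case: eqVneq => [->|xn] h; apply: one_sub_neq0.
      by rewrite !mul0r normc0.
    have xp : 0 < x by pos.
    by rewrite !normcM normc_ee mulr1 normc_nneg// -(divff xn) ltr_pM2l.
  have := mean_value hH (x := 1); rewrite ler01 b'1 => /(_ isT).
  rewrite /H !mulr0 subr0 divr1 => <-; apply: eq_cint => t _.
  by rewrite mul1r eeD mulrA mulrAC.
have split3 : cint (fun t => chi (ee t) * G (rho%:C * ee t) * (1 - x%:C * ee (t - u))^-1) =
  cint (fun t => Q (ee t) * G (rho%:C * ee t) * (1 - x%:C * ee (t - u))^-1) +
  ((chi (ee u) - Q (ee u)) * G 0 +
   cint (fun t => ((chi (ee t) - Q (ee t)) - (chi (ee u) - Q (ee u))) * G (rho%:C * ee t) * (1 - x%:C * ee (t - u))^-1)).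
  rewrite -hmean -cintZ; last by move=> t _; cts.
  rewrite -cintD; [|by move=> t _; cts|by move=> t _; cts].
  rewrite -cintD; [|by move=> t _; cts|by move=> t _; cts].
  by apply: eq_cint => t _; ring.
have b3 : normc (cint (fun t => ((chi (ee t) - Q (ee t)) - (chi (ee u) - Q (ee u))) * G (rho%:C * ee t) * (1 - x%:C * ee (t - u))^-1)) <=
    2 * eta * rint (fun t => normc (G (rho%:C * ee t)) * normc (1 - x%:C * ee (t - u)) `^ (s - 1)).
  apply: le_trans (normc_cint_le _) _; first by move=> t _; cts.
  rewrite -rintZ; last by move=> t _; cts.
  apply: ler_rint => [t _|t _|t _]; [cts|cts|].
  rewrite !normcM mulrAC [leRHS]mulrCA mulrC ler_wpM2l ?normc_ge0// normcV.
  set q := normc (1 - x%:C * ee (t - u)); have qp : 0 < q by exact: q0.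
  have e1 : normc (ee t - ee u) <= 2 * q.
    rewrite (_ : normc _ = normc (1 - ee (t - u))); first by apply: chord_le; rewrite x0 ltW.
    by rewrite normcB normc_1subM ?normc_ee// mulrC eeD ee_opp.
  have e2 : normc (ee t - ee u) `^ s <= 2 * q `^ s.
    apply: le_trans (powR_le (ltW s0) (normc_ge0 _) e1) _.
    rewrite powRM ?(ltW qp)// ler_wpM2r ?powR_ge0//.
    by rewrite -[leRHS]powRr1// ler_powR// ler1n.
  have e3 : q `^ (s - 1) = q `^ s * q^-1 by rewrite powR_add// powR_inv1// ltW.
  rewrite e3; apply: (@le_trans _ _ (eta * (2 * q `^ s) * q^-1)).
    rewrite ler_wpM2r ?invr_ge0 ?(ltW qp)//.
    by apply: le_trans (heta _ _) _; rewrite ler_wpM2l.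
  by rewrite le_eqVlt; apply/orP; left; apply/eqP; ring.
have AG0 : normc (G 0) <= AG by apply: hAG; rewrite normc0 (le_trans a0)// ltW.
have b2 : normc ((chi (ee u) - Q (ee u)) * G 0) <= M1 * AG.
  by rewrite normcM; apply: ler_pM; rewrite ?normc_ge0.
rewrite -normc_conj; rewrite split3 in hrep.
set X := conjc _ in hrep *; set S := cint _ + _ in hrep.
apply: (@le_trans _ _ (normc (X - S) + normc S)).
  by rewrite -{1}(subrK S X) le_normcD.
have hS : normc S <= AQ * AG / (1 - rho') + (M1 * AG + 2 * eta * rint (fun t => normc (G (rho%:C * ee t)) * normc (1 - x%:C * ee (t - u)) `^ (s - 1))).
  apply: le_trans (le_normcD _ _) _; apply: lerD; first exact: hhol.
  by apply: le_trans (le_normcD _ _) _; exact: lerD.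
apply: le_trans (lerD hrep hS) _; rewrite le_eqVlt; apply/orP; left; apply/eqP; ring.
Qed.

(** The estimate of [pair_pointwise] with the terms that do not depend on rho, x and u collected in
    A. *)
Definition dominated F G chi A eta s := forall rho x u, 0 < rho < 1 -> 0 <= x < 1 ->
  normc (F (rho%:C * (x%:C * ee u))) <= A + defect F G chi rho / (1 - x) +
    2 * eta * rint (fun t => normc (G (rho%:C * ee t)) * normc (1 - x%:C * ee (t - u)) `^ (s - 1)).

Definition excess F A r := rint (fun t => Num.max (normc (F (r%:C * ee t)) - A) 0).

Section kernel_means.
Variables (x s : R) (x01 : 0 <= x < 1).
Let q0 t : 0 < normc (1 - x%:C * ee t). Proof. exact: kernel_circle_gt0. Qed.

Lemma cta_kernel (T : topologicalType) (f : T -> R) (t : T) : cta f t ->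
  cta (fun y => normc (1 - x%:C * ee (f y)) `^ (s - 1)) t.
Proof. by move=> hf; have := q0 (f t) => ?; cts. Qed.

Lemma rint_kernel_l u : rint (fun t => normc (1 - x%:C * ee (t - u)) `^ (s - 1)) =
  rint (fun t => normc (1 - x%:C * ee t) `^ (s - 1)).
Proof.
apply: (@rint_shift _ (fun t => normc (1 - x%:C * ee t) `^ (s - 1)) (- u)) => t.
  by cts.
by rewrite ee_per.
Qed.

Lemma rint_kernel_r t : rint (fun u => normc (1 - x%:C * ee (t - u)) `^ (s - 1)) =
  rint (fun t => normc (1 - x%:C * ee t) `^ (s - 1)).
Proof.
rewrite -(rint_kernel_l t); apply: eq_rint => u _; congr (_ `^ _).
by rewrite -(opprB u t) ee_opp -normc_conj conjB conjM conjc1 conjc_real conjcK.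
Qed.
End kernel_means.

Lemma cta_circle1 F r t : hol (disc 1) F -> 0 <= r < 1 -> cta (fun t => F (r%:C * ee t)) t.
Proof.
move=> hF /andP[r0 r1]; apply: (cta_circle hF) => s.
by rewrite /disc /= normc_circle ger0_norm.
Qed.

(** |G| is split at the level 4 A. The part below contributes at most 8 eta K A <= A, so that F
    exceeds 4 A only through the excess of G, and integrating over u gives at most 2 eta K w <= w /
    4. *)
Lemma excess_step F G chi A eta s K w : hol (disc 1) F -> hol (disc 1) G ->
  paired F G chi -> dominated F G chi A eta s -> 0 <= A -> 0 <= eta ->
  (forall x, 0 <= x < 1 -> rint (fun t => normc (1 - x%:C * ee t) `^ (s - 1)) <= K) ->
  8 * eta * K <= 1 -> (forall r, 0 < r < 1 -> excess G (4 * A) r <= w) ->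
  forall r, 0 < r < 1 -> excess F (4 * A) r <= w / 4.
Proof.
move=> hF hG hp hd A0 eta0 hK etaK hw r /andP[r0 r1].
apply: le_eps => e e0.
have er : 0 < e * ((1 - r) / 2) by rewrite mulr_gt0// divr_gt0// subr_gt0.
have [|rho /andP[h1 h2] [rho0 hdef]] := hp _ ((1 + r) / 2) er; first by lra.
have rho01 : 0 < rho < 1 by rewrite rho0.
have rho01' : 0 <= rho < 1 by rewrite ltW.
(* The circle of radius r is reached as rho x with rho so close to 1 that 1 - x >= (1 - r) / 2; the
   defect term is then at most e. *)
pose x := r / rho; have x0 : 0 <= x by rewrite divr_ge0// ltW.
have xr : rho * x = r by rewrite /x mulrCA divff ?mulr1// gt_eqF.
have x1 : x <= 1 - (1 - r) / 2.
  rewrite /x ler_pdivrMr//; nra.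
have x01 : 0 <= x < 1 by rewrite x0; lra.
have hdx : defect F G chi rho / (1 - x) <= e.
  have xx : (1 - r) / 2 <= 1 - x by lra.
  have xp : 0 < 1 - x by lra.
  rewrite ler_pdivrMr//; apply: le_trans hdef _.
  by rewrite ler_wpM2l// ltW.
have cG t : cta (fun t => G (rho%:C * ee t)) t by exact: cta_circle1.
pose E t := Num.max (normc (G (rho%:C * ee t)) - 4 * A) 0.
have cE t : cta E t.
  have h : cta (fun t => Num.max (normc (G (rho%:C * ee t)) - 4 * A) 0) t by cts.
  exact: h.
have E0 t : 0 <= E t by rewrite /E le_max lexx orbT.
pose q u t := normc (1 - x%:C * ee (t - u)) `^ (s - 1).
have cq u t : cta (q u) t by apply: cta_kernel => //; cts.
have cq' u t : cta (q ^~ t) u by apply: cta_kernel => //; cts.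
have q0 u t : 0 <= q u t by exact: powR_ge0.
have cqq p : cta (fun p : R * R => q p.1 p.2) p by apply: cta_kernel => //; cts.
have key u : Num.max (normc (F (r%:C * ee u)) - 4 * A) 0 <= e + 2 * eta * rint (fun t => E t * q u t).
  have IE : 0 <= rint (fun t => E t * q u t) by apply: rint_ge0 => t _; rewrite mulr_ge0.
  rewrite ge_max; apply/andP; split; last by rewrite addr_ge0 ?(ltW e0)// !mulr_ge0.
  have hd1 := hd rho x u rho01 x01.
  rewrite (_ : rho%:C * (x%:C * ee u) = r%:C * ee u) in hd1; last by rewrite mulrA -rmorphM xr.
  have h3 : rint (fun t => normc (G (rho%:C * ee t)) * q u t) <=
      4 * A * K + rint (fun t => E t * q u t).
    apply: (@le_trans _ _ (rint (fun t => 4 * A * q u t + E t * q u t))).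
      apply: ler_rint => [t _|t _|t _]; [by have := cq u => ?; cts|by have := cq u => ?; cts|].
      rewrite -mulrDl ler_wpM2r// /E -lerBlDl le_max lexx; by [].
    rewrite rintD; [|by move=> t _; have := cq u => ?; cts|by move=> t _; have := cq u => ?; cts].
    rewrite lerD2r rintZ; last by move=> t _; exact: cq.
    by rewrite ler_wpM2l ?mulr_ge0// /q rint_kernel_l// hK.
  have h4 : 2 * eta * (4 * A * K) <= A.
    rewrite (_ : _ * _ = A * (8 * eta * K)); last by ring.
    by rewrite -[leRHS]mulr1 ler_wpM2l.
  have h5 := ler_wpM2l (mulr_ge0 (ler0n R 2) eta0) h3.
  rewrite mulrDr in h5; move: hd1 h5 h4 hdx A0; rewrite /q.
  move: (rint _) (rint _) (_ / _) (normc _) => i1 i2 dd nf.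
  move: (2 * eta * _) (2 * eta * _) (2 * eta * _) => a b c; lra.
have cFr t : cta (fun t => F (r%:C * ee t)) t by apply: cta_circle1 => //; rewrite ltW.
pose k u t := E t * q u t.
have ck p : cta (fun p : R * R => k p.1 p.2) p.
  have h : cta (fun p : R * R => E p.2 * q p.1 p.2) p.
    have h1' : cta (fun p : R * R => E p.2) p by apply: (@ctao _ _ _ E snd); [exact: cE|cts].
    by cts.
  exact: h.
have cik u : cta (fun u => rint (k u)) u.
  apply: cta_rint => [t _|]; first exact: ck.
  apply: near_all => v t _; have h : cta (fun t => E t * q v t) t by have := cq v => ?; cts.
  exact: h.
have : excess F (4 * A) r <= rint (fun u => e + 2 * eta * rint (k u)).
  by apply: ler_rint => [t _|t _|t _]; [cts|cts|exact: key].
rewrite rintD; [|by move=> t _; cts|by move=> t _; cts].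
rewrite rint_cst rintZ; last by move=> t _; exact: cik.
rewrite rint_fubini// => h; apply: le_trans h _.
rewrite addrC lerD2r.
have h6 : rint (fun t => rint (k ^~ t)) <= K * w.
  apply: (@le_trans _ _ (rint (fun t => K * E t))).
    apply: ler_rint => [t _|t _|t _]; last first.
    - rewrite /k rintZ; last by move=> u _; exact: cq'.
      by rewrite mulrC ler_wpM2r// /q rint_kernel_r// hK.
    - by cts.
    - apply: (@cta_rint _ _ (fun t u => k u t)) => [u _|].
        by apply: (@ctao _ _ _ (fun p : R * R => k p.1 p.2) (fun p : R * R => (p.2, p.1))); [exact: ck|apply: cta_pair; cts].
      apply: near_all => v u _; have h' : cta (fun u => E v * q u v) u by have := cq' ^~ v => ?; cts.
      exact: h'.
  rewrite rintZ; last by move=> t _; exact: cE.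
  rewrite ler_wpM2l//; last by apply: hw.
  apply: le_trans (hK 0 _); last by rewrite lexx ltr01.
  by apply: rint_ge0 => t _; exact: powR_ge0.
have w0 : 0 <= w.
  by apply: le_trans (hw rho rho01); apply: rint_ge0 => t _; exact: E0.
apply: le_trans (ler_wpM2l (mulr_ge0 (ler0n R 2) eta0) h6) _.
rewrite (_ : 2 * eta * (K * w) = (8 * eta * K) * (w / 4)); last by field.
by rewrite -[leRHS]mul1r ler_wpM2r// divr_ge0.
Qed.

(** Both excesses are at most B to begin with, and alternating the two estimates divides the bound
    by 4 any number of times. *)
Lemma excess_vanish F G chiF chiG A eta s K B : hol (disc 1) F -> hol (disc 1) G ->
  paired F G chiF -> paired G F chiG ->
  dominated F G chiF A eta s -> dominated G F chiG A eta s -> 0 <= A -> 0 <= eta ->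
  (forall x, 0 <= x < 1 -> rint (fun t => normc (1 - x%:C * ee t) `^ (s - 1)) <= K) ->
  8 * eta * K <= 1 -> mean_bounded F B -> mean_bounded G B ->
  forall r, 0 < r < 1 -> excess F (4 * A) r <= 0 /\ excess G (4 * A) r <= 0.
Proof.
move=> hF hG pF pG dF dG A0 eta0 hK etaK bF bG.
have iter k : forall r, 0 < r < 1 -> excess F (4 * A) r <= B * 4^-1 ^+ k /\ excess G (4 * A) r <= B * 4^-1 ^+ k.
  elim: k => [|k IH] r r01.
    have base H : hol (disc 1) H -> mean_bounded H B -> excess H (4 * A) r <= B * 4^-1 ^+ 0.
      move=> hH bH; rewrite expr0 mulr1; have /andP[r0 r1] := r01.
      have r01' : 0 <= r < 1 by lra.
      apply: le_trans (bH r r01'); have cH t : cta (fun t => H (r%:C * ee t)) t by exact: cta_circle1.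
      apply: ler_rint => [t _|t _|t _]; [cts|cts|].
      by rewrite ge_max normc_ge0 lerBlDr lerDl mulr_ge0.
    by split; exact: base.
  rewrite exprSr mulrA; split.
    by apply: (excess_step hF hG pF dF A0 eta0 hK etaK) => // v /IH[].
  by apply: (excess_step hG hF pG dG A0 eta0 hK etaK) => // v /IH[].
have B0 : 0 <= B.
  apply: le_trans (bF 0 _); last by lra.
  by apply: rint_ge0 => t _; exact: normc_ge0.
have lim0 (y : R) : (forall k, y <= B * 4^-1 ^+ k) -> y <= 0.
  move=> h; apply: le_eps => e e0; rewrite add0r.
  have [k hk] : exists k, B * 4^-1 ^+ k <= e.
    have [k hk] : exists k : nat, B / e <= k%:R.
      by exists (Num.bound (B / e)); apply/ltW/archi_boundP; rewrite divr_ge0// ltW.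
    exists k; rewrite exprVn ler_pdivrMr ?exprn_gt0//.
    move: hk; rewrite ler_pdivrMr// => hk; apply: le_trans hk _.
    rewrite mulrC ler_wpM2l ?(ltW e0)// -natrX ler_nat.
    by apply: ltnW; exact: ltn_expl.
  exact: le_trans (h k) hk.
move=> r r01; split; apply: lim0 => k; by have [] := iter k r r01.
Qed.

End conjugate_pairs.

(** * Boundedness of a pair and the estimate against high powers of the kernel *)

Section uniform_bound.
Context {R : realType}.
Local Notation C := R[i].
Implicit Types (F G Q chi : C -> C) (r x s t u v e A B H M eta rho : R).

(** The primitive is monotone with increment at most 0, hence constant, so its derivative f vanishes
    in the interior. *)
Lemma rint_le0_eq0 (f : R -> R) : (forall t, cta f t) -> (forall t, 0 <= f t) ->
  rint f <= 0 -> forall t, 0 < t < 1 -> f t = 0.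
Proof.
move=> cf f0 hf t /andP[t0 t1].
have [P hP] := primitive (-1) 2 cf.
have hPr x : 0 <= x <= 1 -> rder P x (f x) by move=> ?; apply: hP; lra.
have mono a b : 0 <= a -> a <= b -> b <= 1 -> P a <= P b.
  move=> a0 ab b1.
  have := @MVTle _ (fun=> 0) P (fun=> 0) f a b ab; rewrite subrr subr_ge0; apply => //.
  - by move=> x _; exact: rder_cst.
  - by move=> x /andP[h1 h2]; apply: hPr; apply/andP; split; lra.
  - by move=> x _; exact: ctac.
  - by move=> x /andP[h1 h2]; apply: (@rder_cta _ _ _ (f x)); apply: hPr; apply/andP; split; lra.
have P01 : P 1 - P 0 <= 0 by rewrite -(FTC hPr).
have Pc x : 0 <= x <= 1 -> P x = P 0.
  move=> /andP[x0 x1]; have := mono 0 x (lexx _) x0 x1; have := mono x 1 x0 x1 (lexx _).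
  by move: P01; lra.
apply/le_anti; rewrite f0 andbT; apply: le_eps => e e0; rewrite add0r.
have /nearRP[d d0 hd] := rderP (hPr t ltac:(by apply/andP; split; lra)) e0.
pose y := Num.min (t + d / 2) 1.
have yt : t < y by rewrite lt_min ltrDl divr_gt0.
have y1 : y <= 1 by rewrite ge_min lexx orbT.
have yd : y <= t + d / 2 by rewrite ge_min lexx.
have := hd y; rewrite !Pc ?subrr; [|by apply/andP; split; lra|by apply/andP; split; lra].
rewrite sub0r normrN normrM !(@gtr0_norm _ (y - t)) ?subr_gt0// ler_pM2r ?subr_gt0//.
by rewrite ger0_norm// => ->//; lra.
Qed.

(** r' and c are chosen before the functions and before B, so they serve all slices at once; only
    the bound A on the disc of radius r' enters the conclusion. *)
Lemma pair_bounded H M s : 0 < s -> s <= 1 -> 0 <= H -> 0 <= M ->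
  exists2 r', 0 < r' < 1 & exists2 c, 0 <= c & forall F G chiF chiG B A,
    hol (disc 1) F -> hol (disc 1) G -> mean_bounded F B -> mean_bounded G B ->
    paired F G chiF -> paired G F chiG ->
    (forall t u, normc (chiF (ee t) - chiF (ee u)) <= H * normc (ee t - ee u) `^ s) ->
    (forall t u, normc (chiG (ee t) - chiG (ee u)) <= H * normc (ee t - ee u) `^ s) ->
    (forall t, normc (chiF (ee t)) <= M) -> (forall t, normc (chiG (ee t)) <= M) ->
    (forall w, normc w <= r' -> normc (F w) <= A) ->
    (forall w, normc w <= r' -> normc (G w) <= A) ->
    forall w, normc w < 1 -> normc (F w) <= c * A /\ normc (G w) <= c * A.
Proof.
move=> s0 s1 H0 M0; have s20 : 0 < s / 2 by pos.
have s21 : s / 2 <= 1 by lra.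
have [K K0 hK] := kernel_mean s20 s21.
pose eta := (8 * K)^-1; have eta0 : 0 < eta by rewrite invr_gt0 mulr_gt0.
have etaK : 8 * eta * K <= 1.
  by rewrite mulrAC divff// gt_eqF// mulr_gt0.
have [r r01 hr] := holder_smoothing s0 s1 H0 eta0.
have /andP[r0 r1] := r01.
pose r' := (1 + r) / 2; have rr' : r < r' by rewrite /r'; lra.
have r'1 : r' < 1 by rewrite /r'; lra.
have r'0 : 0 < r' by lra.
exists r'; first by lra.
pose AQ := M * ((1 - r)^-1 * (1 - r / r')^-1).
have AQ0 : 0 <= AQ.
  rewrite /AQ; apply: mulr_ge0 => //; apply: mulr_ge0; rewrite invr_ge0 subr_ge0.
    exact: ltW.
  by rewrite ler_pdivrMr// mul1r ltW.
pose c := AQ / (1 - r') + (M + AQ).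
have c0 : 0 <= c.
  by rewrite /c; apply: addr_ge0; [rewrite divr_ge0// subr_ge0 ltW|rewrite addr_ge0].
exists (4 * c); first by pos.
move=> F G chiF chiG B A hF hG bF bG pF pG hoF hoG mF mG AF AG.
have A0 : 0 <= A by apply: le_trans (AF 0 _); rewrite ?normc_ge0// normc0 ltW.
have dom F' G' chi : hol (disc 1) F' -> hol (disc 1) G' ->
    (forall t u, normc (chi (ee t) - chi (ee u)) <= H * normc (ee t - ee u) `^ s) ->
    (forall t, normc (chi (ee t)) <= M) ->
    (forall w, normc w <= r' -> normc (G' w) <= A) -> dominated F' G' chi (c * A) eta (s / 2).
  move=> hF' hG' ho mch AG' rho x u rho01 x01.
  have cchi := cta_on_circle s0 ho.
  have pb w : r' <= normc w <= 1 -> normc (poisson r chi w) <= AQ.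
    by move=> hw; exact: (poisson_bound r01 cchi mch rr' hw).
  have := @pair_pointwise _ F' G' chi (poisson r chi) r r^-1 rho r' x u AQ A (M + AQ) eta (s / 2).
  rewrite (_ : c * A = AQ * A / (1 - r') + (M + AQ) * A); last first.
    by rewrite mulrDl mulrAC.
  apply => //.
  - exact: (hol_poisson r01 cchi mch).
  - exact: ltW.
  - by rewrite invf_gt1.
  - by move=> t; apply: pb; rewrite normc_circle gtr0_norm// lexx ltW.
  - exact: ltW.
  - move=> t; apply: le_trans (le_normcB _ _) _; apply: lerD => //.
    by apply: pb; rewrite normc_ee lexx andbT ltW.
  - by move=> t v; exact: hr.
have dF := dom F G chiF hF hG hoF mF AG.
have dG := dom G F chiG hG hF hoG mG AF.
have cA : 0 <= c * A by pos.
have ev := excess_vanish hF hG pF pG dF dG cA (ltW eta0) hK etaK bF bG.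
have fin F' : hol (disc 1) F' -> (forall r, 0 < r < 1 -> excess F' (4 * (c * A)) r <= 0) ->
    forall w, normc w < 1 -> normc (F' w) <= 4 * c * A.
  move=> hF' he.
  have circ x v : 0 < x < 1 -> normc (F' (x%:C * ee v)) <= 4 * c * A.
    move=> /andP[x0 x1]; rewrite -mulrA.
    have x01 : 0 <= x < 1 by lra.
    have cF t : cta (fun t => F' (x%:C * ee t)) t by exact: cta_circle1.
    pose f t := Num.max (normc (F' (x%:C * ee t)) - 4 * (c * A)) 0.
    have cf t : cta f t.
      have h : cta (fun t => Num.max (normc (F' (x%:C * ee t)) - 4 * (c * A)) 0) t by cts.
      exact: h.
    (* The shift moves v to the interior point 1/2, as required by [rint_le0_eq0]. *)
    have fs : rint (fun t => f (t + (v - 2^-1))) <= 0.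
      rewrite (rint_shift _ cf); last by move=> t; rewrite /f ee_per.
      by have := he x; rewrite x0 x1 => /(_ isT).
    have : f (2^-1 + (v - 2^-1)) = 0.
      apply: (@rint_le0_eq0 (fun t => f (t + (v - 2^-1)))) => // [t|t|]; last 2 first.
      - by rewrite le_max lexx orbT.
      - by lra.
      by cts.
    rewrite addrC subrK.
    by rewrite /f => hm; rewrite -subr_le0 -hm le_max lexx.
  move=> w w1; have [v ->] := polar w; have [w0|w0] := eqVneq (normc w) 0; last first.
    by apply: circ; rewrite w1 andbT lt_neqAle eq_sym w0 normc_ge0.
  have h12 : (0 <= 2^-1 :> R) && (2^-1 < 1 :> R) by apply/andP; split; lra.
  rewrite w0 mul0r -(mean_value hF' h12); apply: normc_cint => [t _|t _].
    exact: cta_circle1.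
  by apply: circ; rewrite invr_gt0 ltr0n invf_lt1 ?ltr1n.
by move=> w w1; split; apply: fin => // v /ev[].
Qed.

Lemma powR_le1 (d p : R) : 0 <= p -> 0 < d -> d <= 1 -> d `^ p <= 1.
Proof. move=> p0 d0 d1; have <- : 1 `^ p = 1 :> R by rewrite powR1.
by apply: powR_le => //; exact: ltW. Qed.

(** The Poisson kernel (1 - x^2) |1 - x ee t|^-2 has mean 1. *)
Lemma mean_kernel2 x : 0 < x < 1 ->
  rint (fun t => normc (1 - x%:C * ee t) ^- 2) <= (1 - x)^-1.
Proof.
move=> x01; have /andP[x0 x1] := x01.
have h := rint_pker x01.
have x2 : 0 < 1 - x ^+ 2 by rewrite subr_gt0 expr_lt1// ltW.
have : (1 - x ^+ 2) * rint (fun t => normc (1 - x%:C * ee t) ^- 2) = 1.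
  etransitivity; last exact: h.
  rewrite -rintZ// => t _; have := @kernel_circle_gt0 _ x t; rewrite ltW// x1 => /(_ isT) ?.
  by cts; rewrite expf_neq0// gt_eqF.
move=> e; have d0 : 0 < 1 - x by pos.
rewrite -(ler_pM2l x2) e ler_pdivlMr// mul1r; nra.
Qed.

(* With [G] bounded, an approximation [Q] of [chi] that is accurate near the
   boundary point closest to [y] and holomorphic off the origin bounds the
   Cauchy integral of [F] against a high power of the kernel. *)
Lemma pair_kernel_bound F G chi Q rho x u m K tau c A :
  hol (disc 1) F -> hol (disc 1) G -> (forall t, cta (fun t => chi (ee t)) t) ->
  (forall w, normc w < 1 -> normc (G w) <= A) ->
  hol [set w | w != 0] Q -> 0 < tau -> 0 <= c ->
  K%:R + tau <= m%:R -> (K.+1 <= m)%N ->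
  (forall w, 2^-1 <= normc w <= 1 -> normc (Q w) <= c * (1 - x) ^- K) ->
  (forall t, normc (chi (ee t) - Q (ee t)) <=
     c * (1 - x) `^ tau * (normc (ee t - x%:C * ee u) / (1 - x)) ^+ K) ->
  0 < rho < 1 -> 2^-1 <= x < 1 ->
  normc (cint (fun t => F (rho%:C * ee t) * ((1 - x%:C * ee u * conjc (ee t)) ^+ m.+1)^-1)) <=
    defect F G chi rho / (1 - x) ^+ m.+1 + c * A * (1 + 2 ^+ m.+1) * (1 - x) `^ (tau - m%:R).
Proof.
move=> hF hG cchi hA hQ tau0 c0 Km /subnKC Km' Q1 Q2 rho01 /andP[x2 x1].
move: Km; rewrite -{}Km'; move: (m - K.+1)%N => {m} j.
set m := (K.+1 + j)%N => Km.
have x0 : 0 < x by apply: lt_le_trans x2; rewrite invr_gt0 ltr0n.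
have x01 : 0 <= x < 1 by lra.
have /andP[rho0 rho1] := rho01; have rho01' : 0 <= rho < 1 by lra.
have q0 t := kernel_circle_gt0 t x01.
have A0 : 0 <= A by apply: le_trans (hA 0 _); rewrite ?normc_ge0// normc0.
set d := 1 - x in Q1 Q2 *; have d0 : 0 < d by rewrite subr_gt0.
have d1 : d <= 1 by rewrite gerBl ltW.
have hrep := pair_representation u m.+1 hF hG cchi rho01' x01.
have h12 : (0 < 2^-1 :> R) && (2^-1 < 1 :> R) by apply/andP; split; lra.
have hQ' : hol [set w : C | 0 < normc w < 2] Q.
  by apply: hol_sub hQ => w /= /andP[h _]; rewrite -normc_gt0.
have Qh t : normc (Q (2^-1%:C * ee t)) <= c * d ^- K.
  by apply: Q1; rewrite normc_circle ger0_norm ?lexx; lra.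
have Gh w : normc w <= 2^-1 -> normc (G w) <= A.
  by move=> h; apply: hA; apply: le_lt_trans h _; have /andP[] := h12.
have h1 : 2^-1 < (1 : R) by lra.
have h0 : 0 < 2^-1 :> R by [].
have hhol := pair_holomorphic_part u m.+1 hG hQ' (lexx 0) h0 h1 (ltr1n R 2 : 1 < 2) Qh Gh rho01 x01.
have k0 t : (1 - x%:C * ee (t - u)) ^+ m.+1 != 0 by rewrite expf_neq0// -normc_gt0.
have cG t : cta (fun t => G (rho%:C * ee t)) t by exact: cta_circle1.
have cQ t : cta (fun t => Q (ee t)) t.
  have h : cta (fun t => Q (1%:C * ee t)) t.
    by apply: (cta_circle hQ) => v; rewrite /= mul1r ee_neq0.
  by apply: cta_near h; apply: near_all => v; rewrite mul1r.
have ck t : cta (fun t => ((1 - x%:C * ee (t - u)) ^+ m.+1)^-1) t by have := k0 t => ?; cts.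
(* With q = |1 - x ee (t - u)| >= d, the factor (q / d)^K is absorbed by the kernel q^-(m + 1). A
   power q^-2 is kept, because its mean 1 / d is better than the pointwise bound d^-2. *)
have T1 : normc (cint (fun t => (chi (ee t) - Q (ee t)) * G (rho%:C * ee t) * ((1 - x%:C * ee (t - u)) ^+ m.+1)^-1)) <=
    c * A * d `^ (tau - m%:R).
  apply: le_trans (normc_cint_le _) _; first by move=> t _; cts.
  have cq t : cta (fun t => normc (1 - x%:C * ee (t - u)) ^- 2) t.
    by have := q0 (t - u) => ?; cts; rewrite expf_neq0// gt_eqF.
  apply: (@le_trans _ _ (rint (fun t => c * A * (d `^ tau * d ^- m.-1) * normc (1 - x%:C * ee (t - u)) ^- 2))).
    apply: ler_rint => [t _|t _|t _]; [cts|cts|].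
    rewrite !normcM normcV normcX; set q := normc (1 - x%:C * ee (t - u)).
    have qp : 0 < q by exact: q0.
    have qd : d <= q by apply: kernel_circle_ge; exact: ltW.
    have e1 : normc (ee t - x%:C * ee u) = q.
      rewrite normc_1subM ?normc_ee// /q -normc_conj conjB !conjM conjc1 conjc_real conjcK -ee_opp.
      by rewrite mulrCA eeD.
    have f1 : normc (chi (ee t) - Q (ee t)) * normc (G (rho%:C * ee t)) <= c * d `^ tau * (q / d) ^+ K * A.
      apply: ler_pM; rewrite ?normc_ge0//; first by rewrite -e1; exact: Q2.
      by apply: hA; rewrite normc_circle gtr0_norm.
    apply: le_trans (ler_wpM2r (_ : 0 <= (q ^+ m.+1)^-1) f1) _.
      by pos.
    have -> : m.+1 = (K + j + 2)%N by rewrite addn2.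
    have -> : m.-1 = (K + j)%N by [].
    rewrite !exprD expr_div_n !invfM.
    rewrite [leLHS](_ : _ = c * d `^ tau * A * (d ^- K * (q ^- 2 * (q ^+ j)^-1))); last first.
      by field; rewrite !expf_neq0 ?gt_eqF.
    rewrite [leRHS](_ : _ = c * d `^ tau * A * (d ^- K * (q ^- 2 * (d ^+ j)^-1))); last by lra; ring.
    rewrite ler_wpM2l ?mulr_ge0 ?powR_ge0// ler_wpM2l ?invr_ge0 ?exprn_ge0 ?(ltW d0)//.
    rewrite ler_wpM2l ?invr_ge0 ?sqr_ge0// lef_pV2 ?posrE ?exprn_gt0//.
    by apply: lerXn2r; rewrite ?nnegrE ?(ltW d0) ?(ltW qp).
  rewrite rintZ; last by move=> t _; exact: cq.
  rewrite (rint_shift (f := fun t => normc (1 - x%:C * ee t) ^- 2)) ; last 2 first.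
  - by move=> t; have := q0 t => ?; cts; rewrite expf_neq0// gt_eqF.
  - by move=> t; rewrite ee_per.
  have x01' : 0 < x < 1 by lra.
  rewrite -[leLHS]mulrA ler_wpM2l ?mulr_ge0//.
  apply: le_trans (ler_wpM2l (_ : 0 <= d `^ tau * d ^- m.-1) (mean_kernel2 x01')) _.
    by pos.
  rewrite -/d -mulrA -invfM -exprSr (_ : m.-1.+1 = m)//.
  by rewrite powR_add// powRN powR_mulrn// ltW.
(* On the circle of radius 1/2 the kernel is harmless and only the size d^-K of Q counts; K + tau <=
   m makes it at most d^(tau - m). *)
have T2 : c * d ^- K * A * (1 - 2^-1) ^- m.+1 <= c * A * 2 ^+ m.+1 * d `^ (tau - m%:R).
  have -> : (1 - 2^-1 : R) = 2^-1 by lra.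
  rewrite exprVn invrK; have -> : d ^- K = d `^ (- K%:R) by rewrite powRN powR_mulrn// ltW.
  have : d `^ (- K%:R) <= d `^ (tau - m%:R).
    rewrite (_ : - K%:R = (tau - m%:R) + (m%:R - tau - K%:R)); last by lra.
    rewrite powR_add// ler_piMr ?powR_ge0//; apply: powR_le1 => //.
    by move: Km; move: (K%:R : R) (m%:R : R) => a b; lra.
  move=> h; rewrite [leLHS](_ : _ = c * A * 2 ^+ m.+1 * d `^ (- K%:R)); last by lra.
  apply: ler_wpM2l h; apply: mulr_ge0; [exact: mulr_ge0|exact: exprn_ge0].
rewrite -normc_conj; set X := conjc _ in hrep *; set S := cint _ in hrep.
have hS : S = cint (fun t => (chi (ee t) - Q (ee t)) * G (rho%:C * ee t) * ((1 - x%:C * ee (t - u)) ^+ m.+1)^-1) +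
   cint (fun t => Q (ee t) * G (rho%:C * ee t) * ((1 - x%:C * ee (t - u)) ^+ m.+1)^-1).
  rewrite -cintD; [|by move=> t _; cts|by move=> t _; cts].
  by apply: eq_cint => t _; ring.
apply: (@le_trans _ _ (normc (X - S) + normc S)).
  by rewrite -{1}(subrK S X) le_normcD.
apply: lerD; first exact: hrep.
rewrite hS; apply: le_trans (le_normcD _ _) _; apply: le_trans (lerD T1 (le_trans hhol T2)) _.
by lra.
Qed.
End uniform_bound.

(** * Derivatives of complex-valued functions of a real variable *)

Section real_derivatives.
Context {R : realType}.
Local Notation C := R[i].
Implicit Types (f g : R -> R) (F G : R -> C) (x y a b : R) (c : C).

Lemma rder_eps f x a : (forall e, 0 < e -> \forall y \near x, `|f y - f x - a * (y - x)| <= e * `|y - x|) ->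
  rder f x a.
Proof.
move=> h; pose g y := if y == x then a else (f y - f x) / (y - x).
have fE y : f y - f x = g y * (y - x).
  rewrite /g; case: eqVneq => [->|yx]; first by lra.
  by rewrite divfK// subr_eq0.
have gx : g x = a by rewrite /g eqxx.
have cg : cta g x.
  apply/rtaP => e e0; have e2 : 0 < e / 2 by pos.
  apply: filterS (h _ e2) => y; rewrite gx fE -mulrBl normrM.
  have [->|yx] := eqVneq y x; first by rewrite gx subrr normr0.
  have yx0 : 0 < `|y - x| by rewrite normr_gt0 subr_eq0.
  by rewrite ler_pM2r// distrC => hy; apply: le_lt_trans hy _; lra.
by split; apply/is_derive1_caratheodory; exists g; split; [exact: fE|exact: ctaE cg|exact: gx].
Qed.

Lemma dR_eps F x c : (forall e, 0 < e -> \forall y \near x,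
    normc (F y - F x - (y - x)%:C * c) <= e * `|y - x|) -> dR F x c.
Proof.
move=> h; split; apply: rder_eps => e e0; apply: filterS (h e e0) => y; apply: le_trans.
  apply: le_trans _ (Re_le_normc _).
  by rewrite !Re_add !Re_opp Re_mul mul0r subr0 [_ * (y - x)]mulrC.
apply: le_trans _ (Im_le_normc _).
by rewrite !Im_add !Im_opp Im_mul mul0r addr0 mulrC.
Qed.

Lemma dR_cta F x c : dR F x c -> cta F x.
Proof.
move=> [/rder_cta h1 /rder_cta h2].
have h : cta (fun y => complex.Re (F y) +i* complex.Im (F y)) x by cts.
by apply: cta_near h; apply: near_all => y; case: (F y).
Qed.

Lemma dR_near F G x c : (\forall y \near x, F y = G y) -> dR F x c -> dR G x c.
Proof. by move=> h [h1 h2]; split; apply: rder_near; [|exact: h1| |exact: h2]; apply: filterS (h) => y ->. Qed.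

Lemma dR_eq F x c c' : dR F x c -> c = c' -> dR F x c'.
Proof. by move=> h <-. Qed.

Lemma dR_cst c x : dR (fun=> c) x 0.
Proof. by split; exact: rder_cst. Qed.

Lemma dRD F G x c c' : dR F x c -> dR G x c' -> dR (fun y => F y + G y) x (c + c').
Proof.
move=> [h1 h2] [h3 h4]; split.
  by rewrite Re_add; apply: rder_near (rderD h1 h3); apply: near_all => y; rewrite Re_add.
by rewrite Im_add; apply: rder_near (rderD h2 h4); apply: near_all => y; rewrite Im_add.
Qed.

Lemma dRZ c F x c' : dR F x c' -> dR (fun y => c * F y) x (c * c').
Proof.
move=> [h1 h2]; split.
  have h := rderD (rderZ (complex.Re c) h1) (rderZ (- complex.Im c) h2).
  rewrite Re_mul -mulNr; apply: rder_near h; apply: near_all => y.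
  by rewrite Re_mul mulNr.
have h := rderD (rderZ (complex.Re c) h2) (rderZ (complex.Im c) h1).
by rewrite Im_mul; apply: rder_near h; apply: near_all => y; rewrite Im_mul.
Qed.

Lemma dRN F x c : dR F x c -> dR (fun y => - F y) x (- c).
Proof.
by move=> /(dRZ (-1)); rewrite mulN1r; apply: dR_near; apply: near_all => y; rewrite mulN1r.
Qed.

Lemma dR_sum (I : Type) (s : seq I) (F : I -> R -> C) (c : I -> C) x :
  (forall i, dR (F i) x (c i)) ->
  dR (fun y => \sum_(i <- s) F i y) x (\sum_(i <- s) c i).
Proof.
move=> h; elim: s => [|i s IH].
  rewrite big_nil; apply: dR_near (dR_cst 0 x).
  by apply: near_all => y; rewrite big_nil.
rewrite big_cons; apply: dR_near (dRD (h i) IH).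
by apply: near_all => y; rewrite big_cons.
Qed.

Lemma dR_scale f F x a c : rder f x a -> dR F x c ->
  dR (fun y => (f y)%:C * F y) x (a%:C * F x + (f x)%:C * c).
Proof.
move=> hf [h1 h2]; split.
  rewrite Re_add !Re_mul /= !mul0r !subr0; apply: rder_near (rderM hf h1).
  by apply: near_all => y; rewrite Re_mul /= mul0r subr0.
rewrite Im_add !Im_mul /= !mul0r !addr0; apply: rder_near (rderM hf h2).
by apply: near_all => y; rewrite Im_mul /= mul0r addr0.
Qed.

Lemma dR_comp F g x a c : dR F (g x) c -> rder g x a -> dR (fun y => F (g y)) x (a%:C * c).
Proof.
move=> [h1 h2] hg; split.
  by rewrite Re_mul /= mul0r subr0 mulrC; exact: (rder_comp h1 hg).
by rewrite Im_mul /= mul0r addr0 mulrC; exact: (rder_comp h2 hg).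
Qed.

Lemma cder_dR (F : C -> C) x c : cder F x%:C c -> dR (fun y => F y%:C) x c.
Proof.
move=> /cderP h; apply: dR_eps => e e0; have /nearCP[d d0 hd] := h e e0.
apply/nearRP; exists d => // y yd.
have E : normc (y%:C - x%:C : C) = `|y - x| by rewrite -rmorphB normc_real.
have := hd y%:C; rewrite E => /(_ yd).
by rewrite rmorphB mulrC.
Qed.
End real_derivatives.

(** * Continuously differentiable functions on open sets of C^n *)

Section directional.
Context {R : realType} {n : nat}.
Local Notation C := R[i].
Local Notation V := 'rV[C]_n.
Implicit Types (F G : V -> C) (U : set V) (z v w u p : V) (c : C) (a e s x : R).

Definition dv F v z c := dR (fun s : R => F (z + s%:C *: v)) 0 c.

Lemma rderive_val F v z c : dv F v z c -> rderive v F z = c.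
Proof.
move=> [[h1] [h2]]; rewrite /rderive !derive1E.
rewrite (@derive_val _ _ _ _ _ _ _ h1) (@derive_val _ _ _ _ _ _ _ h2).
by case: c {h1 h2}.
Qed.

Lemma rderivable_dv F v z : rderivable v F z -> dv F v z (rderive v F z).
Proof.
move=> [h1 h2]; split; split.
  by rewrite /= derive1E; apply: DeriveDef; [exact: h1|reflexivity].
by rewrite /= derive1E; apply: DeriveDef; [exact: h2|reflexivity].
Qed.

Definition opn U := forall z, U z -> exists2 d : R, 0 < d & forall w, vnorm (w - z) < d -> U w.

Definition vball z (r : R) : set V := [set w | vnorm (w - z) < r].

Lemma opn_vball z r : opn (vball z r).
Proof.
move=> w wr; exists (r - vnorm (w - z)); first by rewrite subr_gt0.
move=> u hu; apply: le_lt_trans (vnorm_trans w u z) _.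
by lra.
Qed.

Lemma opn_unit_ball : opn (unit_ball : set V).
Proof.
move=> z z1; exists (1 - vnorm z); first by rewrite subr_gt0.
move=> w hw; have := vnorm_sub_ge w z; rewrite /unit_ball /=.
by move: hw; move: (vnorm (w - z)) (vnorm w) (vnorm z) => p q r; lra.
Qed.

Lemma opn_near U z : opn U -> U z -> \forall w \near z, U w.
Proof. by move=> oU /oU[d d0 h]; apply/nearVP; exists d. Qed.

Record C1 U F : Prop := C1I {
  C1_cta : forall z, U z -> cta F z;
  C1_dv : forall v z, U z -> dv F v z (rderive v F z);
  C1_cta_rderive : forall v z, U z -> cta (rderive v F) z }.

Lemma cta_line z v s : cta (fun s : R => z + s%:C *: v) s.
Proof. by apply: cta_vadd; [exact: ctac|apply: cta_scale; [cts|exact: ctac]]. Qed.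

Lemma near_line U z v s : opn U -> U (z + s%:C *: v) -> \forall s' \near s, U (z + s'%:C *: v).
Proof.
move=> oU h; have [hc] := cta_line z v s.
exact: (hc U (opn_near oU h)).
Qed.

Lemma dv_ext U F G v z c : opn U -> U z -> (forall w, U w -> F w = G w) ->
  dv F v z c -> dv G v z c.
Proof.
move=> oU Uz FG; apply: dR_near.
have : U (z + (0 : R)%:C *: v) by rewrite scale0r addr0.
by move=> /(near_line oU); apply: filterS => s /FG.
Qed.

Lemma rderive_ext U F G v z : opn U -> U z -> (forall w, U w -> F w = G w) ->
  rderive v F z = rderive v G z.
Proof.
move=> oU Uz FG; have /(near_line oU) h : U (z + (0 : R)%:C *: v) by rewrite scale0r addr0.
rewrite /rderive !derive1E; congr (_ +i* _); apply: near_eq_derive; rewrite ?oner_eq0//.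
  by apply: filterS h => s /FG ->.
by apply: filterS h => s /FG ->.
Qed.

Lemma rderive_shift F v p : rderive v (fun z => F (z + p)) = (fun z => rderive v F (z + p)).
Proof.
apply/funext => z.
have E : (fun s : R => F (z + s%:C *: v + p)) = (fun s : R => F (z + p + s%:C *: v)).
  by apply/funext => s; rewrite addrAC.
have key (H K : R -> C) : H = K ->
    derive1 (fun s => complex.Re (H s)) 0 +i* derive1 (fun s => complex.Im (H s)) 0 =
    derive1 (fun s => complex.Re (K s)) 0 +i* derive1 (fun s => complex.Im (K s)) 0 by move=> ->.
exact: key E.
Qed.

#[global] Opaque rderive.

Lemma C1_ext U F G : opn U -> (forall w, U w -> F w = G w) -> C1 U F -> C1 U G.
Proof.
move=> oU FG hF; have rE v w : U w -> rderive v F w = rderive v G w.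
  by move=> Uw; exact: (rderive_ext v oU Uw FG).
split=> [z Uz|v z Uz|v z Uz].
- by apply: cta_near (C1_cta hF Uz); apply: filterS (opn_near oU Uz) => w /FG.
- by rewrite -(rE v z Uz); exact: (dv_ext oU Uz FG (C1_dv hF v Uz)).
- by apply: cta_near (C1_cta_rderive hF v Uz); apply: filterS (opn_near oU Uz) => w /(rE v).
Qed.

Lemma C1_sub U W F : (forall z, W z -> U z) -> C1 U F -> C1 W F.
Proof.
move=> h hF; split=> [z /h|v z /h|v z /h].
- exact: (C1_cta hF).
- exact: (C1_dv hF v).
- exact: (C1_cta_rderive hF v).
Qed.

Lemma dv_line F v z s c : dv F v (z + s%:C *: v) c -> dR (fun s => F (z + s%:C *: v)) s c.
Proof.
move=> h; have h1 : rder (fun y => y - s) s 1.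
  by have := rderD (rder_id s) (rder_cst (- s) s); rewrite addr0.
have h0 : dR (fun t : R => F (z + s%:C *: v + t%:C *: v)) (s - s) c by rewrite subrr.
have := @dR_comp _ (fun t => F (z + s%:C *: v + t%:C *: v)) (fun y => y - s) s _ _ h0 h1.
rewrite mul1r; apply: dR_near; apply: near_all => y.
by rewrite -addrA -scalerDl -rmorphD subrKC.
Qed.

Lemma dv_scale F v z c a : dv F v z c -> dv F (a%:C *: v) z (a%:C * c).
Proof.
move=> h; have h1 : rder (fun y => a * y) 0 a.
  by have := rderZ a (rder_id 0); rewrite mulr1.
have h0 : dR (fun t : R => F (z + t%:C *: v)) (a * 0) c by rewrite mulr0.
have := @dR_comp _ (fun t => F (z + t%:C *: v)) (fun y => a * y) 0 _ _ h0 h1.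
by apply: dR_near; apply: near_all => y; rewrite scalerA -rmorphM mulrC.
Qed.

Lemma rderive_scale U F v z a : C1 U F -> U z ->
  rderive (a%:C *: v) F z = a%:C * rderive v F z.
Proof. by move=> hF Uz; exact: (rderive_val (dv_scale a (C1_dv hF v Uz))). Qed.

Lemma dR_mean (F dF : R -> C) c e : (forall x, 0 <= x <= 1 -> dR F x (dF x)) ->
  (forall x, 0 <= x <= 1 -> normc (dF x - c) <= e) -> normc (F 1 - F 0 - c) <= e.
Proof.
move=> h he; pose phi x := F x + (- x)%:C * c.
have dphi x : 0 <= x <= 1 -> dR phi x (dF x - c).
  move=> /h hx; apply: dRD hx _.
  have := dR_scale (rderN (rder_id x)) (dR_cst c x).
  by rewrite mulr0 addr0 rmorphN mulN1r.
have := @normc_MVT R phi (fun x => dF x - c) (fun x => e * x) (fun=> e) 0 1 ler01.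
have -> : phi 1 - phi 0 = F 1 - F 0 - c.
  by rewrite /phi oppr0 rmorphN rmorph1 rmorph0; ring.
rewrite mulr1 mulr0 subr0; apply.
- by move=> x /andP[x0 x1]; apply: dphi; rewrite !ltW.
- by move=> x _; have := rderZ e (rder_id x); rewrite mulr1.
- by move=> x /andP[x0 x1]; apply: he; rewrite !ltW.
- by move=> x /dphi /dR_cta.
- by move=> x _; cts.
Qed.

Lemma C1_mean U F z v c e : C1 U F ->
  (forall x, 0 <= x <= 1 -> U (z + x%:C *: v) /\ normc (rderive v F (z + x%:C *: v) - c) <= e) ->
  normc (F (z + v) - F z - c) <= e.
Proof.
move=> hF h.
have -> : F (z + v) = F (z + (1 : R)%:C *: v) by rewrite scale1r.
have -> : F z = F (z + (0 : R)%:C *: v) by rewrite scale0r addr0.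
apply: (@dR_mean (fun x => F (z + x%:C *: v)) (fun x => rderive v F (z + x%:C *: v))).
  by move=> x /h[Ux _]; exact: (dv_line (C1_dv hF v Ux)).
by move=> x /h[].
Qed.

(** The expansion holds at all base points w near z with the derivative taken at z; this uniformity
    gives additivity in the direction and the symmetry of second derivatives. *)
Lemma C1_small U F v z e : opn U -> C1 U F -> U z -> 0 < e -> exists2 d, 0 < d &
  forall w s, vnorm (w - z) < d -> `|s| < d ->
  [/\ U w, U (w + s%:C *: v) &
  normc (F (w + s%:C *: v) - F w - s%:C * rderive v F z) <= e * `|s|].
Proof.
move=> oU hF Uz e0.
have /ctaP/(_ _ e0) := C1_cta_rderive hF v Uz.
move=> /(near_and (opn_near oU Uz))/nearVP[d d0 hd].
have v0 : 0 < 1 + vnorm v by pos.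
exists (Num.min (d / 2) (d / 2 / (1 + vnorm v))).
  by pos.
move=> w s; rewrite !lt_min => /andP[w1 _] /andP[_ s2].
have sv : `|s| * vnorm v <= d / 2.
  have s0 := normr_ge0 s; move: s2; rewrite ltr_pdivlMr// => s2.
  by lra.
have key x : 0 <= x <= 1 -> U (w + (x * s)%:C *: v) /\
    normc (rderive v F (w + (x * s)%:C *: v) - rderive v F z) <= e.
  move=> /andP[x0 x1].
  have [|Uy hy] := hd (w + (x * s)%:C *: v); last first.
    by split=> //; rewrite normcB ltW.
  rewrite (_ : _ - z = (w - z) + (x * s)%:C *: v); last by rewrite addrAC.
  apply: le_lt_trans (vnormD _ _) _; rewrite vnormZ normc_real normrM (ger0_norm x0).
  have : x * `|s| * vnorm v <= d / 2.
    by apply: le_trans sv; rewrite -mulrA ler_piMl// mulr_ge0// vnorm_ge0.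
  by move: w1; lra.
split.
- by have [] := key 0; rewrite ?lexx ?ler01// mul0r scale0r addr0.
- by have [] := key 1; rewrite ?lexx ?ler01// mul1r.
apply: (@C1_mean U) => // x /key[Ux hx]; rewrite scalerA -rmorphM; split=> //.
rewrite (rderive_scale _ s hF Ux) -mulrBr normcM normc_real mulrC.
by apply: ler_wpM2r => //; exact: normr_ge0.
Qed.

(** The increment along v + w is split at z + s w, where the increment along v is still described by
    the derivative at z. *)
Lemma C1_add U F v w z : opn U -> C1 U F -> U z ->
  rderive (v + w) F z = rderive v F z + rderive w F z.
Proof.
move=> oU hF Uz; apply: rderive_val; apply: dR_eps => e e0.
have e2 : 0 < e / 2 by pos.
have [d1 d10 h1] := C1_small v oU hF Uz e2.
have [d2 d20 h2] := C1_small w oU hF Uz e2.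
have w0 : 0 < 1 + vnorm w by pos.
apply/nearRP; exists (Num.min d2 (Num.min d1 (d1 / (1 + vnorm w)))).
  by pos.
move=> s; rewrite subr0 !lt_min => /and3P[s2 s1 s3].
have z0 : vnorm (z - z) < d2 by rewrite subrr vnorm0.
have z1 : vnorm (z + s%:C *: w - z) < d1.
  rewrite addrAC subrr add0r vnormZ normc_real; move: s3; rewrite ltr_pdivlMr//.
  by apply: le_lt_trans; rewrite mulrDr mulr1 lerDr normr_ge0.
have [_ _ k1] := h1 _ s z1 s1; have [_ _ k2] := h2 _ s z0 s2.
rewrite scale0r addr0 scalerDr [_ *: v + _]addrC addrA.
rewrite (_ : _ - _ = (F (z + s%:C *: w + s%:C *: v) - F (z + s%:C *: w) - s%:C * rderive v F z) +
   (F (z + s%:C *: w) - F z - s%:C * rderive w F z)); last by ring.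
apply: le_trans (le_normcD _ _) _; apply: le_trans (lerD k1 k2) _.
by rewrite -mulrDl -splitr.
Qed.

(** The mean value inequality in direction w for the increment of F along v, whose derivative is an
    increment of [rderive w F]. *)
Lemma C1_second_diff U F v w z e : opn U -> C1 U F -> C1 U (rderive w F) -> U z -> 0 < e ->
  exists2 d, 0 < d & forall s, 0 < s < d ->
  normc (F (z + s%:C *: v + s%:C *: w) - F (z + s%:C *: v) - F (z + s%:C *: w) + F z -
    (s ^+ 2)%:C * rderive v (rderive w F) z) <= e * s ^+ 2.
Proof.
move=> oU hF hwF Uz e0; have [d1 d10 h1] := C1_small v oU hwF Uz e0.
have w0 : 0 < 1 + vnorm w by pos.
exists (Num.min d1 (d1 / (1 + vnorm w))); first by pos.
move=> s; rewrite lt_min => /and3P[s0 s1 s2].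
have key x : 0 <= x <= 1 ->
    [/\ U (z + x%:C *: (s%:C *: w)), U (z + x%:C *: (s%:C *: w) + s%:C *: v) &
     normc (s%:C * (rderive w F (z + x%:C *: (s%:C *: w) + s%:C *: v) -
       rderive w F (z + x%:C *: (s%:C *: w))) - (s ^+ 2)%:C * rderive v (rderive w F) z) <= e * s ^+ 2].
  move=> /andP[x0 x1].
  have [||U1 U2 h] := h1 (z + x%:C *: (s%:C *: w)) s.
  - rewrite addrAC subrr add0r !vnormZ !normc_real (ger0_norm x0) (gtr0_norm s0).
    move: s2; rewrite ltr_pdivlMr// mulrDr mulr1 => s2.
    have sw : 0 <= s * vnorm w by pos.
    apply: le_lt_trans s2; apply: le_trans (_ : s * vnorm w <= _); last by lra.
    by rewrite ler_piMl.
  - by rewrite gtr0_norm.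
  split=> //; rewrite expr2 rmorphM -mulrA -mulrBr normcM normc_real (gtr0_norm s0).
  rewrite mulrCA; apply: ler_wpM2l; first exact: ltW.
  by rewrite (gtr0_norm s0) in h.
have := @dR_mean (fun x => F (z + x%:C *: (s%:C *: w) + s%:C *: v) - F (z + x%:C *: (s%:C *: w)))
  (fun x => s%:C * (rderive w F (z + x%:C *: (s%:C *: w) + s%:C *: v) -
       rderive w F (z + x%:C *: (s%:C *: w)))) ((s ^+ 2)%:C * rderive v (rderive w F) z) (e * s ^+ 2).
rewrite scale1r scale0r addr0 [z + s%:C *: w + _]addrAC.
rewrite (_ : F (z + s%:C *: v + s%:C *: w) - F (z + s%:C *: w) - (F (z + s%:C *: v) - F z) =
  F (z + s%:C *: v + s%:C *: w) - F (z + s%:C *: v) - F (z + s%:C *: w) + F z); last by ring.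
apply=> x /key[U1 U2 h] //; rewrite mulrBr; apply: dRD; last first.
  by apply: dRN; apply: dv_line; exact: (dv_scale s (C1_dv hF w U1)).
have h2 : dR (fun y => F (z + s%:C *: v + y%:C *: (s%:C *: w))) x
   (s%:C * rderive w F (z + x%:C *: (s%:C *: w) + s%:C *: v)).
  by apply: dv_line; rewrite addrAC; exact: (dv_scale s (C1_dv hF w U2)).
by apply: dR_near h2; apply: near_all => y; rewrite addrAC.
Qed.

(** The second difference is symmetric in v and w, and divided by s^2 it tends to either mixed
    derivative. *)
Lemma rderive_comm U F v w z : opn U -> C1 U F -> C1 U (rderive v F) -> C1 U (rderive w F) ->
  U z -> rderive v (rderive w F) z = rderive w (rderive v F) z.
Proof.
move=> oU hF hv hw Uz; apply/eqP; rewrite -subr_eq0; apply/eqP; apply: normc_eq0_eps => e e0.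
have e2 : 0 < e / 2 by pos.
have [d1 d10 h1] := C1_second_diff v oU hF hw Uz e2.
have [d2 d20 h2] := C1_second_diff w oU hF hv Uz e2.
pose s := Num.min d1 d2 / 2.
have m0 : 0 < Num.min d1 d2 by pos.
have s0 : 0 < s by rewrite divr_gt0.
have sm : s < Num.min d1 d2 by rewrite /s; lra.
move: (sm); rewrite lt_min => /andP[s1 s2].
have {}h1 := h1 s; have {}h2 := h2 s; rewrite s0 s1 in h1; rewrite s0 s2 in h2.
move: (h1 isT) (h2 isT); rewrite [z + s%:C *: w + _]addrAC.
set A := rderive v _ z; set B := rderive w _ z.
move: (F _) (F _) (F _) (F _) => a b c d k1 k2.
have s20 : 0 < s ^+ 2 by pos.
rewrite -(ler_pM2l s20).
have -> : s ^+ 2 * normc (A - B) = normc ((s ^+ 2)%:C * (A - B)).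
  by rewrite normcM normc_nneg// ltW.
rewrite (_ : _ * _ = (d - b - c + a - (s ^+ 2)%:C * B) - (d - c - b + a - (s ^+ 2)%:C * A)); last by ring.
apply: le_trans (le_normcB _ _) _; apply: le_trans (lerD k2 k1) _.
by rewrite -mulrDl -splitr mulrC.
Qed.
End directional.

(** * Compact balls and bounds for continuous functions *)

Section compactness.
Context {R : realType} {n : nat}.
Local Notation C := R[i].
Local Notation V := 'rV[C]_n.

Lemma compact_vball (r : R) : compact [set z : V | vnorm z <= r].
Proof.
have h : compact [set v : V | forall i, [set c : C | normc c <= r] (v ord0 i)].
  exact: (@rV_compact C n (fun=> [set c : C | normc c <= r]) (fun=> @compact_cdisc R r)).
apply: subclosed_compact h _.
  apply: (@preimage_closed _ _ (@vnorm R n) [set x : R | x <= r]); last exact: closed_le.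
  by move=> z _; exact: ctaE (cta_vnorm (ctaid z)).
by move=> z /= zr i; apply: le_trans zr; exact: normc_le_vnorm.
Qed.

Lemma within_bounded (A : set V) (F : V -> C) : compact A -> {within A, continuous F} ->
  exists M : R, forall z, A z -> normc (F z) <= M.
Proof.
move=> cA cF; have [A0|/nonemptyPn ->] := pselect (A !=set0); last by exists 0.
have cf : {within A, continuous (fun z => normc (F z))}.
  apply/subspace_continuousP => z Az; move/subspace_continuousP/(_ _ Az): cF => h.
  have hn : cta (@normc R) (F z) by exact: cta_normc (ctaid (F z)).
  exact: (cvg_comp _ _ h (ctaE hn)).
have [c _ h] := compact_EVT_max A0 cA cf.
by exists (normc (F c)) => z Az; apply: h; rewrite inE.
Qed.
End compactness.

(** * Derivatives of holomorphic functions of n variables *)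

Section holomorphic_functions.
Context {R : realType} {n : nat}.
Local Notation C := R[i].
Local Notation V := 'rV[C]_n.
Implicit Types (F G : V -> C) (z v w u : V) (c : C) (a e s x r : R).

(* Continuity together with complex differentiability along lines is easier to
   propagate to derivatives than differentiability. *)
Record hb F : Prop := HB {
  hb_cta : forall z, vnorm z < 1 -> cta F z;
  hb_line : forall z v, vnorm z < 1 -> exists c, cder (fun l => F (z + l *: v)) 0 c }.

Lemma hb_holomorphic F : holomorphic F -> hb F.
Proof.
by move=> hF; split=> [z|z v] z1; [exact: holomorphic_cta|exact: holomorphic_line].
Qed.

Lemma hb_cder F z v : hb F -> vnorm z < 1 -> cder (fun l => F (z + l *: v)) 0 (rderive v F z).
Proof.
move=> hF z1; have [c h] := hb_line hF v z1.
suff -> : rderive v F z = c by [].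
apply: rderive_val; exact: cder_dR h.
Qed.

Lemma rderive_cscale F z v c : hb F -> vnorm z < 1 ->
  rderive (c *: v) F z = c * rderive v F z.
Proof.
move=> hF z1; apply: (cder_uniq (hb_cder (c *: v) hF z1)); rewrite mulrC.
have h : cder (fun l => c * l) 0 c by have := cderZ c (cder_id 0); rewrite mulr1.
have h0 : cder (fun l => F (z + l *: v)) (c * 0) (rderive v F z) by rewrite mulr0; exact: hb_cder.
have := @cder_comp _ (fun l => F (z + l *: v)) (fun l => c * l) 0 _ _ h0 h.
by apply: cder_near; apply: near_all => l; rewrite scalerA mulrC.
Qed.

Lemma hb_cder_line F z v (l : C) : hb F -> vnorm (z + l *: v) < 1 ->
  cder (fun l => F (z + l *: v)) l (rderive v F (z + l *: v)).
Proof.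
move=> hF z1.
have h : cder (fun m : C => m - l) l 1 by have := cderD (cder_id l) (cder_cst (- l) l); rewrite addr0.
have h0 : cder (fun m => F (z + l *: v + m *: v)) (l - l) (rderive v F (z + l *: v)).
  by rewrite subrr; exact: hb_cder.
have := @cder_comp _ (fun m => F (z + l *: v + m *: v)) (fun m => m - l) l _ _ h0 h.
rewrite mulr1; apply: cder_near; apply: near_all => m.
by rewrite -addrA -scalerDl subrKC.
Qed.

Lemma hb_cder_ray F z (l : C) : hb F -> vnorm (l *: z) < 1 ->
  cder (fun l => F (l *: z)) l (rderive z F (l *: z)).
Proof.
move=> hF z1; have := @hb_cder_line F 0 z l hF; rewrite add0r => /(_ z1).
by apply: cder_near; apply: near_all => m; rewrite add0r.
Qed.

Lemma hb_slice F z : hb F -> vnorm z = 1 -> hol (disc 1) (fun l => F (l *: z)).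
Proof.
move=> hF z1 l l1; exists (rderive z F (l *: z)).
by apply: hb_cder_ray => //; rewrite vnormZ z1 mulr1.
Qed.

Lemma line_in_ball z v (l : C) r : vnorm z + r * vnorm v < 1 -> normc l <= r -> vnorm (z + l *: v) < 1.
Proof.
move=> h lr; apply: le_lt_trans (vnormD _ _) _; apply: le_lt_trans h.
by rewrite lerD2l vnormZ; apply: ler_wpM2r => //; exact: vnorm_ge0.
Qed.

Lemma hb_hol F z v r : hb F -> vnorm z + r * vnorm v < 1 -> hol (disc r) (fun l => F (z + l *: v)).
Proof.
move=> hF h l lr; exists (rderive v F (z + l *: v)); apply: hb_cder_line => //.
exact: line_in_ball h (ltW lr).
Qed.

Lemma ball_room z v : vnorm z < 1 -> exists2 r, 0 < r & vnorm z + r * vnorm v < 1.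
Proof.
move=> z1; have v0 := vnorm_ge0 v; exists ((1 - vnorm z) / (1 + vnorm v)).
  by pos.
rewrite -ltrBrDl mulrAC -mulrA gtr_pMr ?subr_gt0// ltr_pdivrMr ?ltr_pwDl// mul1r.
by lra.
Qed.

Lemma hb_cauchy F z v r : hb F -> 0 < r -> vnorm z + r * vnorm v < 1 ->
  r%:C * rderive v F z = cint (fun t => F (z + (r%:C * ee t) *: v) * conjc (ee t)).
Proof.
move=> hF r0 h.
have [d d0 hd] : exists2 d, 0 < d & vnorm z + (r + d) * vnorm v < 1.
  exists ((1 - (vnorm z + r * vnorm v)) / (1 + vnorm v)).
    by pos.
  rewrite mulrDl addrA -ltrBrDl mulrAC -mulrA gtr_pMr ?subr_gt0//.
  by rewrite ltr_pdivrMr ?ltr_pwDl ?vnorm_ge0// mul1r ltrDr.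
have z1 : vnorm z < 1 by apply: le_lt_trans h; rewrite lerDl mulr_ge0 ?vnorm_ge0 ?ltW.
have rd : 0 < r < r + d by lra.
have rd' : 0 <= r < r + d by lra.
have [M hM] := c01_bounded (c01_circle (hb_hol hF hd) rd').
by have [] := cauchy_coef (hb_hol hF hd) rd (hb_cder v hF z1) hM.
Qed.

Lemma hb_ext F G : hb F -> (forall z, vnorm z < 1 -> F z = G z) -> hb G.
Proof.
move=> hF FG; split=> [z z1|z v z1].
  apply: cta_near (hb_cta hF z1); apply: filterS (opn_near opn_unit_ball z1) => w; exact: FG.
exists (rderive v F z); apply: cder_near (hb_cder v hF z1).
have [r r0 hr] := ball_room v z1; apply/nearCP; exists r => // l; rewrite subr0 => lr.
by apply: FG; exact: line_in_ball hr (ltW lr).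
Qed.

Lemma hb_cta_circle F z v r : hb F -> vnorm z + r * vnorm v < 1 -> 0 <= r ->
  forall t, cta (fun t => F (z + (r%:C * ee t) *: v)) t.
Proof.
move=> hF h r0 t; apply: (@ctao _ _ _ F (fun t => z + (r%:C * ee t) *: v)).
  by apply: hb_cta => //; apply: line_in_ball h _; rewrite normc_circle ger0_norm.
by apply: cta_vadd; [exact: ctac|apply: cta_scale; [cts|exact: ctac]].
Qed.

Lemma near_ball z a : vnorm z < a -> \forall w \near z, vnorm w < a.
Proof.
move=> za; apply/nearVP; exists (a - vnorm z); first by pos.
by move=> w; rewrite ltrBrDr; apply: le_lt_trans; rewrite -lerBlDr; exact: vnorm_sub_ge.
Qed.

(** Near z the derivative is a Cauchy integral over circles of one fixed radius, and this integral
    is continuous in the centre. *)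
Lemma hb_cta_rderive F z v : hb F -> vnorm z < 1 -> cta (rderive v F) z.
Proof.
move=> hF z1; have [r r0 hr] := ball_room v z1.
have rv : vnorm z < 1 - r * vnorm v by lra.
have near w : vnorm w < 1 - r * vnorm v -> vnorm w + r * vnorm v < 1 by lra.
pose k w t := r^-1%:C * (F (w + (r%:C * ee t) *: v) * conjc (ee t)).
have ck w : vnorm w < 1 - r * vnorm v -> c01 (k w).
  move=> /near hw t _; have h := hb_cta_circle hF hw (ltW r0); rewrite /k; cts.
have : cta (fun w => cint (k w)) z.
  apply: cta_cint => [t t01|]; last by apply: filterS (near_ball rv); exact: ck.
  have h : cta (fun p : V * R => F (p.1 + (r%:C * ee p.2) *: v)) (z, t).
    apply: (@ctao _ _ _ F (fun p : V * R => p.1 + (r%:C * ee p.2) *: v)).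
      by apply: hb_cta => //; apply: line_in_ball hr _; rewrite normc_circle ger0_norm// ltW.
    by apply: cta_vadd; [cts|apply: cta_scale; [cts|exact: ctac]].
  by rewrite /k; cts; exact: h.
apply: cta_near; apply: filterS (near_ball rv) => w /near hw.
rewrite /k cintZ; last by move=> t _; have h := hb_cta_circle hF hw (ltW r0); cts.
rewrite -(hb_cauchy hF r0 hw) mulrA -rmorphM mulVf ?gt_eqF// mul1r //.
Qed.

Lemma hb_C1 F : hb F -> C1 unit_ball F.
Proof.
move=> hF; split=> [z|v z|v z] z1; [exact: hb_cta| |exact: hb_cta_rderive].
exact: cder_dR (hb_cder v hF z1).
Qed.

(** The derivative along v is a Cauchy integral, which is differentiated along u under the integral
    sign; the radius q leaves room for moving along u inside a compact ball. *)
Lemma hb_cder_rderive F u v z : hb F -> vnorm z < 1 -> exists2 r, 0 < r &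
  vnorm z + r * vnorm v < 1 /\
  cder (fun l => rderive v F (z + l *: u)) 0
    (r^-1%:C * cint (fun t => rderive u F (z + (r%:C * ee t) *: v) * conjc (ee t))).
Proof.
move=> hF z1; have [r0 r00 hr0] := ball_room v z1; pose r := r0 / 2.
have r_gt0 : 0 < r by rewrite divr_gt0.
have hr : vnorm z + r * vnorm v < 1.
  apply: le_lt_trans hr0; rewrite lerD2l ler_wpM2r ?vnorm_ge0// /r.
  by move: r00; lra.
have [q q0 hq] : exists2 q, 0 < q & vnorm z + r * vnorm v + q * vnorm u < 1.
  exists ((1 - (vnorm z + r * vnorm v)) / (1 + vnorm u)).
    by pos.
  rewrite -ltrBrDl mulrAC -mulrA gtr_pMr ?subr_gt0//.
  by rewrite ltr_pdivrMr ?ltr_pwDl ?vnorm_ge0// mul1r ltrDr.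
exists r => //; split=> //.
pose rho := vnorm z + r * vnorm v + q * vnorm u.
have inb (l : C) t : normc l <= q -> vnorm (z + l *: u + (r%:C * ee t) *: v) <= rho.
  move=> lq; rewrite addrAC; apply: le_trans (vnormD _ _) _; rewrite vnormZ.
  apply: lerD; last by apply: ler_wpM2r => //; exact: vnorm_ge0.
  apply: le_trans (vnormD _ _) _; rewrite vnormZ normc_circle ger0_norm ?(ltW r_gt0)//.
have [M hM] : exists M, forall w, vnorm w <= rho -> normc (F w) <= M.
  apply: (@within_bounded R n [set w | vnorm w <= rho]); first exact: compact_vball.
  apply: continuous_in_subspaceT => w; rewrite inE /= => wr.
  by apply: ctaE; apply: hb_cta => //; exact: le_lt_trans wr hq.
have czu (l : C) : normc l <= q -> vnorm (z + l *: u) + r * vnorm v < 1.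
  move=> lq; apply: le_lt_trans hq; rewrite addrAC lerD2r.
  apply: le_trans (vnormD _ _) _; rewrite lerD2l vnormZ.
  by apply: ler_wpM2r => //; exact: vnorm_ge0.
have d1 : cder (fun l => cint (fun t => F (z + l *: u + (r%:C * ee t) *: v) * conjc (ee t))) 0
   (cint (fun t => rderive u F (z + (r%:C * ee t) *: v) * conjc (ee t))).
  have E t (l : C) : z + l *: u + (r%:C * ee t) *: v = z + (r%:C * ee t) *: v + l *: u by rewrite addrAC.
  apply: (@cder_cint _ _ _ _ q M) => //.
  - move=> t t01 l /=; rewrite subr0 => lq.
    exists (rderive u F (z + (r%:C * ee t) *: v + l *: u) * conjc (ee t) + F (z + (r%:C * ee t) *: v + l *: u) * 0).
    rewrite (_ : (fun l => _) = (fun l => F (z + (r%:C * ee t) *: v + l *: u) * conjc (ee t))).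
      apply: cderM; [|exact: cder_cst]; apply: hb_cder_line => //.
      by rewrite -E; apply: le_lt_trans hq; apply: inb; exact: ltW.
    by apply/funext => m; rewrite E.
  - move=> l t t01; rewrite subr0 => lq; rewrite normcM normc_conj normc_ee mulr1.
    by apply: hM; apply: inb; exact: ltW.
  - move=> t t01.
    rewrite (_ : (fun l => _) = (fun l => F (z + (r%:C * ee t) *: v + l *: u) * conjc (ee t))); last first.
      by apply/funext => m; rewrite E.
    have zr : vnorm (z + (r%:C * ee t) *: v) < 1.
      by apply: line_in_ball hr _; rewrite normc_circle ger0_norm// ltW.
    by have := cderM (hb_cder u hF zr) (cder_cst (conjc (ee t)) 0); rewrite mulr0 addr0.
  - move=> l; rewrite subr0 => lq t _.
    have h := hb_cta_circle hF (czu l (ltW lq)) (ltW r_gt0); cts.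
  - move=> t _.
    have h : cta (fun t => rderive u F (z + (r%:C * ee t) *: v)) t.
      apply: (@ctao _ _ _ (rderive u F) (fun t => z + (r%:C * ee t) *: v)).
        by apply: hb_cta_rderive => //; apply: line_in_ball hr _; rewrite normc_circle ger0_norm// ltW.
      by apply: cta_vadd; [exact: ctac|apply: cta_scale; [cts|exact: ctac]].
    cts.
apply: cder_near (cderZ r^-1%:C d1); apply/nearCP; exists q => // l; rewrite subr0 => lq.
rewrite -(hb_cauchy hF r_gt0 (czu l (ltW lq))) mulrA -rmorphM mulVf ?gt_eqF// mul1r //.
Qed.

Lemma hb_rderive F v : hb F -> hb (rderive v F).
Proof.
move=> hF; split=> [z|z u] z1; first exact: hb_cta_rderive.
by have [r _ [_ h]] := hb_cder_rderive u v hF z1; eexists; exact: h.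
Qed.

Lemma hb_comm F u v z : hb F -> vnorm z < 1 ->
  rderive u (rderive v F) z = rderive v (rderive u F) z.
Proof.
move=> hF z1; apply: (rderive_comm opn_unit_ball) z1; apply: hb_C1 => //; exact: hb_rderive.
Qed.
End holomorphic_functions.

(** * The operators that raise the power of the Cauchy kernel *)

Section radial_tower.
Context {R : realType} {n : nat}.
Local Notation C := R[i].
Local Notation V := 'rV[C]_n.
Implicit Types (F G : V -> C) (z v u zeta : V) (a e x r p tau : R).

Lemma cder_sum (I : Type) (s : seq I) (F : I -> C -> C) (c : I -> C) (y : C) :
  (forall i, cder (F i) y (c i)) ->
  cder (fun w : C => \sum_(i <- s) F i w) y (\sum_(i <- s) c i).
Proof.
move=> h; elim: s => [|i s IH].
  rewrite big_nil; apply: cder_near (cder_cst 0 y).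
  by apply: near_all => w; rewrite big_nil.
rewrite big_cons; apply: cder_near (cderD (h i) IH).
by apply: near_all => w; rewrite big_cons.
Qed.

Lemma cder_eq (F : C -> C) y c c' : cder F y c -> c = c' -> cder F y c'.
Proof. by move=> h <-. Qed.

Lemma hb_rderiveE F z v c : hb F -> vnorm z < 1 -> cder (fun l => F (z + l *: v)) 0 c ->
  rderive v F z = c.
Proof. by move=> hF z1; apply: cder_uniq; exact: hb_cder. Qed.

Lemma hb_by F (dF : V -> V -> C) : (forall z, vnorm z < 1 -> cta F z) ->
  (forall z v, vnorm z < 1 -> cder (fun l => F (z + l *: v)) 0 (dF v z)) ->
  hb F /\ forall z v, vnorm z < 1 -> rderive v F z = dF v z.
Proof.
move=> h1 h2; have hF : hb F by split=> // z v z1; exists (dF v z); exact: h2.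
by split=> // z v z1; apply: hb_rderiveE => //; exact: h2.
Qed.

Lemma hb_lin (a b : C) F G : hb F -> hb G -> hb (fun z => a * F z + b * G z) /\
  forall z v, vnorm z < 1 ->
    rderive v (fun z => a * F z + b * G z) z = a * rderive v F z + b * rderive v G z.
Proof.
move=> hF hG; apply: hb_by => [z z1|z v z1].
  by have h1 := hb_cta hF z1; have h2 := hb_cta hG z1; cts.
by apply: cderD; apply: cderZ; exact: hb_cder.
Qed.

(** The Euler operator, that is, the radial derivative. *)
Definition rad G z : C := \sum_j z ord0 j * rderive (e_ j) G z.

Lemma row_sum_e v : v = \sum_j v ord0 j *: e_ j.
Proof. exact: row_sum_delta. Qed.

Lemma rderive_basis F z v : hb F -> vnorm z < 1 ->
  rderive v F z = \sum_j v ord0 j * rderive (e_ j) F z.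
Proof.
move=> hF z1; rewrite {1}(row_sum_e v); elim: (index_enum _) => [|j s IH].
  rewrite !big_nil -(scale0r (0 : V)) rderive_cscale// mul0r //.
rewrite !big_cons (C1_add _ _ opn_unit_ball (hb_C1 hF) z1) IH.
by rewrite rderive_cscale.
Qed.

Lemma hb_rad G : hb G -> hb (rad G) /\
  forall z v, vnorm z < 1 -> rderive v (rad G) z = rad (rderive v G) z + rderive v G z.
Proof.
move=> hG; have hj j : hb (rderive (e_ j) G) by exact: hb_rderive.
apply: (@hb_by (rad G) (fun v z => rad (rderive v G) z + rderive v G z)) => [z z1|z v z1].
  have h j := hb_cta (hj j) z1.
  apply: ctaS => j; apply: ctaM; last exact: h.
  exact: cta_coord (ctaid z).
have dj j : cder (fun l : C => (z + l *: v) ord0 j * rderive (e_ j) G (z + l *: v)) 0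
    (v ord0 j * rderive (e_ j) G z + z ord0 j * rderive (e_ j) (rderive v G) z).
  have h1 : cder (fun l : C => (z + l *: v) ord0 j) 0 (v ord0 j).
    have := cderD (cder_cst (z ord0 j) 0) (cderM (cder_id 0) (cder_cst (v ord0 j) 0)).
    rewrite mul1r mulr0 addr0 add0r; apply: cder_near; apply: near_all => l.
    by rewrite !mxE.
  have := cderM h1 (hb_cder v (hj j) z1).
  by rewrite scale0r addr0 (hb_comm v (e_ j) hG z1).
apply: cder_eq (cder_sum _ dj) _.
by rewrite big_split -rderive_basis// addrC.
Qed.

Definition raise (j : nat) G z : C := G z + j.+1%:R^-1 * rad G z.

Lemma hb_raise j G : hb G -> hb (raise j G).
Proof.
move=> hG; have [h _] := hb_lin 1 j.+1%:R^-1 hG (hb_rad hG).1.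
by apply: hb_ext h _ => z _; rewrite mul1r.
Qed.

Definition D (l : seq 'I_n) G := foldr (fun j => rderive (e_ j)) G l.

Lemma hb_D l G : hb G -> hb (D l G).
Proof. by move=> hG; elim: l => [//|j l IH] /=; exact: hb_rderive. Qed.

(** Each derivative commutes with the Euler operator up to adding itself once, so a word adds its
    length to the constant j + 1. *)
Lemma D_raise j l G z : hb G -> vnorm z < 1 ->
  j.+1%:R * D l (raise j G) z = (j.+1 + size l)%:R * D l G z + rad (D l G) z.
Proof.
move=> hG; elim: l z => [|i l IH] z z1.
  by rewrite mulrDr mulVKf// addn0.
have E w : vnorm w < 1 -> D l (raise j G) w =
    (j.+1%:R^-1 * (j.+1 + size l)%:R) * D l G w + j.+1%:R^-1 * rad (D l G) w.
  by move=> w1; rewrite -mulrA -mulrDr -IH// mulKf.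
rewrite [D (i :: l) _]/= (rderive_ext (e_ i) opn_unit_ball z1 E).
have hl := hb_D l hG; have [hr dr] := hb_rad hl.
have [_ ->//] := hb_lin (j.+1%:R^-1 * (j.+1 + size l)%:R) j.+1%:R^-1 hl hr.
rewrite dr// mulrDr mulrA mulVKf// mulVKf// [size (i :: l)]/= addnS [_.+1%:R]mulrSr mulrDl mul1r.
by rewrite -!addrA [rad _ _ + _]addrC.
Qed.

Fixpoint tower F (j : nat) : V -> C := if j is j'.+1 then raise j' (tower F j') else F.

Lemma hb_tower F j : hb F -> hb (tower F j).
Proof. by move=> hF; elim: j => [//|j IH] /=; exact: hb_raise. Qed.

(** 1 + (1/k) y d/dy maps (1 - y c)^-k to (1 - y c)^-(k + 1). Starting from Cauchy's formula, each
    storey of the tower raises the power by one. *)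
Lemma tower_slice F zeta rho j (y : C) : hb F -> vnorm zeta = 1 -> 0 < rho < 1 -> normc y < 1 ->
  tower F j ((rho%:C * y) *: zeta) =
  cint (fun t => F ((rho%:C * ee t) *: zeta) * ((1 - y * conjc (ee t)) ^+ j.+1)^-1).
Proof.
move=> hF z1 /andP[r0 r1]; have hr : vnorm (0 : V) + rho * vnorm zeta < 1.
  by rewrite vnorm0 add0r z1 mulr1.
have inb (y' : C) : normc y' < 1 -> vnorm ((rho%:C * y') *: zeta) < 1.
  move=> y1; rewrite vnormZ z1 mulr1 normcM normc_nneg ?(ltW r0)//.
  by apply: lt_trans r1; rewrite gtr_pMr.
have hF1 := hb_slice hF z1.
have cF : c01 (fun t => F ((rho%:C * ee t) *: zeta)).
  by apply: (c01_circle hF1); rewrite (ltW r0).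
have [M hM] := c01_bounded cF.
have key (q b N : C) k : q != 0 -> - (N * q ^+ k * - b) / (q ^+ k.+1) ^+ 2 = N * b * (q ^+ k.+2)^-1.
  move=> q0; have -> : (q ^+ k.+1) ^+ 2 = q ^+ k * q ^+ k.+2.
    by rewrite -exprM muln2 -addnn -exprD addSnnS.
  have h1 := expf_neq0 k q0; have h2 := expf_neq0 k.+2 q0.
  by move: (q ^+ k) (q ^+ k.+2) h1 h2 => X Y h1 h2; field; rewrite h1 h2.
elim: j y => [|j IH] y y1.
  have r01 : 0 < rho < 1 by lra.
  have h := cauchy_formula hF1 r01 y1; rewrite [LHS]/=; apply: eq_trans (esym h) _.
  by [].
have k0 (y' : C) t : normc y' < 1 -> 1 - y' * conjc (ee t) != 0.
  by move=> y1'; apply: kernel_neq0 => //; rewrite normc_conj normc_ee.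
pose ker k (y' : C) t := ((1 - y' * conjc (ee t)) ^+ k)^-1.
have dk (y' : C) t : normc y' < 1 ->
    cder (fun y => ker j.+1 y t) y' (j.+1%:R * conjc (ee t) * ker j.+2 y' t).
  move=> y1'; have h : cder (fun y : C => 1 - y * conjc (ee t)) y' (0 - (1 * conjc (ee t) + y' * 0)).
    by cdr.
  have := @cderV _ (fun y : C => (1 - y * conjc (ee t)) ^+ j.+1) y' _ _ (cderX j.+1 h).
  move=> /(_ (expf_neq0 _ (k0 y' t y1'))); rewrite /ker.
  move/cder_eq; apply; rewrite mul1r mulr0 addr0 sub0r -[j.+1.-1]/j.
  exact: key (k0 y' t y1').
pose r := (1 - normc y) / 2.
have r_gt0 : 0 < r by rewrite divr_gt0 ?subr_gt0.
have yr w : normc (w - y) < r -> normc w <= 1 - r.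
  move=> wr; have := normc_sub_ge w y; rewrite /r in wr *; lra.
have yr1 w : normc (w - y) < r -> normc w < 1 by move=> /yr; lra.
have ck k (w : C) : normc w < 1 -> c01 (fun t => ker k w t).
  by move=> w1 t _; rewrite /ker; cts; apply: expf_neq0; exact: k0.
have d1 : cder (fun w => cint (fun t => F ((rho%:C * ee t) *: zeta) * ker j.+1 w t)) y
   (cint (fun t => F ((rho%:C * ee t) *: zeta) * (j.+1%:R * conjc (ee t) * ker j.+2 y t))).
  apply: (@cder_cint _ _ _ y r (M * r ^- j.+1)) => //.
  - move=> t t01 w wr; eexists; apply: (cderZ (F ((rho%:C * ee t) *: zeta))).
    exact: dk (yr1 w wr).
  - move=> w t t01 wr; rewrite normcM; apply: ler_pM (hM t t01) _; try exact: normc_ge0.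
    rewrite /ker normcV normcX.
    have k1 : r <= normc (1 - w * conjc (ee t)).
      apply: le_trans (kernel_ge w _); first by have := yr w wr; lra.
      by rewrite normc_conj normc_ee.
    rewrite lef_pV2 ?posrE ?exprn_gt0 ?(lt_le_trans r_gt0)//.
    by apply: lerXn2r; rewrite ?nnegrE ?(ltW r_gt0) ?normc_ge0.
  - move=> t t01; apply: (cderZ (F ((rho%:C * ee t) *: zeta))); exact: dk.
  - by move=> w wr; apply: c01M cF _; apply: ck; exact: yr1.
  - by apply: c01M cF _; apply: c01M (ck _ _ y1) => t _; cts.
have hT := hb_tower j hF.
have d2 : cder (fun w => tower F j ((rho%:C * w) *: zeta)) y
    (rderive zeta (tower F j) ((rho%:C * y) *: zeta) * rho%:C).
  have h : cder (fun w : C => rho%:C * w) y rho%:C by have := cderZ rho%:C (cder_id y); rewrite mulr1.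
  have h0 := hb_cder_ray hT (inb y y1).
  exact: (@cder_comp _ (fun l => tower F j (l *: zeta)) (fun w => rho%:C * w) y _ _ h0 h).
have E : rderive zeta (tower F j) ((rho%:C * y) *: zeta) * rho%:C =
   cint (fun t => F ((rho%:C * ee t) *: zeta) * (j.+1%:R * conjc (ee t) * ker j.+2 y t)).
  apply: (cder_uniq d2); apply: cder_near d1; apply/nearCP; exists r => // w wr.
  by rewrite (IH w (yr1 w wr)).
(* On a slice the Euler operator is y d/dy in the slice variable. *)
have radE : rad (tower F j) ((rho%:C * y) *: zeta) =
    y * (rderive zeta (tower F j) ((rho%:C * y) *: zeta) * rho%:C).
  rewrite (rderive_basis zeta hT (inb y y1)) mulr_suml mulr_sumr /rad.
  by apply: eq_bigr => i _; rewrite !mxE; ring.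
rewrite [tower F j.+1]/= /raise radE E (IH y y1).
have c1 : c01 (fun t => F ((rho%:C * ee t) *: zeta) * (j.+1%:R * conjc (ee t) * ker j.+2 y t)).
  by apply: c01M cF _; apply: c01M (ck _ _ y1) => t _; cts.
have c2 : c01 (fun t => F ((rho%:C * ee t) *: zeta) * ker j.+1 y t) by apply: c01M cF (ck _ _ y1).
rewrite mulrA -cintZ// -cintD//; last by apply: c01M c1; exact: c01c.
apply: eq_cint => t _; rewrite /ker; have := k0 y t y1.
set q := 1 - _; set A := F _ => q0.
have -> : (q ^+ j.+1)^-1 = q * (q ^+ j.+2)^-1 by rewrite invfM mulVKf.
move: (q ^+ j.+2)^-1 => B; rewrite /q.
transitivity (A * B * (1 - y * conjc (ee t) + (j.+1%:R^-1 * j.+1%:R) * (y * conjc (ee t)))); first by ring.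
by rewrite mulVf//; ring.
Qed.
End radial_tower.

(** * From a growth bound for the tower to membership in [Binfty] *)

Section growth.
Context {R : realType} {n : nat}.
Local Notation C := R[i].
Local Notation V := 'rV[C]_n.
Implicit Types (F G K : V -> C) (z v u zeta : V) (a e x r p tau : R).

Lemma vnorm_e (j : 'I_n) : vnorm (e_ j : V) <= 1.
Proof.
rewrite -[leRHS]sqrtr1; apply: ler_wsqrtr; rewrite (bigD1 j)//= mxE !eqxx /= normc1 expr1n.
rewrite big1 ?addr0// => i ij; rewrite mxE (negbTE ij) andbF normc0 expr0n //.
Qed.

(** Cauchy's estimate on a circle of radius half the distance to the boundary. *)
Lemma hb_growth G A p : hb G -> 0 <= A -> 0 <= p ->
  (forall z, vnorm z < 1 -> normc (G z) <= A * (1 - vnorm z) `^ (- p)) ->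
  forall j z, vnorm z < 1 ->
  normc (rderive (e_ j) G z) <= (2 * 2 `^ p * A) * (1 - vnorm z) `^ (- (p + 1)).
Proof.
move=> hG A0 p0 h j z z1; set d := 1 - vnorm z; have d0 : 0 < d by rewrite subr_gt0.
have d2 : 0 < d / 2 by pos.
have v1 := vnorm_e j.
have hr : vnorm z + d / 2 * vnorm (e_ j : V) <= 1 - d / 2.
  have : d / 2 * vnorm (e_ j : V) <= d / 2 by rewrite ler_piMr// ltW.
  by rewrite /d; move: (vnorm z) (_ * vnorm _) => a b; lra.
have hr1 : vnorm z + d / 2 * vnorm (e_ j : V) < 1 by apply: le_lt_trans hr _; lra.
have := hb_cauchy hG d2 hr1.
set I := cint _ => E.
have cI : c01 (fun t => G (z + ((d / 2)%:C * ee t) *: e_ j) * conjc (ee t)).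
  by move=> t _; have hc := hb_cta_circle hG hr1 (ltW d2); cts.
have hI : normc I <= A * (d / 2) `^ (- p).
  apply: normc_cint cI _ => t _; rewrite normcM normc_conj normc_ee mulr1.
  have zt : vnorm (z + ((d / 2)%:C * ee t) *: e_ j) <= 1 - d / 2.
    apply: le_trans hr; apply: le_trans (vnormD _ _) _; rewrite lerD2l vnormZ normc_circle.
    by rewrite ger0_norm ?(ltW d2).
  apply: le_trans (h _ _) _; first by lra; lra.
  apply: ler_wpM2l => //; apply: powR_anti => //; first by lra.
  by move: zt; lra.
have dp : (d / 2) `^ (- p) = 2 `^ p * d `^ (- p).
  rewrite powRM ?ltW ?invr_gt0 ?ltr0n// mulrC; congr (_ * _).
  by rewrite -powR_inv1// -powRrM mulN1r opprK.
have -> : normc (rderive (e_ j) G z) = normc I / (d / 2).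
  rewrite -E normcM normc_nneg ?(ltW d2)// mulrC mulKf// gt_eqF//.
rewrite ler_pdivrMr//; apply: le_trans hI _; rewrite dp opprD powR_add// (powR_inv1 (ltW d0)).
rewrite [leRHS](_ : _ = A * (2 `^ p * d `^ (- p)) * (d^-1 * d)); last by lra; move: (2 `^ p) (d `^ _) => b c; field.
by rewrite mulVf ?gt_eqF// mulr1.
Qed.

Lemma ball_dist z : vnorm z < 1 -> 0 < 1 - vnorm z /\ 1 - vnorm z <= 1.
Proof. by move=> z1; rewrite subr_gt0 gerBl vnorm_ge0. Qed.

Lemma powR_exp_anti (d a b : R) : 0 < d -> d <= 1 -> a <= b -> d `^ b <= d `^ a.
Proof.
move=> d0 d1 ab; have -> : b = a + (b - a) by lra.
rewrite powR_add//; apply: ler_piMr; first exact: powR_ge0.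
by apply: powR_le1 => //; rewrite subr_ge0.
Qed.

Lemma power_integral (phi dphi : R -> C) (K d p : R) : 0 < d -> 1 < p -> 0 <= K ->
  (forall x, 0 <= x <= 1 -> dR phi x (dphi x)) ->
  (forall x, 0 < x < 1 -> normc (dphi x) <= K * (1 - x + d) `^ (- p)) ->
  normc (phi 1 - phi 0) <= K / (p - 1) * d `^ (- (p - 1)).
Proof.
move=> d0 p1 K0 dphiE hK; have q0 : p - 1 != 0 by pos.
pose B x := (K / (p - 1)) * (1 - x + d) `^ (- (p - 1)).
pose dB x := K * (1 - x + d) `^ (- p).
have B1 : B 1 - B 0 <= K / (p - 1) * d `^ (- (p - 1)).
  rewrite /B subrr add0r gerBl; apply: mulr_ge0 (powR_ge0 _ _).
  by pos.
apply: le_trans (@normc_MVT R phi dphi B dB 0 1 ler01 _ _ _ _ _) B1.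
- by move=> x /andP[x0 x1]; apply: dphiE; rewrite !ltW.
- move=> x /andP[x0 x1].
  have xd : 0 < 1 - x + d by pos.
  have h1 : rder (fun y => 1 - y + d) x (-1).
    have := rderD (rderD (rder_cst 1 x) (rderN (rder_id x))) (rder_cst d x).
    by rewrite add0r addr0.
  have := @rder_comp _ (fun y => y `^ (- (p - 1))) (fun y => 1 - y + d) x _ _ (rder_powR _ xd) h1.
  move=> /(rderZ (K / (p - 1))) h2; apply: (rder_eq h2); rewrite /dB.
  have -> : - (p - 1) - 1 = - p by lra.
  by move: (_ `^ (- p)) => b; field.
- by move=> x x01; exact: hK.
- by move=> x /dphiE /dR_cta.
- move=> x /andP[x0 x1]; have xd : 0 < 1 - x + d by pos.
  by rewrite /B; cts; exact: xd.
Qed.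

(** 1 - x (1 - d) is at least half of 1 - x + d, whose powers have explicit primitives in x. *)
Lemma radial_dist (d x p : R) : 0 < d -> d <= 1 -> 0 <= x -> x < 1 -> 0 <= p ->
  (1 - x * (1 - d)) `^ (- p) <= 2 `^ p * (1 - x + d) `^ (- p).
Proof.
move=> d0 d1 x0 x1 p0.
have e1 : (1 - x + d) / 2 <= 1 - x * (1 - d).
  rewrite -subr_ge0 (_ : _ - _ = ((1 - x) * (1 - d) + d * x) / 2); last by lra.
  by pos.
have e2 : 0 < (1 - x + d) / 2 by pos.
apply: le_trans (powR_anti _ e2 e1) _; first by lra.
have xd : 0 <= 1 - x + d by pos.
rewrite powRM ?invr_ge0 ?ler0n// mulrC.
by rewrite -(powR_inv1 (ler0n _ 2)) -powRrM mulN1r opprK.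
Qed.

Lemma dv_ray F z x c : dv F z (x%:C *: z) c -> dR (fun y => F (y%:C *: z)) x c.
Proof.
move=> h; have h' : dv F z (0 + x%:C *: z) c by rewrite add0r.
by apply: dR_near (dv_line h'); apply: near_all => y; rewrite add0r.
Qed.

Lemma ray_ball z x : vnorm z < 1 -> 0 <= x <= 1 -> vnorm (x%:C *: z) < 1.
Proof.
move=> z1 /andP[x0 x1]; rewrite vnormZ normc_nneg//; apply: le_lt_trans z1.
by rewrite ler_piMl// vnorm_ge0.
Qed.

(** The derivative of x^N G(x z) in x is x^(N - 1) (N G + rad G)(x z), so G is recovered from K by
    integration along the ray, which lowers the exponent by 1. *)
Lemma hb_descend G K (N j : nat) A p : hb G -> (0 < N)%N -> 0 <= A -> 1 < p ->
  (forall z, vnorm z < 1 -> j%:R * K z = N%:R * G z + rad G z) ->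
  (forall z, vnorm z < 1 -> normc (K z) <= A * (1 - vnorm z) `^ (- p)) ->
  forall z, vnorm z < 1 ->
  normc (G z) <= (j%:R * A * 2 `^ p / (p - 1)) * (1 - vnorm z) `^ (- (p - 1)).
Proof.
move=> hG N0 A0 p1 hK hA z z1; have [d0 d1] := ball_dist z1; set d := 1 - vnorm z in d0 d1 *.
pose phi x := (x ^+ N)%:C * G (x%:C *: z).
have -> : G z = phi 1 - phi 0.
  by rewrite /phi expr1n expr0n gtn_eqF//= scale1r mul1r mul0r subr0.
apply: (power_integral (dphi := fun x => (x ^+ N.-1)%:C * (j%:R * K (x%:C *: z)))) => //.
- by pos.
- move=> x x01; have h1 : rder (fun y => y ^+ N) x (N%:R * x ^+ N.-1).
    by have := rderX N (rder_id x); rewrite mulr1.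
  have xz := ray_ball z1 x01.
  apply: dR_eq (dR_scale h1 (dv_ray (C1_dv (hb_C1 hG) z xz))) _.
  rewrite hK// (rderive_basis z hG xz).
  have -> : rad G (x%:C *: z) = x%:C * \sum_i z ord0 i * rderive (e_ i) G (x%:C *: z).
    by rewrite /rad mulr_sumr; apply: eq_bigr => i _; rewrite !mxE mulrA.
  have -> : x ^+ N = x ^+ N.-1 * x by rewrite -exprSr prednK.
  rewrite !rmorphM /= rmorph_nat; ring.
- move=> x /andP[x0 x1]; have x01 : 0 <= x <= 1 by rewrite !ltW.
  rewrite !normcM normc_nneg; last by rewrite exprn_ge0 ?ltW.
  have -> : normc (j%:R : C) = j%:R.
    by rewrite -(rmorph_nat (real_complex R)) normc_nneg ?ler0n.
  have xN : x ^+ N.-1 <= 1 by rewrite exprn_ile1 ?ltW.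
  apply: le_trans (_ : j%:R * normc (K (x%:C *: z)) <= _).
    by rewrite ler_piMl// mulr_ge0 ?normc_ge0.
  rewrite -!mulrA; apply: ler_wpM2l; first exact: ler0n.
  apply: le_trans (hA _ (ray_ball z1 x01)) _; apply: ler_wpM2l => //.
  have := radial_dist d0 d1 (ltW x0) x1 (ltW (lt_trans ltr01 p1)).
  by rewrite subKr vnormZ normc_nneg// ltW.
Qed.

Lemma hb_growth_words G A p k : hb G -> 0 <= A -> 0 <= p ->
  (forall z, vnorm z < 1 -> normc (G z) <= A * (1 - vnorm z) `^ (- p)) ->
  exists2 B, 0 <= B & forall l : seq 'I_n, (size l <= k)%N -> forall z, vnorm z < 1 ->
    normc (D l G z) <= B * (1 - vnorm z) `^ (- (p + k%:R)).
Proof.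
move=> hG A0 p0 hA; elim: k => [|k [B B0 hB]].
  by exists A => // -[|//] _ z z1; rewrite addr0; exact: hA.
pose B' := 2 * 2 `^ (p + k%:R) * B.
have B'0 : 0 <= B' by rewrite !mulr_ge0.
have pk : 0 <= p + k%:R by pos.
exists (B + B'); first by pos.
move=> l lk z z1; have [d0 d1] := ball_dist z1; rewrite mulrDl.
have w0 := powR_ge0 (1 - vnorm z) (- (p + k.+1%:R)).
case: l lk => [_|i l lk] /=.
  apply: le_trans (hB [::] isT z z1) _; apply: le_trans (_ : B * (1 - vnorm z) `^ (- (p + k.+1%:R)) <= _).
    apply: ler_wpM2l => //; apply: powR_exp_anti => //.
    by lra.
  by rewrite lerDl mulr_ge0.
have := hb_growth (hb_D l hG) B0 pk (hB l lk) i z1.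
rewrite -addrA -(natrD _ k 1) addn1 => h; apply: le_trans h _.
by rewrite lerDr mulr_ge0.
Qed.

(** Up to m derivatives of the top storey cost m powers, and descending the m storeys regains them.
    Taking the derivatives first keeps every exponent above 1, where integration along rays gains a
    full power. *)
Lemma tower_growth G m tau : hb G -> (0 < m)%N -> tau < m%:R ->
  (exists2 A, 0 <= A & forall z, vnorm z < 1 ->
     normc (tower G m z) <= A * (1 - vnorm z) `^ (tau - m%:R)) ->
  exists2 B, 0 <= B & forall l : seq 'I_n, (size l <= m)%N -> forall z, vnorm z < 1 ->
    normc (D l G z) <= B * (1 - vnorm z) `^ (tau - m%:R).
Proof.
move=> hG m0 taum [A A0 hA].
have p0 : 0 <= m%:R - tau by pos.
have hA' z : vnorm z < 1 -> normc (tower G m z) <= A * (1 - vnorm z) `^ (- (m%:R - tau)).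
  by rewrite opprB; exact: hA.
have step i : (i <= m)%N -> exists2 B, 0 <= B & forall l : seq 'I_n, (size l <= m)%N ->
    forall z, vnorm z < 1 ->
    normc (D l (tower G (m - i)) z) <= B * (1 - vnorm z) `^ (- (m%:R - tau + (m - i)%:R)).
  elim: i => [_|i IH im].
    by rewrite subn0; exact: hb_growth_words (hb_tower m hG) A0 p0 hA'.
  have [B B0 hB] := IH (ltnW im).
  have mi : (m - i = (m - i.+1).+1)%N by rewrite -subSn.
  set j := (m - i.+1)%N in mi *; rewrite mi in hB.
  pose p := m%:R - tau + j.+1%:R.
  have p1 : 1 < p by rewrite /p -natr1 addrA ltrDr ltr_wpDr// subr_gt0.
  have pj : p - 1 = m%:R - tau + j%:R by rewrite /p -natr1 addrA addrK.
  exists (j.+1%:R * B * 2 `^ p / (p - 1)).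
    by pos.
  move=> l lm z z1; rewrite -pj.
  apply: (@hb_descend (D l (tower G j)) (D l (tower G j.+1)) (j.+1 + size l) j.+1 B p) => //.
  - exact: hb_D (hb_tower j hG).
  - by move=> w w1; exact: D_raise (hb_tower j hG) w1.
  - by move=> w w1; exact: hB.
have [B B0 hB] := step m (leqnn m); exists B => // l lm z z1.
by have := hB l lm z z1; rewrite subnn addr0 opprB.
Qed.

Definition mword k (alpha : {ffun 'I_n -> 'I_k}) : seq 'I_n :=
  flatten [seq nseq (alpha j) j | j <- enum 'I_n].

Lemma mderiveE k (T : 'I_n -> (V -> C) -> V -> C) (alpha : {ffun 'I_n -> 'I_k}) F :
  mderive T alpha F = foldr T F (mword alpha).
Proof.
rewrite /mderive /mword; elim: (enum _) => [//|j s IH] /=.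
rewrite foldr_cat IH; elim: (nat_of_ord (alpha j)) => [//|i IHi] /=; by rewrite IHi.
Qed.

Lemma size_mword k (alpha : {ffun 'I_n -> 'I_k}) : size (mword alpha) = (\sum_(j < n) alpha j)%N.
Proof.
rewrite /mword size_flatten /shape -map_comp sumnE big_map big_enum /=.
by apply: eq_bigr => j _; rewrite size_nseq.
Qed.

Lemma hb_rderive_ie F j z : hb F -> vnorm z < 1 -> rderive (ie_ j) F z = 'i%C * rderive (e_ j) F z.
Proof. by move=> hF z1; rewrite /ie_ -/(e_ j) rderive_cscale. Qed.

Lemma sqr_i : 'i%C * 'i%C = -1 :> C.
Proof. by rewrite -expr2 sqr_i. Qed.

Lemma hb_dz F j z : hb F -> vnorm z < 1 -> dz j F z = rderive (e_ j) F z.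
Proof.
move=> hF z1; rewrite /dz hb_rderive_ie// mulrA sqr_i mulN1r opprK.
by move: (rderive _ _ _) => c; field.
Qed.

Lemma hb_dzbar F j z : hb F -> vnorm z < 1 -> dzbar j F z = 0.
Proof.
by move=> hF z1; rewrite /dzbar hb_rderive_ie// mulrA sqr_i mulN1r subrr mulr0.
Qed.

Lemma foldr_dz F (l : seq 'I_n) : hb F -> hb (foldr (@dz R n) F l) /\
  forall z, vnorm z < 1 -> foldr (@dz R n) F l z = D l F z.
Proof.
move=> hF; elim: l => [|j l [IH1 IH2]]; first by [].
rewrite [foldr _ _ _]/= [D _ _]/=.
have E z : vnorm z < 1 -> rderive (e_ j) (foldr (@dz R n) F l) z = dz j (foldr (@dz R n) F l) z.
  by move=> z1; rewrite hb_dz.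
split; first exact: hb_ext (hb_rderive (e_ j) IH1) E.
by move=> z z1; rewrite -E// (rderive_ext (e_ j) opn_unit_ball z1 IH2).
Qed.

Lemma hb_cst (c : C) : hb (fun _ : V => c).
Proof. by split=> [z _|z v _]; [exact: ctac|exists 0; exact: cder_cst]. Qed.

Lemma foldr_dzbar F (l : seq 'I_n) : hb F -> l != [::] ->
  forall z, vnorm z < 1 -> foldr (@dzbar R n) F l z = 0.
Proof.
move=> hF; case: l => // j l _.
have h : hb (foldr (@dzbar R n) F l).
  elim: l => [//|i l IH] /=.
  by apply: hb_ext (hb_cst 0) _ => z z1; rewrite hb_dzbar.
by move=> z z1 /=; exact: hb_dzbar.
Qed.

(** Terms with a conjugate derivative vanish, and the others are words in the holomorphic
    derivatives. *)
Lemma dnorm_le F B k z : hb F -> 0 <= B -> vnorm z < 1 ->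
  (forall l : seq 'I_n, size l = k -> normc (D l F z) <= B) ->
  dnorm k F z <= #|{: {ffun 'I_n -> 'I_k.+1} * {ffun 'I_n -> 'I_k.+1}}|%:R * B.
Proof.
move=> hF B0 z1 hB; rewrite /dnorm.
apply: (@le_trans _ _ (\sum_(ab : {ffun 'I_n -> 'I_k.+1} * {ffun 'I_n -> 'I_k.+1}) B)); last first.
  by rewrite sumr_const mulr_natl.
rewrite big_mkcond; apply: ler_sum => -[a b] _ /=; case: ifP => // /eqP ab.
rewrite !mderiveE; have [b0|b0] := eqVneq (mword b) [::].
  rewrite b0 /= (foldr_dz _ hF).2//; apply: hB; rewrite size_mword; apply: etrans ab.
  by have := size_mword b; rewrite b0 => <-; rewrite addn0.
have hE w : vnorm w < 1 -> (fun=> 0 : C) w = foldr (@dzbar R n) F (mword b) w.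
  by move=> w1; rewrite foldr_dzbar.
have h0 := hb_ext (hb_cst 0) hE.
rewrite (foldr_dz _ h0).2//.
suff -> : D (mword a) (foldr (@dzbar R n) F (mword b)) z = 0 by rewrite normc0.
elim: (mword a) z {hB ab} z1 => [|i l IH] w w1 /=; first by rewrite -hE.
rewrite -(rderive_ext (F := fun=> 0) (e_ i) opn_unit_ball w1); last by move=> u /IH.
by apply: rderive_val; exact: dR_cst.
Qed.

Lemma growth_Binfty F m tau : holomorphic F -> (0 < m)%N -> tau < m%:R ->
  (exists2 A, 0 <= A & forall z, vnorm z < 1 ->
     normc (tower F m z) <= A * (1 - vnorm z) `^ (tau - m%:R)) ->
  Binfty tau F.
Proof.
move=> hF m0 taum hA; split=> //; exists m => //.
have hb := hb_holomorphic hF; have [B B0 hB] := tower_growth hb m0 taum hA.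
apply: lte_sum_pinfty => j _; rewrite /weighted_sup.
pose N : R := #|{: {ffun 'I_n -> 'I_j.+1} * {ffun 'I_n -> 'I_j.+1}}|%:R.
apply: (@le_lt_trans _ _ (N * B * 2 `^ (m%:R - tau))%:E); last exact: ltry.
apply: ge_ereal_sup => _ [z z1 <-]; rewrite lee_fin.
have [d0 d1] := ball_dist z1; set d := 1 - vnorm z in d0 d1.
have hd := @dnorm_le F (B * d `^ (tau - m%:R)) j z hb _ z1 _.
apply: le_trans (ler_wpM2r (powR_ge0 _ _) (hd _ _)) _.
- by pos.
- by move=> l lj; apply: hB z1; rewrite lj -ltnS.
have e : 1 - vnorm z ^+ 2 <= 2 * d.
  rewrite [leLHS](_ : _ = (1 + vnorm z) * d); last by rewrite /d; ring.
  by apply: ler_wpM2r; [exact: ltW|move: d0; rewrite /d; lra].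
have e0 : 0 <= 1 - vnorm z ^+ 2 by rewrite subr_ge0 exprn_ile1 ?vnorm_ge0// ltW.
have mt : 0 <= m%:R - tau by pos.
apply: le_trans (ler_wpM2l _ (powR_le mt e0 e)) _.
  by pos.
rewrite powRM ?ler0n ?(ltW d0)//.
rewrite [leLHS](_ : _ = N * B * 2 `^ (m%:R - tau) * (d `^ (tau - m%:R) * d `^ (m%:R - tau))); last by lra.
by rewrite -powR_add// (_ : tau - m%:R + (m%:R - tau) = 0) ?powRr0 ?mulr1//; ring.
Qed.
End growth.

(** * Harmonic functions and the 2n real coordinate directions *)

Section real_directions.
Context {R : realType} {n : nat}.
Local Notation C := R[i].
Local Notation V := 'rV[C]_n.
Implicit Types (F G : V -> C) (U : set V) (z v w u p c : V) (a e s x r M : R) (q : 'I_n * bool).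

Definition dir q : V := if q.2 then ie_ q.1 else e_ q.1.
Definition dcoord q v : R := if q.2 then complex.Im (v ord0 q.1) else complex.Re (v ord0 q.1).

Lemma dirE q k : dir q ord0 k = (k == q.1)%:R * (if q.2 then 'i%C else 1).
Proof. by rewrite /dir; case: q => j [] /=; rewrite !mxE eqxx /= ?mulr1// mulrC. Qed.

Lemma dcoordD q v w : dcoord q (v + w) = dcoord q v + dcoord q w.
Proof. by rewrite /dcoord !mxE; case: q.2; rewrite ?Re_add ?Im_add. Qed.

Lemma dcoordZ q v a : dcoord q (a%:C *: v) = a * dcoord q v.
Proof. by rewrite /dcoord !mxE; case: q.2; rewrite ?Re_mul ?Im_mul /= mul0r ?subr0 ?addr0. Qed.

Lemma dcoordN q v : dcoord q (- v) = - dcoord q v.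
Proof. by rewrite /dcoord !mxE; case: q.2; rewrite ?Re_opp ?Im_opp. Qed.

Lemma dcoord0 q : dcoord q 0 = 0.
Proof. by rewrite /dcoord !mxE; case: q.2. Qed.

Lemma dcoord_dir q q' : dcoord q (dir q') = (q == q')%:R.
Proof.
case: q q' => j b [k b']; rewrite /dcoord dirE /= xpair_eqE.
case: (eqVneq j k) => _ /=; last by rewrite mul0r; case: b.
by rewrite mul1r; case: b; case: b'.
Qed.

Lemma sum_dir (T : nmodType) (f : 'I_n * bool -> T) : \sum_q f q = \sum_j (f (j, false) + f (j, true)).
Proof.
rewrite (eq_bigr (fun q => f (q.1, q.2))); last by case.
rewrite -(pair_bigA _ (fun j b => f (j, b))) /=; apply: eq_bigr => j _.
by rewrite big_bool addrC.
Qed.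

Lemma vec_dir v : v = \sum_q (dcoord q v)%:C *: dir q.
Proof.
rewrite sum_dir {1}[v]row_sum_delta; apply: eq_bigr => j _.
rewrite /dcoord /dir /= /ie_ -/(e_ j) scalerA -scalerDl; congr (_ *: _).
by apply: ReIm_eq; rewrite ?Re_add ?Im_add ?Re_mul ?Im_mul /=; ring.
Qed.

Lemma vnorm_dir q : vnorm (dir q) = 1.
Proof.
apply/eqP; rewrite -(@eqrXn2 _ 2)// ?vnorm_ge0// sqr_vnorm expr1n; apply/eqP.
rewrite (bigD1 q.1)//= big1 ?addr0 => [|k kq].
  have i1 : normc ('i%C : C) = 1 by apply/eqP; rewrite -(@eqrXn2 _ 2)// ?normc_ge0// -normcX expr2 sqr_i normcN normc1 expr1n.
  by rewrite dirE eqxx mul1r; case: q.2; rewrite ?i1 ?normc1 expr1n.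
by rewrite dirE (negbTE kq) mul0r normc0 expr0n.
Qed.

Lemma dcoord_le q v : `|dcoord q v| <= vnorm v.
Proof.
apply: le_trans (normc_le_vnorm v q.1); rewrite /dcoord.
by case: q.2; [exact: Im_le_normc|exact: Re_le_normc].
Qed.

(** Reflection in the real hyperplane orthogonal to [dir q]. *)
Definition refl q v : V := v - (2 * dcoord q v)%:C *: dir q.

Lemma vnorm_refl q v : vnorm (refl q v) = vnorm v.
Proof.
rewrite /vnorm; congr Num.sqrt; apply: eq_bigr => k _; congr (_ ^+ 2).
rewrite !mxE dirE; have [->|_] := eqVneq k q.1; last by rewrite mul0r mulr0 subr0.
rewrite /dcoord; case: q.2; rewrite mul1r; case: (v ord0 q.1) => x y /=.
  by congr Num.sqrt; ring.
by congr Num.sqrt; ring.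
Qed.

Lemma refl_add q v w : refl q (v + w) = refl q v + refl q w.
Proof. by rewrite /refl dcoordD mulrDr rmorphD scalerDl opprD addrACA. Qed.

Lemma refl_dir q q' a : refl q (a%:C *: dir q') = a%:C *: dir q' \/ refl q (a%:C *: dir q') = - (a%:C *: dir q').
Proof.
rewrite /refl dcoordZ dcoord_dir; have [->|_] := eqVneq q q'; last first.
  by left; rewrite !mulr0 scale0r subr0.
right; rewrite mulr1 mulrDl mul1r rmorphD scalerDl opprD addrA subrr add0r //.
Qed.

Lemma vnorm_parallelogram v w :
  vnorm (v + w) ^+ 2 + vnorm (v - w) ^+ 2 = 2 * vnorm v ^+ 2 + 2 * vnorm w ^+ 2.
Proof.
rewrite !sqr_vnorm -big_split /= !mulr_sumr -big_split /=; apply: eq_bigr => k _.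
rewrite !mxE !sqr_normc_ReIm !Re_add !Im_add !Re_opp !Im_opp; ring.
Qed.

Lemma C1_by U F (dF : V -> V -> C) : opn U -> (forall z, U z -> cta F z) ->
  (forall v z, U z -> dv F v z (dF v z)) -> (forall v z, U z -> cta (dF v) z) ->
  C1 U F /\ forall v z, U z -> rderive v F z = dF v z.
Proof.
move=> oU h1 h2 h3.
have E v z : U z -> rderive v F z = dF v z by move=> Uz; exact: rderive_val (h2 v z Uz).
split; last exact: E.
split=> [z Uz|v z Uz|v z Uz]; first exact: h1.
  by rewrite (E v z Uz); exact: h2.
by apply: cta_near (h3 v z Uz); apply: filterS (opn_near oU Uz) => w /(E v).
Qed.

Lemma C1_lin U (a b : C) F G : opn U -> C1 U F -> C1 U G ->
  C1 U (fun z => a * F z + b * G z) /\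
  forall v z, U z -> rderive v (fun z => a * F z + b * G z) z = a * rderive v F z + b * rderive v G z.
Proof.
move=> oU hF hG.
apply: (@C1_by U (fun z => a * F z + b * G z) (fun v z => a * rderive v F z + b * rderive v G z)) => //.
- by move=> z Uz; have h1 := C1_cta hF Uz; have h2 := C1_cta hG Uz; cts.
- by move=> v z Uz; exact: (dRD (dRZ a (C1_dv hF v Uz)) (dRZ b (C1_dv hG v Uz))).
- by move=> v z Uz; have h1 := C1_cta_rderive hF v Uz; have h2 := C1_cta_rderive hG v Uz; cts.
Qed.

Lemma C1_shift U W F p : (forall z, W z -> U (z + p)) -> C1 U F -> C1 W (fun z => F (z + p)).
Proof.
move=> h hF; have cp z : cta (fun z => z + p) z by apply: cta_vadd; [exact: ctaid|exact: ctac].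
split=> [z /h Uz|v z /h Uz|v z /h Uz].
- exact: (@ctao _ _ _ F (fun z => z + p)) (C1_cta hF Uz) (cp z).
- rewrite rderive_shift; apply: dR_near (C1_dv hF v Uz); apply: near_all => s.
  by rewrite addrAC.
- by rewrite rderive_shift; exact: (@ctao _ _ _ (rderive v F) (fun z => z + p)) (C1_cta_rderive hF v Uz) (cp z).
Qed.

Lemma rderive_dirs U F v z : opn U -> C1 U F -> U z ->
  rderive v F z = \sum_q (dcoord q v)%:C * rderive (dir q) F z.
Proof.
move=> oU hF Uz; rewrite {1}(vec_dir v); elim: (index_enum _) => [|q s IH].
  by rewrite !big_nil -(scale0r (0 : V)) (rderive_scale 0 0 hF Uz) mul0r.
by rewrite !big_cons (C1_add _ _ oU hF Uz) (rderive_scale _ _ hF Uz) IH.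
Qed.

(** The symmetric difference is integrated from the first-order expansion of [rderive v F], so two
    continuous derivatives suffice. *)
Lemma C1_symmetric U F v z e : opn U -> C1 U F -> C1 U (rderive v F) -> U z -> 0 < e ->
  exists2 d, 0 < d & forall s, 0 < s < d ->
  normc (F (z + s%:C *: v) + F (z - s%:C *: v) - 2 * F z -
    (s ^+ 2)%:C * rderive v (rderive v F) z) <= e * s ^+ 2.
Proof.
move=> oU hF hG Uz e0; have e2 : 0 < e / 2 by pos.
have [d d0 hd] := C1_small v oU hG Uz e2.
have v0 : 0 < 1 + vnorm v by pos.
exists (Num.min (d / 2) (d / (1 + vnorm v))).
  by pos.
move=> s; rewrite lt_min => /and3P[s0 s1 s2]; set A := rderive v (rderive v F) z.
have sv : s * vnorm v < d.
  move: s2; rewrite ltr_pdivlMr// => h; apply: le_lt_trans h.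
  by lra.
have key x : 0 <= x <= 1 ->
    [/\ U (z + (- (x * s))%:C *: v), U (z + (x * s)%:C *: v) &
     normc (s%:C * (rderive v F (z + (x * s)%:C *: v) - rderive v F (z + (- (x * s))%:C *: v)) -
       (2 * x * s ^+ 2)%:C * A) <= e * s ^+ 2].
  move=> /andP[x0 x1]; have xs : x * s <= s by rewrite ler_piMl// ltW.
  have xs0 : 0 <= x * s by pos.
  have [||U1 U2 h] := hd (z + (- (x * s))%:C *: v) (2 * (x * s)).
  - rewrite addrAC subrr add0r vnormZ normc_real normrN ger0_norm//; apply: le_lt_trans sv.
    by apply: ler_wpM2r => //; exact: vnorm_ge0.
  - by rewrite ger0_norm ?mulr_ge0 ?ler0n//; move: s1 xs; lra.
  have E : z + (- (x * s))%:C *: v + (2 * (x * s))%:C *: v = z + (x * s)%:C *: v.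
    by rewrite -addrA -scalerDl -rmorphD /=; congr (_ + _%:C *: _); ring.
  rewrite E in U2 h; split=> //.
  rewrite (_ : _ - _ = s%:C * (rderive v F (z + (x * s)%:C *: v) - rderive v F (z + (- (x * s))%:C *: v) -
     (2 * (x * s))%:C * A)); last first.
    have -> : (2 * x * s ^+ 2)%:C = s%:C * (2 * (x * s))%:C by rewrite -rmorphM; congr (_%:C); ring.
    by rewrite [RHS]mulrBr -[in LHS]mulrA.
  rewrite normcM normc_nneg ?(ltW s0)//; apply: le_trans (ler_wpM2l (ltW s0) h) _.
  have n2 : `|2 * (x * s)| = 2 * (x * s) by rewrite ger0_norm// mulr_ge0.
  rewrite n2; have -> : s * (e / 2 * (2 * (x * s))) = e * (x * s) * s by lra.
  by rewrite expr2 [e * (s * s)]mulrA; apply: ler_wpM2r; [exact: ltW|apply: ler_wpM2l; [exact: ltW|]].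
pose phi x := F (z + (x * s)%:C *: v) + F (z + (- (x * s))%:C *: v) + (x ^+ 2)%:C * (- ((s ^+ 2)%:C * A)).
have := @dR_mean _ phi (fun x => s%:C * (rderive v F (z + (x * s)%:C *: v) -
  rderive v F (z + (- (x * s))%:C *: v)) - (2 * x * s ^+ 2)%:C * A) 0 (e * s ^+ 2).
have -> : phi 1 - phi 0 - 0 = F (z + s%:C *: v) + F (z - s%:C *: v) - 2 * F z - (s ^+ 2)%:C * A.
  rewrite /phi mul1r mul0r oppr0 rmorphN rmorph0 scale0r addr0 expr1n expr0n /= rmorph1 rmorph0.
  by rewrite scaleNr; ring.
apply=> x /key[U1 U2 h]; last by rewrite subr0.
have dF a : U (z + (x * a)%:C *: v) -> dR (fun y => F (z + (y * a)%:C *: v)) x (a%:C * rderive v F (z + (x * a)%:C *: v)).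
  move=> Ux; have h1 : rder (fun y => y * a) x a.
    have := rderM (rder_id x) (rder_cst a x); rewrite mul1r mulr0 addr0 //.
  exact: (@dR_comp _ (fun y => F (z + y%:C *: v)) (fun y => y * a) x _ _ (dv_line (C1_dv hF v Ux)) h1).
rewrite -mulrN in U1 h *.
have hx2 : rder (fun y => y ^+ 2) x (2 * x).
  by have := rderX 2 (rder_id x); rewrite mulr1 /= expr1.
have h2 : dR (fun y => F (z + (y * s)%:C *: v) + F (z + (- (y * s))%:C *: v)) x
   (s%:C * rderive v F (z + (x * s)%:C *: v) + (- s)%:C * rderive v F (z + (x * - s)%:C *: v)).
  apply: dRD (dF s U2) _; apply: dR_near (dF (- s) U1).
  by apply: near_all => y; rewrite mulrN.
apply: dR_eq (dRD h2 (dR_scale hx2 (dR_cst (- ((s ^+ 2)%:C * A)) x))) _.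
move: (rderive v F (z + (x * s)%:C *: v)) (rderive v F (z + (x * - s)%:C *: v)) (A) => P Q B.
by rewrite rmorphN !rmorphM /=; ring.
Qed.

Record har U F : Prop := Har {
  har_C1 : C1 U F;
  har_C2 : forall v, C1 U (rderive v F);
  har_lap : forall z, U z -> \sum_q rderive (dir q) (rderive (dir q) F) z = 0 }.

Lemma laplacian_dir F z : laplacian F z = \sum_q rderive (dir q) (rderive (dir q) F) z.
Proof. by rewrite sum_dir. Qed.

Lemma sum_lin (a b : C) (f g : 'I_n * bool -> C) :
  \sum_q (a * f q + b * g q) = a * (\sum_q f q) + b * (\sum_q g q).
Proof. by rewrite big_split !mulr_sumr. Qed.

Lemma har_lin U (a b : C) F G : opn U -> har U F -> har U G -> har U (fun z => a * F z + b * G z).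
Proof.
move=> oU [F1 F2 F3] [G1 G2 G3]; have [h1 E1] := C1_lin a b oU F1 G1.
have E v z : U z -> a * rderive v F z + b * rderive v G z = rderive v (fun z => a * F z + b * G z) z.
  by move=> Uz; rewrite (E1 v z Uz).
split=> [//|v|z Uz].
  by apply: (C1_ext oU (E v)); have [] := C1_lin a b oU (F2 v) (G2 v).
rewrite (eq_bigr (fun q => a * rderive (dir q) (rderive (dir q) F) z + b * rderive (dir q) (rderive (dir q) G) z)).
  have h := f_equal2 (fun x y : C => a * x + b * y) (F3 z Uz) (G3 z Uz).
  apply: etrans (sum_lin a b (fun q => rderive (dir q) (rderive (dir q) F) z)
    (fun q => rderive (dir q) (rderive (dir q) G) z)) _.
  by apply: etrans h _; rewrite !mulr0 addr0.
move=> q _; rewrite -(rderive_ext _ oU Uz (E (dir q))).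
by have [_ ->] := C1_lin a b oU (F2 (dir q)) (G2 (dir q)).
Qed.

Lemma har_sub U W F : (forall z, W z -> U z) -> har U F -> har W F.
Proof.
move=> h [F1 F2 F3]; split=> [|v|z /h]; [exact: C1_sub F1|exact: C1_sub (F2 v)|exact: F3].
Qed.

Lemma har_shift U W F p : (forall z, W z -> U (z + p)) -> har U F -> har W (fun z => F (z + p)).
Proof.
move=> h [F1 F2 F3]; split=> [|v|z /h Uz].
- exact: C1_shift F1.
- by rewrite rderive_shift; exact: C1_shift (F2 v).
- by rewrite -[RHS](F3 _ Uz); apply: eq_bigr => q _; rewrite !rderive_shift.
Qed.

(** The Laplace equation in terms of second differences, which can be compared directly at a
    maximum. *)
Lemma har_symmetric U F z e : opn U -> har U F -> U z -> 0 < e ->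
  exists2 d, 0 < d & forall s, 0 < s < d ->
  normc (\sum_q (F (z + s%:C *: dir q) + F (z - s%:C *: dir q) - 2 * F z)) <= e * s ^+ 2.
Proof.
move=> oU [F1 F2 F3] Uz e0.
suff h (l : seq ('I_n * bool)) : exists2 d, 0 < d & forall s, 0 < s < d ->
  normc (\sum_(q <- l) (F (z + s%:C *: dir q) + F (z - s%:C *: dir q) - 2 * F z -
     (s ^+ 2)%:C * rderive (dir q) (rderive (dir q) F) z)) <= e * s ^+ 2.
  have [d d0 hd] := h (index_enum _); exists d => // s /hd.
  by rewrite sumrB -mulr_sumr F3// mulr0 subr0.
suff h (m : R) : 0 < m -> exists2 d, 0 < d & forall s, 0 < s < d ->
  normc (\sum_(q <- l) (F (z + s%:C *: dir q) + F (z - s%:C *: dir q) - 2 * F z -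
     (s ^+ 2)%:C * rderive (dir q) (rderive (dir q) F) z)) <= (size l)%:R * m * s ^+ 2.
  have m0 : 0 < e / (1 + (size l)%:R) by pos.
  have [d d0 hd] := h _ m0; exists d => // s sd; apply: le_trans (hd s sd) _.
  apply: ler_wpM2r; first exact: sqr_ge0.
  by rewrite mulrCA ler_piMr ?(ltW e0)// ler_pdivrMr// mul1r lerDr.
move=> m0; elim: l => [|q l [d1 d10 h1]].
  by exists 1 => // s _; rewrite big_nil normc0 !mul0r.
have [d2 d20 h2] := C1_symmetric oU F1 (F2 (dir q)) Uz m0.
exists (Num.min d1 d2); first by pos.
move=> s; rewrite lt_min => /and3P[s0 s1 s2]; rewrite big_cons.
have {}h1 := h1 s; have {}h2 := h2 s; rewrite s0 s1 in h1; rewrite s0 s2 in h2.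
apply: le_trans (le_normcD _ _) _; apply: le_trans (lerD (h2 isT) (h1 isT)) _.
by rewrite /= -natr1; lra.
Qed.
End real_directions.

(** * Interior gradient bound for harmonic functions *)

Section gradient_bound.
Context {R : realType} {n : nat}.
Local Notation C := R[i].
Local Notation V := 'rV[C]_n.
Implicit Types (F G : V -> C) (U : set V) (z v w u p c : V) (a e s x r M : R) (q : 'I_n * bool).

Lemma compact_cball c r : compact [set w : V | vnorm (w - c) <= r].
Proof.
apply: subclosed_compact (@compact_vball R n (r + vnorm c)) _.
  apply: (@preimage_closed _ _ (fun w : V => vnorm (w - c)) [set x : R | x <= r]); last exact: closed_le.
  move=> z _; have h : cta (fun w : V => vnorm (w - c)) z.
    by apply: cta_vnorm; apply: cta_vadd; [exact: ctaid|exact: ctac].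
  exact: ctaE h.
move=> w /= wr; have := vnorm_sub_ge w c; lra.
Qed.

Lemma cta_dcoord q p z : cta (fun w => dcoord q (w - p)) z.
Proof.
have h : cta (fun w : V => (w - p) ord0 q.1) z.
  by apply: cta_coord; apply: cta_vadd; [exact: ctaid|exact: ctac].
have hI := cta_Im h; have hR := cta_Re h.
by case: q h hI hR => j [] h hI hR; [exact: hI|exact: hR].
Qed.

Lemma odd_second_difference (om f1 f2 f3 f4 f5 f6 : C) (b1 b2 b3 : R) :
  complex.Re (om * (f1 - f2)) - b1 + (complex.Re (om * (f3 - f4)) - b2) -
    2 * (complex.Re (om * (f5 - f6)) - b3) =
  complex.Re (om * (f1 + f3 - 2 * f5 - (f2 + f4 - 2 * f6))) - (b1 + b2 - 2 * b3).
Proof.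
rewrite -[2 in RHS](rmorph_nat (real_complex R) 2).
by case: om f1 f2 f3 f4 f5 f6 => o1 o2 [x1 y1] [x2 y2] [x3 y3] [x4 y4] [x5 y5] [x6 y6] /=; ring.
Qed.

(* Comparison of F(z) - F(reflection of z) with a superharmonic barrier on the
   half ball bounds the odd difference at the centre. *)
Lemma har_reflection U F c r M q h : opn U -> har U F ->
  (forall w, vnorm (w - c) <= r -> U w) -> (forall w, vnorm (w - c) <= r -> normc (F w) <= M) ->
  0 < M -> 0 < r -> 0 < h <= r ->
  normc (F (c + h%:C *: dir q) - F (c - h%:C *: dir q)) <=
    2 * M / r ^+ 2 * (h ^+ 2 + (2 * n%:R + 1) * (h * r - h ^+ 2)).
Proof.
move=> oU hF cU hM M0 r0 /andP[h0 hr].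
have [om om1 omE] := unimodular (F (c + h%:C *: dir q) - F (c - h%:C *: dir q)).
(* The Laplacian of |w - c|^2 is 4 n and that of - N X^2 is - 2 N = - 4 n - 2, so the barrier b has
   Laplacian - 2 k < 0. The value of k makes b at least 2 M on the sphere of radius r. *)
pose N : R := 2 * n%:R + 1; have N0 : 0 <= N by rewrite /N.
pose k : R := 2 * M / r ^+ 2; have k0 : 0 < k by rewrite !mulr_gt0 ?invr_gt0 ?exprn_gt0.
pose X w := dcoord q (w - c).
pose rho w := c + refl q (w - c).
pose b w : R := k * (vnorm (w - c) ^+ 2 + N * (X w * r - X w ^+ 2)).
pose W w : R := complex.Re (om * (F w - F (rho w))) - b w.
pose K := [set w : V | vnorm (w - c) <= r /\ 0 <= X w].
have rhoc w : rho w - c = refl q (w - c) by rewrite addrC addKr.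
have rhoN w : vnorm (rho w - c) = vnorm (w - c) by rewrite rhoc vnorm_refl.
have WM w : vnorm (w - c) <= r -> W w <= 2 * M - b w.
  move=> wr; rewrite lerD2r; apply: le_trans (ler_norm _) _; apply: le_trans (Re_le_normc _) _.
  rewrite normcM om1 mul1r; apply: le_trans (le_normcB _ _) _.
  by have := hM w wr; have := hM (rho w); rewrite rhoN => /(_ wr); lra.
have cX z : cta X z by exact: cta_dcoord.
have crho z : cta rho z.
  have cz : cta (fun w : V => w - c) z by apply: cta_vadd; [exact: ctaid|exact: ctac].
  have ch : cta (fun w => (2 * X w)%:C : C) z by cts.
  apply: cta_vadd; first exact: ctac.
  apply: cta_vadd; first exact: cz.
  by apply: cta_vopp; apply: cta_scale; [exact: ch|exact: ctac].
have cb z : cta b z.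
  have cz : cta (fun w : V => vnorm (w - c)) z.
    by apply: cta_vnorm; apply: cta_vadd; [exact: ctaid|exact: ctac].
  rewrite /b; cts.
have cW z : vnorm (z - c) <= r -> cta W z.
  move=> zr; have h1 := C1_cta (har_C1 hF) (cU z zr).
  have rz : vnorm (rho z - c) <= r by rewrite rhoN.
  have h2 : cta (fun w => F (rho w)) z.
    exact: (@ctao _ _ _ F rho) (C1_cta (har_C1 hF) (cU _ rz)) (crho z).
  rewrite /W; cts.
have cK : compact K.
  apply: (subclosed_compact _ (@compact_cball c r)); last by move=> w [].
  apply: closedI.
    apply: (@preimage_closed _ _ (fun w : V => vnorm (w - c)) [set x : R | x <= r]); last exact: closed_le.
    move=> z _; have hz : cta (fun w : V => vnorm (w - c)) z.
      by apply: cta_vnorm; apply: cta_vadd; [exact: ctaid|exact: ctac].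
    exact: ctaE hz.
  apply: (@preimage_closed _ _ X [set x : R | 0 <= x]); last exact: closed_ge.
  by move=> z _; exact: ctaE (cX z).
have Kc : K !=set0.
  by exists c; rewrite /K /X /= subrr vnorm0 dcoord0 ltW.
have cWK : {within K, continuous W}.
  by apply: continuous_in_subspaceT => z; rewrite inE => -[zr _]; exact: ctaE (cW z zr).
have [p + pmax] := compact_EVT_max Kc cK cWK.
rewrite inE => -[pr pX].
have Xc : X (c + h%:C *: dir q) = h.
  by rewrite /X addrC addKr dcoordZ dcoord_dir eqxx mulr1.
have nc : vnorm (c + h%:C *: dir q - c) = h.
  by rewrite addrC addKr vnormZ vnorm_dir mulr1 normc_nneg// ltW.
have Wc : W (c + h%:C *: dir q) = normc (F (c + h%:C *: dir q) - F (c - h%:C *: dir q)) -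
   k * (h ^+ 2 + N * (h * r - h ^+ 2)).
  rewrite /W /b nc Xc; congr (_ - _).
  rewrite (_ : rho _ = c - h%:C *: dir q) ?omE//.
  have Ec : c + h%:C *: dir q - c = h%:C *: dir q by rewrite addrC addKr.
  rewrite /rho Ec /refl dcoordZ dcoord_dir eqxx mulr1; congr (_ + _).
  by rewrite mulrDl mul1r rmorphD scalerDl opprD addrA subrr add0r.
rewrite -subr_le0 -/k -/N -Wc leNgt; apply/negP => Wpos.
have Kh : K (c + h%:C *: dir q) by rewrite /K /= nc Xc hr ltW.
have Wp : 0 < W p by apply: lt_le_trans Wpos (pmax _ _); rewrite inE.
have b_ge0 w : vnorm (w - c) <= r -> 0 <= X w -> k * vnorm (w - c) ^+ 2 <= b w.
  move=> wr wX; rewrite /b ler_pM2l// lerDl mulr_ge0// expr2 -mulrBr mulr_ge0// subr_ge0.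
  by apply: le_trans wr; apply: le_trans (dcoord_le q (w - c)); exact: ler_norm.
have pr' : vnorm (p - c) < r.
  rewrite lt_neqAle pr andbT; apply/eqP => E.
  have := b_ge0 p pr pX; have := WM p pr; rewrite E /k divfK ?expf_neq0 ?gt_eqF//.
  by move: Wp; lra.
(* On the hyperplane X = 0 the reflection is the identity, so W = - b <= 0 there. *)
have pX' : 0 < X p.
  rewrite lt_neqAle pX andbT eq_sym; apply/eqP => E.
  have Ep : rho p = p by rewrite /rho /refl -/(X p) E mulr0 scale0r subr0 subrKC.
  have := Wp; rewrite /W Ep subrr mulr0 /= => Wp'.
  have := b_ge0 p pr pX; have : 0 <= k * vnorm (p - c) ^+ 2 by pos.
  by move: Wp'; lra.
(* The two expansions of F together lose 2 e s^2 = k s^2, less than the gain 2 k s^2 of the barrier,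
   which contradicts the maximum at p. *)
pose e := k / 2; have e0 : 0 < e by rewrite divr_gt0.
have Up := cU p pr; have Urp : U (rho p) by apply: cU; rewrite rhoN.
have [d1 d10 h1] := har_symmetric oU hF Up e0.
have [d2 d20 h2] := har_symmetric oU hF Urp e0.
pose m := Num.min (Num.min d1 d2) (Num.min (r - vnorm (p - c)) (X p)).
have m0 : 0 < m by rewrite !lt_min d10 d20 subr_gt0 pr'.
pose s := m / 2; have s0 : 0 < s by rewrite divr_gt0.
have sm : s < m by rewrite /s; lra.
move: (sm); rewrite !lt_min => /andP[/andP[s1 s2] /andP[s3 s4]].
have {}h1 := h1 s; rewrite s0 s1 in h1; have {}h1 := h1 isT.
have {}h2 := h2 s; rewrite s0 s2 in h2; have {}h2 := h2 isT.
pose sd q' := s%:C *: dir q' : V.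
have nsd q' : vnorm (sd q') = s by rewrite vnormZ vnorm_dir mulr1 normc_nneg// ltW.
have Xsd q' : dcoord q (sd q') = s * (q == q')%:R by rewrite dcoordZ dcoord_dir.
have inK v : vnorm v = s -> K (p + v).
  move=> vs; split.
    rewrite /= addrAC; apply: le_trans (vnormD _ _) _; rewrite vs.
    by move: s3; lra.
  rewrite /X addrAC dcoordD -/(X p).
  have := dcoord_le q v; rewrite vs => /ler_normlP[]; move: s4; lra.
have le1 q' : W (p + sd q') + W (p - sd q') - 2 * W p <= 0.
  have := pmax (p + sd q'); rewrite inE => /(_ (inK _ (nsd q'))).
  have := pmax (p - sd q'); rewrite inE => /(_ (inK _ _)); rewrite vnormN nsd => /(_ erefl).
  lra.
have bsd q' : b (p + sd q') + b (p - sd q') - 2 * b p = k * (2 * s ^+ 2 - N * 2 * s ^+ 2 * (q == q')%:R).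
  have XD v : X (p + v) = X p + dcoord q v by rewrite /X (addrAC p v (- c)); exact: dcoordD.
  have := vnorm_parallelogram (p - c) (sd q'); rewrite nsd => E.
  rewrite /b !XD dcoordN Xsd (addrAC p (sd q') (- c)) (addrAC p (- sd q') (- c)).
  have tt : (q == q')%:R ^+ 2 = (q == q')%:R :> R by case: (q == q'); rewrite ?expr1n ?expr0n.
  move: E tt; move: (vnorm (p - c + sd q')) (vnorm (p - c - sd q')) (vnorm (p - c)) (X p) (_ == _)%:R => x1 x2 x3 y t E tt.
  have -> : x1 ^+ 2 = 2 * x3 ^+ 2 + 2 * s ^+ 2 - x2 ^+ 2 by rewrite -E; ring.
  transitivity (k * (2 * s ^+ 2 - N * 2 * s ^+ 2 * t ^+ 2)); last by rewrite tt.
  by lra.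
have rsd q' : F (rho (p + sd q')) + F (rho (p - sd q')) = F (rho p + sd q') + F (rho p - sd q').
  have rE v : rho (p + v) = rho p + refl q v by rewrite /rho -[RHS]addrA -refl_add (addrAC p v (- c)).
  rewrite !rE; have -> : refl q (- sd q') = - refl q (sd q').
    by apply/eqP; rewrite -subr_eq0 opprK -refl_add addNr /refl dcoord0 mulr0 scale0r subr0.
  by have [->|->] := refl_dir q q' s; rewrite ?opprK// addrC.
have tot : \sum_q' (W (p + sd q') + W (p - sd q') - 2 * W p) <= 0 by apply: sumr_le0 => q' _; exact: le1.
have WE q' : W (p + sd q') + W (p - sd q') - 2 * W p =
  complex.Re (om * ((F (p + sd q') + F (p - sd q') - 2 * F p) -
                    (F (rho p + sd q') + F (rho p - sd q') - 2 * F (rho p)))) -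
  k * (2 * s ^+ 2 - N * 2 * s ^+ 2 * (q == q')%:R).
  rewrite -bsd -rsd /W.
  exact: odd_second_difference.
move: tot; rewrite (eq_bigr _ (fun q' _ => WE q')) sumrB.
rewrite -mulr_sumr sumrB.
have -> : \sum_(i : 'I_n * bool) 2 * s ^+ 2 = (2 * n%:R) * (2 * s ^+ 2).
  by rewrite sumr_const card_prod card_ord card_bool -[LHS]mulr_natl natrM; ring.
have -> : \sum_i N * 2 * s ^+ 2 * (q == i)%:R = N * 2 * s ^+ 2.
  rewrite (bigD1 q)//= eqxx mulr1 big1 ?addr0// => i iq.
  by rewrite eq_sym (negbTE iq) mulr0.
set T := \sum_i _.
have TE : - (2 * e * s ^+ 2) <= T.
  have -> : T = complex.Re (om * (\sum_q' (F (p + sd q') + F (p - sd q') - 2 * F p) -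
                    \sum_q' (F (rho p + sd q') + F (rho p - sd q') - 2 * F (rho p)))).
    rewrite -sumrB mulr_sumr /T; elim: (index_enum _) => [|i l IH]; first by rewrite !big_nil.
    by rewrite !big_cons Re_add IH.
  have := Re_le_normc (om * (\sum_q' (F (p + sd q') + F (p - sd q') - 2 * F p) -
                    \sum_q' (F (rho p + sd q') + F (rho p - sd q') - 2 * F (rho p)))).
  rewrite normcM om1 mul1r => /le_trans/(_ (le_normcB _ _)).
  move=> /le_trans/(_ (lerD h1 h2))/ler_normlP[]; lra.
have ks : 0 < k * s ^+ 2 by pos.
by move: TE; rewrite /e /N; lra.
Qed.

(** The odd difference is divided by 2 h, with h tending to 0. *)
Lemma har_gradient U F c r M q : opn U -> har U F ->
  (forall w, vnorm (w - c) <= r -> U w) -> (forall w, vnorm (w - c) <= r -> normc (F w) <= M) ->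
  0 < M -> 0 < r -> normc (rderive (dir q) F c) <= (2 * n%:R + 2) * M / r.
Proof.
move=> oU hF cU hM M0 r0.
have Uc : U c by apply: cU; rewrite subrr vnorm0 ltW.
apply: le_eps => e e0; have e2 : 0 < e / 2 by pos.
have [d d0 hd] := C1_small (dir q) oU (har_C1 hF) Uc e2.
pose m := Num.min d r; have m0 : 0 < m by rewrite lt_min d0.
pose h := m / 2; have h0 : 0 < h by rewrite divr_gt0.
have hm : h < m by rewrite /h; lra.
move: (hm); rewrite lt_min => /andP[h1 h2].
have cc : vnorm (c - c) < d by rewrite subrr vnorm0.
have [|_ _ k1] := hd c h cc; first by rewrite gtr0_norm.
rewrite gtr0_norm// in k1.
have [|_ _ k2] := hd c (- h) cc; first by rewrite normrN gtr0_norm.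
rewrite normrN gtr0_norm// in k2.
have hr : 0 < h <= r by lra.
have := har_reflection q oU hF cU hM M0 r0 hr.
rewrite -(ler_pM2l h0) => k3.
rewrite rmorphN scaleNr mulNr in k2.
set A := rderive _ _ _ in k1 k2 *; set Fp := F (c + _) in k1 k3; set Fm := F (c - _) in k2 k3.
have k4 : h * normc A <= h * (((2 * n%:R + 2) * M / r) + e).
  have -> : h * normc A = normc (h%:C * A) by rewrite normcM normc_nneg// ltW.
  have E : 2 * (h%:C * A) = (Fp - Fm) - (Fp - F c - h%:C * A) + (Fm - F c - - (h%:C * A)) by ring.
  have k5 : 2 * normc (h%:C * A) <= 2 * M / r ^+ 2 * (h ^+ 2 + (2 * n%:R + 1) * (h * r - h ^+ 2)) + e * h.
    have -> : 2 * normc (h%:C * A) = normc (2 * (h%:C * A)).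
      by rewrite [in RHS]normcM -(rmorph_nat (real_complex R)) normc_nneg.
    rewrite E; apply: le_trans (le_normcD _ _) _.
    rewrite [e * h](_ : _ = e / 2 * h + e / 2 * h); last by lra.
    rewrite addrA; apply: lerD k2; apply: le_trans (le_normcB _ _) _; apply: lerD k1.
    by move: k3; rewrite ler_pM2l.
  have k6 : 2 * M / r ^+ 2 * (h ^+ 2 + (2 * n%:R + 1) * (h * r - h ^+ 2)) <= 2 * (h * ((2 * n%:R + 2) * M / r)).
    rewrite [leRHS](_ : _ = 2 * M / r ^+ 2 * (h * r + (2 * n%:R + 1) * (h * r))); last first.
      by field; rewrite gt_eqF.
    apply: ler_wpM2l; first by pos.
    apply: lerD; first by rewrite ler_pM2l// ltW.
    apply: ler_wpM2l; first by [].
    by rewrite gerBl sqr_ge0.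
  rewrite [leRHS]mulrDr [h * e]mulrC; have := le_trans k5 (lerD k6 (lexx (e * h))).
  by have := mulr_ge0 (ltW e0) (ltW h0); move: (normc _) (h * _) (e * h) => X1 X2 X3; lra.
by move: k4; rewrite ler_pM2l.
Qed.
End gradient_bound.

(** * Derivatives of harmonic functions are harmonic *)

Section harmonic_derivative.
Context {R : realType} {n : nat}.
Local Notation C := R[i].
Local Notation V := 'rV[C]_n.
Implicit Types (F G : V -> C) (U : set V) (z v w u p c : V) (a e s x r M : R) (q : 'I_n * bool).

Let N1 : R := (n * 2)%:R * (2 * n%:R + 2).

Let N1_ge0 : 0 <= N1. Proof. by rewrite /N1. Qed.

Lemma har_gradient_dir U F c r M v : opn U -> har U F ->
  (forall w, vnorm (w - c) <= r -> U w) -> (forall w, vnorm (w - c) <= r -> normc (F w) <= M) ->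
  0 < M -> 0 < r -> normc (rderive v F c) <= N1 * vnorm v * (M / r).
Proof.
move=> oU hF cU hM M0 r0; have Uc : U c by apply: cU; rewrite subrr vnorm0 ltW.
rewrite (rderive_dirs v oU (har_C1 hF) Uc); apply: le_trans (normc_sum _ _ _) _.
apply: (@le_trans _ _ (\sum_(q : 'I_n * bool) vnorm v * ((2 * n%:R + 2) * M / r))).
  apply: ler_sum => q _; rewrite normcM; apply: ler_pM; rewrite ?normc_ge0//.
    by rewrite normc_real; exact: dcoord_le.
  exact: (har_gradient q oU hF cU hM M0 r0).
rewrite sumr_const card_prod card_ord card_bool -[leLHS]mulr_natl /N1.
by lra.
Qed.

(** The mean value inequality for f k, with the derivatives uniformly close to the continuous
    function g, passes to the limit in k. *)
Lemma C1_limit U (f : nat -> V -> C) F (g : V -> V -> C) : opn U -> (forall k, C1 U (f k)) ->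
  (forall z, U z -> forall e, 0 < e -> exists K, forall k, (K <= k)%N -> normc (f k z - F z) <= e) ->
  (forall v, exists B, 0 <= B /\ forall k z, U z -> normc (rderive v (f k) z - g v z) <= B / k.+1%:R) ->
  (forall z, U z -> cta F z) ->
  C1 U F /\ forall v z, U z -> rderive v F z = g v z.
Proof.
move=> oU hf fF fg cF.
have small (B e : R) : 0 <= B -> 0 < e -> exists K, forall k, (K <= k)%N -> B / k.+1%:R <= e.
  move=> B0 e0; exists (Num.truncn (B / e)).+1 => k Kk; rewrite ler_pdivrMr ?ltr0n// mulrC -ler_pdivrMr//.
  apply: ltW; apply: lt_le_trans (Num.Theory.truncnS_gt _) _.
  by rewrite ler_nat ltnW.
have cg v z : U z -> cta (g v) z.
  move=> Uz; apply/ctaP => e e0; have [B [B0 hB]] := fg v.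
  have e4 : 0 < e / 4 by pos.
  have [K hK] := small B _ B0 e4; have {}hK := hK K (leqnn K).
  have /ctaP/(_ _ e4) := C1_cta_rderive (hf K) v Uz.
  move=> /(near_and (opn_near oU Uz)); apply: filterS => w [Uw hw].
  have h1 := le_trans (hB K z Uz) hK; have h2 := le_trans (hB K w Uw) hK.
  apply: le_lt_trans (le_normc_trans (rderive v (f K) z) _ _) _.
  rewrite normcB; apply: le_lt_trans (lerD h1 (le_normc_trans (rderive v (f K) w) _ _)) _.
  by move: h2 hw; move: (normc _) (normc _) => X1 X2; lra.
apply: C1_by => // v z Uz; apply: dR_eps => e e0.
have e2 : 0 < e / 2 by pos.
have /ctaP/(_ _ e2) := cg v z Uz.
move=> /(near_and (opn_near oU Uz))/nearVP[d d0 hd].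
have v0 : 0 < 1 + vnorm v by pos.
apply/nearRP; exists (d / (1 + vnorm v)); first by pos.
move=> s; rewrite subr0 => sd; rewrite scale0r addr0.
have sv : `|s| * vnorm v < d.
  move: sd; rewrite ltr_pdivlMr//; apply: le_lt_trans.
  by rewrite mulrDr lerDr.
have ball x : 0 <= x <= 1 -> U (z + x%:C *: (s%:C *: v)) /\ normc (g v z - g v (z + x%:C *: (s%:C *: v))) < e / 2.
  move=> /andP[x0 x1]; apply: hd; rewrite addrAC subrr add0r !vnormZ !normc_real (ger0_norm x0).
  apply: le_lt_trans sv; rewrite ler_piMl// mulr_ge0// vnorm_ge0 //.
have Us : U (z + s%:C *: v) by have [] := ball 1; rewrite ?ler01 ?lexx// scale1r.
have [B [B0 hB]] := fg v; have [K1 hK1] := small B _ B0 e2.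
apply: le_eps => m m0; have m2 : 0 < m / 2 by pos.
have [K2 hK2] := fF z Uz _ m2; have [K3 hK3] := fF _ Us _ m2.
pose k := maxn K1 (maxn K2 K3).
have {}hK1 := hK1 k (leq_maxl _ _).
have {}hK2 := hK2 k (leq_trans (leq_maxl _ _) (leq_maxr _ _)).
have {}hK3 := hK3 k (leq_trans (leq_maxr _ _) (leq_maxr _ _)).
have h1 : normc (f k (z + s%:C *: v) - f k z - s%:C * g v z) <= e * `|s|.
  apply: (C1_mean (hf k)) => x x01; have [Ux hx] := ball x x01; split=> //.
  rewrite (rderive_scale _ s (hf k) Ux) -mulrBr normcM normc_real mulrC; apply: ler_wpM2r => //.
  apply: le_trans (le_normc_trans (g v (z + x%:C *: (s%:C *: v))) _ _) _.
  have h3 := le_trans (hB k _ Ux) hK1; rewrite [e](splitr e).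
  by apply: lerD h3 _; rewrite normcB ltW.
rewrite (_ : F (z + s%:C *: v) - _ - _ = (f k (z + s%:C *: v) - f k z - s%:C * g v z) +
   (f k z - F z) - (f k (z + s%:C *: v) - F (z + s%:C *: v))); last by ring.
apply: le_trans (le_normcB _ _) _; apply: le_trans (lerD (le_normcD _ _) hK3) _.
by move: h1 hK2; move: (normc _) (normc _) (e * _) => X1 X2 X3; lra.
Qed.

(** For a real sequence the explicit rate makes the supremum of the lower bounds u k - B / (k + 1) a
    limit; real and imaginary parts give the factor 2. *)
Lemma rate_limit (u : nat -> C) (B : R) : (forall k l, normc (u k - u l) <= B * (k.+1%:R^-1 + l.+1%:R^-1)) ->
  exists a : C, forall k, normc (u k - a) <= 2 * B / k.+1%:R.
Proof.
move=> hu.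
have real (f : nat -> R) : (forall k l, `|f k - f l| <= B * (k.+1%:R^-1 + l.+1%:R^-1)) ->
    exists a : R, forall k, `|f k - a| <= B / k.+1%:R.
  move=> hf; pose S : set R := [set f k - B / k.+1%:R | k in setT].
  have ub l : ubound S (f l + B / l.+1%:R).
    move=> _ [k _ <-]; have := le_trans (ler_norm _) (hf k l); rewrite mulrDr.
    by move: (B / _) (B / _) => x y; lra.
  have S0 : S !=set0 by exists (f 0%N - B / 1); exists 0%N.
  exists (sup S) => k; rewrite ler_norml; apply/andP; split.
    by have := ge_sup S0 (ub k); move: (B / _) => x; lra.
  have : f k - B / k.+1%:R <= sup S by apply: ub_le_sup; [exists (f 0%N + B / 1); exact: (ub 0%N)|exists k].
  by move: (B / _) => x; lra.
have hRe k l : `|complex.Re (u k) - complex.Re (u l)| <= B * (k.+1%:R^-1 + l.+1%:R^-1).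
  by apply: le_trans (hu k l); apply: le_trans (Re_le_normc _); rewrite Re_add Re_opp.
have hIm k l : `|complex.Im (u k) - complex.Im (u l)| <= B * (k.+1%:R^-1 + l.+1%:R^-1).
  by apply: le_trans (hu k l); apply: le_trans (Im_le_normc _); rewrite Im_add Im_opp.
have [a ha] := real _ hRe; have [b hb] := real _ hIm.
exists (a +i* b) => k; apply: le_trans (normc_le_ReIm _) _.
rewrite Re_add Im_add Re_opp Im_opp /=; apply: le_trans (lerD (ha k) (hb k)) _.
by rewrite -mulrA; move: (B / _) => x; lra.
Qed.

Lemma neg_sum_sub (f g h : 'I_n * bool -> C) : \sum_q f q = 0 -> (forall q, h q = g q) ->
  \sum_q h q = - \sum_q (f q - g q).
Proof. by move=> f0 hg; rewrite sumrB f0 sub0r opprK; exact: eq_bigr. Qed.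

Lemma rderive2_lin U (a b : C) F G v w z : opn U -> C1 U F -> C1 U G ->
  C1 U (rderive v F) -> C1 U (rderive v G) -> U z ->
  rderive w (rderive v (fun z => a * F z + b * G z)) z =
  a * rderive w (rderive v F) z + b * rderive w (rderive v G) z.
Proof.
move=> oU F1 G1 F2 G2 Uz; have [_ E] := C1_lin a b oU F1 G1.
rewrite (rderive_ext w oU Uz (E v)).
by have [_ ->] := C1_lin a b oU F2 G2.
Qed.

(** The increment F(z + s w) - F(z) is harmonic and, by the gradient bound, at most s L; a second
    use of the gradient bound controls its derivative along v. Derivatives of F need not be known to
    be harmonic for this. *)
Lemma har_hessian U F c r M v w : opn U -> har U F ->
  (forall z, vnorm (z - c) <= 2 * r -> U z) -> (forall z, vnorm (z - c) <= 2 * r -> normc (F z) <= M) ->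
  0 < M -> 0 < r ->
  normc (rderive w (rderive v F) c) <= 2 * N1 * vnorm v * (N1 * vnorm w + 1) * M / r ^+ 2.
Proof.
move=> oU hF cU hM M0 r0; set A := rderive w _ c.
have Uc : U c by apply: cU; rewrite subrr vnorm0 mulr_ge0 ?ler0n// ltW.
pose L := (N1 * vnorm w + 1) * M / r.
have L0 : 0 < L by rewrite !mulr_gt0 ?invr_gt0// ltr_wpDl// mulr_ge0 ?vnorm_ge0.
have dF z : vnorm (z - c) <= r -> normc (rderive w F z) <= L.
  move=> zr.
  have sub u : vnorm (u - z) <= r -> vnorm (u - c) <= 2 * r.
    by move=> ur; apply: le_trans (vnorm_trans z _ _) _; lra.
  have := har_gradient_dir w oU hF (fun u h => cU u (sub u h)) (fun u h => hM u (sub u h)) M0 r0.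
  move/le_trans; apply; rewrite /L -[leRHS]mulrA; apply: ler_wpM2r; last by lra.
  by pos.
apply: le_eps => e e0.
have [d d0 hd] := C1_small w oU (har_C2 hF v) Uc e0.
have w0 : 0 < 1 + vnorm w by pos.
pose m := Num.min d (r / 2 / (1 + vnorm w)).
have m0 : 0 < m by rewrite lt_min d0 !divr_gt0.
pose s := m / 2; have s0 : 0 < s by rewrite divr_gt0.
have sm : s < m by rewrite /s; lra.
move: (sm); rewrite lt_min => /andP[s1 s2].
have sw : s * vnorm w <= r / 2.
  move: s2; rewrite ltr_pdivlMr// => h; apply: le_trans (ltW h).
  by lra.
pose de z := 1 * F (z + s%:C *: w) + (-1) * F z.
have oW : opn (vball c r) by exact: opn_vball.
have WU z : vball c r z -> U z by move=> zr; apply: cU; move: zr; rewrite /vball /=; lra.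
have WU' z : vball c r z -> U (z + s%:C *: w).
  rewrite /vball /= => zr; apply: cU; rewrite addrAC; apply: le_trans (vnormD _ _) _.
  by rewrite vnormZ normc_nneg ?(ltW s0)//; move: sw zr; lra.
have hde : har (vball c r) de := har_lin 1 (-1) oW (har_shift WU' hF) (har_sub WU hF).
have r2 : 0 < r / 2 by pos.
have de_le z : vnorm (z - c) <= r / 2 -> normc (de z) <= s * L.
  move=> zr; have := @C1_mean R n U F z (s%:C *: w) 0 (s * L) (har_C1 hF).
  rewrite subr0 /de mul1r mulN1r; apply=> x /andP[x0 x1].
  have pr : vnorm (z + x%:C *: (s%:C *: w) - c) <= r.
    rewrite addrAC; apply: le_trans (vnormD _ _) _; rewrite !vnormZ !normc_nneg ?(ltW s0)//.
    have : x * (s * vnorm w) <= r / 2.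
      by apply: le_trans sw; rewrite ler_piMl// mulr_ge0 ?vnorm_ge0// ltW.
    by move: zr; lra.
  have Up : U (z + x%:C *: (s%:C *: w)) by apply: cU; move: pr; lra.
  split=> //; rewrite subr0 (rderive_scale _ _ (har_C1 hF) Up) normcM normc_nneg ?(ltW s0)//.
  by apply: ler_wpM2l; [exact: ltW|exact: dF].
have sub2 z : vnorm (z - c) <= r / 2 -> vball c r z by rewrite /vball /=; lra.
have := har_gradient_dir v oW hde sub2 de_le (mulr_gt0 s0 L0) r2.
have Wc : vball c r c by rewrite /vball /= subrr vnorm0.
have -> : rderive v de c = rderive v F (c + s%:C *: w) - rderive v F c.
  have [_ ->//] := C1_lin 1 (-1) oW (C1_shift WU' (har_C1 hF)) (C1_sub WU (har_C1 hF)).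
  by rewrite rderive_shift mul1r mulN1r.
move=> h1; have cc : vnorm (c - c) < d by rewrite subrr vnorm0.
have sd : `|s| < d by rewrite gtr0_norm.
have [_ _] := hd c s cc sd; rewrite -/A gtr0_norm// => h2.
rewrite -(ler_pM2l s0).
have -> : s * normc A = normc (s%:C * A) by rewrite normcM normc_nneg// ltW.
rewrite (_ : s%:C * A = (rderive v F (c + s%:C *: w) - rderive v F c) -
  (rderive v F (c + s%:C *: w) - rderive v F c - s%:C * A)); last by ring.
apply: le_trans (le_normcB _ _) _; apply: le_trans (lerD h1 h2) _.
rewrite mulrDr [s * e]mulrC lerD2r /L le_eqVlt; apply/orP; left; apply/eqP.
by lra.
Qed.

(** The difference quotients H k along v are harmonic and converge to the derivative at rate 1 / (k
    + 1). By [har_hessian] for H k - H l their second derivatives converge uniformly at the same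
    rate, so the limit has continuous second derivatives and zero Laplacian. *)
Lemma har_rderive_local U F v z0 : opn U -> har U F -> U z0 ->
  exists2 rho, 0 < rho & (forall z, vball z0 rho z -> U z) /\ har (vball z0 rho) (rderive v F).
Proof.
(* Room for the radii rho, 3 rho and 4 rho of the nested balls below. *)
move=> oU hF Uz0; have [d d0 hd] := oU _ Uz0; pose rho := d / 5.
have rho0 : 0 < rho by rewrite divr_gt0.
have U4 z : vnorm (z - z0) <= 4 * rho -> U z.
  by move=> h; apply: hd; apply: le_lt_trans h _; rewrite /rho; lra.
have v0 : 0 < 1 + vnorm v by pos.
pose h0 := rho / (1 + vnorm v); have h00 : 0 < h0 by rewrite divr_gt0.
pose st k : R := h0 / k.+1%:R.
have st0 k : 0 < st k by rewrite divr_gt0.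
have stv k : st k * vnorm v <= rho.
  apply: (@le_trans _ _ (h0 * vnorm v)).
    apply: ler_wpM2r; first exact: vnorm_ge0.
    by rewrite ler_pdivrMr// ler_peMr ?(ltW h00)// ler1n.
  rewrite /h0 -mulrA ger_pMr// mulrC ler_pdivrMr// mul1r; lra.
pose W3 : set V := vball z0 (3 * rho); pose W : set V := vball z0 rho.
have oW3 : opn W3 by exact: opn_vball.
have oW : opn W by exact: opn_vball.
have W3U z : W3 z -> U z by rewrite /W3 /vball /= => h; apply: U4; lra.
have seg k x z : W3 z -> 0 <= x <= 1 -> vnorm (z + x%:C *: ((st k)%:C *: v) - z0) <= 4 * rho.
  rewrite /W3 /vball /= => zr /andP[x0 x1]; rewrite addrAC; apply: le_trans (vnormD _ _) _.
  rewrite !vnormZ !normc_nneg ?(ltW (st0 k))//.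
  have : x * (st k * vnorm v) <= rho.
    by apply: le_trans (stv k); rewrite ler_piMl// mulr_ge0 ?vnorm_ge0// ltW.
  by move: zr; lra.
have W3U' k z : W3 z -> U (z + (st k)%:C *: v).
  by move=> h; apply: U4; have := @seg k 1 z h; rewrite scale1r; apply; rewrite ler01 lexx.
have WW3 z : W z -> W3 z by rewrite /W /W3 /vball /=; lra.
have WU z : W z -> U z by move=> /WW3/W3U.
exists rho; first exact: rho0.
split; first exact: WU.
pose G := rderive v F; have hG := har_C2 hF v.
pose H k z := (st k)^-1%:C * F (z + (st k)%:C *: v) + (- (st k)^-1%:C) * F z.
have hH k : har W3 (H k) := har_lin _ _ oW3 (har_shift (W3U' k) hF) (har_sub W3U hF).
have HE k (P : V -> C) z : (st k)^-1%:C * P (z + (st k)%:C *: v) + (- (st k)^-1%:C) * P z =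
   (st k)^-1%:C * (P (z + (st k)%:C *: v) - P z) by ring.
have stE k (c : C) : c = (st k)^-1%:C * ((st k)%:C * c).
  by rewrite mulrA -rmorphM mulVf ?gt_eqF// mul1r.
have nst k : normc ((st k)^-1%:C : C) = (st k)^-1 by rewrite normc_nneg// invr_ge0 ltW.
have [B hB] : exists B, forall z, vnorm (z - z0) <= 4 * rho -> normc (rderive v G z) <= B.
  apply: (@within_bounded R n [set w | vnorm (w - z0) <= 4 * rho]); first exact: compact_cball.
  apply: continuous_in_subspaceT => w; rewrite inE /= => wr.
  by apply: ctaE; exact: (C1_cta_rderive hG v (U4 w wr)).
have B0 : 0 <= B.
  by apply: le_trans (normc_ge0 _) (hB z0 _); rewrite subrr vnorm0 mulr_ge0 ?ler0n// ltW.
have HG k z : W3 z -> normc (H k z - G z) <= st k * B.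
  move=> Wz; rewrite /H HE (stE k (G z)) -mulrBr normcM nst.
  rewrite ler_pdivrMl//; apply: (C1_mean (har_C1 hF)) => x x01.
  have pr := seg k x z Wz x01; have Up := U4 _ pr; split=> //.
  rewrite (rderive_scale _ _ (har_C1 hF) Up) -mulrBr normcM normc_nneg ?(ltW (st0 k))//.
  apply: ler_wpM2l; first exact: ltW.
  have E : x%:C *: ((st k)%:C *: v) = (x * st k)%:C *: v by rewrite scalerA -rmorphM.
  rewrite E; have := @C1_mean R n U G z ((x * st k)%:C *: v) 0 (st k * B) hG; rewrite subr0; apply.
  move=> y /andP[y0 y1]; case/andP: x01 => x0 x1.
  have pr' : vnorm (z + y%:C *: ((x * st k)%:C *: v) - z0) <= 4 * rho.
    by rewrite -E scalerA -rmorphM; apply: seg Wz _; rewrite mulr_ge0//= mulr_ile1.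
  split; first exact: U4.
  rewrite subr0 (rderive_scale _ _ hG (U4 _ pr')).
  have xs0 : 0 <= x * st k by rewrite mulr_ge0// ltW.
  have xs1 : x * st k <= st k by rewrite ler_piMl// ltW.
  by rewrite normcM (normc_nneg xs0); exact: (ler_pM xs0 (normc_ge0 _) xs1 (hB _ pr')).
(* The constant of [har_hessian] at radius rho / 2 with M = (B + 1) h0; B + 1 replaces B because M
   has to be positive. *)
pose Q u w := 2 * N1 * vnorm u * (N1 * vnorm w + 1) * ((B + 1) * h0) / (rho / 2) ^+ 2.
have Q0 u w : 0 <= Q u w.
  have := vnorm_ge0 u; have := vnorm_ge0 w => a b; rewrite /Q; nn; lra.
have rate u w z k l : W z -> normc (rderive w (rderive u (H k)) z - rderive w (rderive u (H l)) z) <=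
    Q u w * (k.+1%:R^-1 + l.+1%:R^-1).
  move=> Wz; pose Mkl := (B + 1) * h0 * (k.+1%:R^-1 + l.+1%:R^-1).
  have kl : 0 < k.+1%:R^-1 + l.+1%:R^-1 :> R by [].
  have B1 : 0 < B + 1 by pos.
  have M0 : 0 < Mkl := mulr_gt0 (mulr_gt0 B1 h00) kl.
  have sub3 p : vnorm (p - z) <= 2 * (rho / 2) -> W3 p.
    move=> pz; rewrite /W3 /vball /=; apply: le_lt_trans (vnorm_trans z _ _) _.
    by move: Wz pz; rewrite /W /vball /=; lra.
  have hM p : vnorm (p - z) <= 2 * (rho / 2) -> normc (1 * H k p + (-1) * H l p) <= Mkl.
    move=> /sub3 Wp; rewrite mul1r mulN1r; apply: le_trans (le_normc_trans (G p) _ _) _.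
    rewrite [X in _ + X]normcB; apply: le_trans (lerD (HG k p Wp) (HG l p Wp)) _.
    rewrite [leLHS](_ : _ = B * (h0 * (k.+1%:R^-1 + l.+1%:R^-1))); last by rewrite /st; ring.
    by rewrite /Mkl -mulrA; apply: ler_wpM2r; [rewrite mulr_ge0 ?ltW|lra].
  have r2 : 0 < rho / 2 by pos.
  have := har_hessian u w oW3 (har_lin 1 (-1) oW3 (hH k) (hH l)) sub3 hM M0 r2.
  rewrite (rderive2_lin _ _ w oW3 (har_C1 (hH k)) (har_C1 (hH l)) (har_C2 (hH k) u) (har_C2 (hH l) u) (WW3 _ Wz)).
  rewrite mul1r mulN1r => h; apply: le_trans h _; rewrite /Q /Mkl le_eqVlt; apply/orP; left; apply/eqP.
  by move: (_ + _ : R) (_ ^+ 2)^-1 => a b; ring.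
pose S w u z : C := xget 0 [set a | forall k, normc (rderive w (rderive u (H k)) z - a) <= 2 * Q u w / k.+1%:R].
have hS w u z : W z -> forall k, normc (rderive w (rderive u (H k)) z - S w u z) <= 2 * Q u w / k.+1%:R.
  move=> Wz; have [a ha] := rate_limit (fun k l => rate u w z k l Wz).
  apply: (@xgetPex _ 0 [set a : C | forall k,
    normc (rderive w (rderive u (H k)) z - a) <= 2 * Q u w / k.+1%:R]).
  by exists a.
have hC u : C1 W (rderive u G) /\ forall w z, W z -> rderive w (rderive u G) z = S w u z.
  apply: (@C1_limit W (fun k => rderive u (H k)) (rderive u G) (fun w => S w u)).
  - exact: oW.
  - move=> k; exact: (C1_sub WW3 (har_C2 (hH k) u)).
  - move=> z Wz e e0; have Uz := WU z Wz; pose P := rderive u F.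
    have [dl dl0 hdl] := C1_small v oU (har_C2 hF u) Uz e0.
    have -> : rderive u G z = rderive v P z.
      by rewrite (rderive_comm oU (har_C1 hF) (har_C2 hF v) (har_C2 hF u) Uz).
    exists (Num.truncn (h0 / dl)).+1 => k Kk.
    have sd : st k < dl.
      rewrite ltr_pdivrMr ?ltr0n// mulrC -ltr_pdivrMr//.
      by apply: lt_le_trans (Num.Theory.truncnS_gt _) _; rewrite ler_nat ltnW.
    have zz : vnorm (z - z) < dl by rewrite subrr vnorm0.
    have sd' : `|st k| < dl by rewrite gtr0_norm.
    have [_ _] := hdl z (st k) zz sd'; rewrite gtr0_norm// => hk.
    have -> : rderive u (H k) z = (st k)^-1%:C * (P (z + (st k)%:C *: v) - P z).
      have [_ ->] := C1_lin (st k)^-1%:C (- (st k)^-1%:C) oW3 (C1_shift (W3U' k) (har_C1 hF)) (C1_sub W3U (har_C1 hF)); last exact: WW3.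
      by rewrite rderive_shift.
    rewrite (stE k (rderive v P z)) -mulrBr normcM nst ler_pdivrMl// [st k * e]mulrC.
    exact: hk.
  - move=> w; exists (2 * Q u w); split; first by rewrite mulr_ge0.
    by move=> k z Wz; exact: hS.
  - by move=> z /WU Uz; exact: (C1_cta_rderive hG u Uz).
split.
- exact: C1_sub WU hG.
- by move=> u; have [] := hC u.
- move=> z Wz; apply: normc_eq0_eps => e e0.
  pose T := \sum_(q : 'I_n * bool) 2 * Q (dir q) (dir q).
  pose k := (Num.truncn (T / e)).+1.
  have Tk : T / k.+1%:R <= e.
    rewrite ler_pdivrMr ?ltr0n// mulrC -ler_pdivrMr//; apply: ltW.
    by apply: lt_le_trans (Num.Theory.truncnS_gt _) _; rewrite ler_nat leqnSn.
  apply: le_trans Tk; have hk := har_lap (hH k) (WW3 _ Wz).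
  have -> := neg_sum_sub hk (fun q => (hC (dir q)).2 (dir q) z Wz).
  rewrite normcN; apply: le_trans (normc_sum _ _ _) _; rewrite /T mulr_suml.
  by apply: ler_sum => q _; exact: hS.
Qed.

(** Its iteration provides the derivatives of all orders used from here on. *)
Lemma har_rderive U F v : opn U -> har U F -> har U (rderive v F).
Proof.
move=> oU hF; have loc z : U z -> exists2 rho, 0 < rho & har (vball z rho) (rderive v F) /\ vball z rho z.
  move=> Uz; have [rho rho0 [_ h]] := har_rderive_local v oU hF Uz.
  by exists rho => //; split=> //; rewrite /vball /= subrr vnorm0.
split.
- exact: har_C2.
- move=> u; split=> [z /loc[rho _ [h zz]]|w z /loc[rho _ [h zz]]|w z /loc[rho _ [h zz]]].
  + exact: (C1_cta (har_C2 h u) zz).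
  + exact: (C1_dv (har_C2 h u) w zz).
  + exact: (C1_cta_rderive (har_C2 h u) w zz).
- by move=> z /loc[rho _ [h zz]]; exact: (har_lap h zz).
Qed.
End harmonic_derivative.

(** * Words of Wirtinger derivatives and iterated directional derivatives *)

Section derivative_words.
Context {R : realType} {n : nat}.
Local Notation C := R[i].
Local Notation V := 'rV[C]_n.
Implicit Types (F G : V -> C) (U : set V) (z v u p : V) (a e x r M : R) (q : 'I_n * bool).

(* The letters (j, false) and (j, true) stand for the derivatives along z_j and
   conj z_j. *)
Definition letter q F : V -> C := if q.2 then dzbar q.1 F else dz q.1 F.
Definition word (w : seq ('I_n * bool)) F : V -> C := foldr letter F w.
Definition coef v q : C := if q.2 then conjc (v ord0 q.1) else v ord0 q.1.

#[local] Opaque e_ ie_.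

Let half : C := 2^-1.
Definition lcoef q : C := if q.2 then half * 'i%C else - (half * 'i%C).

Lemma letterE q F z :
  letter q F z = half * rderive (e_ q.1) F z + lcoef q * rderive (ie_ q.1) F z.
Proof.
rewrite /letter /lcoef /half /dzbar /dz; case: q.2; move: (rderive _ F z) (rderive _ F z) => a b; ring.
Qed.

Lemma har_ext U F G : opn U -> (forall z, U z -> F z = G z) -> har U F -> har U G.
Proof.
move=> oU FG hF; have E v z : U z -> rderive v F z = rderive v G z.
  by move=> Uz; exact: (rderive_ext v oU Uz FG).
split=> [|v|z Uz]; [exact: (C1_ext oU FG (har_C1 hF))|exact: (C1_ext oU (E v) (har_C2 hF v))|].
apply: etrans (har_lap hF Uz); apply: eq_bigr => q _.
exact: (esym (rderive_ext (dir q) oU Uz (E (dir q)))).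
Qed.

Lemma har_letter U F q : opn U -> har U F -> har U (letter q F).
Proof.
move=> oU hF; apply: (har_ext oU _ (har_lin half (lcoef q) oU
  (har_rderive (e_ q.1) oU hF) (har_rderive (ie_ q.1) oU hF))).
by move=> z _; exact: (esym (letterE q F z)).
Qed.

Lemma letter_ext U F G q z : opn U -> U z -> (forall w, U w -> F w = G w) -> letter q F z = letter q G z.
Proof.
move=> oU Uz h; apply: etrans (letterE _ _ _) _; apply: etrans (esym (letterE _ _ _)).
by rewrite (rderive_ext (e_ q.1) oU Uz h) (rderive_ext (ie_ q.1) oU Uz h).
Qed.

Lemma rderive_letter U F q v z : opn U -> har U F -> U z ->
  rderive v (letter q F) z = letter q (rderive v F) z.
Proof.
move=> oU hF Uz.
have E w : U w -> letter q F w = half * rderive (e_ q.1) F w + lcoef q * rderive (ie_ q.1) F w.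
  by move=> _; exact: letterE.
apply: etrans (rderive_ext v oU Uz E) _; apply: etrans (esym (letterE _ _ _)).
have h1 := rderive_comm oU (har_C1 hF) (har_C2 hF v) (har_C2 hF (e_ q.1)) Uz.
have h2 := rderive_comm oU (har_C1 hF) (har_C2 hF v) (har_C2 hF (ie_ q.1)) Uz.
apply: etrans ((C1_lin half (lcoef q) oU (har_C2 hF (e_ q.1)) (har_C2 hF (ie_ q.1))).2 v z Uz) _.
exact: (f_equal2 (fun x y : C => half * x + lcoef q * y) h1 h2).
Qed.

Lemma letter_comm U F q q' z : opn U -> har U F -> U z ->
  letter q (letter q' F) z = letter q' (letter q F) z.
Proof.
move=> oU hF Uz; apply: etrans (letterE _ _ _) _.
have E w : U w -> letter q F w = half * rderive (e_ q.1) F w + lcoef q * rderive (ie_ q.1) F w.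
  by move=> _; exact: letterE.
have f1 := etrans (rderive_letter q' (e_ q.1) oU hF Uz) (letterE q' (rderive (e_ q.1) F) z).
have f2 := etrans (rderive_letter q' (ie_ q.1) oU hF Uz) (letterE q' (rderive (ie_ q.1) F) z).
apply: etrans (f_equal2 (fun x y : C => half * x + lcoef q * y) f1 f2) _.
apply: etrans (esym (letter_ext q' oU Uz E)); apply: etrans (esym (letterE q' _ z)).
have L v := (C1_lin half (lcoef q) oU (har_C2 hF (e_ q.1)) (har_C2 hF (ie_ q.1))).2 v z Uz.
apply: etrans (esym (f_equal2 (fun x y : C => half * x + lcoef q' * y) (L (e_ q'.1)) (L (ie_ q'.1)))).
have alg (x y t a b c d : C) :
  x * (x * a + t * b) + y * (x * c + t * d) = x * (x * a + y * c) + t * (x * b + y * d) by ring.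
exact: alg.
Qed.

Lemma letter_C1 U F v z : opn U -> C1 U F -> U z ->
  rderive v F z = \sum_q coef v q * letter q F z.
Proof.
move=> oU hF Uz; rewrite (rderive_dirs v oU hF Uz) !sum_dir; apply: eq_bigr => j _.
rewrite (letterE (j, false)) (letterE (j, true)) /dir /coef /dcoord /lcoef /=.
move: (rderive (e_ j) F z) (rderive (ie_ j) F z) => a b.
have n2 : half * 2 = 1 by rewrite mulVf.
case: (v ord0 j) => x y /=.
have -> : x +i* y = x%:C + y%:C * 'i%C by apply: ReIm_eq => /=; ring.
have -> : x -i* y = x%:C - y%:C * 'i%C by apply: ReIm_eq => /=; ring.
rewrite -[x%:C * a]mulr1 -[y%:C * b]mulr1 -n2.
have i2 : 'i%C * 'i%C = -1 :> C by exact: sqr_i.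
transitivity (half * (2 * x%:C * a - 2 * ('i%C * 'i%C) * y%:C * b)); last by ring.
by rewrite i2; ring.
Qed.

#[global] Opaque letter.

Lemma har_word U F w : opn U -> har U F -> har U (word w F).
Proof. by move=> oU hF; elim: w => [//|q w IH] /=; exact: (har_letter q oU IH). Qed.

Lemma word_cat w1 w2 F : word (w1 ++ w2) F = word w1 (word w2 F).
Proof. exact: foldr_cat. Qed.

Lemma word_move U F q w z : opn U -> har U F -> U z -> word w (letter q F) z = letter q (word w F) z.
Proof.
move=> oU hF; elim: w z => [|q' w IH] z Uz; first by [].
apply: etrans (letter_ext q' oU Uz IH) _.
exact: (letter_comm q' q oU (har_word w oU hF) Uz).
Qed.

Lemma word_perm U F w1 w2 z : opn U -> har U F -> U z -> perm_eq w1 w2 -> word w1 F z = word w2 F z.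
Proof.
move=> oU hF; elim: w1 w2 z => [|q w1 IH] w2 z Uz.
  by rewrite perm_sym => /perm_nilP ->.
move=> h; have qw : q \in w2 by rewrite -(perm_mem h) mem_head.
have [s1 [s2 E]] : exists s1 s2 : seq ('I_n * bool), w2 = s1 ++ q :: s2.
  by case/splitPr: qw => s1 s2; exists s1, s2.
have h' : perm_eq w1 (s1 ++ s2).
  by rewrite -(perm_cons q) (perm_trans h)// E -[q :: s2]cat1s perm_catCA.
apply: etrans (letter_ext q oU Uz (fun w Uw => IH _ w Uw h')) _.
rewrite E !word_cat.
exact: (esym (word_move q s1 oU (har_word s2 oU hF) Uz)).
Qed.

Lemma count_mword k (al : {ffun 'I_n -> 'I_k}) j : count_mem j (mword al) = al j.
Proof.
rewrite /mword count_flatten -map_comp sumnE big_map big_enum /=.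
rewrite (bigD1 j)//= big1 => [|i ij]; first by rewrite count_nseq /= eqxx mul1n addn0.
by rewrite count_nseq /= (negbTE ij).
Qed.

(** Derivatives commute, so sorting the letters turns the word into one of the multi-index
    derivatives summed in [dnorm]. *)
Lemma word_le_dnorm U F w z : opn U -> har U F -> U z -> normc (word w F z) <= dnorm (size w) F z.
Proof.
move=> oU hF Uz; set k := size w.
pose al b : {ffun 'I_n -> 'I_k.+1} := [ffun j => inord (count_mem (j, b) w)].
have alE b j : al b j = count_mem (j, b) w :> nat.
  by rewrite ffunE inordK// ltnS count_size.
pose can := [seq (j, false) | j <- mword (al false)] ++ [seq (j, true) | j <- mword (al true)].
have canE : word can F = mderive dz (al false) (mderive dzbar (al true) F).
  by rewrite !mderiveE word_cat /word !foldr_map.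
have cE b c (s : seq 'I_n) i : count_mem (i, b) [seq (j, c) | j <- s] = (if b == c then count_mem i s else 0)%N.
  rewrite count_map; case: eqP => [->|bc].
    by apply: eq_count => j /=; rewrite xpair_eqE eqxx andbT.
  by apply/eqP; rewrite -leqn0 leqNgt -has_count; apply/hasPn => j _ /=; rewrite xpair_eqE negb_and; apply/orP; right; apply/eqP => cb; apply: bc.
have pe : perm_eq w can.
  rewrite /perm_eq; apply/allP => -[i b] _ /=; rewrite count_cat !cE !count_mword !alE.
  by case: b; rewrite /= ?addn0 ?add0n eqxx.
rewrite (word_perm oU hF Uz pe) canE /dnorm.
have sz : (\sum_(j < n) (al false, al true).1 j + \sum_(j < n) (al false, al true).2 j == k)%N.
  rewrite /= -!size_mword -(size_map (pair^~ false)) -(size_map (pair^~ true) (mword (al true))).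
  by rewrite -size_cat -(perm_size pe).
rewrite (bigD1 (al false, al true) sz) /= lerDl; apply: sumr_ge0 => ab _.
exact: normc_ge0.
Qed.

(* P j c G z is the j-th derivative of G at z along v when c = coef v; the
   coefficients are left free so that conj z can be replaced by a function
   holomorphic near the circle. *)
Fixpoint P (j : nat) (c : 'I_n * bool -> C) G z : C :=
  if j is j'.+1 then \sum_q c q * P j' c (letter q G) z else G z.

Lemma P_le j c G z A B : 0 <= A -> \sum_q normc (c q) <= A -> 0 <= B ->
  (forall w, size w = j -> normc (word w G z) <= B) -> normc (P j c G z) <= A ^+ j * B.
Proof.
move=> A0 hc; elim: j G B => [|j IH] G B B0 hB; first by rewrite mul1r; exact: (hB [::] erefl).
apply: (le_trans (normc_sum _ _ _)).
apply: (@le_trans _ _ (\sum_q normc (c q) * (A ^+ j * B))).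
  apply: ler_sum => q _; rewrite normcM; apply: ler_wpM2l; first exact: normc_ge0.
  apply: IH B0 _ => w wj.
  by have := hB (rcons w q); rewrite size_rcons wj -cats1 word_cat => /(_ erefl).
rewrite -mulr_suml exprS -mulrA; apply: ler_wpM2r hc.
by pos.
Qed.

Lemma sum_coef_le v : \sum_q normc (coef v q) <= (n * 2)%:R * vnorm v.
Proof.
apply: (@le_trans _ _ (\sum_(q : 'I_n * bool) vnorm v)).
  apply: ler_sum => q _; rewrite /coef; case: q.2; rewrite ?normc_conj; exact: normc_le_vnorm.
by rewrite sumr_const card_prod card_ord card_bool -[leLHS]mulr_natl.
Qed.

Lemma rderive_sum U (G : 'I_n * bool -> V -> C) (c : 'I_n * bool -> C) v z :
  (forall q, C1 U (G q)) -> U z ->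
  rderive v (fun z => \sum_q c q * G q z) z = \sum_q c q * rderive v (G q) z.
Proof.
move=> h Uz; apply: rderive_val; apply: dR_sum => q; apply: dRZ.
exact: (C1_dv (h q) v Uz).
Qed.

Fixpoint nder v (j : nat) F : V -> C := if j is j'.+1 then rderive v (nder v j' F) else F.

Lemma har_nder U F v j : opn U -> har U F -> har U (nder v j F).
Proof. by move=> oU hF; elim: j => [//|j IH]; exact: (har_rderive v oU IH). Qed.

Lemma nder_ext U F G v j z : opn U -> (forall w, U w -> F w = G w) -> U z -> nder v j F z = nder v j G z.
Proof.
move=> oU h; elim: j z => [|j IH] z Uz; first exact: (h z Uz).
exact: (rderive_ext v oU Uz IH).
Qed.

Lemma nder_sum U (G : 'I_n * bool -> V -> C) (c : 'I_n * bool -> C) v j z : opn U ->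
  (forall q, har U (G q)) -> U z ->
  nder v j (fun z => \sum_q c q * G q z) z = \sum_q c q * nder v j (G q) z.
Proof.
move=> oU h; elim: j z => [|j IH] z Uz; first by [].
apply: etrans (rderive_ext v oU Uz IH) _.
exact: (rderive_sum c v (fun q => har_C1 (har_nder v j oU (h q))) Uz).
Qed.

Lemma nderSr v j F : nder v j.+1 F = nder v j (rderive v F).
Proof. by elim: j => [//|j IH]; exact: (f_equal (rderive v) IH). Qed.

Lemma nder_P U F v j z : opn U -> har U F -> U z -> nder v j F z = P j (coef v) F z.
Proof.
move=> oU; elim: j F => [//|j IH] F hF Uz; rewrite nderSr.
have E w : U w -> rderive v F w = \sum_q coef v q * letter q F w.
  by move=> Uw; exact: (letter_C1 v oU (har_C1 hF) Uw).
apply: etrans (nder_ext v j oU E Uz) _.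
apply: etrans (nder_sum (coef v) v j oU (fun q => har_letter q oU hF) Uz) _.
by apply: eq_bigr => q _; rewrite (IH _ (har_letter q oU hF) Uz).
Qed.
End derivative_words.

(** * Derivative growth and Taylor expansion of harmonic extensions *)

Section lambda_decay.
Context {R : realType} {n : nat}.
Local Notation C := R[i].
Local Notation V := 'rV[C]_n.
Implicit Types (F G : V -> C) (z v u zeta : V) (a d e p x r A K M tau sg : R) (q : 'I_n * bool).

Lemma cta_within_open F (A : set V) z : {within A, continuous F} -> opn A -> A z -> cta F z.
Proof.
move=> /subspace_continuousP h oA Az; split=> B hB; have k := h z Az B hB.
have {}k : \forall x \near z, A x -> B (F x) := k.
have r : \forall x \near z, B (F x).
  by apply: filterS (near_and (opn_near oA Az) k) => x [Ax hx]; exact: hx.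
exact: r.
Qed.

Lemma harmonic_har phi Phi : harmonic_extension phi Phi -> har (@unit_ball R n) Phi.
Proof.
move=> [cP C2P lap _]; have oU := @opn_unit_ball R n.
have inB z : unit_ball z -> z \in unit_ball by move=> h; rewrite inE.
have cPhi z : unit_ball z -> cta Phi z.
  move=> z1; split=> B hB.
  move/subspace_continuousP: cP => /(_ z (ltW z1)) h; have k := h B hB.
  have {}k : \forall x \near z, closed_unit_ball x -> B (Phi x) := k.
  have r : \forall x \near z, B (Phi x).
    by apply: filterS (near_and (opn_near oU z1) k) => x [Ax hx]; exact: (hx (ltW Ax)).
  exact: r.
split.
- split=> [z|v z z1|v z z1]; first exact: cPhi.
    by apply: rderivable_dv; have [h _ _ _] := C2P v v; exact: (h z (inB z z1)).
  by have [_ h _ _] := C2P v v; exact: (cta_within_open h oU z1).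
- move=> v; split=> [z z1|w z z1|w z z1].
  + by have [_ h _ _] := C2P v v; exact: (cta_within_open h oU z1).
  + by apply: rderivable_dv; have [_ _ h _] := C2P v w; exact: (h z (inB z z1)).
  + by have [_ _ _ h] := C2P v w; exact: (cta_within_open h oU z1).
- by move=> z z1; apply: etrans (lap z (inB z z1)); exact: (esym (laplacian_dir Phi z)).
Qed.

(** The counterpart of [power_integral] for an integrable singularity at 1. *)
Lemma power_integral_lt (phi dphi : R -> C) K a x : 0 < a -> 0 <= K -> 0 <= x < 1 ->
  (forall x, 0 <= x < 1 -> dR phi x (dphi x)) ->
  (forall x, 0 <= x < 1 -> normc (dphi x) <= K * (1 - x) `^ (a - 1)) ->
  normc (phi x - phi 0) <= K / a.
Proof.
move=> a0 K0 /andP[x0 x1] dphiE hK; have a0' : a != 0 by pos.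
pose B y := (- (K / a)) * (1 - y) `^ a.
pose dB y := K * (1 - y) `^ (a - 1).
have B1 : B x - B 0 <= K / a.
  rewrite /B subr0 powR1 mulr1 opprK mulNr addrC gerBl; apply: mulr_ge0 (powR_ge0 _ _).
  by pos.
apply: le_trans (@normc_MVT R phi dphi B dB 0 x x0 _ _ _ _ _) B1.
- by move=> y /andP[y0 yx]; apply: dphiE; rewrite ltW//= (lt_trans yx).
- move=> y /andP[y0 yx].
  have xd : 0 < 1 - y by pos.
  have h1 : rder (fun y => 1 - y) y (-1).
    by have := rderD (rder_cst 1 y) (rderN (rder_id y)); rewrite add0r.
  have := @rder_comp _ (fun y => y `^ a) (fun y => 1 - y) y _ _ (rder_powR _ xd) h1.
  move=> /(rderZ (- (K / a))) h2; apply: (rder_eq h2); rewrite /dB.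
  by move: (_ `^ (a - 1)) => b; field.
- by move=> y /andP[y0 yx]; apply: hK; rewrite ltW//= (lt_trans yx).
- by move=> y /andP[y0 yx]; apply: (@dR_cta _ _ _ (dphi y)); apply: dphiE; rewrite y0 (le_lt_trans yx).
- move=> y /andP[y0 yx]; have xd : 0 < 1 - y by pos.
  by rewrite /B; cts; exact: xd.
Qed.

Lemma rderive_letters_le G v z A : har unit_ball G -> unit_ball z -> 0 <= A ->
  (forall q, normc (letter q G z) <= A) -> normc (rderive v G z) <= (n * 2)%:R * vnorm v * A.
Proof.
move=> hG z1 A0 hA; have := nder_P v 1 opn_unit_ball hG z1; rewrite [LHS]/= => ->.
have v0 : 0 <= (n * 2)%:R * vnorm v by pos.
rewrite -[_ * vnorm v]expr1; apply: (P_le v0 (sum_coef_le v) A0) => -[//|q [|//]] _.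
exact: hA.
Qed.

Lemma har_descend G A p : har (@unit_ball R n) G -> 0 <= A -> 1 < p ->
  (forall q z, vnorm z < 1 -> normc (letter q G z) <= A * (1 - vnorm z) `^ (- p)) ->
  forall z, vnorm z < 1 ->
  normc (G z) <= normc (G 0) + (n * 2)%:R * A * 2 `^ p / (p - 1) * (1 - vnorm z) `^ (- (p - 1)).
Proof.
move=> hG A0 p1 hA z z1; have [d0 d1] := ball_dist z1; set d := 1 - vnorm z in d0 d1 *.
have h : normc (G ((1 : R)%:C *: z) - G ((0 : R)%:C *: z)) <= (n * 2)%:R * A * 2 `^ p / (p - 1) * d `^ (- (p - 1)).
  apply: (@power_integral R (fun x => G (x%:C *: z)) (fun x => rderive z G (x%:C *: z))) => //.
  - by pos.
  - by move=> x x01; exact: dv_ray (C1_dv (har_C1 hG) z (ray_ball z1 x01)).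
  - move=> x /andP[x0 x1]; have x01 : 0 <= x <= 1 by lra.
    have xz := ray_ball z1 x01.
    have A1 : 0 <= A * (1 - vnorm (x%:C *: z)) `^ (- p) by pos.
    apply: le_trans (rderive_letters_le z hG xz A1 (fun q => hA q _ xz)) _.
    have := radial_dist d0 d1 (ltW x0) x1 (ltW (lt_trans ltr01 p1)).
    rewrite vnormZ normc_nneg ?(ltW x0)// (_ : vnorm z = 1 - d); last by rewrite subKr.
    move=> h; apply: (@le_trans _ _ ((n * 2)%:R * 1 * (A * (2 `^ p * (1 - x + d) `^ (- p))))).
      apply: ler_pM.
      + by pos.
      + by pos.
      + by apply: ler_wpM2l; [exact: ler0n|lra].
      + exact: ler_wpM2l.
    by lra.
have -> : G z = G ((1 : R)%:C *: z) by rewrite scale1r.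
have -> : G 0 = G ((0 : R)%:C *: z) by rewrite scale0r.
by have := normc_sub_ge (G ((1 : R)%:C *: z)) (G ((0 : R)%:C *: z)); lra.
Qed.

(** The bound of order k is integrated down to orders k - 1, ..., 1. With an exponent sg < 1 in
    place of tau every step has p > 1, so no logarithm arises at integer tau and no case where the
    exponent changes sign. *)
Lemma har_decay Phi M tau sg k : har (@unit_ball R n) Phi -> 0 <= M -> sg <= tau -> 0 < sg -> sg < 1 ->
  (forall z, vnorm z < 1 -> dnorm k Phi z <= M * (1 - vnorm z) `^ (tau - k%:R)) ->
  exists2 B, 0 <= B & forall w, (0 < size w <= k)%N -> forall z, vnorm z < 1 ->
    normc (word w Phi z) <= B * (1 - vnorm z) `^ (sg - (size w)%:R).
Proof.
move=> hPhi M0 sgt sg0 sg1 hM; have oU := @opn_unit_ball R n.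
have step i : exists2 B, 0 <= B & forall w, (0 < size w)%N -> (k - i <= size w <= k)%N -> forall z, vnorm z < 1 ->
    normc (word w Phi z) <= B * (1 - vnorm z) `^ (sg - (size w)%:R).
  elim: i => [|i [B B0 hB]].
    exists M => // w w0; rewrite subn0 -eqn_leq => /eqP kw z z1; have [d0 d1] := ball_dist z1.
    apply: le_trans (word_le_dnorm w oU hPhi z1) _; rewrite -kw; apply: le_trans (hM z z1) _.
    apply: (ler_wpM2l M0); apply: (powR_exp_anti d0 d1).
    by lra.
  have [ki|ki] := leqP k i.
    exists B => // w w0 /andP[_ wk] z z1; apply: hB => //.
    by rewrite (leq_trans _ (leq0n _))// leqn0.
  pose j := (k - i.+1)%N; have kj : (k - i = j.+1)%N by rewrite subnSK.
  have [j0|j0] := posnP j.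
    exists B => // w w0 /andP[_ wk] z z1; apply: hB => //.
    by rewrite wk andbT kj j0.
  pose p : R := j.+1%:R - sg.
  have p1 : 1 < p.
    have j1 : 1 <= j%:R :> R by rewrite ler1n.
    by rewrite /p -natr1; move: j1 sg1; lra.
  have Z0 : vnorm (0 : V) < 1 by rewrite vnorm0.
  pose B' := dnorm j Phi 0 + (n * 2)%:R * B * 2 `^ p / (p - 1).
  have dn0 : 0 <= dnorm j Phi 0 by apply: sumr_ge0 => ? _; exact: normc_ge0.
  have c0 : 0 <= (n * 2)%:R * B * 2 `^ p / (p - 1).
    by pos.
  exists (B + B'); first by rewrite !addr_ge0.
  move=> w w0 /andP[jw wk] z z1; have [d0 d1] := ball_dist z1; rewrite mulrDl.
  have e0 := powR_ge0 (1 - vnorm z) (sg - (size w)%:R).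
  have [wj|wj] := ltnP j (size w).
    apply: le_trans (hB w w0 _ z z1) _; first by rewrite kj wj.
    by rewrite lerDl mulr_ge0// addr_ge0.
  have wj' : size w = j by apply/eqP; rewrite eqn_leq wj.
  have hq q y : vnorm y < 1 -> normc (letter q (word w Phi) y) <= B * (1 - vnorm y) `^ (- p).
    move=> y1; have := hB (q :: w) isT _ y y1; rewrite /= wj' kj leqnn /p opprB; apply.
    by rewrite -kj leq_subr.
  have := har_descend (har_word w oU hPhi) B0 p1 hq z1.
  have pj : - (p - 1) = sg - j%:R by rewrite /p; ring.
  rewrite pj wj' in e0 * => h; apply: le_trans h _.
  apply: ler_wpDl; first exact: mulr_ge0.
  rewrite /B' mulrDl; apply: lerD; last by [].
  have h0 := word_le_dnorm w oU hPhi Z0; rewrite wj' in h0; apply: le_trans h0 _.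
  have j1 : 1 <= j%:R :> R by rewrite ler1n.
  have e1 : 1 <= (1 - vnorm z) `^ (sg - j%:R).
    by rewrite -{1}(powRr0 (1 - vnorm z)); apply: (powR_exp_anti d0 d1); move: j1 sg1; lra.
  by rewrite ler_peMr.
have [B B0 hB] := step k; exists B => // w /andP[w0 wk] z z1; apply: hB => //.
by rewrite subnn.
Qed.

Lemma closed_ball_continuity Phi : {within closed_unit_ball, continuous Phi} ->
  forall zeta, vnorm zeta <= 1 -> forall e, 0 < e -> exists2 d, 0 < d &
    forall w, vnorm w <= 1 -> vnorm (w - zeta) < d -> normc (Phi zeta - Phi w) < e.
Proof.
move=> /subspace_continuousP h zeta z1 e e0.
have e0' : 0 < e%:C by rewrite ltcR.
have := h zeta z1 => /cvgrPdist_lt/(_ _ e0') k.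
have {}k : \forall x \near zeta, closed_unit_ball x -> `|Phi zeta - Phi x| < e%:C := k.
move/nearVP: k => [d d0 hd]; exists d => // w w1 wz.
by have := hd w wz w1; rewrite normr_normc ltcR.
Qed.

(** The Taylor polynomial at the moving centre z + s v, evaluated at z + v. In s it goes from the
    polynomial at z to the value at z + v, and its derivative in s telescopes to the top term. *)
Definition taylor Phi z v k s : C :=
  \sum_(j < k) ((1 - s) ^+ j / j`!%:R)%:C * nder v j Phi (z + s%:C *: v).

Lemma taylor_dR Phi z v k s : har (@unit_ball R n) Phi -> vnorm (z + s%:C *: v) < 1 ->
  dR (taylor Phi z v k.+1) s (((1 - s) ^+ k / k`!%:R)%:C * nder v k.+1 Phi (z + s%:C *: v)).
Proof.
move=> hPhi zs.
have dj j : dR (fun s => nder v j Phi (z + s%:C *: v)) s (nder v j.+1 Phi (z + s%:C *: v)).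
  by apply: dv_line; exact: (C1_dv (har_C1 (har_nder v j (@opn_unit_ball R n) hPhi)) v zs).
have h1 : rder (fun y => 1 - y) s (-1).
  by have := rderD (rder_cst 1 s) (rderN (rder_id s)); rewrite add0r.
elim: k => [|k IH].
  rewrite expr0 fact0 divr1 mul1r; apply: dR_near (dj 0%N); apply: near_all => y.
  by rewrite /taylor big_ord1 divr1 mul1r.
have h2 : rder (fun y => (1 - y) ^+ k.+1 / k.+1`!%:R) s (- ((1 - s) ^+ k / k`!%:R)).
  have := rderM (rderX k.+1 h1) (rder_cst (k.+1`!%:R)^-1 s) => h; apply: (rder_eq h).
  rewrite mulr0 addr0 /= factS natrM invfM.
  by move: ((1 - s) ^+ k) (k`!%:R^-1) => a b; rewrite mulrN1 mulNr; congr (- _); rewrite mulrC -mulrA mulrCA; field.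
have h3 := dRD IH (dR_scale h2 (dj k.+1)).
have h4 : dR (taylor Phi z v k.+2) s (((1 - s) ^+ k / k`!%:R)%:C * nder v k.+1 Phi (z + s%:C *: v) +
    ((- ((1 - s) ^+ k / k`!%:R))%:C * nder v k.+1 Phi (z + s%:C *: v) +
     ((1 - s) ^+ k.+1 / k.+1`!%:R)%:C * nder v k.+2 Phi (z + s%:C *: v))).
  by apply: dR_near h3; apply: near_all => y; rewrite /taylor [RHS]big_ord_recr.
apply: dR_eq h4 _; rewrite rmorphN mulNr addrA subrr add0r //.
Qed.

Lemma nder_le Phi v j z B : har (@unit_ball R n) Phi -> vnorm z < 1 -> 0 <= B ->
  (forall w, size w = j -> normc (word w Phi z) <= B) ->
  normc (nder v j Phi z) <= ((n * 2)%:R * vnorm v) ^+ j * B.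
Proof.
move=> hPhi z1 B0 hB; rewrite (nder_P v j (@opn_unit_ball R n) hPhi z1).
by apply: P_le => //; [rewrite mulr_ge0 ?ler0n ?vnorm_ge0|exact: sum_coef_le].
Qed.

(** The segment ends on the sphere, where the derivatives blow up. The derivative of [taylor] in s
    is still integrable, because (1 - s)^k (1 - s)^(tau - k - 1) = (1 - s)^(tau - 1); the value at s
    = 1 is reached through the weaker exponent sg and the continuity of Phi. *)
Lemma taylor_boundary Phi tau sg k M B z v : har (@unit_ball R n) Phi ->
  {within closed_unit_ball, continuous Phi} ->
  0 < tau -> tau <= k.+1%:R -> 0 < sg -> sg <= 1 -> 0 <= M -> 0 <= B ->
  (forall w, size w = k.+1 -> forall y, vnorm y < 1 ->
    normc (word w Phi y) <= M * (1 - vnorm y) `^ (tau - k.+1%:R)) ->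
  (forall w, (0 < size w <= k)%N -> forall y, vnorm y < 1 ->
    normc (word w Phi y) <= B * (1 - vnorm y) `^ (sg - (size w)%:R)) ->
  vnorm z < 1 -> vnorm (z + v) = 1 ->
  normc (Phi (z + v) - taylor Phi z v k.+1 0) <=
    ((n * 2)%:R * vnorm v) ^+ k.+1 * M * (1 - vnorm z) `^ (tau - k.+1%:R) / tau.
Proof.
move=> hPhi cPhi tau0 tauk sg0 sg1 M0 B0 hM hB z1 zv.
have [d0 d1] := ball_dist z1; set d := 1 - vnorm z in d0 d1 *.
pose N := (n * 2)%:R * vnorm v; have N0 : 0 <= N by rewrite mulr_ge0 ?vnorm_ge0.
(* Convexity of the norm, as z + v has norm 1. *)
have segd s : 0 <= s < 1 -> (1 - s) * d <= 1 - vnorm (z + s%:C *: v).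
  move=> /andP[s0 s1]; have -> : z + s%:C *: v = (1 - s)%:C *: z + s%:C *: (z + v).
    by rewrite scalerDr addrA -scalerDl -rmorphD subrK scale1r.
  have := vnormD ((1 - s)%:C *: z) (s%:C *: (z + v)).
  rewrite !vnormZ zv !normc_nneg ?subr_ge0 ?(ltW s1)// /d; lra.
have segp s : 0 <= s < 1 -> 0 < (1 - s) * d.
  by move=> /andP[s0 s1]; rewrite mulr_gt0// subr_gt0.
have inb s : 0 <= s < 1 -> vnorm (z + s%:C *: v) < 1.
  by move=> s01; rewrite -subr_gt0; apply: lt_le_trans (segp s s01) (segd s s01).
have dpow s a : 0 <= s < 1 -> a <= 0 -> (1 - vnorm (z + s%:C *: v)) `^ a <= (1 - s) `^ a * d `^ a.
  move=> s01 a0; apply: le_trans (powR_anti a0 (segp s s01) (segd s s01)) _.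
  have s1' : 0 <= 1 - s by case/andP: s01 => _ s1; rewrite subr_ge0 ltW.
  by rewrite (powRM _ s1' (ltW d0)).
pose K := N ^+ k.+1 * M * d `^ (tau - k.+1%:R).
have K0 : 0 <= K by rewrite !mulr_ge0 ?powR_ge0 ?exprn_ge0.
have tk0 : tau - k.+1%:R <= 0 by lra.
have main s : 0 <= s < 1 -> normc (taylor Phi z v k.+1 s - taylor Phi z v k.+1 0) <= K / tau.
  move=> s01; apply: (power_integral_lt tau0 K0 s01 (fun y y01 => taylor_dR k hPhi (inb y y01))).
  move=> y y01; have [y0 y1] := andP y01; have y1' : 0 < 1 - y by lra.
  have p0 : 0 <= (1 - vnorm (z + y%:C *: v)) `^ (tau - k.+1%:R) by pos.
  have h := nder_le v hPhi (inb y y01) (mulr_ge0 M0 p0) (fun w wk => hM w wk _ (inb y y01)).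
  rewrite normcM normc_nneg; last by pos.
  have f1 : (1 - y) ^+ k / k`!%:R <= (1 - y) ^+ k.
    rewrite ler_pdivrMr ?ltr0n ?fact_gt0// ler_peMr ?exprn_ge0 ?(ltW y1')// ler1n fact_gt0 //.
  apply: le_trans (ler_pM _ _ f1 h) _.
  - by pos.
  - exact: normc_ge0.
  apply: (@le_trans _ _ ((1 - y) ^+ k * (N ^+ k.+1 * (M * ((1 - y) `^ (tau - k.+1%:R) * d `^ (tau - k.+1%:R)))))).
    apply: ler_wpM2l; first by pos.
    apply: ler_wpM2l; first exact: exprn_ge0.
    by apply: (ler_wpM2l M0); exact: dpow.
  have -> : (1 - y) `^ (tau - 1) = (1 - y) ^+ k * (1 - y) `^ (tau - k.+1%:R).
    rewrite -powR_mulrn ?(ltW y1')// -powR_add//; congr (_ `^ _).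
    by lra.
  by rewrite /K le_eqVlt; apply/orP; left; apply/eqP; ring.
apply: le_eps => e e0.
(* The terms of order 1 to k tend to 0 like (1 - s)^sg, which leaves Phi (z + s v). *)
pose Tl := \sum_(j < k) N ^+ j.+1 * B * d `^ (sg - j.+1%:R).
have Tl0 : 0 <= Tl.
  by apply: sumr_ge0 => j _; rewrite !mulr_ge0 ?powR_ge0 ?exprn_ge0.
have tail s : 0 <= s < 1 -> normc (taylor Phi z v k.+1 s - Phi (z + s%:C *: v)) <= Tl * (1 - s) `^ sg.
  move=> s01; have [s0 s1] := andP s01; have s1' : 0 < 1 - s by lra.
  rewrite /taylor big_ord_recl expr0 fact0 divr1 mul1r /= addrC addrA addNr add0r.
  apply: le_trans (normc_sum _ _ _) _; rewrite /Tl mulr_suml; apply: ler_sum => j _.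
  rewrite normcM normc_nneg; last by pos.
  rewrite (_ : bump 0 j = j.+1)//.
  have sj : sg - j.+1%:R <= 0 by rewrite subr_le0 (le_trans sg1)// ler1n.
  have p0 : 0 <= (1 - vnorm (z + s%:C *: v)) `^ (sg - j.+1%:R) by pos.
  have hw w : size w = j.+1 -> normc (word w Phi (z + s%:C *: v)) <= B * (1 - vnorm (z + s%:C *: v)) `^ (sg - j.+1%:R).
    by move=> wj; rewrite -wj; apply: hB (inb s s01); rewrite wj /= ltn_ord.
  have h := nder_le v hPhi (inb s s01) (mulr_ge0 B0 p0) hw.
  have f1 : (1 - s) ^+ j.+1 / j.+1`!%:R <= (1 - s) ^+ j.+1.
    rewrite ler_pdivrMr ?ltr0n ?fact_gt0// ler_peMr ?exprn_ge0 ?(ltW s1')// ler1n fact_gt0 //.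
  apply: le_trans (ler_pM _ _ f1 h) _.
  - by pos.
  - exact: normc_ge0.
  apply: (@le_trans _ _ ((1 - s) ^+ j.+1 * (N ^+ j.+1 * (B * ((1 - s) `^ (sg - j.+1%:R) * d `^ (sg - j.+1%:R)))))).
    apply: ler_wpM2l; first by pos.
    apply: ler_wpM2l; first exact: exprn_ge0.
    by apply: (ler_wpM2l B0); exact: dpow.
  have -> : (1 - s) `^ sg = (1 - s) ^+ j.+1 * (1 - s) `^ (sg - j.+1%:R).
    rewrite -powR_mulrn ?(ltW s1')// -powR_add//; congr (_ `^ _); ring.
  by rewrite le_eqVlt; apply/orP; left; apply/eqP; ring.
have e2 : 0 < e / 2 by pos.
have zv1 : vnorm (z + v) <= 1 by lra.
have [dl dl0 hdl] := closed_ball_continuity cPhi zv1 e2.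
have v0 : 0 < 1 + vnorm v by pos.
have T1 : 0 < 1 + Tl by pos.
pose q := (e / 2 / (1 + Tl)) `^ sg^-1.
have q0 : 0 < q by rewrite powR_gt0// divr_gt0.
pose m := Num.min 1 (Num.min q (dl / (1 + vnorm v))).
have m0 : 0 < m by rewrite !lt_min ltr01 q0 divr_gt0.
pose s := 1 - m / 2.
have s1E : 1 - s = m / 2 by rewrite subKr.
have m1 : m <= 1 by rewrite ge_min lexx.
have m2 : m / 2 < m by lra.
have s01 : 0 <= s < 1 by rewrite /s; apply/andP; split; lra.
move: (m2); rewrite !lt_min => /and3P[_ mq md].
have h1 := tail s s01; have h2 := main s s01.
have h3 : Tl * (1 - s) `^ sg <= e / 2.
  have qs : q `^ sg = e / 2 / (1 + Tl).
    by rewrite -powRrM mulVf ?gt_eqF// powRr1// divr_ge0 ?ltW.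
  have : (1 - s) `^ sg <= e / 2 / (1 + Tl).
    by rewrite -qs s1E; apply: powR_le; rewrite ?divr_ge0 ?ltW// ?ltW ?ltr0n.
  move=> h; apply: le_trans (ler_wpM2l Tl0 h) _.
  by rewrite mulrCA ler_piMr ?(ltW e2)// ler_pdivrMr// mul1r lerDr.
have h4 : normc (Phi (z + v) - Phi (z + s%:C *: v)) < e / 2.
  apply: hdl; first by rewrite ltW// inb.
  rewrite opprD addrACA subrr add0r -{2}(scale1r v) -scalerBl -[1 : C]/((1 : R)%:C) -rmorphB vnormZ.
  rewrite normc_real distrC s1E gtr0_norm ?divr_gt0 ?ltr0n//.
  move: md; rewrite ltr_pdivlMr//; apply: le_lt_trans; rewrite mulrDr mulr1 lerDr ltW//.
  by pos.
rewrite (_ : Phi (z + v) - _ = (Phi (z + v) - Phi (z + s%:C *: v)) -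
   (taylor Phi z v k.+1 s - Phi (z + s%:C *: v)) + (taylor Phi z v k.+1 s - taylor Phi z v k.+1 0)); last by ring.
apply: le_trans (le_normcD _ _) _; rewrite addrC; apply: lerD; first exact: h2.
apply: le_trans (le_normcB _ _) _; rewrite [e](splitr e); apply: lerD (ltW h4) _.
exact: le_trans h1 h3.
Qed.
End lambda_decay.

(** * Approximation on slices by functions holomorphic off the origin *)

Section slice_approximation.
Context {R : realType} {n : nat}.
Local Notation C := R[i].
Local Notation V := 'rV[C]_n.
Implicit Types (chi : V -> C) (zeta : V) (H M c tau sg x t u : R) (K l : nat).

Definition holder_slices chi sg H := forall zeta, vnorm zeta = 1 -> forall t u,
  normc (chi (ee t *: zeta) - chi (ee u *: zeta)) <= H * normc (ee t - ee u : C) `^ sg.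

(* On the slice through zeta, chi agrees with a function holomorphic off the
   origin to order d^tau near the circle point closest to x ee u, at the scale
   d = 1 - x. *)
Definition approx chi tau K c := forall zeta, vnorm zeta = 1 -> forall u x, 2^-1 <= x < 1 ->
  exists2 Q : C -> C, hol [set w | w != 0] Q &
    (forall w, 2^-1 <= normc w <= 2 -> normc (Q w) <= c * (1 - x) ^- K) /\
    (forall t, normc (chi (ee t *: zeta) - Q (ee t)) <=
       c * (1 - x) `^ tau * (normc (ee t - x%:C * ee u) / (1 - x)) ^+ K).

Lemma ratio_ge1 x t u : 2^-1 <= x < 1 -> 1 <= normc (ee t - x%:C * ee u) / (1 - x).
Proof.
move=> /andP[x0 x1]; rewrite ler_pdivlMr ?subr_gt0// mul1r.
by have := normc_sub_ge (ee t) (x%:C * ee u); rewrite normc_ee normc_circle ger0_norm//; lra.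
Qed.

Lemma pow_dist_ge1 x K : 2^-1 <= x < 1 -> 1 <= (1 - x) ^- K.
Proof.
by move=> /andP[x0 x1]; rewrite invf_ge1 ?exprn_gt0 ?subr_gt0// exprn_ile1//; lra.
Qed.

(** Both 1 / (1 - x) and the ratio |ee t - x ee u| / (1 - x) are at least 1. *)
Lemma approx_weaken chi tau K K' c : (K <= K')%N -> 0 <= c -> approx chi tau K c -> approx chi tau K' c.
Proof.
move=> KK c0 h zeta z1 u x hx; have [Q hQ [h1 h2]] := h zeta z1 u x hx; exists Q => //.
have /andP[x0 x1] := hx; split=> [w hw|t].
  apply: le_trans (h1 w hw) _; apply: (ler_wpM2l c0).
  by rewrite lef_pV2 ?posrE ?exprn_gt0 ?subr_gt0//; apply: ler_wiXn2l => //; lra.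
apply: le_trans (h2 t) _; apply: ler_wpM2l; first by pos.
by apply: ler_weXn2l => //; exact: ratio_ge1.
Qed.

Lemma chord_dist x t u : 2^-1 <= x < 1 -> normc (ee t - ee u : C) <= 2 * normc (ee t - x%:C * ee u).
Proof.
move=> /andP[x0 x1]; have x01 : 0 <= x <= 1 by apply/andP; split; lra.
rewrite (normc_1subM (ee u) (normc_ee t)) (normc_1subM (x%:C * ee u) (normc_ee t)).
rewrite mulrCA -ee_opp -eeD; exact: chord_le.
Qed.

Lemma dist_le2 x t u : 2^-1 <= x < 1 -> normc (ee t - x%:C * ee u : C) <= 2.
Proof.
move=> /andP[x0 x1]; apply: le_trans (le_normcB _ _) _.
by rewrite normc_ee normc_circle ger0_norm; lra.
Qed.

(** K = 1 is enough: the ratio |ee t - x ee u| / (1 - x) is at least 1, so its power sg <= 1 is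
    below the ratio itself. *)
Lemma holder_approx chi sg H M : 0 < sg -> sg <= 1 -> 0 <= H ->
  (forall zeta, vnorm zeta = 1 -> normc (chi zeta) <= M) ->
  holder_slices chi sg H -> exists2 c, 0 <= c & approx chi sg 1 c.
Proof.
move=> sg0 sg1 H0 hM hH; exists (Num.max M 0 + H * 2 `^ sg).
  by rewrite addr_ge0 ?le_max ?lexx ?orbT ?mulr_ge0.
move=> zeta z1 u x hx; have /andP[x0 x1] := hx; have d0 : 0 < 1 - x by pos.
have H2 : 0 <= H * 2 `^ sg by pos.
have M0 : 0 <= Num.max M 0 by rewrite le_max lexx orbT.
have ez v : vnorm (ee v *: zeta) = 1 by rewrite vnormZ normc_ee mul1r.
exists (fun=> chi (ee u *: zeta)); first exact: hol_cst.
split=> [w _|t].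
  apply: le_trans (hM _ (ez u)) _; apply: (@le_trans _ _ (Num.max M 0)); first by rewrite le_max lexx.
  apply: (@le_trans _ _ (Num.max M 0 + H * 2 `^ sg)); first by lra.
  by apply: ler_peMr; [rewrite addr_ge0|exact: pow_dist_ge1].
apply: le_trans (hH zeta z1 t u) _; set r := normc (ee t - x%:C * ee u).
have rd : r = (1 - x) * (r / (1 - x)) by rewrite mulrCA divff ?mulr1// gt_eqF.
have q1 : 1 <= r / (1 - x) by exact: ratio_ge1.
have q0 : 0 <= r / (1 - x) := le_trans ler01 q1.
have e1 : normc (ee t - ee u) `^ sg <= 2 `^ sg * ((1 - x) `^ sg * (r / (1 - x)) ^+ 1).
  apply: le_trans (powR_le (ltW sg0) (normc_ge0 _) (chord_dist t u hx)) _.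
  rewrite powRM ?ler0n ?normc_ge0//; apply: ler_wpM2l; first exact: powR_ge0.
  rewrite -/r {1}rd powRM ?(ltW d0)//; apply: ler_wpM2l; first exact: powR_ge0.
  by rewrite expr1 -[leRHS]powRr1//; apply: ler_powR.
apply: le_trans (ler_wpM2l H0 e1) _; rewrite [leLHS]mulrA -[leRHS]mulrA; apply: ler_wpM2r; last by lra.
by pos.
Qed.

(** On a slice the pseudodistance |1 - hdot| is the chord |ee t - ee u|. *)
Lemma Gamma_holder phi tau : 0 < tau -> tau < 2^-1 -> Gamma tau phi ->
  exists2 H, 0 <= H & holder_slices phi tau H.
Proof.
rewrite /Gamma => tau0 tau2; rewrite tau2 => -[_ [M hM]].
exists `|M| => // zeta z1 t u.
have inS v : ee v *: zeta \in unit_sphere by rewrite inE /unit_sphere /= vnormZ normc_ee mul1r.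
have [E|ne] := eqVneq (ee t *: zeta) (ee u *: zeta).
  by rewrite E subrr normc0 mulr_ge0 ?powR_ge0.
have hd : hdot (ee t *: zeta) (ee u *: zeta) = conjc (ee t) * ee u.
  rewrite /hdot -[RHS]mulr1; transitivity (conjc (ee t) * ee u * \sum_(j < n) (normc (zeta ord0 j) ^+ 2)%:C).
    rewrite mulr_sumr; apply: eq_bigr => j _; rewrite !mxE conjM -mul_conjc; ring.
  by rewrite -rmorph_sum -sqr_vnorm z1 expr1n.
have := hM _ _ (inS t) (inS u) ne; rewrite hd -(normc_1subM (ee u) (normc_ee t)).
have r0 : 0 < normc (ee t - ee u).
  by rewrite normc_gt0 subr_eq0; apply: contraNneq ne => ->.
rewrite ler_pdivrMr ?powR_gt0// => h; apply: le_trans h _.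
by apply: ler_wpM2r; [exact: powR_ge0|exact: ler_norm].
Qed.

(** Reflection in the unit circle: on |w| = 1 this function is conj (Q w). *)
Lemma conj_hol (Q : C -> C) : hol [set w | w != 0] Q -> hol [set w | w != 0] (fun w => conjc (Q (conjc w)^-1)).
Proof.
move=> hQ w w0.
have cw0 : conjc w != 0 by rewrite -normc_gt0 normc_conj normc_gt0.
have [c0 h0] := hQ _ (invr_neq0 cw0 : (conjc w)^-1 != 0).
have h1 := @cderV _ (fun y : C => y) (conjc w) 1 cw0 (cder_id _).
have /cderP h := cder_comp h0 h1; exists (conjc (c0 * (- 1 / conjc w ^+ 2))).
apply/cderP => e e0; have /nearCP[d d0 hd] := h e e0; apply/nearCP; exists d => // y yw.
have cy : normc (conjc y - conjc w) = normc (y - w) by rewrite -conjB normc_conj.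
have := hd (conjc y); rewrite cy => /(_ yw).
have eq1 (a b c f : C) : normc (conjc a - conjc b - conjc c * f) = normc (a - b - c * conjc f).
  by rewrite -[in RHS]normc_conj !conjB conjM conjcK.
by rewrite eq1 conjB.
Qed.

(** The annulus 1/2 <= |w| <= 2 in [approx] is invariant under this reflection. *)
Lemma approx_conj chi tau K c : approx chi tau K c -> approx (fun z => conjc (chi z)) tau K c.
Proof.
move=> h zeta z1 u x hx; have [Q hQ [h1 h2]] := h zeta z1 u x hx.
exists (fun w => conjc (Q (conjc w)^-1)); first exact: conj_hol.
split=> [w /andP[w1 w2]|t].
  rewrite normc_conj; apply: h1; rewrite normcV normc_conj.
  have w0 : 0 < normc w by apply: lt_le_trans w1; rewrite invr_gt0 ltr0n.
  by rewrite lef_pV2 ?posrE// w2 invf_ple ?posrE.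
by rewrite conj_ee invrK -conjB normc_conj; exact: h2.
Qed.

Lemma hol_sum (D : set C) (I : Type) (s : seq I) (F : I -> C -> C) :
  (forall i, hol D (F i)) -> hol D (fun w => \sum_(i <- s) F i w).
Proof.
move=> h; elim: s => [|i s IH] w Dw.
  by exists 0; apply: cder_near (cder_cst 0 w); apply: near_all => y; rewrite big_nil.
have [a ha] := holD (h i) IH Dw; exists a; apply: cder_near ha; apply: near_all => y.
by rewrite big_cons.
Qed.

Lemma geometric_inverse (a b : C) l : a != 0 -> b != 0 ->
  b^-1 - \sum_(i < l) (a - b) ^+ i / a ^+ i.+1 = (a - b) ^+ l / (a ^+ l * b).
Proof.
move=> a0 b0; elim: l => [|l IH]; first by rewrite big_ord0 subr0 !mul1r.
rewrite big_ord_recr /= opprD addrA IH.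
have al := expf_neq0 l a0; rewrite !exprS; move: (a ^+ l) ((a - b) ^+ l) al => A B A0.
by field; rewrite A0 b0 a0.
Qed.

Lemma diff_powers (X Y : C) (D : R) i : 1 <= D -> normc X <= D -> normc Y <= D ->
  normc (X ^+ i - Y ^+ i) <= normc (X - Y) * (i%:R * D ^+ i).
Proof.
move=> D1 XD YD; have D0 : 0 <= D := le_trans ler01 D1.
elim: i => [|i IH]; first by rewrite subrr normc0 mul0r mulr0.
rewrite !exprS (_ : X * X ^+ i - _ = X * (X ^+ i - Y ^+ i) + (X - Y) * Y ^+ i); last by ring.
apply: le_trans (le_normcD _ _) _; rewrite !normcM.
have h1 := ler_pM (normc_ge0 X) (normc_ge0 _) XD IH.
have h2 : normc (Y ^+ i) <= D * D ^+ i.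
  rewrite normcX; apply: (@le_trans _ _ (D ^+ i)); last by rewrite ler_peMl// exprn_ge0.
  by apply: lerXn2r; rewrite ?nnegrE ?normc_ge0.
apply: le_trans (lerD h1 (ler_wpM2l (normc_ge0 (X - Y)) h2)) _.
rewrite -natr1 le_eqVlt; apply/orP; left; apply/eqP.
by move: (normc _) (D ^+ i) => a b; ring.
Qed.

(** Q may have zeros, so 1 / Q is not an admissible choice. The partial sum of (a - Q)^i / a^(i +
    1), with a = chi (ee u zeta), is polynomial in Q; its remainder (a - b)^l, b = chi (ee t zeta),
    has order sg l >= tau by Hoelder continuity. *)
Lemma approx_inv chi tau sg K c H m M : 0 < tau -> 0 < sg -> sg <= 1 -> 0 <= c -> 0 <= H -> 0 < m ->
  (forall zeta, vnorm zeta = 1 -> m <= normc (chi zeta) <= M) ->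
  holder_slices chi sg H -> approx chi tau K c ->
  exists K' c', 0 <= c' /\ approx (fun z => (chi z)^-1) tau K' c'.
Proof.
move=> tau0 sg0 sg1 c0 H0 m0 hM hH hA0.
(* l is large enough for sg l >= tau. K + 1 in place of K makes K1 positive, so that K' >= l >=
   tau. *)
pose l := (Num.truncn (tau / sg)).+1; pose K1 := K.+1; pose K' := (K1 * l)%N.
have hA := approx_weaken (leqnSn K) c0 hA0; rewrite -/K1 in hA.
have lsg : tau <= sg * l%:R.
  by rewrite mulrC -ler_pdivrMr// ltW// Num.Theory.truncnS_gt.
have K'tau : tau <= K'%:R.
  apply: le_trans lsg _; apply: (@le_trans _ _ l%:R); first by rewrite ler_piMl.
  by rewrite ler_nat leq_addr.
pose D0 := 1 + `|M| + `|M| + c.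
have D01 : 1 <= D0 by rewrite /D0 -!addrA lerDl !addr_ge0.
(* c1 is the cost of replacing chi by Q in the partial sum, c2 bounds the remainder of the series,
   and c3 the size of the sum. *)
pose c1 := \sum_(i < l) c * (i%:R * D0 ^+ i) / m ^+ i.+1.
pose c2 := H ^+ l * 4 `^ (sg * l%:R) / (m ^+ l * m).
pose c3 := \sum_(i < l) D0 ^+ i / m ^+ i.+1.
have D00 : 0 <= D0 := le_trans ler01 D01.
have mX i : 0 < m ^+ i by pos.
have c10 : 0 <= c1.
  by apply: sumr_ge0 => i _; rewrite divr_ge0 ?mulr_ge0 ?ler0n ?exprn_ge0// ltW.
have c20 : 0 <= c2 by rewrite divr_ge0 ?mulr_ge0 ?exprn_ge0// ltW.
have c30 : 0 <= c3 by apply: sumr_ge0 => i _; rewrite divr_ge0 ?exprn_ge0// ltW.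
exists K', (c1 + c2 + c3); split; first by pos.
move=> zeta z1 u x hx; have /andP[x0 x1] := hx; have d0 : 0 < 1 - x by lra.
have d1 : 1 - x <= 1 by lra.
have ez v : vnorm (ee v *: zeta) = 1 by rewrite vnormZ normc_ee mul1r.
have [Q hQ [Q1 Q2]] := hA zeta z1 u x hx.
set a := chi (ee u *: zeta).
have [ma Ma] := andP (hM _ (ez u)); rewrite -/a in ma Ma.
have a0 : a != 0 by rewrite -normc_gt0; exact: lt_le_trans ma.
have M1 : M <= `|M| := ler_norm M.
have am i : m ^+ i <= normc (a ^+ i) by rewrite normcX; apply: lerXn2r; rewrite ?nnegrE ?normc_ge0 ?(ltW m0).
have inv_a i (X : C) (B : R) : normc X <= B -> normc (X / a ^+ i) <= B / m ^+ i.
  move=> XB; rewrite normcM normcV; apply: ler_pM XB _; rewrite ?normc_ge0 ?invr_ge0 ?normc_ge0//.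
  by rewrite lef_pV2 ?posrE// (lt_le_trans (mX i) (am i)).
exists (fun w => \sum_(i < l) (a - Q w) ^+ i / a ^+ i.+1).
  apply: hol_sum => i; apply: holM; last exact: hol_cst.
  apply: holX; apply: holD; first exact: hol_cst.
  by move=> w w0; have [b hb] := hQ w w0; exists (- b); exact: cderN.
split=> [w hw|t].
  apply: (@le_trans _ _ (c3 * (1 - x) ^- K')); last first.
    by apply: ler_wpM2r; [rewrite invr_ge0 exprn_ge0// ltW|rewrite lerDr addr_ge0].
  apply: le_trans (normc_sum _ _ _) _; rewrite /c3 mulr_suml; apply: ler_sum => i _.
  rewrite mulrAC; apply: inv_a; rewrite normcX.
  have q1 := pow_dist_ge1 K1 hx.
  have h1 : normc (a - Q w) <= D0 * (1 - x) ^- K1.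
    apply: le_trans (le_normcB _ _) _; apply: le_trans (lerD Ma (Q1 w hw)) _.
    have : M <= `|M| * (1 - x) ^- K1 by apply: le_trans M1 _; rewrite ler_peMr.
    by rewrite /D0 !mulrDl mul1r; move: q1; move: ((1 - x) ^- K1) (`|M| * _) (c * _) => X Y Z; lra.
  apply: (@le_trans _ _ ((D0 * (1 - x) ^- K1) ^+ i)).
    by apply: lerXn2r => //; rewrite nnegrE ?normc_ge0// mulr_ge0// (le_trans ler01).
  rewrite exprMn; apply: ler_wpM2l; first exact: exprn_ge0.
  rewrite -exprVn -exprM -exprVn; apply: ler_weXn2l.
    by rewrite invf_ge1.
  by rewrite leq_mul2l ltnW.
set b := chi (ee t *: zeta); set q := Q (ee t).
have [mb Mb] := andP (hM _ (ez t)); rewrite -/b in mb Mb.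
have b0 : b != 0 by rewrite -normc_gt0; exact: lt_le_trans mb.
set r := normc (ee t - x%:C * ee u); set rho := r / (1 - x).
have rho1 : 1 <= rho by exact: ratio_ge1.
have rho0 : 0 <= rho := le_trans ler01 rho1.
have rE : r = (1 - x) * rho by rewrite mulrCA divff ?mulr1// gt_eqF.
have hbq : normc (b - q) <= c * (1 - x) `^ tau * rho ^+ K1 by exact: Q2.
have dt1 : (1 - x) `^ tau <= 1 by apply: powR_le1 => //; exact: ltW.
have hK1 : 1 <= rho ^+ K1 by exact: exprn_ege1.
have rhoX i : 0 <= rho ^+ i by pos.
pose D := D0 * rho ^+ K1.
have D1 : 1 <= D by rewrite -[1]mul1r; apply: ler_pM; rewrite ?ler01.
have MD : `|M| + `|M| + c * rho ^+ K1 <= D.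
  have : `|M| <= `|M| * rho ^+ K1 by rewrite ler_peMr.
  have -> : D = rho ^+ K1 + `|M| * rho ^+ K1 + `|M| * rho ^+ K1 + c * rho ^+ K1 by rewrite /D /D0; ring.
  by lra.
have XD : normc (a - b) <= D.
  apply: le_trans (le_normcB _ _) _; apply: le_trans MD.
  have := mulr_ge0 c0 (rhoX K1); move: (c * _) => Y; lra.
have bq1 : normc (b - q) <= c * rho ^+ K1.
  apply: le_trans hbq _; rewrite mulrAC; apply: ler_piMr => //; exact: mulr_ge0.
have YD : normc (a - q) <= D.
  apply: le_trans (le_normc_trans b a q) _; apply: le_trans MD.
  apply: lerD bq1; apply: le_trans (le_normcB _ _) _; lra.
rewrite (_ : b^-1 - _ = (b^-1 - \sum_(i < l) (a - b) ^+ i / a ^+ i.+1) +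
   \sum_(i < l) ((a - b) ^+ i - (a - q) ^+ i) / a ^+ i.+1); last first.
  have E : \sum_(i < l) ((a - b) ^+ i - (a - q) ^+ i) / a ^+ i.+1 =
      \sum_(i < l) (a - b) ^+ i / a ^+ i.+1 - \sum_(i < l) (a - q) ^+ i / a ^+ i.+1.
    by rewrite -sumrB; apply: eq_bigr => i _; rewrite mulrBl.
  by rewrite E addrA subrK.
rewrite (geometric_inverse l a0 b0).
have p0 := powR_ge0 (1 - x) tau.
have t1 : normc ((a - b) ^+ l / (a ^+ l * b)) <= c2 * (1 - x) `^ tau * rho ^+ K'.
  rewrite normcM normcV normcM normcX.
  have h1 : normc (a - b) ^+ l <= H ^+ l * 4 `^ (sg * l%:R) * ((1 - x) `^ tau * rho ^+ K').
    have h2 : normc (a - b) <= H * (2 * r) `^ sg.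
      rewrite normcB; apply: le_trans (hH zeta z1 t u) _; apply: (ler_wpM2l H0).
      by apply: powR_le; [exact: ltW|exact: normc_ge0|exact: chord_dist].
    have r0 : 0 <= r by exact: normc_ge0.
    have r2 : r / 2 <= 1 by rewrite ler_pdivrMr// mul1r; exact: (dist_le2 t u hx).
    have rp : 0 < r by rewrite rE mulr_gt0// (lt_le_trans ltr01).
    apply: (@le_trans _ _ ((H * (2 * r) `^ sg) ^+ l)).
      by apply: lerXn2r => //; rewrite nnegrE ?normc_ge0// mulr_ge0 ?powR_ge0.
    rewrite exprMn -mulrA; apply: ler_wpM2l; first exact: exprn_ge0.
    rewrite -powR_mulrn ?powR_ge0// -powRrM.
    (* As r / 2 <= 1, the exponent sg l may be lowered to tau. *)
    rewrite (_ : 2 * r = 4 * (r / 2)); last by field.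
    rewrite powRM ?ler0n ?divr_ge0//; apply: ler_wpM2l; first exact: powR_ge0.
    have r20 : 0 < r / 2 by pos.
    apply: le_trans (powR_exp_anti r20 r2 lsg) _.
    have rr : r / 2 <= r by rewrite ler_pdivrMr// ler_peMr// ler1n.
    apply: le_trans (powR_le (ltW tau0) (ltW r20) rr) _.
    rewrite rE powRM ?(ltW d0)//; apply: ler_wpM2l => //.
    by rewrite -[leRHS]powR_mulrn//; apply: ler_powR.
  apply: (@le_trans _ _ (H ^+ l * 4 `^ (sg * l%:R) * ((1 - x) `^ tau * rho ^+ K') * (m ^+ l * m)^-1)).
    apply: ler_pM h1 _; rewrite ?exprn_ge0 ?normc_ge0// ?invr_ge0 ?mulr_ge0 ?normc_ge0//.
    rewrite lef_pV2 ?posrE ?mulr_gt0 ?mX// ?(lt_le_trans (mX l) (am l)) ?(lt_le_trans m0 mb)//.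
    by apply: ler_pM (am l) mb; rewrite ltW// mX.
  by rewrite /c2 le_eqVlt; apply/orP; left; apply/eqP; move: (m ^+ l * m)^-1 => X; ring.
have t2 : normc (\sum_(i < l) ((a - b) ^+ i - (a - q) ^+ i) / a ^+ i.+1) <= c1 * (1 - x) `^ tau * rho ^+ K'.
  apply: le_trans (normc_sum _ _ _) _; rewrite /c1 !mulr_suml; apply: ler_sum => i _.
  have h1 := diff_powers i D1 XD YD.
  have abq : normc (a - b - (a - q)) = normc (b - q) by rewrite normcB; congr normc; ring.
  rewrite abq in h1.
  have h2 : normc ((a - b) ^+ i - (a - q) ^+ i) <= c * (i%:R * D0 ^+ i) * ((1 - x) `^ tau * rho ^+ K').
    apply: le_trans h1 _.
    apply: le_trans (ler_wpM2r _ hbq) _; first by rewrite mulr_ge0 ?exprn_ge0// (le_trans ler01).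
    have -> : D ^+ i = D0 ^+ i * rho ^+ (K1 * i) by rewrite exprMn exprM.
    rewrite [leLHS](_ : _ = c * (i%:R * D0 ^+ i) * (1 - x) `^ tau * (rho ^+ K1 * rho ^+ (K1 * i))); last by ring.
    rewrite [leRHS]mulrA; apply: ler_wpM2l; first by pos.
    rewrite -exprD -mulnS; apply: ler_weXn2l => //.
    by rewrite leq_mul2l ltn_ord.
  apply: le_trans (inv_a i.+1 _ _ h2) _.
  by rewrite le_eqVlt; apply/orP; left; apply/eqP; move: (m ^+ i.+1)^-1 => X; ring.
apply: le_trans (le_normcD _ _) _; apply: le_trans (lerD t1 t2) _.
rewrite -!mulrDl -mulrA -[leRHS]mulrA; apply: ler_wpM2r; first exact: mulr_ge0.
by move: c30; lra.
Qed.

Lemma Lambda_bounds phi tau : Lambda tau phi -> exists k Phi M,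
  [/\ tau < k%:R, har (@unit_ball R n) Phi, {within closed_unit_ball, continuous Phi},
    (forall zeta, vnorm zeta = 1 -> Phi zeta = phi zeta) & 0 <= M /\
    forall z, vnorm z < 1 -> dnorm k Phi z <= M * (1 - vnorm z) `^ (tau - k%:R)].
Proof.
move=> [_ [k tk [Phi hPhi wk]]].
have fin : exists M : R, forall z, vnorm z < 1 -> dnorm k Phi z * (1 - vnorm z ^+ 2) `^ (k%:R - tau) <= M.
  move: wk; rewrite /weighted_sup; set S := [set _ | _ in _] => wk.
  have ub z : vnorm z < 1 -> ((dnorm k Phi z * (1 - vnorm z ^+ 2) `^ (k%:R - tau))%:E <= ereal_sup S)%E.
    by move=> z1; apply: ereal_sup_ubound; exists z.
  case E : (ereal_sup S) wk ub => [M| |] // _ ub.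
    by exists M => z /ub; rewrite lee_fin.
  by exists 0 => z /ub.
have [M hM] := fin; exists k, Phi, (Num.max M 0).
have [cP _ _ bP] := hPhi; have hh := harmonic_har hPhi.
split=> //; first by move=> zeta z1; apply: bP; rewrite inE.
split; first by rewrite le_max lexx orbT.
move=> z z1; have [d0 d1] := ball_dist z1; have v0 := vnorm_ge0 z.
have dd : 1 - vnorm z <= 1 - vnorm z ^+ 2 by rewrite lerD2l lerN2 ler_piMl// ltW.
have tk0 : tau - k%:R <= 0 by lra.
have p0 : 0 < (1 - vnorm z ^+ 2) `^ (k%:R - tau) by pos.
have pE : (1 - vnorm z ^+ 2) `^ (tau - k%:R) = ((1 - vnorm z ^+ 2) `^ (k%:R - tau))^-1.
  by rewrite -powRN opprB.
apply: (@le_trans _ _ (Num.max M 0 * (1 - vnorm z ^+ 2) `^ (tau - k%:R))).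
  by rewrite pE ler_pdivlMr//; apply: le_trans (hM z z1) _; rewrite le_max lexx.
by apply: ler_wpM2l; [rewrite le_max lexx orbT|exact: powR_anti].
Qed.

Lemma vnorm_slice zeta (a : C) : vnorm zeta = 1 -> vnorm (a *: zeta) = normc a.
Proof. by move=> z1; rewrite vnormZ z1 mulr1. Qed.

(** The Hardy-Littlewood argument: for points at distance h < 1 go radially down to radius 1 - h,
    across and up again; each part costs a multiple of h^sg. *)
Lemma decay_holder Phi sg B M0 : har (@unit_ball R n) Phi -> {within closed_unit_ball, continuous Phi} ->
  0 < sg -> sg <= 1 -> 0 <= B -> (forall z, vnorm z <= 1 -> normc (Phi z) <= M0) ->
  (forall q z, vnorm z < 1 -> normc (letter q Phi z) <= B * (1 - vnorm z) `^ (sg - 1)) ->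
  exists2 H, 0 <= H & holder_slices Phi sg H.
Proof.
move=> hPhi cPhi sg0 sg1 B0 hM hB.
have Z1 : vnorm (0 : V) <= 1 by rewrite vnorm0.
have M00 : 0 <= M0 := le_trans (normc_ge0 _) (hM 0 Z1).
pose N : R := (n * 2)%:R; have N0 : 0 <= N by [].
pose A := N * B / sg; have A0 : 0 <= A by rewrite divr_ge0 ?mulr_ge0 ?(ltW sg0).
have Hc0 : 0 <= 2 * M0 + A + N * B + A by have := mulr_ge0 N0 B0; lra.
(* 2 M0 serves the case h >= 1, A each radial part, and N B the crossing. *)
exists (2 * M0 + A + N * B + A); first exact: Hc0.
move=> zeta z1 t u; set h := normc (ee t - ee u).
have h0 : 0 <= h by exact: normc_ge0.
have ez v : vnorm (ee v *: zeta) = 1 by rewrite vnorm_slice// normc_ee.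
have [hh|hh] := leP 1 h.
  apply: le_trans (le_normcB _ _) _; apply: le_trans (lerD (hM _ _) (hM _ _)) _; rewrite ?ez//.
  have e1 : 1 <= h `^ sg.
    have := powR_le (ltW sg0) ler01 hh; by rewrite powR1.
  apply: (@le_trans _ _ (2 * M0 + A + N * B + A)).
    by have := mulr_ge0 N0 B0; move: A0; lra.
  by rewrite ler_peMr.
have [E|ne] := eqVneq (ee t) (ee u :> C).
  by rewrite E subrr normc0 mulr_ge0 ?powR_ge0.
have hp : 0 < h by rewrite normc_gt0 subr_eq0.
have h1E : 1 - (1 - h) = h by lra.
pose w v : V := (1 - h)%:C *: (ee v *: zeta).
have nw v : vnorm (w v) = 1 - h by rewrite vnormZ ez mulr1 normc_nneg// subr_ge0 ltW.
have end_bound v : normc (Phi (ee v *: zeta) - Phi (w v)) <= A * h `^ sg.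
  have E : w v + h%:C *: (ee v *: zeta) = ee v *: zeta.
    by rewrite -scalerDl -rmorphD subrK scale1r.
  have wv1 : vnorm (w v) < 1 by rewrite nw ltrBlDr ltrDl.
  have := @taylor_boundary R n Phi sg sg 0 B 0 (w v) (h%:C *: (ee v *: zeta)) hPhi cPhi sg0 sg1 sg0 sg1 B0 (lexx 0).
  rewrite E ez => hT; have := hT _ _ wv1 erefl.
  rewrite /taylor big_ord1 expr0 fact0 divr1 mul1r /= scale0r addr0 nw h1E vnormZ ez mulr1 normc_nneg//.
  rewrite expr1 => hT'; apply: le_trans (hT' _ _) _.
  - by move=> [//|q [|//]] _ y y1; exact: hB.
  - by move=> [//|q s] /andP[_].
  rewrite powR_add// (powR_inv1 h0) /A le_eqVlt; apply/orP; left; apply/eqP.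
  by have hn := lt0r_neq0 hp; have sn := lt0r_neq0 sg0; rewrite /A -/N; move: (h `^ sg) => X; field; rewrite ?hn ?sn.
have mid : normc (Phi (w t) - Phi (w u)) <= N * B * h `^ sg.
  have E : w u + (w t - w u) = w t by rewrite addrC subrK.
  have dE : vnorm (w t - w u) = (1 - h) * h.
    rewrite -scalerBr -scalerBl vnormZ vnorm_slice// normc_nneg// subr_ge0 ltW//.
  have := @C1_mean R n unit_ball Phi (w u) (w t - w u) 0 (N * B * h `^ sg) (har_C1 hPhi).
  rewrite E subr0; apply=> y /andP[y0 y1].
  have pE : vnorm (w u + y%:C *: (w t - w u)) <= 1 - h.
    have -> : w u + y%:C *: (w t - w u) = (1 - y)%:C *: w u + y%:C *: w t.
      by rewrite scalerBr rmorphB scalerBl scale1r addrA [in RHS]addrAC.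
    apply: le_trans (vnormD _ _) _; rewrite (vnormZ (1 - y)%:C (w u)) (vnormZ y%:C (w t)) !nw !normc_nneg ?subr_ge0//.
    by lra.
  have p1 : vnorm (w u + y%:C *: (w t - w u)) < 1 by apply: le_lt_trans pE _; rewrite ltrBlDr ltrDl.
  split; first exact: p1.
  rewrite subr0.
  have q0 : 0 <= B * (1 - vnorm (w u + y%:C *: (w t - w u))) `^ (sg - 1) by pos.
  apply: le_trans (rderive_letters_le (w t - w u) hPhi p1 q0 (fun q => hB q _ p1)) _.
  have h2 : (1 - vnorm (w u + y%:C *: (w t - w u))) `^ (sg - 1) <= h `^ (sg - 1).
    by apply: powR_anti => //; [rewrite subr_le0|rewrite -{1}h1E lerD2l lerN2].
  have hs : h `^ sg = h * h `^ (sg - 1).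
    by rewrite -{2}(powRr1 h0) -powR_add//; congr (_ `^ _); ring.
  rewrite dE -/N hs; move: h2; set p := _ `^ _ => h2.
  rewrite [leLHS](_ : _ = N * B * ((1 - h) * h * p)); last by lra.
  apply: ler_wpM2l; first exact: mulr_ge0.
  apply: ler_pM h2; rewrite ?powR_ge0 ?mulr_ge0 ?subr_ge0 ?(ltW hh)//.
  by rewrite ler_piMl// lerBlDr lerDl.
rewrite (_ : _ - _ = (Phi (ee t *: zeta) - Phi (w t)) + (Phi (w t) - Phi (w u)) - (Phi (ee u *: zeta) - Phi (w u))); last by ring.
apply: le_trans (le_normcB _ _) _; apply: le_trans (lerD (le_normcD _ _) (end_bound u)) _.
apply: le_trans (lerD (lerD (end_bound t) mid) (lexx _)) _.
have X0 := powR_ge0 h sg; rewrite -!mulrDl; apply: ler_wpM2r => //.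
by move: M00; lra.
Qed.

Lemma closed_ball_bounded Phi : {within closed_unit_ball, continuous Phi} ->
  exists M0, forall z : V, vnorm z <= 1 -> normc (Phi z) <= M0.
Proof. by move=> cP; exact: within_bounded (@compact_vball R n 1) cP. Qed.

Lemma Lambda_approx phi tau : 0 < tau -> Lambda tau phi ->
  (exists sg H, [/\ 0 < sg, sg <= 1, 0 <= H & holder_slices phi sg H]) /\
  exists K c, 0 <= c /\ approx phi tau K c.
Proof.
move=> tau0 /Lambda_bounds[[|k] [Phi [M [tk hPhi cPhi bPhi [M0 hM]]]]].
  by move: tk; rewrite ltNge ltW.
have oU := @opn_unit_ball R n.
have [S0 hS] := closed_ball_bounded cPhi.
(* Any exponent in (0, 1) not above tau would do. *)
pose sg := Num.min tau 1 / 2.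
have mt : 0 < Num.min tau 1 by pos.
have mt1 : Num.min tau 1 <= 1 by rewrite ge_min lexx orbT.
have mtt : Num.min tau 1 <= tau by rewrite ge_min lexx.
have sg0 : 0 < sg by rewrite divr_gt0.
have sg1 : sg < 1 by rewrite /sg; move: mt1 mt; move: (Num.min _ _) => X; lra.
have sgt : sg <= tau by rewrite /sg; move: mtt mt; move: (Num.min _ _) => X; lra.
have [B B0 hB] := har_decay hPhi M0 sgt sg0 sg1 hM.
have ez v zeta : vnorm zeta = 1 -> vnorm (ee v *: zeta) = 1 by move=> z1; rewrite vnorm_slice// normc_ee.
split.
  have [H H0 hH] := decay_holder hPhi cPhi sg0 (ltW sg1) B0 hS (fun q => hB [:: q] isT).
  exists sg, H; split=> //; first exact: ltW.
  by move=> zeta z1 t u; rewrite -!bPhi ?ez//; exact: hH.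
pose N : R := (n * 2)%:R.
have S00 : 0 <= S0.
  by apply: le_trans (normc_ge0 (Phi 0)) (hS 0 _); rewrite vnorm0 ler01.
pose c1 := N ^+ k.+1 * M / tau.
(* For 1/2 <= |w| <= 2 both |w - x ee u| and |1/w - x conj (ee u)| are at most 2 + 1. *)
pose A := N * 3; pose c2 := \sum_(j < k.+1) A ^+ j * (S0 + B).
have A0 : 0 <= A by rewrite mulr_ge0.
have c10 : 0 <= c1 by rewrite divr_ge0 ?(ltW tau0)// mulr_ge0 ?exprn_ge0.
have c20 : 0 <= c2 by apply: sumr_ge0 => j _; rewrite mulr_ge0 ?exprn_ge0 ?addr_ge0.
exists k.+1, (c1 + c2); split; first exact: addr_ge0.
move=> zeta z1 u x hx; have /andP[x0 x1] := hx; have d0 : 0 < 1 - x by lra.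
have d1 : 1 - x <= 1 by lra.
have xp : 0 <= x by lra.
pose p : V := (x%:C * ee u) *: zeta.
have np : vnorm p = x by rewrite vnorm_slice// normc_circle ger0_norm.
have p1 : vnorm p < 1 by lra.
(* On |w| = 1 these are the coefficients [coef v] of v = (w - x ee u) zeta. *)
pose cf (w : C) (q : 'I_n * bool) : C :=
  if q.2 then (w^-1 - x%:C * conjc (ee u)) * conjc (zeta ord0 q.1) else (w - x%:C * ee u) * zeta ord0 q.1.
pose Q (w : C) : C := \sum_(j < k.+1) (j`!%:R^-1)%:C * P j (cf w) Phi p.
have holP j G : hol [set w | w != 0] (fun w => P j (cf w) G p).
  elim: j G => [|j IH] G; first exact: hol_cst.
  apply: hol_sum => q; apply: holM (IH _); rewrite /cf; case: q.2.
    apply: (@holM _ _ (fun w => w^-1 - x%:C * conjc (ee u)) (fun=> conjc (zeta ord0 q.1))); last exact: hol_cst.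
    apply: (@holD _ _ (fun w => w^-1) (fun=> - (x%:C * conjc (ee u)))); last exact: hol_cst.
    by apply: (@holV _ _ (fun w => w)) => [w //|]; exact: hol_id.
  apply: (@holM _ _ (fun w => w - x%:C * ee u) (fun=> zeta ord0 q.1)); last exact: hol_cst.
  by apply: (@holD _ _ (fun w => w) (fun=> - (x%:C * ee u))); [exact: hol_id|exact: hol_cst].
exists Q; first by apply: hol_sum => j;
  apply: (@holM _ _ (fun=> (j`!%:R^-1)%:C) (fun w => P j (cf w) Phi p)); [exact: hol_cst|exact: holP].
split=> [w /andP[w1 w2]|t].
  have w0 : 0 < normc w by apply: lt_le_trans w1; rewrite invr_gt0 ltr0n.
  have iw : normc w^-1 <= 2 by rewrite normcV invf_ple ?posrE.
  have cf3 : \sum_q normc (cf w q) <= A.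
    apply: (@le_trans _ _ (\sum_(q : 'I_n * bool) 3)); last first.
      by rewrite sumr_const card_prod card_ord card_bool -[leLHS]mulr_natl.
    apply: ler_sum => q _; have zq : normc (zeta ord0 q.1) <= 1 by rewrite -z1; exact: normc_le_vnorm.
    have k3 (X Y : C) : normc X <= 3 -> normc Y <= 1 -> normc (X * Y) <= 3.
      by move=> h1 h2; rewrite normcM -[leRHS]mulr1; apply: ler_pM; rewrite ?normc_ge0.
    rewrite /cf; case: q.2; apply: k3; rewrite ?normc_conj//; apply: le_trans (le_normcB _ _) _.
      by rewrite normcM normc_conj normc_ee normc_nneg//; lra.
    by rewrite normc_circle ger0_norm//; lra.
  apply: (@le_trans _ _ (c2 * (1 - x) ^- k.+1)); last first.
    by apply: ler_wpM2r; [rewrite invr_ge0 exprn_ge0// ltW|rewrite lerDr].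
  apply: le_trans (normc_sum _ _ _) _; rewrite /c2 mulr_suml; apply: ler_sum => j _.
  have f0 : 0 < j`!%:R :> R by [].
  rewrite normcM normc_nneg ?invr_ge0 ?(ltW f0)//.
  apply: (@le_trans _ _ (normc (P j (cf w) Phi p))).
    by rewrite ler_piMl ?normc_ge0// invf_le1// ler1n fact_gt0.
  have q1 := pow_dist_ge1 k.+1 hx.
  rewrite -mulrA; apply: P_le => //; first by pos.
  (* The decay estimate starts at order 1; order 0 uses the supremum S0 of Phi. *)
  move=> wd wj; rewrite mulrDl; have [j0|j0] := posnP j.
    move: wj; rewrite j0 => /size0nil ->.
    apply: (@le_trans _ _ S0); first by apply: hS; rewrite np ltW.
    by apply: ler_wpDr; [rewrite mulr_ge0// (le_trans ler01)|rewrite ler_peMr].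
  have jk : (0 < size wd <= k.+1)%N by rewrite wj j0 ltnW.
  apply: le_trans (hB wd jk p p1) _; rewrite np.
  apply: ler_wpDl; first by pos.
  apply: (ler_wpM2l B0); rewrite -powR_mulrn ?(ltW d0)// -powRN; apply: powR_exp_anti => //.
  rewrite wj; have : j%:R <= k.+1%:R :> R by rewrite ler_nat ltnW.
  by move: sg0; lra.
pose v : V := (ee t - x%:C * ee u) *: zeta.
have pv : p + v = ee t *: zeta by rewrite -scalerDl subrKC.
have nv : vnorm v = normc (ee t - x%:C * ee u) by rewrite vnorm_slice.
have QE : Q (ee t) = taylor Phi p v k.+1 0.
  rewrite /Q /taylor; apply: eq_bigr => j _; rewrite subr0 expr1n mul1r scale0r addr0.
  rewrite (nder_P v j oU hPhi p1); congr (_ * _).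
  have cE : cf (ee t) = coef v.
    apply/funext => q; rewrite /cf /coef /v !mxE; case: q.2 => //.
    have cx : conjc (x%:C : C) = x%:C by apply: ReIm_eq => //=; rewrite oppr0.
    by rewrite -(conj_ee t) (conjM (ee t - _)) conjB (conjM x%:C) cx.
  by rewrite cE.
rewrite -bPhi ?ez// QE -pv.
have hB' w : (0 < size w <= k)%N -> forall y, vnorm y < 1 ->
    normc (word w Phi y) <= B * (1 - vnorm y) `^ (sg - (size w)%:R).
  by move=> /andP[w0 wk]; apply: hB; rewrite w0 ltnW.
have hM' w : size w = k.+1 -> forall y, vnorm y < 1 ->
    normc (word w Phi y) <= M * (1 - vnorm y) `^ (tau - k.+1%:R).
  by move=> wk y y1; apply: le_trans (word_le_dnorm w oU hPhi y1) _; rewrite wk; exact: hM.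
have pv1 : vnorm (p + v) = 1 by rewrite pv ez.
apply: le_trans (taylor_boundary hPhi cPhi tau0 (ltW tk) sg0 (ltW sg1) M0 B0 hM' hB' p1 pv1) _.
rewrite nv np; set r := normc (ee t - _).
have -> : (1 - x) `^ (tau - k.+1%:R) = (1 - x) `^ tau * (1 - x) ^- k.+1.
  by rewrite powR_add// powRN powR_mulrn ?(ltW d0).
rewrite expr_div_n exprMn.
apply: (@le_trans _ _ (c1 * (1 - x) `^ tau * (r ^+ k.+1 / (1 - x) ^+ k.+1))).
  rewrite le_eqVlt; apply/orP; left; apply/eqP; rewrite /c1 -/N.
  by move: (tau^-1) ((1 - x) ^- k.+1) => X Y; ring.
rewrite -[leLHS]mulrA -[leRHS]mulrA; apply: ler_wpM2r; last by rewrite lerDl.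
by rewrite mulr_ge0 ?powR_ge0// divr_ge0 ?exprn_ge0 ?normc_ge0// ltW.
Qed.
End slice_approximation.

(** * From slices to the ball, and the conclusion *)

Section assembly.
Context {R : realType} {n : nat}.
Local Notation C := R[i].
Local Notation V := 'rV[C]_n.
Implicit Types (f g phi chi F G : V -> C) (zeta z : V) (m K : nat) (tau sg c A H M x r e : R).

Lemma compact_sphere : compact (@unit_sphere R n).
Proof.
apply: subclosed_compact (@compact_vball R n 1) _; last by move=> z /= ->.
apply: (@preimage_closed _ _ (@vnorm R n) [set x : R | x = 1]); last exact: closed_eq.
by move=> z _; exact: ctaE (cta_vnorm (ctaid z)).
Qed.

Lemma unit_vector : (0 < n)%N -> exists zeta : V, vnorm zeta = 1.
Proof. by case: n => // k _; exists (dir (ord0, false)); exact: vnorm_dir. Qed.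

Lemma sphere_bounds phi : (0 < n)%N -> {within unit_sphere, continuous phi} ->
  (forall zeta, zeta \in unit_sphere -> phi zeta <> 0) ->
  exists M m : R, 0 < m /\ forall zeta, vnorm zeta = 1 -> m <= normc (phi zeta) <= M.
Proof.
move=> n0 cphi phi0; have [M hM] := within_bounded compact_sphere cphi.
have cf : {within unit_sphere, continuous (fun z => normc (phi z))}.
  apply/subspace_continuousP => z Az; move/subspace_continuousP/(_ _ Az): cphi => h.
  have hn : cta (@normc R) (phi z) by exact: cta_normc (ctaid (phi z)).
  exact: (cvg_comp _ _ h (ctaE hn)).
have S0 : (@unit_sphere R n) !=set0 by have [z z1] := unit_vector n0; exists z.
have [c cS hc] := compact_EVT_min S0 compact_sphere cf.
exists M, (normc (phi c)); split; first by rewrite normc_gt0; apply/eqP; exact: phi0.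
by move=> zeta z1; rewrite hM// hc// inE.
Qed.

Lemma Gamma_regular phi tau : 0 < tau -> Gamma tau phi ->
  [/\ {within unit_sphere, continuous phi},
    exists sg H, [/\ 0 < sg, sg <= 1, 0 <= H & holder_slices phi sg H] &
    (exists M, forall zeta, vnorm zeta = 1 -> normc (phi zeta) <= M) ->
    exists K c, 0 <= c /\ approx phi tau K c].
Proof.
move=> tau0 hG; have [t2|t2] := ltP tau 2^-1.
  have [H H0 hH] := Gamma_holder tau0 t2 hG.
  have t1 : tau <= 1 by move: t2; lra.
  split.
  - by move: hG; rewrite /Gamma t2 => -[].
  - by exists tau, H.
  - by move=> [M hM]; have [c c0 hc] := holder_approx tau0 t1 H0 hM hH; exists 1%N, c.
have hL : Lambda tau phi by move: hG; rewrite /Gamma ltNge t2 /=; case: eqP => // _ [].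
have [h1 h2] := Lambda_approx tau0 hL.
by split=> //; case: hL.
Qed.

Lemma holder_conj_inv phi sg H (m : R) : 0 < m -> 0 <= H ->
  (forall zeta, vnorm zeta = 1 -> m <= normc (phi zeta)) -> holder_slices phi sg H ->
  holder_slices (fun z => (conjc (phi z))^-1) sg (H / m ^+ 2).
Proof.
move=> m0 H0 hm hH zeta z1 t u.
have ez v : vnorm (ee v *: zeta) = 1 by rewrite vnormZ normc_ee mul1r.
have := hH zeta z1 t u; have := hm _ (ez t); have := hm _ (ez u).
move: (phi (ee t *: zeta)) (phi (ee u *: zeta)) => a b mb ma h.
have nz (y : C) : m <= normc y -> conjc y != 0.
  by move=> my; rewrite -normc_gt0 normc_conj (lt_le_trans m0).
have a0 := nz a ma; have b0 := nz b mb.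
have -> : (conjc a)^-1 - (conjc b)^-1 = (conjc b - conjc a) / (conjc a * conjc b) by field; rewrite a0 b0.
rewrite normcM normcV normcM !normc_conj -conjB normc_conj normcB mulrAC.
apply: ler_pM h _; rewrite ?normc_ge0 ?invr_ge0 ?mulr_ge0 ?normc_ge0//.
rewrite lef_pV2 ?posrE ?exprn_gt0// ?mulr_gt0 ?(lt_le_trans m0)//.
by rewrite expr2; apply: ler_pM => //; exact: ltW.
Qed.

Lemma holder_le phi sg (H H' : R) : H <= H' -> holder_slices phi sg H -> holder_slices phi sg H'.
Proof. by move=> HH' h zeta z1 t u; apply: le_trans (h zeta z1 t u) _; rewrite ler_wpM2r// powR_ge0. Qed.

Lemma holder_conj phi sg H : holder_slices phi sg H -> holder_slices (fun z => conjc (phi z)) sg H.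
Proof. by move=> hH zeta z1 t u; rewrite -conjB normc_conj; exact: hH. Qed.

Lemma holder_circle chi sg H zeta : 0 < sg -> holder_slices chi sg H -> vnorm zeta = 1 ->
  forall s, cta (fun s : R => chi (ee s *: zeta)) s.
Proof.
by move=> sg0 hH z1; apply: (@cta_on_circle R (fun l => chi (l *: zeta)) H sg sg0) => t u; exact: hH.
Qed.

(** The bound depends only on |z|, so continuity of F carries it from points of equal norm on good
    slices to z. *)
Lemma dense_bound (P : V -> Prop) F (b : R -> R) : (0 < n)%N -> hb F ->
  (forall zeta0 e, vnorm zeta0 = 1 -> 0 < e ->
     exists zeta, [/\ vnorm zeta = 1, vnorm (zeta - zeta0) < e & P zeta]) ->
  (forall zeta, vnorm zeta = 1 -> P zeta -> forall x, 0 <= x < 1 -> normc (F (x%:C *: zeta)) <= b x) ->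
  forall z, vnorm z < 1 -> normc (F z) <= b (vnorm z).
Proof.
move=> n0 hF hP hb z z1.
have [zeta0 [zeta1 zE]] : exists zeta0 : V, vnorm zeta0 = 1 /\ z = (vnorm z)%:C *: zeta0.
  have [z0|z0] := eqVneq (vnorm z) 0.
    have [w w1] := unit_vector n0; exists w; split=> //.
    by rewrite z0 scale0r (vnorm_eq0 z0).
  exists ((vnorm z)^-1%:C *: z); split.
    by rewrite vnormZ normc_nneg ?invr_ge0 ?vnorm_ge0// mulVf.
  by rewrite scalerA -rmorphM mulfV// scale1r.
apply: le_eps => e e0; have /ctaP/(_ _ e0)/nearVP[d d0 hd] := hb_cta hF z1.
have [zeta [w1 wz Pw]] := hP zeta0 d zeta1 d0.
have v0 := vnorm_ge0 z.
have close : vnorm ((vnorm z)%:C *: zeta - z) < d.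
  rewrite {2}zE -scalerBr vnormZ normc_nneg//; apply: le_lt_trans wz.
  by rewrite ler_piMl ?vnorm_ge0// ltW.
have hx : 0 <= vnorm z < 1 by lra.
have h1 := hb zeta w1 Pw (vnorm z) hx.
have h2 := hd _ close.
have := normc_sub_ge (F z) (F ((vnorm z)%:C *: zeta)); lra.
Qed.

(** By [tower_slice] the integral in [pair_kernel_bound] is a value of the tower. For fixed x the
    defect term vanishes as rho tends to 1, and the tower is continuous at x zeta. *)
Lemma tower_bound f g chi tau K c A m zeta x : hb f -> hb g ->
  (forall z, vnorm z < 1 -> normc (g z) <= A) -> vnorm zeta = 1 ->
  (forall s, cta (fun s : R => chi (ee s *: zeta)) s) ->
  0 < tau -> 0 <= c -> K%:R + tau <= m%:R -> (K.+1 <= m)%N -> approx chi tau K c ->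
  paired (fun l => f (l *: zeta)) (fun l => g (l *: zeta)) (fun l => chi (l *: zeta)) ->
  2^-1 <= x < 1 ->
  normc (tower f m (x%:C *: zeta)) <= c * A * (1 + 2 ^+ m.+1) * (1 - x) `^ (tau - m%:R).
Proof.
move=> hf hg gA z1 cchi tau0 c0 Km K1m hA hp hx; have /andP[x0 x1] := hx.
have d0 : 0 < 1 - x by pos.
have xp : 0 <= x by lra.
have [Q hQ [Q1 Q2]] := hA zeta z1 0 x hx.
have T1 : vnorm (x%:C *: zeta) < 1 by rewrite vnormZ z1 mulr1 normc_nneg.
apply: le_eps => e e0; have e2 : 0 < e / 2 by pos.
have /ctaP/(_ _ e2)/nearVP[d dl0 hd] := hb_cta (hb_tower m hf) T1.
have de : 0 < e / 2 * (1 - x) ^+ m.+1 by rewrite mulr_gt0// exprn_gt0.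
have [|rho /andP[r0 r1] [rp hdef]] := hp _ (1 - d) de; first by lra.
have rho01 : 0 < rho < 1 by lra.
have gA' w : normc w < 1 -> normc (g (w *: zeta)) <= A.
  by move=> w1; apply: gA; rewrite vnormZ z1 mulr1.
have Q1' w : 2^-1 <= normc w <= 1 -> normc (Q w) <= c * (1 - x) ^- K.
  by move=> /andP[w1 w2]; apply: Q1; rewrite w1 (le_trans w2)// ler1n.
have := @pair_kernel_bound R (fun l => f (l *: zeta)) (fun l => g (l *: zeta)) (fun l => chi (l *: zeta))
  Q rho x 0 m K tau c A (hb_slice hf z1) (hb_slice hg z1) cchi gA' hQ tau0 c0 Km K1m Q1' Q2 rho01 hx.
have y1 : normc (x%:C * ee 0 : C) < 1 by rewrite normc_circle ger0_norm.
rewrite -(tower_slice m hf z1 rho01 y1) ee0 mulr1 => h.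
have close : vnorm ((rho%:C * x%:C) *: zeta - x%:C *: zeta) < d.
  rewrite -scalerBl vnormZ z1 mulr1 -rmorphM -rmorphB normc_real.
  rewrite (_ : rho * x - x = - ((1 - rho) * x)); last by lra.
  rewrite normrN ger0_norm; last by rewrite mulr_ge0// subr_ge0 ltW.
  apply: (@le_lt_trans _ _ (1 - rho)); last by move: r0; lra.
  by rewrite ler_piMr ?subr_ge0// ltW.
have h2 := hd _ close.
have h3 : defect (fun l => f (l *: zeta)) (fun l => g (l *: zeta)) (fun l => chi (l *: zeta)) rho / (1 - x) ^+ m.+1 <= e / 2.
  by rewrite ler_pdivrMr// exprn_gt0.
have := normc_sub_ge (tower f m (x%:C *: zeta)) (tower f m ((rho%:C * x%:C) *: zeta)).
move: h h2 h3; move: (c * A * _ * _) (defect _ _ _ _ / _) => X Y; lra.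
Qed.

Lemma ball_bounded F r : hb F -> r < 1 -> exists2 A, 0 <= A & forall z, vnorm z <= r -> normc (F z) <= A.
Proof.
move=> hF r1; have [A hA] : exists A, forall z, vnorm z <= r -> normc (F z) <= A.
  apply: (@within_bounded R n [set z | vnorm z <= r]); first exact: compact_vball.
  apply: continuous_in_subspaceT => z; rewrite inE /= => zr.
  by apply: ctaE; apply: hb_cta => //; exact: le_lt_trans zr r1.
exists `|A| => // z zr; apply: le_trans (hA z zr) _; exact: ler_norm.
Qed.

Lemma paired_Binfty f g chi tau sg H K c A : (0 < n)%N -> holomorphic f -> holomorphic g ->
  (forall z, vnorm z < 1 -> normc (g z) <= A) -> 0 <= A -> 0 < tau -> 0 < sg -> 0 <= c ->
  holder_slices chi sg H -> approx chi tau K c ->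
  (forall zeta0 e, vnorm zeta0 = 1 -> 0 < e ->
     exists zeta, [/\ vnorm zeta = 1, vnorm (zeta - zeta0) < e &
       paired (fun l => f (l *: zeta)) (fun l => g (l *: zeta)) (fun l => chi (l *: zeta))]) ->
  Binfty tau f.
Proof.
move=> n0 hf hg gA A0 tau0 sg0 c0 hH hA hP.
have bf := hb_holomorphic hf; have bg := hb_holomorphic hg.
(* m is above K + tau, for [tower_bound], and above tau, for [growth_Binfty]. *)
pose m := (K + (Num.truncn tau).+1)%N.
have tm : tau < (Num.truncn tau).+1%:R by exact: Num.Theory.truncnS_gt.
have Km : K%:R + tau <= m%:R by rewrite natrD lerD2l ltW.
have K1m : (K.+1 <= m)%N by rewrite /m addnS leq_addr.
have mt : tau < m%:R by apply: lt_le_trans tm _; rewrite ler_nat leq_addl.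
have half1 : 2^-1 < 1 :> R by lra.
have [A2 A20 hA2] := ball_bounded (hb_tower m bf) half1.
apply: (@growth_Binfty R n f m tau hf _ mt); first by rewrite /m addnS.
pose B := c * A * (1 + 2 ^+ m.+1).
have B0 : 0 <= B by rewrite !mulr_ge0.
exists (A2 + B); first exact: addr_ge0.
apply: (@dense_bound (fun zeta => paired (fun l => f (l *: zeta)) (fun l => g (l *: zeta)) (fun l => chi (l *: zeta)))
  (tower f m) (fun r => (A2 + B) * (1 - r) `^ (tau - m%:R)) n0 (hb_tower m bf) hP) => zeta z1 hp x /andP[x0 x1].
have p0 := powR_ge0 (1 - x) (tau - m%:R).
(* [approx] starts at x = 1/2. Below, compactness gives the bound A2, and (1 - x)^(tau - m) >= 1. *)
have [x2|x2] := ltP x 2^-1.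
  apply: (@le_trans _ _ A2); first by apply: hA2; rewrite vnormZ z1 mulr1 normc_nneg// ltW.
  rewrite mulrDl; apply: ler_wpDr; first exact: mulr_ge0.
  apply: ler_peMr => //; rewrite -{1}(powRr0 (1 - x)); apply: powR_exp_anti; first by lra.
    by lra.
  by lra.
have hx : 2^-1 <= x < 1 by lra.
apply: le_trans (tower_bound bf bg gA z1 (holder_circle sg0 hH z1) tau0 c0 Km K1m hA hp hx) _.
by apply: ler_wpM2r => //; rewrite lerDr.
Qed.

(** The bounds A1 and A2 of f and g on the ball of radius r' hold on every slice, so [pair_bounded]
    gives one constant for all good slices, whatever B is on each of them. *)
Lemma slices_bounded f g chi1 chi2 H M sg : (0 < n)%N -> holomorphic f -> holomorphic g ->
  0 < sg -> sg <= 1 -> 0 <= H -> 0 <= M -> holder_slices chi1 sg H -> holder_slices chi2 sg H ->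
  (forall zeta, vnorm zeta = 1 -> normc (chi1 zeta) <= M) ->
  (forall zeta, vnorm zeta = 1 -> normc (chi2 zeta) <= M) ->
  (forall zeta0 e, vnorm zeta0 = 1 -> 0 < e ->
     exists zeta, [/\ vnorm zeta = 1, vnorm (zeta - zeta0) < e,
       exists B, mean_bounded (fun l => f (l *: zeta)) B /\ mean_bounded (fun l => g (l *: zeta)) B,
       paired (fun l => f (l *: zeta)) (fun l => g (l *: zeta)) (fun l => chi1 (l *: zeta)) &
       paired (fun l => g (l *: zeta)) (fun l => f (l *: zeta)) (fun l => chi2 (l *: zeta))]) ->
  exists2 A, 0 <= A &
    forall z, vnorm z < 1 -> normc (f z) <= A /\ normc (g z) <= A.
Proof.
move=> n0 hf hg sg0 sg1 H0 M0 h1 h2 b1 b2 hP.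
have bf := hb_holomorphic hf; have bg := hb_holomorphic hg.
have [r' /andP[_ r'1] [c c0 hc]] := pair_bounded sg0 sg1 H0 M0.
have [A1 A10 hA1] := ball_bounded bf r'1; have [A2 A20 hA2] := ball_bounded bg r'1.
exists (c * (A1 + A2)); first by pos.
pose P zeta := forall w, normc w < 1 ->
  normc (f (w *: zeta)) <= c * (A1 + A2) /\ normc (g (w *: zeta)) <= c * (A1 + A2).
have hP' zeta0 e : vnorm zeta0 = 1 -> 0 < e ->
    exists zeta, [/\ vnorm zeta = 1, vnorm (zeta - zeta0) < e & P zeta].
  move=> z0 e0; have [zeta [z1 ze [B [mf mg]] p1 p2]] := hP zeta0 e z0 e0.
  have ez t : vnorm (ee t *: zeta) = 1 by rewrite vnormZ normc_ee mul1r.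
  exists zeta; split=> //.
  apply: (hc _ _ _ _ B (A1 + A2) (holomorphic_slice hf z1) (holomorphic_slice hg z1) mf mg p1 p2
    (h1 zeta z1) (h2 zeta z1)) => [t|t|w wr|w wr].
  - exact: b1.
  - exact: b2.
  - by apply: le_trans (hA1 _ _) _; rewrite ?vnormZ ?z1 ?mulr1// lerDl.
  - by apply: le_trans (hA2 _ _) _; rewrite ?vnormZ ?z1 ?mulr1// lerDr.
have xn x : 0 <= x < 1 -> normc (x%:C : C) < 1 by move=> /andP[x0 x1]; rewrite normc_nneg.
move=> z z1; split.
  by apply: (@dense_bound P f (fun=> c * (A1 + A2)) n0 bf hP' _ z z1) => zeta _ h x /xn /h[].
by apply: (@dense_bound P g (fun=> c * (A1 + A2)) n0 bg hP' _ z z1) => zeta _ h x /xn /h[].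
Qed.
End assembly.

Theorem corollary1p7 (R : realType) (n : nat) (hn : (1 <= n)%N)
    (tau : R) (htau : 0 < tau)
    (f g : 'rV[R[i]]_n -> R[i]) (hf : hardy1 f) (hg : hardy1 g)
    (f_neq0 : exists2 z, z \in unit_ball & f z <> 0)
    (phi : 'rV[R[i]]_n -> R[i])
    (hphi : {ae @sphere_measure R (n + n), forall t,
       phi (cvec t) =
       conjc (boundary_value g (cvec t)) / boundary_value f (cvec t)})
    (phi_Gamma : Gamma tau phi)
    (phi_neq0 : forall zeta, zeta \in unit_sphere -> phi zeta <> 0) :
  Binfty tau f /\ Binfty tau g.

Proof.
have [cphi [sg [H [sg0 sg1 H0 hH]]] happ] := Gamma_regular htau phi_Gamma.
have hM := sphere_bounds hn cphi phi_neq0; have [M [m [m0 bM]]] := hM.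
have [K [c [c0 hA]]] : exists K c, 0 <= c /\ approx phi tau K c.
  by apply: happ; exists M => zeta /bM/andP[].
have bC zeta : vnorm zeta = 1 -> m <= normc (conjc (phi zeta)) <= M.
  by rewrite normc_conj; exact: bM.
(* conj phi is approximated by reflection and then inverted, since 1 / conj phi is the multiplier
   for f and phi the one for g. *)
have [K' [c' [c'0 hA']]] := approx_inv htau sg0 sg1 c0 H0 m0 bC (holder_conj hH) (approx_conj hA).
have bm zeta z1 : m <= normc (phi zeta) := proj1 (andP (bM zeta z1)).
have hI := holder_conj_inv m0 H0 bm hH.
have good := good_pairs hn hf hg hphi (fun zeta z1 s => holder_circle sg0 hH z1 s) hM.
have [A A0 hfg] : exists2 A, 0 <= A & forall z, vnorm z < 1 -> normc (f z) <= A /\ normc (g z) <= A.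
  have M0 : 0 <= M.
    by have [z z1] := @unit_vector R n hn; have /andP[h1 h2] := bM z z1; exact: le_trans (ltW m0) (le_trans h1 h2).
  have H'0 : 0 <= H / m ^+ 2 by rewrite divr_ge0// exprn_ge0// ltW.
  have m'0 : 0 <= m^-1 by rewrite invr_ge0 ltW.
  (* [slices_bounded] takes one Hoelder constant for both multipliers; the sum serves phi and 1 /
     conj phi. *)
  have hH1 : holder_slices phi sg (H + H / m ^+ 2) by apply: holder_le hH; rewrite lerDl.
  have hI1 : holder_slices (fun z => (conjc (phi z))^-1) sg (H + H / m ^+ 2).
    by apply: holder_le hI; rewrite lerDr.
  apply: (slices_bounded hn hf.1 hg.1 sg0 sg1 (addr_ge0 H0 H'0) (addr_ge0 M0 m'0) hI1 hH1) => [z z1|z z1|//].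
    rewrite normcV normc_conj; apply: (@le_trans _ _ m^-1); last by rewrite lerDr.
    by rewrite lef_pV2 ?posrE ?(lt_le_trans m0)// bm.
  by have /andP[_ h] := bM z z1; apply: (le_trans h); rewrite lerDl.
have [f1 g1] := (hf.1, hg.1).
split.
  apply: (paired_Binfty hn f1 g1 (fun z z1 => proj2 (hfg z z1)) A0 htau sg0 c'0 hI hA').
  by move=> zeta0 e z0 e0; have [zeta [z1 ze _ p1 _]] := good zeta0 e z0 e0; exists zeta.
apply: (paired_Binfty hn g1 f1 (fun z z1 => proj1 (hfg z z1)) A0 htau sg0 c0 hH hA).
by move=> zeta0 e z0 e0; have [zeta [z1 ze _ _ p2]] := good zeta0 e z0 e0; exists zeta.
Qed.
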